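(* Let $\Omega\subset\mathbb{R}^3$ be a bounded domain, $\nu>0$, $\mathbf{f}\in V'$, and let $r_0=\|\mathbf{f}\|_{V'}/(\nu\lambda_1^{1/2})$ and $B_H(r_0)=\{\mathbf{u}\in H:\|\mathbf{u}\|_{L^2}\le r_0\}$. Let $\phi:V\cap B_H(r_0)\to\mathbb{R}$ be (sequentially) continuous with respect to the weak topology of $V$ and have sub-quadratic growth on $V$, i.e. there exist $C_0,C_1\ge 0$ and $0<\delta\le 2$ such that $|\phi(\mathbf{u})|\le C_0+C_1\|\nabla\mathbf{u}\|_{L^2}^{2-\delta}$ for all $\mathbf{u}\in V\cap B_H(r_0)$. Then $$\max_{\mu\in\mathcal{P}_{\mathrm{fpsss}}(H)}\int_H\phi(\mathbf{u})\,d\mu(\mathbf{u})=\inf_{\Psi\in\mathcal{T}^{\mathrm{cyl}}}\ \max_{(\theta_1,\theta_2,\mathbf{u}_1,\mathbf{u}_2)\in\mathcal{B}_f}\ \sum_{i=1}^2\theta_i\left\{\phi(\mathbf{u}_i)+\langle\mathbf{F}(\mathbf{u}_i),\mathbf{D}\Psi(\mathbf{u}_i)\rangle_{V',V}\right\},$$ where $\mathcal{B}_f$ is the set defined in the context with $B=B_H(r_0)$.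
   Context: Spaces: $H$ (resp. $V$) is the closure of $\{\mathbf{u}\in C_c^\infty(\Omega)^3:\nabla\cdot\mathbf{u}=0\}$ in $L^2(\Omega)^3$ (resp. in $H_0^1(\Omega)^3$), with norm $\|\mathbf{u}\|_{L^2}$ (resp. $\|\nabla\mathbf{u}\|_{L^2}$). $H$ is identified with its dual, so $V\subset H=H'\subset V'$; $\langle\cdot,\cdot\rangle_{V',V}$ is the duality pairing (extending the $L^2$ inner product) and $\|\cdot\|_{V'}$ the dual norm. $\lambda_1>0$ is the first eigenvalue of the Stokes operator, i.e. the largest constant with $\lambda_1\|\mathbf{u}\|_{L^2}^2\le\|\nabla\mathbf{u}\|_{L^2}^2$ for all $\mathbf{u}\in V$. $\mathbf{F}:V\to V'$ is given by $\langle\mathbf{F}(\mathbf{u}),\mathbf{w}\rangle_{V',V}=\langle\mathbf{f},\mathbf{w}\rangle_{V',V}-\nu\int_\Omega\nabla\mathbf{u}:\nabla\mathbf{w}\,d\mathbf{x}-\int_\Omega(\mathbf{u}\cdot\nabla)\mathbf{u}\cdot\mathbf{w}\,d\mathbf{x}$ for $\mathbf{w}\in V$. Test functionals: $\mathcal{T}^{\mathrm{cyl}}$ is the set of $\Psi:V'\to\mathbb{R}$ of the form $\Psi(\mathbf{u})=\psi(\langle\mathbf{u},\mathbf{w}_1\rangle_{V',V},\dots,\langle\mathbf{u},\mathbf{w}_m\rangle_{V',V})$ with $m\in\mathbb{N}$, $\mathbf{w}_1,\dots,\mathbf{w}_m\in V$, $\psi\in C_c^1(\mathbb{R}^m)$;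 its differential is $\mathbf{D}\Psi(\mathbf{u})=\sum_{j=1}^m\partial_j\psi(\langle\mathbf{u},\mathbf{w}_1\rangle_{V',V},\dots,\langle\mathbf{u},\mathbf{w}_m\rangle_{V',V})\,\mathbf{w}_j\in V$. Stationary statistical solutions: $\mathcal{P}_{\mathrm{fpsss}}(H)$ is the set of Borel probability measures $\mu$ on $H$ such that (i) $\int_H\|\nabla\mathbf{u}\|_{L^2}^2\,d\mu(\mathbf{u})<\infty$ (with $\|\nabla\mathbf{u}\|_{L^2}=+\infty$ if $\mathbf{u}\notin V$, so $\mu(H\setminus V)=0$); (ii) $\int_H\psi'(\|\mathbf{u}\|_{L^2}^2)(\nu\|\nabla\mathbf{u}\|_{L^2}^2-\langle\mathbf{f},\mathbf{u}\rangle_{V',V})\,d\mu(\mathbf{u})\le 0$ for every nonnegative, non-decreasing, continuously differentiable $\psi:[0,\infty)\to\mathbb{R}$ with bounded derivative; (iii) $\int_H\langle\mathbf{F}(\mathbf{u}),\mathbf{D}\Psi(\mathbf{u})\rangle_{V',V}\,d\mu(\mathbf{u})=0$ for all $\Psi\in\mathcal{T}^{\mathrm{cyl}}$. Every such $\mu$ is carried by $V\cap B_H(r_0)$, so $\int_H\phi\,d\mu$ is understood as the integral over $V\cap B_H(r_0)$. The set $\mathcal{B}_f$ (for a given $B\subset H$): let $\ell(\mathbf{u})=\nu\|\nabla\mathbf{u}\|_{L^2}^2-\langle\mathbf{f},\mathbf{u}\rangle_{V',V}$ for $\mathbf{u}\in V$. Then $\mathcal{B}_f=\mathcal{B}_{f,1}\cup\mathcal{B}_{f,2}$,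 where $\mathcal{B}_{f,1}=\{(1,0,\mathbf{u},\mathbf{u}):\mathbf{u}\in B\cap V,\ \ell(\mathbf{u})\le 0\}$ and $\mathcal{B}_{f,2}$ is the set of $(\theta_1,\theta_2,\mathbf{u}_1,\mathbf{u}_2)$ with $0<\theta_1<1$, $\theta_2=1-\theta_1$, $\mathbf{u}_1,\mathbf{u}_2\in B\cap V$, $\|\mathbf{u}_1\|_{L^2}=\|\mathbf{u}_2\|_{L^2}$, $\ell(\mathbf{u}_1)<0<\ell(\mathbf{u}_2)$ and $\theta_1\ell(\mathbf{u}_1)+\theta_2\ell(\mathbf{u}_2)=0$. *)

(* Defs.v *)
From HB Require Import structures.
From mathcomp Require Import all_boot all_order all_algebra ring_quotient.
From mathcomp Require Import all_classical all_reals all_analysis measurable_realfun.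
Import numFieldNormedType.Exports.
Set Implicit Arguments.
Unset Strict Implicit.
Unset Printing Implicit Defensive.
Import Order.TTheory GRing.Theory Num.Theory.
Local Open Scope classical_set_scope.
Local Open Scope ring_scope.
Local Open Scope quotient_scope.

(* [R3] carries the normed topology, [mR3] the Borel sigma-algebra that
   [lebesgue_measure] lives on; the two carriers are convertible. *)
Notation R3 R := (R * R * R)%type.
Notation mR3 R :=
  (measurableTypeR R * measurableTypeR R * measurableTypeR R)%type.

Definition leb3 {R : realType} : {measure set (mR3 R) -> \bar R} :=
  ((@lebesgue_measure R \x @lebesgue_measure R) \x @lebesgue_measure R)%E.

Definition domain {R : realType} (Omega : set (R3 R)) :=
  [/\ open Omega, connected Omega & Omega !=set0].

Section test_functions.
Context {R : realType}.
Implicit Types (Omega : set (R3 R)) (f : R3 R -> R).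

Definition e3 (i : 'I_3) : R3 R :=
  ((i == 0 :> nat)%:R, (i == 1 :> nat)%:R, (i == 2 :> nat)%:R).

Definition pd (i : 'I_3) f : R3 R -> R := 'D_(e3 i) f.

Definition smooth f := forall s : seq 'I_3,
  continuous (foldr pd f s) /\
  forall i x, derivable (foldr pd f s) x (e3 i).

Definition support {T : topologicalType} (f : T -> R) : set T :=
  closure [set x | f x != 0].

Definition Cc_infty Omega f :=
  [/\ smooth f, compact (support f) & support f `<=` Omega].

End test_functions.

(* [L0 Omega] is the vector space of measurable functions modulo equality
   almost everywhere on Omega.  A measurable function on the open set Omega is
   the restriction of its extension by zero, so representatives are taken
   measurable on the whole space. *)
Section L0.
Context {R : realType} (Omega : set (R3 R)).

Notation mfun3 := ({mfun mR3 R >-> R} : lmodType R).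

Definition null_on : {pred mfun3} :=
  fun u => `[< {ae leb3, forall x, Omega x -> u x = 0} >].

Lemma null_on_zmod_closed : zmod_closed null_on.
Proof.
split; first by apply/asboolP; exact: aeW.
move=> u v /asboolP u0 /asboolP v0; apply/asboolP.
apply: (@filterS2 _ _ (ae_filter_ringOfSetsType leb3) _ _ _ _ u0 v0) => x ux vx Ox.
by rewrite -[LHS]/(u x - v x) (ux Ox) (vx Ox) subr0.
Qed.

HB.instance Definition _ := GRing.isZmodClosed.Build _ null_on
  null_on_zmod_closed.

Definition L0 : Type := Quotient.quot null_on.

HB.instance Definition _ := GRing.Zmodule.on L0.
HB.instance Definition _ := EqQuotient.on L0.

Definition L0_scale (a : R) (u : L0) : L0 := \pi_L0 (a *: repr u).

Lemma L0_piE (u v : mfun3) :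
  (u - v \in null_on) -> \pi_L0 u = \pi_L0 v.
Proof. by move=> uv; apply/eqmodP; rewrite -Quotient.equivE in uv. Qed.

Lemma null_on_scale a u : u \in null_on -> a *: u \in null_on.
Proof.
move=> /asboolP u0; apply/asboolP; apply: (@filterS _ _ (ae_filter_ringOfSetsType leb3) _ _ _ u0) => x ux Ox.
by rewrite -[LHS]/(a * u x) (ux Ox) mulr0.
Qed.

Lemma L0_repr_pi u : repr (\pi_L0 u) - u \in null_on.
Proof. by rewrite Quotient.idealrBE reprK. Qed.

Lemma L0_scale_pi a u : L0_scale a (\pi_L0 u) = \pi_L0 (a *: u).
Proof.
by apply: L0_piE; rewrite -scalerBr null_on_scale// L0_repr_pi.
Qed.

Lemma L0_piD u v : \pi_L0 (u + v) = \pi_L0 u + \pi_L0 v.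
Proof. by rewrite !piE. Qed.

Lemma L0_scalerA a b v : L0_scale a (L0_scale b v) = L0_scale (a * b) v.
Proof. by rewrite -[v]reprK (L0_scale_pi b) !L0_scale_pi scalerA. Qed.

Lemma L0_scale1r : left_id 1 L0_scale.
Proof. by move=> v; rewrite -[v]reprK L0_scale_pi scale1r. Qed.

Lemma L0_scalerDr : right_distributive L0_scale +%R.
Proof.
move=> a u v; rewrite -[u]reprK -[v]reprK -L0_piD !L0_scale_pi scalerDr.
exact: L0_piD.
Qed.

Lemma L0_scalerDl v : {morph L0_scale^~ v : a b / a + b}.
Proof.
move=> a b; rewrite -[v]reprK !L0_scale_pi scalerDl.
exact: L0_piD.
Qed.

HB.instance Definition _ := GRing.Zmodule_isLmodule.Build R L0
  L0_scalerA L0_scale1r L0_scalerDr L0_scalerDl.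

Definition rep (u : L0) : mR3 R -> R := repr u.

Definition is_class (u : L0) (f : R3 R -> R) :=
  {ae leb3, forall x, Omega x -> rep u x = f x}.

End L0.

Section spaces.
Context {R : realType} (Omega : set (R3 R)).

Definition vec : Type := 'I_3 -> L0 Omega.
HB.instance Definition _ := GRing.Lmodule.on vec.
HB.instance Definition _ := Choice.on vec.

(* [I = 'I_3] for vector fields, [I = 'I_3 * 'I_3] for their gradients. *)
Definition L2 {I : finType} : set (I -> L0 Omega) :=
  [set u | forall i, (\int[leb3]_(x in Omega) (rep (u i) x ^+ 2)%:E < +oo)%E].

Definition dot {I : finType} (u v : I -> L0 Omega) : R :=
  \sum_i \int[leb3]_(x in Omega) (rep (u i) x * rep (v i) x).

Definition norm {I : finType} (u : I -> L0 Omega) : R := Num.sqrt (dot u u).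

(* [G (i, j)] is the weak derivative of [u j] in direction [i]. *)
Definition weak_grad (u : vec) (G : 'I_3 * 'I_3 -> L0 Omega) :=
  forall i j eta, Cc_infty Omega eta ->
    \int[leb3]_(x in Omega) (rep (u j) x * pd i eta x) =
    - \int[leb3]_(x in Omega) (rep (G (i, j)) x * eta x).

Definition space_H1 : set vec :=
  [set u | L2 u /\ exists2 G, L2 G & weak_grad u G].

(* For [u] in [space_H1] such a [G] is unique in [L0 Omega]. *)
Definition grad (u : vec) : 'I_3 * 'I_3 -> L0 Omega :=
  xget 0 [set G | L2 G /\ weak_grad u G].

Definition H1norm (u : vec) : R :=
  Num.sqrt (norm u ^+ 2 + norm (grad u) ^+ 2).

Definition closure_in (N : vec -> R) (X S : set vec) : set vec :=
  [set u | X u /\ forall e, 0 < e -> exists2 v, S v & N (u - v) < e].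

Definition Cc_infty3 : set vec :=
  [set u | exists f : 'I_3 -> R3 R -> R,
    forall i, Cc_infty Omega (f i) /\ is_class (u i) (f i)].

Definition Cc_infty_div0 : set vec :=
  [set u | exists f : 'I_3 -> R3 R -> R,
    (forall i, Cc_infty Omega (f i) /\ is_class (u i) (f i)) /\
    (forall x, \sum_i pd i (f i) x = 0)].

Definition space_H10 : set vec := closure_in H1norm space_H1 Cc_infty3.

Definition space_H : set vec := closure_in norm L2 Cc_infty_div0.

Definition space_V : set vec := closure_in H1norm space_H10 Cc_infty_div0.

(* Elements of V' are functions on all of [vec] of which only the restriction
   to [V] is meaningful. *)
Definition dual_V : set (vec -> R) :=
  [set g | (forall (a b : R) u v, space_V u -> space_V v ->
              g (a *: u + b *: v) = a * g u + b * g v) /\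
           exists C, forall u, space_V u -> `|g u| <= C * norm (grad u)].

Definition dual_V_norm (g : vec -> R) : R :=
  sup [set `|g u| | u in [set u | space_V u /\ norm (grad u) <= 1]].

Definition L2_dual_V (u : vec) : vec -> R := fun w => dot u w.

Definition weakly_cvg_V (u_ : nat -> vec) (u : vec) :=
  forall g, dual_V g -> g (u_ n) @[n --> \oo] --> g u.

Definition lambda1 : R :=
  sup [set c | forall u, space_V u -> c * norm u ^+ 2 <= norm (grad u) ^+ 2].

Definition ball_H (r : R) : set vec := [set u | space_H u /\ norm u <= r].

End spaces.

Arguments space_H {R} Omega.
Arguments space_V {R} Omega.

Section borel.
Context {R : realType} (Omega : set (R3 R)).

Lemma null_on_integral (u : {mfun mR3 R >-> R}) : u \in null_on Omega ->
  (\int[leb3]_(x in Omega) (u x ^+ 2)%:E = 0)%E.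
Proof.
move=> /asboolP[N [mN N0 uN]]; apply/eqP; rewrite eq_le.
apply/andP; split; last first.
  by apply: integral_ge0 => x _; rewrite lee_fin sqr_ge0.
pose g : mR3 R -> \bar R := fun x => (u x ^+ 2)%:E.
have g0 x : (0 <= g x)%E by rewrite lee_fin sqr_ge0.
have gN0 : (\int[leb3]_(x in N) g x = 0)%E.
  apply: null_set_integral => //; apply: (@measurable_funS _ _ _ _ setT) => //.
  by apply/measurable_EFinP; exact: measurable_funX.
rewrite -[leRHS]gN0 -/g !(integral_mkcond _ g).
rewrite !ge0_integralTE; last 2 first.
- by move=> x; rewrite patchE; case: ifPn.
- by move=> x; rewrite patchE; case: ifPn.
apply: ereal_sup_le => _ [h hg <-]; exists h => // x.
apply: le_trans (hg x) _; rewrite !patchE; case: ifPn => [|_]; last first.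
  by case: ifPn.
rewrite inE => Ox; case: ifPn => // /negP; rewrite inE => nNx.
have -> : g x = 0%E; last by [].
rewrite /g; have -> : u x = 0.
  by apply: contrapT => ux; apply: nNx; apply: uN => /= /(_ Ox).
by rewrite expr0n.
Qed.

Lemma repr0_null : repr (0 : L0 Omega) \in null_on Omega.
Proof.
have -> : (0 : L0 Omega) = \pi_(L0 Omega) 0 by rewrite !piE.
by rewrite -[X in X \in _]subr0 L0_repr_pi.
Qed.

Lemma smooth0 : smooth (cst 0 : R3 R -> R).
Proof.
move=> s; suff -> : foldr pd (cst 0 : R3 R -> R) s = cst 0.
  split=> [|i x]; first exact: cst_continuous.
  exact: derivable_cst.
elim: s => //= i s ->; apply/funext => x; exact: derive_cst.
Qed.

Lemma Cc_infty0 : Cc_infty Omega (cst 0).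
Proof.
have s0 : support (cst 0 : R3 R -> R) = set0.
  rewrite /support (_ : [set x | _] = set0) ?closure0//.
  by apply/seteqP; split => x //=; rewrite eqxx.
by split; [exact: smooth0|rewrite s0; exact: compact0|rewrite s0].
Qed.

Lemma space_H_0 : space_H Omega 0.
Proof.
have i0 (i : 'I_3) :
    (\int[leb3]_(x in Omega) (rep ((0 : vec Omega) i) x ^+ 2)%:E = 0)%E.
  exact: (null_on_integral repr0_null).
split=> [i|e e0]; first by rewrite i0.
exists 0.
  exists (fun=> cst 0); split=> [i|x].
    split; first exact: Cc_infty0.
    exact/asboolP/repr0_null.
  by rewrite big1// => i _; exact: derive_cst.
rewrite subrr /norm /dot big1 ?sqrtr0// => i _.
rewrite /Rintegral (_ : integral _ _ _ = 0%E)//.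
by rewrite -[RHS](i0 i).
Qed.

Definition Hspace : Type := set_type (space_H Omega).
HB.instance Definition _ := Choice.on Hspace.
HB.instance Definition _ :=
  isPointed.Build Hspace (exist _ 0 (mem_set space_H_0)).

Definition H_open : set (set Hspace) :=
  [set U | forall u, U u -> exists2 e : R, 0 < e &
     forall v, norm (val v - val u) < e -> U v].

Definition Hborel := g_sigma_algebraType H_open.

Definition Hval (u : Hborel) : vec Omega := val (u : Hspace).

End borel.

Definition Cc1 {R : realType} (m : nat) (psi : 'rV[R]_m -> R) :=
  [/\ continuous psi,
      forall j x, derivable psi x (delta_mx 0 j),
      forall j, continuous ('D_(delta_mx 0 j) psi) &
      compact (support psi)].

(* A functional is given by data (m, w, psi) representing it; its value and its
   differential do not depend on the representation. *)
Record Tcyl {R : realType} (Omega : set (R3 R)) := {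
  cyl_m : nat;
  cyl_w : 'I_cyl_m -> vec Omega;
  cyl_wP : forall j, space_V Omega (cyl_w j);
  cyl_psi : 'rV[R]_cyl_m -> R;
  cyl_psiP : Cc1 cyl_psi }.

Section cylindrical.
Context {R : realType} (Omega : set (R3 R)) (Psi : Tcyl Omega).
Implicit Type g : vec Omega -> R.

Definition cyl_coord g : 'rV[R]_(cyl_m Psi) := \row_j g (cyl_w j).

Definition cyl_val g : R := cyl_psi (cyl_coord g).

Definition cyl_diff g : vec Omega :=
  \sum_j ('D_(delta_mx 0 j) (@cyl_psi _ _ Psi) (cyl_coord g)) *: cyl_w j.

End cylindrical.

Section navier_stokes.
Context {R : realType} (Omega : set (R3 R)) (nu : R) (f : vec Omega -> R).
Implicit Type u v w : vec Omega.

Definition convection u v w : R :=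
  \int[leb3]_(x in Omega)
    \sum_(i < 3) \sum_(j < 3) rep (u i) x * rep (grad v (i, j)) x * rep (w j) x.

Definition F u : vec Omega -> R :=
  fun w => f w - nu * dot (grad u) (grad w) - convection u u w.

Definition ell u : R := nu * norm (grad u) ^+ 2 - f u.

Definition enstrophy u : \bar R :=
  if `[< space_V Omega u >] then (norm (grad u) ^+ 2)%:E else +oo%E.

Definition in_V : set (Hborel Omega) := @Hval _ _ @^-1` space_V Omega.

(* [dpsi] is the derivative of [psi] on [0, +oo[, one-sided at 0. *)
Definition C1_halfline (psi dpsi : R -> R) :=
  (forall t, 0 <= t ->
     (psi s - psi t) / (s - t) @[s --> within `[0, +oo[%classic t^'] --> dpsi t)
  /\ {within `[0, +oo[%classic, continuous dpsi}.

Definition energy_test (psi dpsi : R -> R) :=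
  [/\ C1_halfline psi dpsi,
      forall t, 0 <= t -> 0 <= psi t,
      forall s t, 0 <= s -> s <= t -> psi s <= psi t &
      exists C, forall t, 0 <= t -> `|dpsi t| <= C].

Definition fpsss : set (probability (Hborel Omega) R) :=
  [set mu |
    [/\ (\int[mu]_u enstrophy (Hval u) < +oo)%E,
        forall psi dpsi, energy_test psi dpsi ->
          (\int[mu]_(u in in_V) (dpsi (norm (Hval u) ^+ 2) * ell (Hval u))%:E
             <= 0)%E &
        forall Psi : Tcyl Omega,
          (\int[mu]_(u in in_V)
             (F (Hval u) (cyl_diff Psi (L2_dual_V (Hval u))))%:E = 0)%E]].

Definition r0 : R := dual_V_norm f / (nu * Num.sqrt (lambda1 Omega)).

Definition Bf1 (B : set (vec Omega)) : set (R * R * vec Omega * vec Omega) :=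
  [set p | exists u, [/\ p = (1, 0, u, u), B u, space_V Omega u & ell u <= 0]].

Definition Bf2 (B : set (vec Omega)) : set (R * R * vec Omega * vec Omega) :=
  [set p | let: (th1, th2, u1, u2) := p in
    [/\ 0 < th1 < 1 /\ th2 = 1 - th1,
        (B u1 /\ space_V Omega u1) /\ (B u2 /\ space_V Omega u2),
        norm u1 = norm u2,
        ell u1 < 0 < ell u2 &
        th1 * ell u1 + th2 * ell u2 = 0]].

Definition Bf (B : set (vec Omega)) := Bf1 B `|` Bf2 B.

Definition objective (phi : vec Omega -> R) (Psi : Tcyl Omega)
    (p : R * R * vec Omega * vec Omega) : R :=
  let: (th1, th2, u1, u2) := p in
  th1 * (phi u1 + F u1 (cyl_diff Psi (L2_dual_V u1))) +
  th2 * (phi u2 + F u2 (cyl_diff Psi (L2_dual_V u2))).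

End navier_stokes.

Definition is_max {R : realType} (A : set R) (m : R) := A m /\ ubound A m.

(* Main.v *)
Require Import Defs.
From HB Require Import structures.
From mathcomp Require Import all_boot all_order all_algebra ring_quotient.
From mathcomp Require Import all_classical all_reals all_analysis measurable_realfun.
From mathcomp Require Import ring lra.
Import numFieldNormedType.Exports.
Set Implicit Arguments.
Unset Strict Implicit.
Unset Printing Implicit Defensive.
Import Order.TTheory GRing.Theory Num.Theory.
Local Open Scope classical_set_scope.
Local Open Scope ring_scope.

(** Two-point states [t1 delta_u1 + t2 delta_u2] with [|u1| = |u2|] and
    [t1 ell u1 + t2 ell u2 <= 0] play the role of extreme measures.  If the mean
    of [phi + <F, DPsi>] on them is at most [m], a Lagrange multiplier [lam > 0]
    gives [phi + <F, DPsi> <= m + e + lam (|u|^2) ell] pointwise; integrating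
    against a stationary solution, the stationarity equation kills [<F, DPsi>]
    and the energy inequality with [psi' = lam] kills the last term, so that
    [int phi <= m].

    Conversely let [M] be the infimum over [Psi] of the maximal means, and let
    [q G] be the infimum over [t >= 0] and [Psi] of the maximal mean of
    [G + t phi + <F, DPsi>], minus [t M].  This is sublinear, and it is finite
    because the maximal mean of [<F, DPsi>] alone is nonnegative: otherwise
    [Psi + Lam (|u|^2) / 2] would decrease along the Galerkin flow on the span of
    the [w_j], which leaves a ball invariant.  A linear form
    below [q] (Hahn-Banach) is positive, is at least [M] at [phi] and vanishes
    on every [<F, DPsi>].  By Rellich compactness it satisfies Dini's condition,
    so Daniell's construction represents it by a probability measure; the
    energy inequality passes to this measure because [|grad u|^2] is the
    increasing limit of its Moreau-Yosida regularizations, which are Lipschitz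
    for the norm of [H]. *)

(** * Square-integrable functions on R3 *)

(** The energy inequality is tested only with functions of [|u|^2], so it constrains the mean of
    [ell] on each sphere of [H] separately: one linear constraint besides the total mass, hence two
    points of equal norm. Such states form no compact family, since only the weighted enstrophy is
    bounded; but a point whose enstrophy escapes to infinity carries a weight of order
    [1 / |grad u|^2], and sub-quadratic growth makes its contribution vanish in the limit. Putting
    [t phi] inside the infimum that defines [q] lets a single linear form carry both stationarity
    and the lower bound at [phi]. That form must be defined on [|grad u|^2], which is not weakly
    continuous; there it only dominates the integral, and this is the direction in which the energy
    inequality needs it. Weak continuity of [<F, DPsi>] rests on smooth test fields, whose
    boundedness replaces one [L^4] factor in the convection term; general fields of [V] follow by
    approximation with weight [1 + |grad u|^2]. The convex-analytic part knows the flow only through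
    the record [hilbert_pair] and a few properties of [F] and [ell]. *)

Section borel_R3.
Context {R : realType}.

Definition rbox (q : rat * rat * rat * rat) : set (R3 R) :=
  [set x | [/\ `|x.1.1 - ratr q.1.1.1| < ratr q.2, `|x.1.2 - ratr q.1.1.2| < ratr q.2
   & `|x.2 - ratr q.1.2| < ratr q.2]].

Lemma measurable_rbox q : measurable (rbox q : set (mR3 R)).
Proof.
have m1 : measurable_fun setT (fun x : mR3 R => x.1.1).
  exact: measurableT_comp measurable_fst measurable_fst.
have m2 : measurable_fun setT (fun x : mR3 R => x.1.2).
  exact: measurableT_comp measurable_snd measurable_fst.
have m3 : measurable_fun setT (fun x : mR3 R => x.2) by exact: measurable_snd.
have H (g : mR3 R -> R) (c d : R) : measurable_fun setT g ->
    measurable [set x | `|g x - c| < d].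
  move=> mg; have mh : measurable_fun setT (fun x => `|g x - c| < d).
    apply: measurable_fun_ltr => //; apply: measurableT_comp => //.
    exact: measurable_funB.
  by have := mh measurableT [set true] I; rewrite setTI; congr (measurable _);
    apply/seteqP; split => x /=.
rewrite (_ : rbox q = [set x : mR3 R | `|x.1.1 - ratr q.1.1.1| < ratr q.2] `&`
  [set x : mR3 R | `|x.1.2 - ratr q.1.1.2| < ratr q.2] `&`
  [set x : mR3 R | `|x.2 - ratr q.1.2| < ratr q.2]).
  by apply: measurableI; [apply: measurableI|]; exact: H.
by apply/seteqP; split => x /=; [case|case=> -[]].
Qed.

(** Rational cubes are countably many and form a base of the topology, so an open set is the
    countable union of those it contains. This links the topology of [R3] to the product
    sigma-algebra of [mR3]. *)
Lemma open_measurable3 (U : set (R3 R)) : open U -> measurable (U : set (mR3 R)).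
Proof.
move=> oU.
rewrite (_ : U = \bigcup_q (if `[< rbox q `<=` U >] then rbox q else set0)).
  apply: countable_bigcupT_measurable => // q.
  by case: ifP => _; [exact: measurable_rbox|exact: measurable0].
apply/seteqP; split=> [x Ux|x [q _]]; last first.
  by case: ifP => [/asboolP qU|//]; exact: qU.
have /nbhs_ballP[e /= e0 eU] : nbhs x U by exact: open_nbhs_nbhs.
have [d /= /andP[d0 de]] : exists d : rat, 0 < (ratr d : R) < e / 2.
  have [d] := rat_in_itvoo (divr_gt0 e0 (ltr0Sn R 1)).
  by rewrite in_itv /=; exists d.
have rq (y : R) : exists q : rat, `|y - ratr q| < ratr d.
  have [q] := @rat_in_itvoo R (y - ratr d) (y + ratr d) ltac:(lra).
  rewrite in_itv /= => /andP[q1 q2]; exists q.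
  by rewrite ltr_norml; apply/andP; split; lra.
have [q1 h1] := rq x.1.1; have [q2 h2] := rq x.1.2; have [q3 h3] := rq x.2.
exists (q1, q2, q3, d) => //; case: asboolP => [_|]; first by split.
case=> y [] /= k1 k2 k3; apply: eU.
have tri (a b c : R) : `|a - c| < ratr d -> `|b - c| < ratr d -> ball a e b.
  move=> ac bc; rewrite /ball /=.
  rewrite (_ : a - b = (a - c) - (b - c)); last by ring.
  by apply: le_lt_trans (ler_normB _ _) _; lra.
by split; [split|]; [exact: tri h1 k1|exact: tri h2 k2|exact: tri h3 k3].
Qed.

Lemma continuous_measurable3 (f : R3 R -> R) : continuous f ->
  measurable_fun setT (f : mR3 R -> R).
Proof.
move=> /continuousP cf; apply: (measurability _ (RGenOpens.measurableE R)).
move=> _ [_ [a [b ->] <-]]; rewrite setTI; apply: open_measurable3.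
exact/cf/interval_open.
Qed.
End borel_R3.

Lemma nneseries_geometric_lty {R : realType} (c : R) (u : nat -> \bar R) :
  (forall n, 0 <= u n)%E -> (forall n, u n <= (c * 2^-1 ^+ n)%:E)%E ->
  (\sum_(0 <= n <oo) u n < +oo)%E.
Proof.
move=> u0 uc.
have gc : cvgn (series (geometric c 2^-1)).
  apply: is_cvg_geometric_series.
  by rewrite ger0_norm ?invr_ge0// invf_lt1// ltr1n.
apply: (@le_lt_trans _ _ (\sum_(0 <= n <oo) (c * 2^-1 ^+ n : R)%:E)%E).
  by apply: lee_nneseries => n _.
rewrite (_ : limn _ = (limn (series (geometric c 2^-1)))%:E) ?ltry//.
rewrite -EFin_lim//; congr (limn _); apply/funext => n /=.
by rewrite /series /= sumEFin.
Qed.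

Lemma nneseries_cvg0 {R : realType} (a : nat -> R) : (forall n, 0 <= a n) ->
  (\sum_(0 <= n <oo) (a n)%:E)%E \is a fin_num -> a n @[n --> \oo] --> 0.
Proof.
move=> a0 fa; apply: cvg_series_cvg_0; apply: nondecreasing_is_cvgn.
  apply/nondecreasing_seqP => n; rewrite /series /= big_nat_recr//= lerDl//.
exists (fine (\sum_(0 <= n <oo) (a n)%:E)%E) => _ [n _ <-].
rewrite -lee_fin fineK// /series /= -sumEFin.
by apply: nneseries_lim_ge => i _ _; rewrite lee_fin.
Qed.

Lemma sqr_cvg0 {R : realType} (a : nat -> R) :
  a n ^+ 2 @[n --> \oo] --> 0 -> a n @[n --> \oo] --> 0.
Proof.
move=> /cvgrPdist_le a0; apply/cvgrPdist_le => e e0.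
have [N _ NP] := a0 (e ^+ 2) (exprn_gt0 _ e0).
exists N => // n /NP /=; rewrite !sub0r !normrN normrX.
by rewrite ler_pXn2r// nnegrE// ltW.
Qed.

Lemma subr_cvg0 {R : realType} (a : nat -> R) l :
  a n - l @[n --> \oo] --> 0 <-> a n @[n --> \oo] --> l.
Proof.
split=> /cvgrPdist_le h; apply/cvgrPdist_le => e /h; apply: filterS => n.
  by rewrite sub0r opprB.
by rewrite sub0r opprB.
Qed.

Section square_integrable.
Context {d} {T : measurableType d} {R : realType}.
Variables (mu : {measure set T -> \bar R}) (D : set T).
Hypothesis mD : measurable D.
Implicit Types f g : T -> R.

Definition sqint f :=
  measurable_fun D f /\ (\int[mu]_(x in D) (f x ^+ 2)%:E < +oo)%E.

Definition ip f g : R := \int[mu]_(x in D) (f x * g x).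

Lemma sqint_sqr f : sqint f -> mu.-integrable D (EFin \o (fun x => f x ^+ 2)).
Proof.
move=> [mf fi]; apply/integrableP; split.
  by apply/measurable_EFinP; exact: measurable_funX.
by under eq_integral do rewrite /= ger0_norm ?sqr_ge0//.
Qed.

Lemma sqint_of_sqr f : measurable_fun D f ->
  mu.-integrable D (EFin \o (fun x => f x ^+ 2)) -> sqint f.
Proof.
move=> mf /integrableP[_ fi]; split => //; apply: le_lt_trans fi.
by rewrite le_eqVlt; apply/orP; left; apply/eqP/eq_integral => x _ /=;
  rewrite ger0_norm ?sqr_ge0.
Qed.

Lemma sqint_le f g h : measurable_fun D f -> sqint g -> sqint h ->
  (forall x, D x -> f x ^+ 2 <= g x ^+ 2 + h x ^+ 2) -> sqint f.
Proof.
move=> mf sg sh fgh; apply: sqint_of_sqr => //.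
apply: (@le_integrable _ _ _ mu D mD _
  (EFin \o (fun x => g x ^+ 2 + h x ^+ 2))).
- by apply/measurable_EFinP; exact: measurable_funX.
- move=> x Dx /=; rewrite lee_fin !ger0_norm ?addr_ge0 ?sqr_ge0//; exact: fgh.
- have := integrableD mD (sqint_sqr sg) (sqint_sqr sh).
  by apply: eq_integrable.
Qed.

Lemma sqintZ a f : sqint f -> sqint (fun x => a * f x).
Proof.
move=> sf; have mf := sf.1; apply: sqint_of_sqr.
  exact: measurable_funM.
have := integrableZl mD (a ^+ 2) (sqint_sqr sf).
by apply: eq_integrable => // x _ /=; rewrite exprMn EFinM.
Qed.

Lemma sqintD f g : sqint f -> sqint g -> sqint (fun x => f x + g x).
Proof.
move=> sf sg; have [mf _] := sf; have [mg _] := sg.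
apply: (sqint_le _ (sqintZ 2 sf) (sqintZ 2 sg)).
  exact: measurable_funD.
by move=> x _; nra.
Qed.

Lemma sqintB f g : sqint f -> sqint g -> sqint (fun x => f x - g x).
Proof.
move=> sf /(sqintZ (-1)) sg; have := sqintD sf sg.
by under eq_fun do rewrite mulN1r.
Qed.

Lemma ip_integrable f g : sqint f -> sqint g ->
  mu.-integrable D (EFin \o (fun x => f x * g x)).
Proof.
move=> sf sg; have [mf _] := sf; have [mg _] := sg.
apply: (@le_integrable _ _ _ mu D mD _
  (EFin \o (fun x => f x ^+ 2 + g x ^+ 2))).
- by apply/measurable_EFinP; exact: measurable_funM.
- move=> x Dx /=; rewrite lee_fin.
  rewrite (@ger0_norm _ (_ + _)) ?addr_ge0 ?sqr_ge0//.
  by rewrite ler_norml; apply/andP; split; nra.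
- have := integrableD mD (sqint_sqr sf) (sqint_sqr sg).
  by apply: eq_integrable.
Qed.

Lemma ipC f g : ip f g = ip g f.
Proof. by apply: eq_Rintegral => x _; rewrite mulrC. Qed.

Lemma ipDl f g h : sqint f -> sqint g -> sqint h ->
  ip (fun x => f x + g x) h = ip f h + ip g h.
Proof.
move=> sf sg sh; rewrite /ip -RintegralD//; [|exact: ip_integrable..].
by apply: eq_Rintegral => x _; rewrite mulrDl.
Qed.

Lemma ipZl a f h : sqint f -> sqint h -> ip (fun x => a * f x) h = a * ip f h.
Proof.
move=> sf sh; rewrite /ip -RintegralZl//; last exact: ip_integrable.
by apply: eq_Rintegral => x _; rewrite mulrA.
Qed.

Lemma ip_ge0 f : 0 <= ip f f.
Proof. by apply: Rintegral_ge0 => x _; rewrite -expr2 sqr_ge0. Qed.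

Lemma ip_sqrE f : sqint f ->
  (\int[mu]_(x in D) (f x ^+ 2)%:E)%E = (ip f f)%:E.
Proof.
move=> sf; rewrite /ip /Rintegral fineK.
  by apply: eq_integral => x _; rewrite expr2.
by apply: integrable_fin_num => //; exact: ip_integrable.
Qed.

Lemma ip0_ae f : sqint f -> ip f f = 0 -> {ae mu, forall x, D x -> f x = 0}.
Proof.
move=> sf f0; have [mf _] := sf.
have : ae_eq mu D (EFin \o (fun x => f x ^+ 2)) (cst 0%E).
  apply/(ae_eq_integral_abs mu mD).
    by apply/measurable_EFinP; exact: measurable_funX.
  under eq_integral do rewrite /= ger0_norm ?sqr_ge0//.
  by rewrite (ip_sqrE sf) f0.
apply: filterS => x /= /[apply] -[] /eqP; rewrite sqrf_eq0 => /eqP//.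
Qed.

Lemma ip_ae f f' g g' : sqint f -> sqint f' -> sqint g -> sqint g' ->
  {ae mu, forall x, D x -> f x = f' x} -> {ae mu, forall x, D x -> g x = g' x} ->
  ip f g = ip f' g'.
Proof.
move=> [mf _] [mf' _] [mg _] [mg' _] ff' gg'.
congr fine; apply: ae_eq_integral => //.
- by apply/measurable_EFinP; exact: measurable_funM.
- by apply/measurable_EFinP; exact: measurable_funM.
- by apply: filterS2 ff' gg' => x ff' gg' Dx; rewrite ff'// gg'.
Qed.

Lemma sqint_abs f : sqint f -> sqint (fun x => `|f x|).
Proof.
move=> [mf fi]; split; first by apply: measurableT_comp mf; exact: normr_measurable.
by under eq_integral do rewrite real_normK ?num_real//.
Qed.

Lemma ip_abs f : ip (fun x => `|f x|) (fun x => `|f x|) = ip f f.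
Proof. by apply: eq_Rintegral => x _; rewrite -!expr2 real_normK ?num_real. Qed.

Lemma ip_cs f g : sqint f -> sqint g -> ip f g ^+ 2 <= ip f f * ip g g.
Proof.
move=> sf sg.
have H (a : R) : 0 <= ip f f + 2 * a * ip f g + a ^+ 2 * ip g g.
  have sag := sqintZ a sg; have := ip_ge0 (fun x => f x + a * g x).
  have sfg := sqintD sf sag.
  rewrite (ipDl sf sag sfg) (ipC f (fun x => f x + a * g x)).
  rewrite (ipC (fun x => a * g x) (fun x => f x + a * g x)).
  rewrite (ipDl sf sag sf) (ipDl sf sag sag) (ipC f (fun x => a * g x)).
  rewrite (ipZl a sg sf) (ipZl a sg sag) (ipC g (fun x => a * g x)) (ipZl a sg sg).
  by rewrite (ipC g f); congr (_ <= _); ring.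
have [g0|g0] := eqVneq (ip g g) 0.
  have [->|fg] := eqVneq (ip f g) 0; first by rewrite g0 mulr0 expr0n.
  (* When [ip g g = 0] the quadratic polynomial in [a] is affine; this value of [a] would make it
     equal to [-1]. *)
  have := H (- (ip f f + 1) / (2 * ip f g)); rewrite g0 mulr0 addr0.
  have -> : 2 * (- (ip f f + 1) / (2 * ip f g)) * ip f g = - (ip f f + 1).
    by field.
  by rewrite opprD addrA subrr add0r oppr_ge0 ler10.
have gp : 0 < ip g g by rewrite lt_def g0 ip_ge0.
have := H (- ip f g / ip g g).
have -> : ip f f + 2 * (- ip f g / ip g g) * ip f g + (- ip f g / ip g g) ^+ 2 * ip g g
   = (ip f f * ip g g - ip f g ^+ 2) / ip g g by field.
by rewrite pmulr_lge0 ?invr_gt0// subr_ge0.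
Qed.

Lemma nneseries_integrable_ae (h : nat -> T -> \bar R) :
  (forall n, measurable_fun D (h n)) ->
  (forall n x, D x -> 0 <= h n x)%E ->
  (\int[mu]_(x in D) (\sum_(0 <= n <oo) h n x) < +oo)%E ->
  {ae mu, forall x, D x -> (\sum_(0 <= n <oo) h n x)%E \is a fin_num}.
Proof.
move=> mh h0 Hfin; apply: integrable_ae => //; apply/integrableP; split.
  apply: (@ge0_emeasurable_sum _ _ _ _ _ xpredT) => // n x Dx _; exact: h0.
apply: le_lt_trans Hfin; rewrite le_eqVlt; apply/orP; left; apply/eqP.
apply: eq_integral => x /[!inE] Dx; rewrite gee0_abs//.
by apply: nneseries_ge0 => n _ _; exact: h0.
Qed.

(** Along indices whose squared distance to [f] is at most [2^-n], the sum of the squared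
    differences has finite integral; it is therefore finite almost everywhere, and there its terms
    tend to 0. *)
Lemma ae_subseq (f_ : nat -> T -> R) f : sqint f -> (forall n, sqint (f_ n)) ->
  ip (fun x => f_ n x - f x) (fun x => f_ n x - f x) @[n --> \oo] --> 0 ->
  exists k : nat -> nat, (forall n, (n <= k n)%N) /\
    {ae mu, forall x, D x -> f_ (k n) x @[n --> \oo] --> f x}.
Proof.
move=> sf sf_ f0.
pose g n x := f_ n x - f x.
have sg n : sqint (g n) by exact: sqintB.
have /choice[k kP] : forall n, exists m, (n <= m)%N /\
    ip (g m) (g m) <= (2^-1) ^+ n.
  move=> n; have /cvgrPdist_le /(_ ((2^-1) ^+ n)) := f0.
  have p0 : (0 : R) < (2^-1) ^+ n by rewrite exprn_gt0// invr_gt0.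
  move=> /(_ p0) [N _ NP]; exists (maxn n N); split; first exact: leq_maxl.
  have := NP (maxn n N) (leq_maxr _ _).
  by rewrite sub0r normrN ger0_norm// ip_ge0.
exists k; split; first by move=> n; case: (kP n).
pose h n : T -> \bar R := EFin \o (fun x => g (k n) x ^+ 2).
have mh n : measurable_fun D (h n).
  by apply/measurable_EFinP; apply: measurable_funX; case: (sg (k n)).
have h0 n x : D x -> (0 <= h n x)%E by rewrite lee_fin sqr_ge0.
have Hfin : (\int[mu]_(x in D) (\sum_(0 <= n <oo) h n x) < +oo)%E.
  rewrite integral_nneseries//.
  apply: (@nneseries_geometric_lty _ 1) => n.
    by apply: integral_ge0 => x Dx; exact: h0.
  by rewrite (ip_sqrE (sg _)) lee_fin mul1r; case: (kP n).
apply: filterS (nneseries_integrable_ae mh h0 Hfin) => x /[swap] Dx /(_ Dx) hfin.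
apply/subr_cvg0; apply: sqr_cvg0.
by apply: nneseries_cvg0 => // n; exact: sqr_ge0.
Qed.

Lemma fatou_ae (f_ : nat -> T -> R) f N (M : \bar R) :
  (forall n, measurable_fun D (f_ n)) -> measurable_fun D f ->
  (forall n x, D x -> 0 <= f_ n x) ->
  {ae mu, forall x, D x -> f_ n x @[n --> \oo] --> f x} ->
  (forall n, (N <= n)%N -> (\int[mu]_(x in D) (f_ n x)%:E <= M)%E) ->
  (\int[mu]_(x in D) (f x)%:E <= M)%E.
Proof.
move=> mf_ mf f0 fcvg fM.
have mg : measurable_fun D (fun x => limn_einf (fun n => (f_ n x)%:E)).
  rewrite /limn_einf; apply: measurableT_comp => //.
  apply: measurable_fun_limn_esup => n; apply: measurableT_comp => //.
  exact/measurable_EFinP.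
have fl : ae_eq mu D (fun x => limn_einf (fun n => (f_ n x)%:E)) (EFin \o f).
  apply: filterS fcvg => x /[apply] cx.
  have cx2 : (f_ n x)%:E @[n --> \oo] --> (f x)%:E.
    by apply: cvg_EFin => //; exact: nearW.
  by rewrite (cvg_limn_einf_sup cx2).1.
have mEf : measurable_fun D (EFin \o f) by exact/measurable_EFinP.
rewrite -(@ae_eq_integral _ _ _ mu D _ _ mD mg mEf fl).
apply: le_trans (@fatou _ _ _ mu D mD (fun n x => (f_ n x)%:E) _ _) _.
- by move=> n; exact/measurable_EFinP.
- by move=> n x Dx; rewrite lee_fin f0.
rewrite limn_einf_lim; apply: lime_le; first exact: is_cvg_einfs.
exists N => // n /= Nn; apply: le_trans (fM n Nn).
by apply: ereal_inf_lbound; exists n => //=.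
Qed.

(** Riesz-Fischer: a fast subsequence converges almost everywhere, and Fatou's lemma in the second
    index turns the Cauchy bound into a bound on the distance of the whole sequence to that
    limit. *)
Lemma sqint_complete (f_ : nat -> T -> R) : (forall n, sqint (f_ n)) ->
  (forall e, 0 < e -> exists N, forall n m, (N <= n)%N -> (N <= m)%N ->
    ip (fun x => f_ n x - f_ m x) (fun x => f_ n x - f_ m x) <= e) ->
  exists f, sqint f /\
    ip (fun x => f_ n x - f x) (fun x => f_ n x - f x) @[n --> \oo] --> 0.
Proof.
move=> sf Cf.
(* Squared gaps of order [16^-n] leave room for the weights [2^n]: the weighted gaps [2^n g_n] still
   have summable squared norms, so that almost everywhere [|g_n|] is at most a constant times [2^-n]
   and the series of gaps converges absolutely. *)
pose q : R := (4^-1) ^+ 2.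
have /choice[k kP] : forall n, exists k, forall m, (k <= m)%N ->
    ip (fun x => f_ k x - f_ m x) (fun x => f_ k x - f_ m x) <= q ^+ n.
  move=> n; have [N NP] := Cf (q ^+ n) ltac:(by rewrite exprn_gt0// exprn_gt0// invr_gt0).
  by exists N => m Nm; exact: NP.
pose j := fix j n := if n is n'.+1 then maxn (j n').+1 (k n) else k 0%N.
have kj n : (k n <= j n)%N by case: n => //= n; exact: leq_maxr.
have jS n : (j n < j n.+1)%N by exact: leq_maxl.
have jge n : (n <= j n)%N.
  by elim: n => // n ih; apply: leq_ltn_trans (jS n).
have sD n m : sqint (fun x => f_ n x - f_ m x) by exact: sqintB.
pose g n x := f_ (j n.+1) x - f_ (j n) x.
have sg n : sqint (g n) by exact: sD.
have gq n : ip (g n) (g n) <= 4 * q ^+ n.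
  have k1 := kP n (j n) (kj n).
  have k2 := kP n (j n.+1) (leq_trans (kj n) (ltnW (jS n))).
  have sa := sD (k n) (j n); have sb := sD (k n) (j n.+1).
  rewrite -lee_fin -(ip_sqrE (sg n)).
  apply: (@le_trans _ _ (\int[mu]_(x in D) ((2 * (f_ (k n) x - f_ (j n) x) ^+ 2)%:E + (2 * (f_ (k n) x - f_ (j n.+1) x) ^+ 2)%:E))%E).
    apply: ge0_le_integral => //.
    - by move=> x _; rewrite lee_fin sqr_ge0.
    - by apply/measurable_EFinP; apply: measurable_funX; case: (sg n).
    - by apply/measurable_EFinP; apply: measurable_funD; apply: measurable_funM => //;
        apply: measurable_funX; [case: sa|case: sb].
    - move=> x Dx; rewrite -EFinD lee_fin /g.
      have := sqr_ge0 (f_ (k n) x - f_ (j n) x + (f_ (k n) x - f_ (j n.+1) x)).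
      nra.
  rewrite ge0_integralD//; last 4 first.
  - by move=> x _; rewrite lee_fin mulr_ge0// sqr_ge0.
  - by apply/measurable_EFinP; apply: measurable_funM => //; apply: measurable_funX; case: sa.
  - by move=> x _; rewrite lee_fin mulr_ge0// sqr_ge0.
  - by apply/measurable_EFinP; apply: measurable_funM => //; apply: measurable_funX; case: sb.
  under eq_integral do rewrite EFinM.
  rewrite integralZl//; last exact: sqint_sqr.
  under [X in (_ + X)%E]eq_integral do rewrite EFinM.
  rewrite integralZl//; last exact: sqint_sqr.
  by rewrite !ip_sqrE// -!EFinM -EFinD lee_fin; lra.
pose h n : T -> \bar R := EFin \o (fun x => (2 ^+ n * g n x) ^+ 2).
have sh n : sqint (fun x => 2 ^+ n * g n x) by exact: sqintZ.
have mh n : measurable_fun D (h n).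
  by apply/measurable_EFinP; apply: measurable_funX; case: (sh n).
have Hfin : (\int[mu]_(x in D) (\sum_(0 <= n <oo) h n x) < +oo)%E.
  rewrite integral_nneseries//; last by move=> n x Dx; rewrite lee_fin sqr_ge0.
  apply: (@nneseries_geometric_lty _ 4) => n.
    by apply: integral_ge0 => x Dx; rewrite lee_fin sqr_ge0.
  rewrite (ip_sqrE (sh n)) lee_fin ipZl// ipC ipZl// mulrA -exprMn.
  apply: (@le_trans _ _ ((2 * 2) ^+ n * (4 * q ^+ n))).
    by rewrite ler_wpM2l// exprn_ge0.
  rewrite mulrCA -exprMn (_ : 2 * 2 * q = 4^-1); last by rewrite /q; field.
  by rewrite ler_pM2l// lerXn2r ?nnegrE ?invr_ge0// lef_pV2 ?posrE//; lra.
have aec : {ae mu, forall x, D x -> cvgn (fun n => f_ (j n) x)}.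
  apply: filterS (nneseries_integrable_ae mh _ Hfin); last first.
    by move=> n x _; rewrite lee_fin sqr_ge0.
  move=> x /[swap] Dx /(_ Dx) /= hfin.
  pose c : R := fine (\sum_(0 <= n <oo) h n x)%E.
  have gc n : `|g n x| <= (1 + c) * 2^-1 ^+ n.
    have hn : (2 ^+ n * g n x) ^+ 2 <= c.
      rewrite -lee_fin fineK//.
      apply: le_trans (nneseries_lim_ge n.+1 _) => //.
        rewrite big_nat_recr//= -[leLHS]add0e leeD//.
        by apply: sume_ge0 => i _; rewrite lee_fin sqr_ge0.
      by move=> i _ _; rewrite lee_fin sqr_ge0.
    have e0 : (0 : R) < 2 ^+ n by rewrite exprn_gt0.
    rewrite exprVn ler_pdivlMr// -[X in _ * X]gtr0_norm// -normrM mulrC.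
    set y := _ * _ in hn *; rewrite ler_norml.
    have c0 : 0 <= c by rewrite (le_trans _ hn)// sqr_ge0.
    by apply/andP; split; nra.
  have cs : cvgn (series (fun n => g n x)).
    apply: normed_cvg; apply: (@series_le_cvg _ _ (geometric (1 + c) 2^-1)).
    - by move=> n /=.
    - by move=> n; rewrite (le_trans _ (gc n)).
    - exact: gc.
    - apply: is_cvg_geometric_series.
      by rewrite ger0_norm ?invr_ge0// invf_lt1// ltr1n.
  have -> : (fun n => f_ (j n) x) = (fun n => f_ (j 0%N) x + series (fun n => g n x) n).
    apply/funext => n; rewrite /series /= telescope_sumr//.
    by rewrite addrC subrK.
  exact: is_cvgD (is_cvg_cst _) cs.
(* The upper limit exists and is measurable everywhere, whereas the limit exists only almost
   everywhere; both agree where the subsequence converges. *)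
pose f x := fine (limn_esup (fun n => (f_ (j n) x)%:E)).
have mf : measurable_fun D f.
  apply: (@measurableT_comp _ _ _ _ _ _ fine) => //.
  apply: measurable_fun_limn_esup => n.
  by apply/measurable_EFinP; case: (sf (j n)).
have fcvg : {ae mu, forall x, D x -> f_ (j n) x @[n --> \oo] --> f x}.
  apply: filterS aec => x /[apply] cx.
  rewrite /f is_cvg_limn_esupE.
    by rewrite EFin_lim.
  by apply/cvg_ex; exists (limn (fun n => f_ (j n) x))%:E; apply: cvg_EFin => //; exact: nearW.
have dist e : 0 < e -> exists N, forall n, (N <= n)%N ->
    (\int[mu]_(x in D) ((f_ n x - f x) ^+ 2)%:E <= e%:E)%E.
  move=> e0; have [N NP] := Cf e e0; exists N => n Nn.
  apply: (@fatou_ae (fun i x => (f_ n x - f_ (j i) x) ^+ 2) _ N).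
  - by move=> i; apply: measurable_funX; case: (sD n (j i)).
  - by apply: measurable_funX; apply: measurable_funB => //; case: (sf n).
  - by move=> i x Dx; rewrite sqr_ge0.
  - apply: filterS fcvg => x /[apply] cx.
    by rewrite expr2; under eq_fun do rewrite expr2; apply: cvgM; apply: cvgB => //; exact: cvg_cst.
  - move=> i Ni; rewrite ip_sqrE// lee_fin; apply: NP => //.
    exact: leq_trans Ni (jge i).
have sf' : sqint f.
  have [N NP] := dist 1 ltr01.
  have s1 : sqint (fun x => f_ N x - f x).
    split; first by apply: measurable_funB => //; case: (sf N).
    by apply: le_lt_trans (NP N (leqnn _)) _; rewrite ltry.
  have := sqintB (sf N) s1.
  by under eq_fun do rewrite subKr.
exists f; split=> //.
apply/cvgrPdist_le => e e0; have [N NP] := dist e e0.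
exists N => // n /= Nn; rewrite sub0r normrN ger0_norm ?ip_ge0//.
rewrite -lee_fin -ip_sqrE; last exact: sqintB.
exact: NP.
Qed.

End square_integrable.

Section product3.
Context d1 d2 d3 (T1 : measurableType d1) (T2 : measurableType d2) (T3 : measurableType d3) {R : realType}.
Variables (m1 : {sigma_finite_measure set T1 -> \bar R}) (m2 : {sigma_finite_measure set T2 -> \bar R}) (m3 : {sigma_finite_measure set T3 -> \bar R}).
Lemma product_measure1_sigma_finite : sigma_finite setT (m1 \x m2)%E.
Proof.
have /sigma_finiteP[F [TF ndF Foo]] := sigma_finiteT m1.
have /sigma_finiteP[G [TG ndG Goo]] := sigma_finiteT m2.
exists (fun n => F n `*` G n).
 rewrite -setXTT TF TG predeqE => -[x y]; split.
    move=> [/= [n _ Fnx] [k _ Gky]]; exists (maxn n k) => //; split.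
    - by move: x Fnx; exact/subsetPset/ndF/leq_maxl.
    - by move: y Gky; exact/subsetPset/ndG/leq_maxr.
  by move=> [n _ []/= ? ?]; split; exists n.
move=> k; have [? ?] := Foo k; have [? ?] := Goo k.
split; first exact: measurableX.
by rewrite product_measure1E// lte_mul_pinfty// ge0_fin_numE.
Qed.

(** Packing sigma-finiteness with the product lets the two-factor theorems of Fubini and Tonelli
    apply to [(m1 \x m2) \x m3] with the plane as first factor. *)
Definition prod_sf : {sigma_finite_measure set (T1 * T2)%type -> \bar R} :=
  HB.pack (m1 \x m2)%E (Measure_isSigmaFinite.Build _ _ _ (m1 \x m2)%E product_measure1_sigma_finite).

Lemma tonelli3_12 (F : T1 * T2 * T3 -> \bar R) : measurable_fun setT F ->
  (forall x, 0 <= F x)%E ->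
  (\int[((m1 \x m2) \x m3)%E]_x F x = \int[(m1 \x m2)%E]_p \int[m3]_t F (p, t))%E.
Proof.
move=> mF F0. exact: (@fubini_tonelli1 _ _ _ _ _ prod_sf m3 F mF F0).
Qed.
Lemma tonelli3_21 (F : T1 * T2 * T3 -> \bar R) : measurable_fun setT F ->
  (forall x, 0 <= F x)%E ->
  (\int[((m1 \x m2) \x m3)%E]_x F x = \int[m3]_t \int[(m1 \x m2)%E]_p  F (p, t))%E.
Proof.
move=> mF F0. exact: (@fubini_tonelli2 _ _ _ _ _ prod_sf m3 F mF F0).
Qed.
Lemma fubini3_12 (F : T1 * T2 * T3 -> \bar R) : ((m1 \x m2) \x m3)%E.-integrable setT F ->
  (\int[((m1 \x m2) \x m3)%E]_x F x = \int[(m1 \x m2)%E]_p \int[m3]_t F (p, t))%E.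
Proof. by move=> iF; symmetry; exact: (@integral12_prod_meas1 _ _ _ _ _ prod_sf). Qed.
Lemma fubini3_21 (F : T1 * T2 * T3 -> \bar R) : ((m1 \x m2) \x m3)%E.-integrable setT F ->
  (\int[((m1 \x m2) \x m3)%E]_x F x = \int[m3]_t \int[(m1 \x m2)%E]_p F (p, t))%E.
Proof. by move=> iF; symmetry; exact: (@integral21_prod_meas1 _ _ _ _ _ prod_sf). Qed.
Lemma measurable_slice (F : T1 * T2 * T3 -> \bar R) : measurable_fun setT F ->
  (forall x, 0 <= F x)%E -> measurable_fun setT (fun t => \int[(m1 \x m2)%E]_p F (p, t))%E.
Proof. by move=> mF F0; apply: (@measurable_fun_fubini_tonelli_G _ _ _ _ _ prod_sf F). Qed.
End product3.

(** * Calculus on slices, the inequalities of Poincare and Ladyzhenskaya *)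

Section slices.
Context {R : realType}.
Notation leb := (@lebesgue_measure R).
Implicit Types (h dh : R -> R).

Lemma integral_derive h dh a b : a <= b ->
  (forall t : R, is_derive t 1 h (dh t)) -> continuous dh ->
  \int[leb]_(t in `[a, b]) dh t = h b - h a.
Proof.
rewrite le_eqVlt => /predU1P[<- _ _|ab hd cd].
  by rewrite set_itv1 Rintegral_set1 subrr.
have ch : continuous h.
  by move=> t; apply: differentiable_continuous; apply/derivable1_diffP; case: (hd t).
rewrite /Rintegral (@continuous_FTC2 _ dh h)//.
- exact: continuous_subspaceT.
- split; first by move=> t _; case: (hd t).
    by apply: cvg_at_right_filter; exact: ch.
  by apply: cvg_at_left_filter; exact: ch.
- by move=> t _; rewrite derive1E; exact: (@derive_val _ _ _ _ _ _ _ (hd t)).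
Qed.

Lemma le_integral_derive h dh (a b s t : R) :
  (forall t : R, is_derive t 1 h (dh t)) -> continuous dh ->
  a <= s <= b -> a <= t <= b ->
  (`|h s - h t|%:E <= \int[leb]_(r in `[a, b]) `|dh r|%:E)%E.
Proof.
move=> hd cd; wlog st : s t / s <= t.
  move=> H sab tab; have [st|/ltW ts] := leP s t; first exact: H.
  by rewrite distrC; exact: H.
move=> /andP[sa sb] /andP[ta tb].
rewrite distrC -(integral_derive st hd cd).
have mdh : measurable_fun setT dh by exact: continuous_measurable_fun.
have ci : leb.-integrable `[s, t] (EFin \o dh).
  by apply: continuous_compact_integrable; [exact: segment_compact|exact: continuous_subspaceT].
rewrite EFin_normr_Rintegral//.
apply: le_trans (le_abse_integral _ _ _) _ => //.
  by apply/measurable_EFinP; exact: measurable_funTS.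
apply: ge0_subset_integral => //.
- by apply: measurableT_comp => //; apply/measurable_EFinP; exact: measurable_funTS.
- by apply: subset_itv; rewrite bnd_simp.
Qed.

Lemma le_integralT_derive h dh (L s : R) :
  (forall t : R, is_derive t 1 h (dh t)) -> continuous dh ->
  (forall t, L < `|t| -> h t = 0) ->
  (`|h s|%:E <= \int[leb]_r `|dh r|%:E)%E.
Proof.
move=> hd cd h0; pose M := Num.max 0 L + `|s| + 1.
have mdh : measurable_fun setT dh by exact: continuous_measurable_fun.
have M0 : L < `|- M| by rewrite normrN ger0_norm /M; have := normr_ge0 s; case: (lerP 0 L); lra.
have Ms : - M <= s <= M.
  by rewrite /M -ler_norml; have := normr_ge0 s; case: (lerP 0 L); lra.
have Mm : - M <= - M <= M.
  by rewrite lexx /M; have := normr_ge0 s; case: (lerP 0 L); lra.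
have := le_integral_derive hd cd Ms Mm; rewrite (h0 _ M0) subr0 => /le_trans; apply.
apply: ge0_subset_integral => //.
by apply/measurable_EFinP; apply: measurableT_comp mdh; exact: normr_measurable.
Qed.

Definition sl (i : 'I_3) (x : R3 R) (t : R) : R3 R :=
  if i == 0 :> nat then ((t, x.1.2), x.2)
  else if i == 1 :> nat then ((x.1.1, t), x.2) else ((x.1.1, x.1.2), t).

Definition crd (i : 'I_3) (x : R3 R) : R :=
  if i == 0 :> nat then x.1.1 else if i == 1 :> nat then x.1.2 else x.2.

Lemma sl_add i x t (c : R) : sl i x (c + t) = c *: e3 i + sl i x t.
Proof.
rewrite /sl; case: i => -[|[|[|//]]] ip /=.
- change ((c + t, x.1.2, x.2) = (c * 1 + t, c * 0 + x.1.2, c * 0 + x.2)).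
  by rewrite mulr1 mulr0 !add0r.
- change ((x.1.1, c + t, x.2) = (c * 0 + x.1.1, c * 1 + t, c * 0 + x.2)).
  by rewrite mulr1 mulr0 !add0r.
- change ((x.1.1, x.1.2, c + t) = (c * 0 + x.1.1, c * 0 + x.1.2, c * 1 + t)).
  by rewrite mulr1 mulr0 !add0r.
Qed.

Lemma is_derive_sl i (f : R3 R -> R) x t : derivable f (sl i x t) (e3 i) ->
  is_derive t 1 (fun s => f (sl i x s)) (pd i f (sl i x t)).
Proof.
move=> df.
have E : (fun c : R => c^-1 *: (f (sl i x (c *: 1 + t)) - f (sl i x t))) =
   (fun c : R => c^-1 *: (f (c *: e3 i + sl i x t) - f (sl i x t))).
  by apply/funext => c; rewrite -sl_add /GRing.scale /= mulr1.
by split; [rewrite /derivable /= E|rewrite /pd /derive /= E].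
Qed.

Lemma continuous_sl i x : continuous (sl i x).
Proof.
have -> : sl i x = fun t => t *: e3 i + sl i x 0.
  by apply/funext => t; rewrite -sl_add addr0.
move=> t; apply: cvgD; last exact: cvg_cst.
by apply: cvgZr_tmp; exact: cvg_id.
Qed.

(** The consequences of [Cc_infty] that the slice calculus uses. Vanishing off [Omega] stands for
    compact support and is visibly inherited by products; the common bound gives integrability, as
    [Omega] lies in a box. *)
Definition C1c (Omega : set (R3 R)) (f : R3 R -> R) :=
  [/\ continuous f, (forall i x, derivable f x (e3 i)),
      (forall i, continuous (pd i f)),
      (forall x, ~ Omega x -> f x = 0 /\ forall i, pd i f x = 0) &
      exists M, forall x, `|f x| <= M /\ forall i, `|pd i f x| <= M].

Lemma Cc_infty_C1c Omega f : Cc_infty Omega f -> C1c Omega f.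
Proof.
move=> [sf cs sO].
have f0 x : ~ Defs.support f x -> f x = 0.
  move=> nx; apply: contrapT => /eqP fx; apply: nx; exact: subset_closure.
have pf0 i x : ~ Defs.support f x -> pd i f x = 0.
  move=> nx; rewrite /pd (@near_eq_derive _ _ _ f (cst 0) x (e3 i)) ?derive_cst//.
  have : open (~` Defs.support f) by apply: closed_openC; exact: closed_closure.
  rewrite openE => /(_ x nx); apply: filterS => y; exact: f0.
have cf : continuous f by have [] := sf [::].
have cpf i : continuous (pd i f) by have [] := sf [:: i].
have bnd (g : R3 R -> R) : continuous g -> (forall x, ~ Defs.support f x -> g x = 0) ->
    exists M, forall x, `|g x| <= M.
  move=> cg g0.
  have /compact_bounded[M [_ MP]] : compact (g @` Defs.support f).
    by apply: continuous_compact => //; exact: continuous_subspaceT.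
  exists (`|M| + 1) => x; have [sx|nx] := pselect (Defs.support f x).
    by apply: MP; [rewrite (le_lt_trans (ler_norm _))// ltrDl|exists x].
  by rewrite g0// normr0 addr_ge0.
split=> //.
- by move=> i x; have [_ /(_ i x)] := sf [::].
- move=> x nO; have nx : ~ Defs.support f x by move=> /sO.
  by split; [exact: f0|move=> i; exact: pf0].
- have [M MP] := bnd f cf f0.
  have /choice[N NP] : forall i, exists N, forall x, `|pd i f x| <= N.
    by move=> i; exact: bnd (cpf i) (pf0 i).
  exists (Num.max M (\sum_i `|N i|)) => x; split; first by rewrite le_max MP.
  move=> i; rewrite le_max; apply/orP; right; apply: le_trans (NP i x) _.
  by rewrite (bigD1 i)//= (le_trans (ler_norm _))// lerDl sumr_ge0.
Qed.

Lemma integrable_bs d (T : measurableType d) (mu : {measure set T -> \bar R})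
  (A : set T) (F : T -> R) M : measurable A -> (mu A < +oo)%E ->
  measurable_fun setT F -> (forall x, `|F x| <= M) -> (forall x, ~ A x -> F x = 0) ->
  mu.-integrable setT (EFin \o F).
Proof.
move=> mA Afin mF FM F0.
have -> : EFin \o F = (EFin \o F) \_ A.
  by apply/funext => x; rewrite patchE; case: ifPn => //; rewrite notin_setE /= => /F0 ->.
apply/(integrable_mkcond _ mA); apply: measurable_bounded_integrable => //.
  exact: measurable_funTS.
by exists M; split; [exact: num_real|move=> M' MM' x _; apply: le_trans (FM x) (ltW MM')].
Qed.

Lemma integralT_derive0 h dh L : (forall t : R, is_derive t 1 h (dh t)) ->
  continuous dh -> (forall t, L < `|t| -> h t = 0 /\ dh t = 0) ->
  (\int[leb]_t (dh t)%:E = 0)%E.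
Proof.
move=> hd cd h0; pose M := `|L| + 1.
have M0 : L < `|M| by rewrite /M ger0_norm; have := ler_norm L; have := normr_ge0 L; lra.
have -> : (\int[leb]_t (dh t)%:E = \int[leb]_(t in `[(- M)%R, M]) (dh t)%:E)%E.
  rewrite [RHS]integral_mkcond; apply: eq_integral => t _; rewrite patchE.
  case: ifPn => //; rewrite notin_setE /= in_itv /= -ler_norml => /negP; rewrite -ltNge.
  move=> Mt; have [|_ ->//] := h0 t; apply: lt_trans Mt.
  by apply: le_lt_trans (ler_norm L) _; rewrite ltrDl.
have MM : - M <= M by rewrite /M; have := normr_ge0 L; lra.
have := integral_derive MM hd cd.
have [-> _] := h0 M M0; rewrite -normrN in M0; have [-> _] := h0 _ M0.
rewrite subrr /Rintegral => I0; rewrite -[LHS]fineK ?I0//; apply: integrable_fin_num => //.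
by apply: continuous_compact_integrable; [exact: segment_compact|exact: continuous_subspaceT].
Qed.

Notation leb2 := (leb \x leb)%E.

Lemma leb3_tonelli_z (F : mR3 R -> \bar R) : measurable_fun setT F ->
  (forall x, 0 <= F x)%E ->
  (\int[leb3]_x F x = \int[leb2]_p \int[leb]_t F (p, t))%E.
Proof. exact: (@tonelli3_12 _ _ _ (measurableTypeR R) (measurableTypeR R) (measurableTypeR R) R leb leb leb). Qed.

Lemma leb3_tonelli_p (F : mR3 R -> \bar R) : measurable_fun setT F ->
  (forall x, 0 <= F x)%E ->
  (\int[leb3]_x F x = \int[leb]_t \int[leb2]_p F (p, t))%E.
Proof. exact: (@tonelli3_21 _ _ _ (measurableTypeR R) (measurableTypeR R) (measurableTypeR R) R leb leb leb). Qed.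

Lemma leb3_fubini_z (F : mR3 R -> \bar R) : leb3.-integrable setT F ->
  (\int[leb3]_x F x = \int[leb2]_p \int[leb]_t F (p, t))%E.
Proof. exact: (@fubini3_12 _ _ _ (measurableTypeR R) (measurableTypeR R) (measurableTypeR R) R leb leb leb). Qed.

Lemma leb3_fubini_p (F : mR3 R -> \bar R) : leb3.-integrable setT F ->
  (\int[leb3]_x F x = \int[leb]_t \int[leb2]_p F (p, t))%E.
Proof. exact: (@fubini3_21 _ _ _ (measurableTypeR R) (measurableTypeR R) (measurableTypeR R) R leb leb leb). Qed.

Lemma leb3_measurable_p (F : mR3 R -> \bar R) : measurable_fun setT F ->
  (forall x, 0 <= F x)%E -> measurable_fun setT (fun t => \int[leb2]_p F (p, t))%E.
Proof. exact: (@measurable_slice _ _ _ (measurableTypeR R) (measurableTypeR R) (measurableTypeR R) R leb leb). Qed.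

Definition boxR (L : R) : set (measurableTypeR R) := `[- L, L]%classic.

Lemma leb_boxR L : (leb (boxR L) < +oo)%E.
Proof. by rewrite /boxR lebesgue_measure_itv/=; case: ifP => _; rewrite ltry. Qed.

Lemma leb2_box L : (leb2 (boxR L `*` boxR L) < +oo)%E.
Proof.
rewrite product_measure1E//; [|exact: measurable_itv..].
by rewrite lte_mul_pinfty ?ge0_fin_numE// leb_boxR.
Qed.

Lemma leb3_box L : (leb3 ((boxR L `*` boxR L) `*` boxR L) < +oo)%E.
Proof.
rewrite [X in (X < _)%E](@product_measure1E _ _ _ _ _ leb2 leb)//.
- rewrite lte_mul_pinfty ?leb_boxR// ge0_fin_numE//; exact: leb2_box.
- by apply: measurableX; exact: measurable_itv.
- exact: measurable_itv.
Qed.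

Section C1c_theory.
Variables (Omega : set (R3 R)) (L : R).
Hypothesis OL : forall x, Omega x -> forall i, `|crd i x| <= L.
Implicit Types f g : R3 R -> R.

Lemma not_box f x : (forall x, ~ Omega x -> f x = 0) ->
  ~ ((boxR L `*` boxR L) `*` boxR L) x -> f x = 0.
Proof.
move=> f0 nb; apply: f0 => /OL Ox; apply: nb.
have h0 := Ox (@Ordinal 3 0 isT); have h1 := Ox (@Ordinal 3 1 isT).
have h2 := Ox (@Ordinal 3 2 isT); rewrite /crd /= in h0 h1 h2.
by split; [split|]; rewrite /boxR /= in_itv /= -ler_norml.
Qed.

Lemma not_box_crd f i x : (forall x, ~ Omega x -> f x = 0) -> L < `|crd i x| -> f x = 0.
Proof. by move=> f0 Lx; apply: f0 => /OL /(_ i); rewrite leNgt Lx. Qed.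

Lemma integrable3_bs f M : measurable_fun setT (f : mR3 R -> R) ->
  (forall x, `|f x| <= M) -> (forall x, ~ Omega x -> f x = 0) ->
  leb3.-integrable setT (EFin \o (f : mR3 R -> R)).
Proof.
move=> mf fM f0; apply: (integrable_bs _ (leb3_box L) mf fM).
  by apply: measurableX; [apply: measurableX|]; exact: measurable_itv.
by move=> x; exact: not_box.
Qed.

Lemma integrable2_bs f M t : measurable_fun setT (f : mR3 R -> R) ->
  (forall x, `|f x| <= M) -> (forall x, ~ Omega x -> f x = 0) ->
  leb2.-integrable setT (EFin \o (fun p => f (p, t))).
Proof.
move=> mf fM f0; apply: (@integrable_bs _ _ _ (boxR L `*` boxR L) _ M) => //.
- by apply: measurableX; exact: measurable_itv.
- exact: leb2_box.
- exact: measurableT_comp mf (pair2_measurable _).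
- by move=> p np; apply: not_box => // -[].
Qed.

Lemma C1c_integrable_pd f i : C1c Omega f -> leb3.-integrable setT (EFin \o (pd i f : mR3 R -> R)).
Proof.
move=> [_ _ cf f0 [M fM]]; apply: (@integrable3_bs _ M).
- exact: continuous_measurable3.
- by move=> x; case: (fM x).
- by move=> x /f0[].
Qed.

Lemma crd_sl i x t : crd i (sl i x t) = t.
Proof. by rewrite /crd /sl; case: i => -[|[|[|//]]] ip. Qed.

Lemma sl_integral_pd0 f i x : C1c Omega f -> (\int[leb]_t (pd i f (sl i x t))%:E = 0)%E.
Proof.
move=> [cf df cpf f0 _].
apply: (@integralT_derive0 (fun t => f (sl i x t)) _ L).
- by move=> t; exact: is_derive_sl.
- by move=> t; apply: continuous_comp; [exact: continuous_sl|exact: cpf].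
- move=> t Lt; split; apply: (@not_box_crd _ i); rewrite ?crd_sl// => y /f0[]//.
Qed.

(** The order of integration is chosen so that direction [i] comes innermost, where the fundamental
    theorem of calculus gives 0 on each line. *)
Lemma C1c_integral_pd0 f i : C1c Omega f -> (\int[leb3]_x (pd i f x)%:E = 0)%E.
Proof.
move=> cf; have ipf := C1c_integrable_pd i cf.
have ip2 t : leb2.-integrable setT (EFin \o (fun p => pd i f (p, t))).
  case: cf => [_ _ cf f0 [M fM]]; apply: (@integrable2_bs _ M).
  - exact: continuous_measurable3.
  - by move=> x; case: (fM x).
  - by move=> x /f0[].
have := @sl_integral_pd0 f i ^~ cf.
case: i ip2 ipf => -[|[|[|//]]] ip ip2 ipf sl0.
- rewrite leb3_fubini_p//; apply: integral0_eq => t _.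
  rewrite -(integral21_prod_meas1 (ip2 t)); apply: integral0_eq => y _.
  exact: (sl0 (0, y, t)).
- rewrite leb3_fubini_p//; apply: integral0_eq => t _.
  rewrite -(integral12_prod_meas1 (ip2 t)); apply: integral0_eq => x _.
  exact: (sl0 (x, 0, t)).
- rewrite leb3_fubini_z//; apply: integral0_eq => -[x y] _.
  exact: (sl0 (x, y, 0)).
Qed.

Lemma C1cM f g : C1c Omega f -> C1c Omega g -> C1c Omega (fun x => f x * g x) /\
  forall i x, pd i (fun x => f x * g x) x = f x * pd i g x + g x * pd i f x.
Proof.
move=> [cf df cpf f0 [M fM]] [cg dg cpg g0 [N gN]].
have E i x : pd i (fun x => f x * g x) x = f x * pd i g x + g x * pd i f x.
  exact: (deriveM (df i x) (dg i x)).
split; last exact: E.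
split.
- by move=> x; apply: cvgM; [exact: cf|exact: cg].
- by move=> i x; exact: (derivableM (df i x) (dg i x)).
- move=> i; rewrite (_ : pd i _ = fun x => f x * pd i g x + g x * pd i f x).
    by move=> x; apply: cvgD; apply: cvgM; [exact: cf|exact: cpg|exact: cg|exact: cpf].
  by apply/funext => x; exact: E.
- by move=> x nx; have [fx fpx] := f0 x nx; rewrite fx mul0r; split=> // i; rewrite E fx fpx mulr0 mul0r addr0.
- exists (M * N + N * M) => x; have [fx fpx] := fM x; have [gx gpx] := gN x.
  have M0 : 0 <= M by exact: le_trans fx. have N0 : 0 <= N by exact: le_trans gx.
  split; first by rewrite normrM ler_wpDr ?mulr_ge0// ler_pM.
  move=> i; rewrite E (le_trans (ler_normD _ _))// !normrM lerD// ler_pM//.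
Qed.

Lemma C1c_sqint f : C1c Omega f -> sqint leb3 setT (f : mR3 R -> R) /\
  forall i, sqint leb3 setT (pd i f : mR3 R -> R).
Proof.
move=> [cf df cpf f0 [M fM]].
have H (g : R3 R -> R) : continuous g -> (forall x, `|g x| <= M) ->
    (forall x, ~ Omega x -> g x = 0) -> sqint leb3 setT (g : mR3 R -> R).
  move=> cg gM g0; apply: sqint_of_sqr => //; first exact: continuous_measurable3.
  apply: (@integrable3_bs (fun x => g x ^+ 2) (M ^+ 2)).
  - by apply: measurable_funX; exact: continuous_measurable3.
  - move=> x; rewrite ger0_norm ?sqr_ge0// -real_normK ?num_real// lerXn2r ?nnegrE//.
    exact: le_trans (gM x).
  - by move=> x /g0 ->; rewrite expr0n.
split; first by apply: H => // x; [case: (fM x)|case/f0].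
by move=> i; apply: H => // x; [case: (fM x)|case/f0].
Qed.

(** The product stays in the class, so its derivative, given by the Leibniz rule, has zero
    integral. *)
Lemma C1c_by_parts f g i : C1c Omega f -> C1c Omega g ->
  ip leb3 setT (f : mR3 R -> R) (pd i g) = - ip leb3 setT (pd i f : mR3 R -> R) g.
Proof.
move=> cf cg; have [cfg E] := C1cM cf cg.
have [sf sdf] := C1c_sqint cf; have [sg sdg] := C1c_sqint cg.
apply/eqP; rewrite -addr_eq0; apply/eqP.
rewrite (ipC _ _ (pd i f : mR3 R -> R)) /ip -RintegralD//; [|exact: ip_integrable..].
rewrite /Rintegral; under eq_integral do rewrite -E.
by rewrite C1c_integral_pd0.
Qed.

(** On the line through [x] in direction [i], the function [f^2] vanishes far away, so its value is
    at most its total variation. Both the Poincare and the Ladyzhenskaya inequality start from this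
    bound. *)
Lemma C1c_sqr_le f i x : C1c Omega f ->
  ((f x ^+ 2)%:E <= \int[leb]_t (`|2 * (f (sl i x t) * pd i f (sl i x t))|)%:E)%E.
Proof.
move=> cf; have [cff E] := C1cM cf cf.
have [cf2 df2 cpf2 f20 _] := cff.
have h1 : continuous (fun t => pd i (fun x0 => f x0 * f x0) (sl i x t)).
  by move=> t; apply: continuous_comp; [exact: continuous_sl|exact: cpf2].
have h2 t : L < `|t| -> f (sl i x t) * f (sl i x t) = 0.
  move=> Lt; apply: (@not_box_crd (fun y => f y * f y) i); rewrite ?crd_sl//.
  by move=> y /f20[].
have := @le_integralT_derive (fun t => f (sl i x t) * f (sl i x t)) _ L (crd i x)
  (fun t => is_derive_sl (df2 i _)) h1 h2.
have -> : sl i x (crd i x) = x.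
  by case: x {h1 h2} => -[x0 x1] x2; rewrite /sl /crd; case: i => -[|[|[|//]]] ip.
rewrite -expr2 ger0_norm ?sqr_ge0// => /le_trans; apply.
rewrite le_eqVlt; apply/orP; left; apply/eqP/eq_integral => t _; congr (`|_|%:E).
by rewrite E; ring.
Qed.

Let mpd f i : C1c Omega f -> measurable_fun setT (pd i f : mR3 R -> R).
Proof. by move=> [_ _ cf _ _]; exact: continuous_measurable3. Qed.

Let mf f : C1c Omega f -> measurable_fun setT (f : mR3 R -> R).
Proof. by move=> [cf _ _ _ _]; exact: continuous_measurable3. Qed.

Let mffd f i : C1c Omega f ->
  measurable_fun setT (fun x : mR3 R => (`|2 * (f x * pd i f x)|)%:E).
Proof.
move=> cf; apply/measurable_EFinP.
have h : measurable_fun setT (fun x : mR3 R => 2 * (f x * pd i f x)).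
  by apply: measurable_funM => //; apply: measurable_funM; [exact: mf|exact: mpd].
by apply: measurableT_comp h; exact: normr_measurable.
Qed.

(* The weighted AM-GM bound on [2 f df] turns the one-dimensional bound into
   [|f|^2 <= |f|^2 / 2 + C |df|^2]. *)
Lemma C1c_poincare f : 0 < L -> C1c Omega f ->
  ip leb3 setT (f : mR3 R -> R) f <=
  16 * L ^+ 2 * ip leb3 setT (pd ord_max f : mR3 R -> R) (pd ord_max f).
Proof.
move=> L0 cf; have [sf sdf] := C1c_sqint cf.
set A := ip _ _ _ _; set B := ip _ _ _ _.
(* [2 L] is the length of a slice of the box, and the weight [4 L] is chosen so that
   [2 L / (4 L) = 1/2]: half of [A] is absorbed and [A <= 16 L^2 B] remains. *)
suff : A <= 2 * L * ((4 * L)^-1 * A + 4 * L * B).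
  rewrite mulrDr !mulrA [2 * L / _](_ : _ = 2^-1); last by field; rewrite gt_eqF.
  by nra.
have cW : forall y, `|2 * (f y * pd ord_max f y)| <=
    (4 * L)^-1 * f y ^+ 2 + 4 * L * pd ord_max f y ^+ 2.
  move=> y; set b := (pd _ f y); set a := f y.
  have q0 : 0 < 4 * L by rewrite mulr_gt0.
  have -> : (4 * L)^-1 * a ^+ 2 + 4 * L * b ^+ 2 =
     (4 * L)^-1 * (a ^+ 2 + (4 * L * b) ^+ 2) by field; rewrite gt_eqF.
  rewrite ler_pdivlMl// -[X in X * _](gtr0_norm q0) -normrM ler_norml.
  by apply/andP; split;
    [have := sqr_ge0 (a + 4 * L * b)|have := sqr_ge0 (a - 4 * L * b)]; nra.
rewrite -lee_fin -(ip_sqrE _ sf)//.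
pose W (x : mR3 R) : \bar R := ((4 * L)^-1 * f x ^+ 2 + 4 * L * pd ord_max f x ^+ 2)%:E.
have mW : measurable_fun setT W.
  apply/measurable_EFinP; apply: measurable_funD; apply: measurable_funM => //;
    apply: measurable_funX; [exact: mf|exact: mpd].
have W0 x : (0 <= W x)%E.
  by rewrite lee_fin addr_ge0// mulr_ge0 ?sqr_ge0// ?invr_ge0 mulr_ge0// ltW.
have mf2 : measurable_fun setT (fun x : mR3 R => (f x ^+ 2)%:E).
  by apply/measurable_EFinP; apply: measurable_funX; exact: mf.
rewrite leb3_tonelli_z//; last by move=> x; rewrite lee_fin sqr_ge0.
have -> : (2 * L * ((4 * L)^-1 * A + 4 * L * B))%:E =
    ((2 * L)%:E * \int[leb2]_p \int[leb]_t W (p, t))%E.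
  rewrite -leb3_tonelli_z// EFinM; congr (_ * _)%E.
  rewrite /W; under eq_integral do rewrite EFinD.
  rewrite ge0_integralD//; last 4 first.
  - by move=> x _; rewrite lee_fin mulr_ge0 ?sqr_ge0// ?invr_ge0 mulr_ge0// ltW.
  - by apply/measurable_EFinP; apply: measurable_funM => //; apply: measurable_funX; exact: mf.
  - by move=> x _; rewrite lee_fin mulr_ge0 ?sqr_ge0// mulr_ge0// ltW.
  - by apply/measurable_EFinP; apply: measurable_funM => //; apply: measurable_funX; exact: mpd.
  under eq_integral do rewrite EFinM.
  rewrite integralZl//; last exact: sqint_sqr.
  under [X in _ = (_ + X)%E]eq_integral do rewrite EFinM.
  rewrite integralZl//; last by apply: sqint_sqr.
  by rewrite !ip_sqrE// -!EFinM -EFinD.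
have mWt : measurable_fun setT (fun p : mR3 R => W p) by [].
have mI : measurable_fun setT (fun p : measurableTypeR R * measurableTypeR R => \int[leb]_t W (p, t))%E.
  exact: (@measurable_fun_fubini_tonelli_F _ _ _ _ _ leb W).
rewrite -ge0_integralZl//; last 2 first.
- by move=> p _; apply: integral_ge0.
- by rewrite lee_fin mulr_ge0// ltW.
apply: ge0_le_integral => //.
- by move=> p _; apply: integral_ge0 => t _; rewrite lee_fin sqr_ge0.
- have f20 (x : mR3 R) : (0 <= (f x ^+ 2)%:E)%E by rewrite lee_fin sqr_ge0.
  exact: (@measurable_fun_fubini_tonelli_F _ _ _ _ _ leb (fun x : mR3 R => (f x ^+ 2)%:E)).
- by apply: measurable_funeM.
move=> p _.
have c0 : (0 <= \int[leb]_t W (p, t))%E by apply: integral_ge0.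
(* The pointwise bound of [f^2] does not depend on [t]; integrating this constant over the slice
   costs the factor [2 L]. *)
apply: (@le_trans _ _ (\int[leb]_(t in `[(- L)%R, L]) \int[leb]_r W (p, r))%E); last first.
  rewrite integral_cst//= lebesgue_measure_itv/= lte_fin ifT; last by lra.
  by rewrite -EFinD muleC opprK (_ : L + L = 2 * L)//; ring.
rewrite [leRHS]integral_mkcond; apply: ge0_le_integral => //.
- by move=> t _; rewrite lee_fin sqr_ge0.
- by apply: measurableT_comp mf2 _; exact: pair1_measurable.
- by apply/(measurable_restrictT _ _).1 => //; exact: measurable_itv.
move=> t _; rewrite patchE; case: ifPn => [_|].
  apply: le_trans (C1c_sqr_le ord_max (p, t) cf) _.
  apply: ge0_le_integral => //.
  - apply: measurableT_comp (mffd ord_max cf) _.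
    by rewrite /sl /=; apply: measurable_fun_pair => //; case: (p).
  - by apply: measurableT_comp mW _; exact: pair1_measurable.
  - by move=> r _; rewrite lee_fin; case: (p) => x y; exact: cW.
rewrite notin_setE /= in_itv /= -ler_norml => /negP; rewrite -ltNge => Lt.
rewrite (@not_box_crd f ord_max (p, t)) ?expr0n//.
by case: cf => _ _ _ f0 _ x /f0[].
Qed.

(** The majorant is a function of [y] times a function of [x], so its planar integral factorizes.
    This is the step of Ladyzhenskaya's argument that turns two line bounds into a bound for the
    fourth power. *)
Lemma leb2_prod_le (q w0 w1 : measurableTypeR R * measurableTypeR R -> \bar R) :
  measurable_fun setT q -> measurable_fun setT w0 -> measurable_fun setT w1 ->
  (forall p, 0 <= q p)%E -> (forall p, 0 <= w0 p)%E -> (forall p, 0 <= w1 p)%E ->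
  (forall x y, q (x, y) <= (\int[leb]_t w0 (t, y)) * (\int[leb]_t w1 (x, t)))%E ->
  (\int[leb2]_p q p <= (\int[leb2]_p w0 p) * (\int[leb2]_p w1 p))%E.
Proof.
move=> mq m0 m1 q0 w00 w10 qw.
pose u := (fun y => \int[leb]_t w0 (t, y))%E; pose v := (fun x => \int[leb]_t w1 (x, t))%E.
have u0 y : (0 <= u y)%E by apply: integral_ge0.
have v0 x : (0 <= v x)%E by apply: integral_ge0.
have mu : measurable_fun setT u by exact: (@measurable_fun_fubini_tonelli_G _ _ _ _ _ leb w0).
have mv : measurable_fun setT v by exact: (@measurable_fun_fubini_tonelli_F _ _ _ _ _ leb w1).
rewrite (@fubini_tonelli2 _ _ _ _ _ leb leb w0 m0 w00) (@fubini_tonelli1 _ _ _ _ _ leb leb w1 m1 w10).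
rewrite (@fubini_tonelli1 _ _ _ _ _ leb leb q mq q0).
rewrite -[X in (_ <= X * _)%E]/(\int[leb]_y u y)%E -[X in (_ <= _ * X)%E]/(\int[leb]_x v x)%E.
rewrite -ge0_integralZl//; last exact: integral_ge0.
apply: ge0_le_integral => //.
- by move=> x _; apply: integral_ge0.
- exact: measurable_fun_fubini_tonelli_F.
- exact: measurable_funeM.
move=> x _; rewrite /fubini_F muleC -ge0_integralZl//.
apply: ge0_le_integral => //.
- exact: measurable_fun_pair2.
- exact: measurable_funeM.
- by move=> y _; rewrite muleC; exact: qw.
Qed.

Lemma L4_arith (a b s d0 d1 tau : R) : 0 <= d0 -> 0 <= d1 ->
  a ^+ 2 <= s * d1 -> b ^+ 2 <= s * d0 -> s <= tau ->
  2 * b * (2 * a) <= 2 * tau * (d0 + d1).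
Proof.
move=> d00 d10 h1 h2 st; apply: (@le_trans _ _ (2 * s * (d0 + d1))).
  by have := sqr_ge0 (a - b); nra.
by rewrite ler_wpM2r ?addr_ge0// ler_wpM2l.
Qed.

(* Ladyzhenskaya's inequality in the plane, applied to each horizontal slice. *)
Lemma C1c_L4 f (n := fun i => ip leb3 setT (pd i f : mR3 R -> R) (pd i f)) :
  C1c Omega f ->
  (\int[leb3]_x (f x ^+ 4)%:E <= (2 * (ip leb3 setT (f : mR3 R -> R) f +
    n (@Ordinal 3 2 isT)) * (n (@Ordinal 3 0 isT) + n (@Ordinal 3 1 isT)))%:E)%E.
Proof.
move=> cf; have [sf sdf] := C1c_sqint cf.
set i0 := @Ordinal 3 0 isT; set i1 := @Ordinal 3 1 isT; set i2 := @Ordinal 3 2 isT.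
set tau := (_ + _ : R).
have tau0 : 0 <= tau by apply: addr_ge0; exact: ip_ge0.
have [M fM] : exists M, forall x, `|f x| <= M /\ forall i, `|pd i f x| <= M by case: cf.
have f0 x : ~ Omega x -> f x = 0 by case: cf => _ _ _ f0 _ /f0[].
have pf0 i x : ~ Omega x -> pd i f x = 0 by case: cf => _ _ _ f1 _ /f1[].
have sq2 (g : R3 R -> R) t : measurable_fun setT (g : mR3 R -> R) -> (forall x, `|g x| <= M) ->
    (forall x, ~ Omega x -> g x = 0) -> sqint leb2 setT (fun p => g (p, t)).
  move=> mg gM g0; apply: sqint_of_sqr => //; first exact: measurable_fun_pair1.
  apply: (@integrable2_bs (fun x => g x ^+ 2) (M ^+ 2)).
  - exact: measurable_funX.
  - move=> x; rewrite ger0_norm ?sqr_ge0// -real_normK ?num_real// lerXn2r ?nnegrE//.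
    exact: le_trans (gM x).
  - by move=> x /g0 ->; rewrite expr0n.
have sqf t : sqint leb2 setT (fun p => f (p, t)).
  by apply: sq2 => // [|x]; [exact: mf|case: (fM x)].
have sqd i t : sqint leb2 setT (fun p => pd i f (p, t)).
  by apply: sq2 => // [|x|x /pf0//]; [exact: mpd|case: (fM x)].
pose S t := ip leb2 setT (fun p => f (p, t)) (fun p => f (p, t)).
pose D i t := ip leb2 setT (fun p => pd i f (p, t)) (fun p => pd i f (p, t)).
pose W i (x : mR3 R) : \bar R := (`|2 * (f x * pd i f x)|)%:E.
have mW i : measurable_fun setT (W i) by exact: mffd.
have W0 i x : (0 <= W i x)%E by rewrite lee_fin.
(* The mass of a horizontal slice is bounded uniformly in its height, by the line bound in the
   vertical direction. This is what lifts the planar inequality to space. *)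
have Stau t : S t <= tau.
  rewrite -lee_fin -(ip_sqrE _ (sqf t))//.
  apply: (@le_trans _ _ (\int[leb3]_x W i2 x)%E).
    rewrite leb3_tonelli_z//; apply: ge0_le_integral => //.
    - by move=> p _; rewrite lee_fin sqr_ge0.
    - by apply/measurable_EFinP; apply: measurable_funX; case: (sqf t).
    - exact: (@measurable_fun_fubini_tonelli_F _ _ _ _ _ leb (W i2)).
    - by move=> -[x y] _; exact: (C1c_sqr_le i2 (x, y, t) cf).
  rewrite /tau EFinD -!ip_sqrE// -ge0_integralD//; last 4 first.
  - by move=> x _; rewrite lee_fin sqr_ge0.
  - by apply/measurable_EFinP; apply: measurable_funX; exact: mf.
  - by move=> x _; rewrite lee_fin sqr_ge0.
  - by apply/measurable_EFinP; apply: measurable_funX; exact: mpd.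
  apply: ge0_le_integral => //.
  - by apply/measurable_EFinP; apply: measurable_funD; apply: measurable_funX; [exact: mf|exact: mpd].
  - move=> x _; rewrite -EFinD lee_fin ler_norml.
    by apply/andP; split; [have := sqr_ge0 (f x + pd i2 f x)|have := sqr_ge0 (f x - pd i2 f x)]; nra.
pose ipa i t := ip leb2 setT (fun p => `|f (p, t)|) (fun p => `|pd i f (p, t)|).
have WE i t : (\int[leb2]_p W i (p, t))%E = (2 * ipa i t)%:E.
  rewrite /ipa.
  have sa := sqint_abs (sqf t); have sb := sqint_abs (sqd i t).
  rewrite EFinM /ip /Rintegral fineK; last first.
    by apply: integrable_fin_num => //; exact: ip_integrable.
  rewrite -integralZl//; last exact: ip_integrable.
  by apply: eq_integral => p _; rewrite /W !normrM ger0_norm// EFinM.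
have Q t : (\int[leb2]_p (f (p, t) ^+ 4)%:E <= (2 * tau)%:E * \int[leb2]_p ((pd i0 f (p, t) ^+ 2)%:E + (pd i1 f (p, t) ^+ 2)%:E))%E.
  have mq : measurable_fun setT (fun p : measurableTypeR R * measurableTypeR R => (f (p, t) ^+ 4)%:E).
    by apply/measurable_EFinP; apply: measurable_funX; case: (sqf t).
  have mw i : measurable_fun setT (fun p : measurableTypeR R * measurableTypeR R => W i (p, t)).
    exact: (measurable_fun_pair1 _ (mW i)).
  apply: le_trans (@leb2_prod_le _ (fun p => W i0 (p, t)) (fun p => W i1 (p, t)) mq (mw i0) (mw i1) _ _ _ _) _.
  - by move=> p; rewrite lee_fin; have := sqr_ge0 (f (p, t) ^+ 2); rewrite -exprM.
  - by move=> p; exact: W0.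
  - by move=> p; exact: W0.
  - move=> x y; rewrite (_ : f (x, y, t) ^+ 4 = f (x, y, t) ^+ 2 * f (x, y, t) ^+ 2); last by rewrite -exprD.
    rewrite EFinM; apply: lee_pmul; rewrite ?lee_fin ?sqr_ge0//.
    + exact: (C1c_sqr_le i0 (x, y, t) cf).
    + exact: (C1c_sqr_le i1 (x, y, t) cf).
  have RH : (\int[leb2]_p ((pd i0 f (p, t) ^+ 2)%:E + (pd i1 f (p, t) ^+ 2)%:E) =
      (D i0 t + D i1 t)%:E)%E.
    transitivity ((\int[leb2]_p (pd i0 f (p, t) ^+ 2)%:E) + \int[leb2]_p (pd i1 f (p, t) ^+ 2)%:E)%E; last first.
      by rewrite EFinD; congr (_ + _)%E; exact: ip_sqrE.
    apply: ge0_integralD => //.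
    - by move=> p _; rewrite lee_fin sqr_ge0.
    - by apply/measurable_EFinP; apply: measurable_funX; case: (sqd i0 t).
    - by move=> p _; rewrite lee_fin sqr_ge0.
    - by apply/measurable_EFinP; apply: measurable_funX; case: (sqd i1 t).
  apply: (@le_trans _ _ ((2 * ipa i0 t)%:E * (2 * ipa i1 t)%:E)%E).
    by rewrite le_eqVlt; apply/orP; left; apply/eqP; congr (_ * _)%E; exact: WE.
  apply: (@le_trans _ _ ((2 * tau)%:E * (D i0 t + D i1 t)%:E)%E); last first.
    by rewrite le_eqVlt; apply/orP; left; apply/eqP; congr (_ * _)%E; symmetry; exact: RH.
  rewrite -!EFinM lee_fin.
  have CS i : ipa i t ^+ 2 <= S t * D i t.
    have := ip_cs measurableT (sqint_abs (sqf t)) (sqint_abs (sqd i t)).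
    by rewrite (ip_abs leb2 setT (fun p => f (p, t))) (ip_abs leb2 setT (fun p => pd i f (p, t))).
  have := CS i0; have := CS i1; set a := ipa _ _; set b := ipa _ _ => h1 h2.
  exact: (L4_arith (ip_ge0 _ _ _) (ip_ge0 _ _ _) h1 h2 (Stau t)).
rewrite leb3_tonelli_p//; last 2 first.
- by apply/measurable_EFinP; apply: measurable_funX; exact: mf.
- by move=> x; rewrite lee_fin; have := sqr_ge0 (f x ^+ 2); rewrite -exprM.
have nE : ((n i0 + n i1)%:E = \int[leb3]_x ((pd i0 f x ^+ 2)%:E + (pd i1 f x ^+ 2)%:E))%E.
  transitivity ((\int[leb3]_x (pd i0 f x ^+ 2)%:E) + \int[leb3]_x (pd i1 f x ^+ 2)%:E)%E.
    by rewrite EFinD; congr (_ + _)%E; symmetry; exact: ip_sqrE.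
  symmetry; apply: ge0_integralD => //.
  - by move=> x _; rewrite lee_fin sqr_ge0.
  - by apply/measurable_EFinP; apply: measurable_funX; exact: mpd.
  - by move=> x _; rewrite lee_fin sqr_ge0.
  - by apply/measurable_EFinP; apply: measurable_funX; exact: mpd.
rewrite EFinM nE.
have mG : measurable_fun setT (fun x : mR3 R => (pd i0 f x ^+ 2)%:E + (pd i1 f x ^+ 2)%:E)%E.
  by apply: emeasurable_funD; apply/measurable_EFinP; apply: measurable_funX; exact: mpd.
have G0 (x : mR3 R) : (0 <= (pd i0 f x ^+ 2)%:E + (pd i1 f x ^+ 2)%:E)%E.
  by rewrite adde_ge0// lee_fin sqr_ge0.
rewrite leb3_tonelli_p// -ge0_integralZl//; last 3 first.
- exact: (leb3_measurable_p mG G0).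
- by move=> t _; apply: integral_ge0.
- by rewrite lee_fin mulr_ge0.
apply: ge0_le_integral => //.
- by move=> t _; apply: integral_ge0 => p _; rewrite lee_fin; have := sqr_ge0 (f (p, t) ^+ 2); rewrite -exprM.
- apply: (@leb3_measurable_p (fun x : mR3 R => (f x ^+ 4)%:E)).
    by apply/measurable_EFinP; apply: measurable_funX; exact: mf.
  by move=> x; rewrite lee_fin; have := sqr_ge0 (f x ^+ 2); rewrite -exprM.
- by apply: measurable_funeM; exact: (leb3_measurable_p mG G0).
Qed.

End C1c_theory.
End slices.

(** * Control of the square integral by averages over small cubes *)

Section averages.
Context {R : realType}.

Lemma sum3E (F : 'I_3 -> R) :
  \sum_i F i = F (@Ordinal 3 0 isT) + F (@Ordinal 3 1 isT) + F (@Ordinal 3 2 isT).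
Proof.
rewrite !big_ord_recl big_ord0 addr0 addrA.
by congr (F _ + F _ + F _); exact/val_inj.
Qed.

Lemma int_bnd d (X : measurableType d) (mu : {measure set X -> \bar R}) (A : set X)
    (k : X -> R) M : measurable A -> (mu A < +oo)%E -> measurable_fun A k ->
    (forall x, A x -> `|k x| <= M) -> mu.-integrable A (EFin \o k).
Proof.
move=> mA Afin mk kM; apply: measurable_bounded_integrable => //.
by exists M; split; [exact: num_real|move=> M' MM' x Ax; apply: le_trans (kM x Ax) (ltW MM')].
Qed.

Lemma le_Rint_bnd d (X : measurableType d) (mu : {measure set X -> \bar R}) (A : set X)
    (k : X -> R) M h : measurable A -> mu A = h%:E -> measurable_fun A k ->
    (forall x, A x -> `|k x| <= M) -> `|\int[mu]_(x in A) k x| <= h * M.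
Proof.
move=> mA Ah mk kM.
have Afin : (mu A < +oo)%E by rewrite Ah ltry.
have ik := int_bnd mA Afin mk kM.
apply: le_trans (le_normr_Rintegral _ ik) _ => //.
have -> : h * M = \int[mu]_(x in A) M by rewrite Rintegral_cst// Ah mulrC.
apply: le_Rintegral => //; first exact: integrable_norm.
by apply: (@int_bnd _ _ _ _ (cst M) `|M|).
Qed.

(** The variance identity: the square integral of [k] is [h^-1] times the square of its integral,
    plus the square integral of its deviation from the mean, which never exceeds the oscillation
    [D]. *)
Lemma sqr_avg_le d (X : measurableType d) (mu : {measure set X -> \bar R}) (A : set X)
    (k : X -> R) (h M D : R) :
  measurable A -> 0 < h -> mu A = h%:E -> measurable_fun A k ->
  (forall x, A x -> `|k x| <= M) ->
  (forall s t, A s -> A t -> `|k s - k t| <= D) ->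
  \int[mu]_(x in A) (k x ^+ 2) <= h^-1 * (\int[mu]_(x in A) k x) ^+ 2 + h * D ^+ 2.
Proof.
move=> mA h0 Ah mk kM kD.
have Afin : (mu A < +oo)%E by rewrite Ah ltry.
have ik := int_bnd mA Afin mk kM.
have icst (c : R) : mu.-integrable A (EFin \o cst c) by apply: (@int_bnd _ _ _ _ (cst c) `|c|).
pose c := h^-1 * \int[mu]_(x in A) k x.
have kc t : A t -> `|k t - c| <= D.
  move=> At; have -> : k t - c = h^-1 * \int[mu]_(x in A) (k t - k x).
    rewrite RintegralB//; last exact: (icst (k t)).
    by rewrite Rintegral_cst// Ah /= mulrBr mulrCA mulVf ?gt_eqF// mulr1.
  rewrite normrM gtr0_norm ?invr_gt0// mulrC ler_pdivrMr// mulrC.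
  apply: le_Rint_bnd => //; last by move=> x Ax; exact: kD.
  exact: measurable_funB.
have M0 x : A x -> `|k x ^+ 2| <= M ^+ 2.
  move=> Ax; rewrite normrX lerXn2r ?nnegrE// ?kM//; exact: le_trans (kM x Ax).
have ik2 : mu.-integrable A (EFin \o (fun x => k x ^+ 2)).
  by apply: int_bnd M0 => //; exact: measurable_funX.
have E : \int[mu]_(x in A) ((k x - c) ^+ 2) =
    \int[mu]_(x in A) (k x ^+ 2) - h^-1 * (\int[mu]_(x in A) k x) ^+ 2.
  transitivity (\int[mu]_(x in A) (k x ^+ 2 - (2 * c * k x - c ^+ 2))).
    by apply: eq_Rintegral => x _; ring.
  have i2 : mu.-integrable A (EFin \o (fun x => 2 * c * k x)).
    have := integrableZl mA (2 * c) ik; apply: eq_integrable => // x _ /=.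
  have i3 : mu.-integrable A (EFin \o (fun x => 2 * c * k x - c ^+ 2)).
    by have := integrableB mA i2 (icst (c ^+ 2)); apply: eq_integrable.
  rewrite RintegralB// RintegralB//; last exact: icst.
  rewrite RintegralZl// Rintegral_cst// Ah /= /c.
  by set I := Rintegral _ _ k; field; rewrite gt_eqF.
suff : \int[mu]_(x in A) ((k x - c) ^+ 2) <= h * D ^+ 2 by rewrite E; lra.
apply: le_trans (ler_norm _) _; apply: le_Rint_bnd => //.
  by apply: measurable_funX; apply: measurable_funB.
move=> x Ax; rewrite normrX lerXn2r ?nnegrE// ?kc//; exact: le_trans (kc x Ax).
Qed.

Lemma EFin_lty (x : \bar R) a : x = a%:E -> (x < +oo)%E.
Proof. by move->; rewrite ltry. Qed.

Section fubini_set.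
Context d1 d2 (X : measurableType d1) (Y : measurableType d2).
Variables (mu : {sigma_finite_measure set X -> \bar R})
  (nu : {sigma_finite_measure set Y -> \bar R}).
Variables (A : set X) (B : set Y) (f : X * Y -> R) (M a b : R).
Hypotheses (mA : measurable A) (mB : measurable B) (Aa : mu A = a%:E) (Bb : nu B = b%:E).
Hypotheses (mf : measurable_fun setT f) (fM : forall x, `|f x| <= M).

Lemma measure_setX : ((mu \x nu) (A `*` B) = (a * b)%:E)%E.
Proof. by rewrite product_measure1E// EFinM; congr (_ * _)%E. Qed.

Let F := f \_ (A `*` B).
Let mAB : measurable (A `*` B). Proof. exact: measurableX. Qed.
Let iF : (mu \x nu)%E.-integrable setT (EFin \o F).
Proof.
rewrite /F -restrict_EFin; apply/(integrable_mkcond _ mAB).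
apply: (@int_bnd _ _ _ _ f M) => //; first exact: (EFin_lty measure_setX).
exact: measurable_funTS.
Qed.

Let FB y : (\int[mu]_x (F (x, y))%:E = (if y \in B then \int[mu]_(x in A) f (x, y) else 0)%:E)%E.
Proof.
case: ifPn => [yB|yB]; last first.
  apply: integral0_eq => x _; rewrite /F patchE ifF//.
  by apply/negbTE; apply: contra yB; rewrite !inE => -[].
rewrite /Rintegral fineK; last first.
  apply: integrable_fin_num => //; apply: (@int_bnd _ _ _ _ _ M) => //.
    exact: (EFin_lty Aa).
  by apply: measurable_funTS; exact: measurable_fun_pair1.
rewrite [RHS]integral_mkcond; apply: eq_integral => x _; rewrite /F !patchE.
rewrite in_setX /= yB andbT.
by case: ifP.
Qed.

Let FA x : (\int[nu]_y (F (x, y))%:E = (if x \in A then \int[nu]_(y in B) f (x, y) else 0)%:E)%E.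
Proof.
case: ifPn => [xA|xA]; last first.
  apply: integral0_eq => y _; rewrite /F patchE ifF//.
  by apply/negbTE; apply: contra xA; rewrite !inE => -[].
rewrite /Rintegral fineK; last first.
  apply: integrable_fin_num => //; apply: (@int_bnd _ _ _ _ _ M) => //.
    exact: (EFin_lty Bb).
  by apply: measurable_funTS; exact: measurable_fun_pair2.
rewrite [RHS]integral_mkcond; apply: eq_integral => y _; rewrite /F !patchE.
rewrite in_setX /= xA /=.
by case: ifP.
Qed.

Let IF : (\int[(mu \x nu)%E]_z (F z)%:E)%E = (\int[(mu \x nu)%E]_(z in A `*` B) f z)%:E.
Proof.
by rewrite Rintegral_mkcond /Rintegral fineK//; exact: (integrable_fin_num measurableT iF).
Qed.

Lemma fubini_set2 : \int[(mu \x nu)%E]_(z in A `*` B) f z =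
  \int[nu]_(y in B) \int[mu]_(x in A) f (x, y).
Proof.
rewrite [RHS]Rintegral_mkcond [RHS]/Rintegral.
have -> : (\int[nu]_y (((fun y => \int[mu]_(x in A) f (x, y)) \_ B) y)%:E =
    \int[nu]_y fubini_G mu (EFin \o F) y)%E.
  by apply: eq_integral => y _; rewrite /fubini_G /= FB patchE.
by rewrite (integral21_prod_meas1 iF) IF.
Qed.

Lemma fubini_set1 : \int[(mu \x nu)%E]_(z in A `*` B) f z =
  \int[mu]_(x in A) \int[nu]_(y in B) f (x, y).
Proof.
rewrite [RHS]Rintegral_mkcond [RHS]/Rintegral.
have -> : (\int[mu]_x (((fun x => \int[nu]_(y in B) f (x, y)) \_ A) x)%:E =
    \int[mu]_x fubini_F nu (EFin \o F) x)%E.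
  by apply: eq_integral => x _; rewrite /fubini_F /= FA patchE.
by rewrite (integral12_prod_meas1 iF) IF.
Qed.

Lemma measurable_fubini_set : measurable_fun B (fun y => \int[mu]_(x in A) f (x, y)).
Proof.
have h : measurable_fun B (fine \o (fun y => \int[mu]_x (F (x, y))%:E)%E).
  apply: measurableT_comp => //; apply: measurable_funTS.
  exact: (measurable_fubini_G iF).
apply: eq_measurable_fun h => y yB /=.
by rewrite FB yB.
Qed.
End fubini_set.

(** The induction step over the dimension. The oscillation in [t] of the partial integral over [A]
    is at most the integral of [|p|] over the cell, and Cauchy-Schwarz on the cell of measure [m h]
    produces the factor [h^2 m]. *)
Lemma sqr_avg_step d (X : measurableType d) (mu : {sigma_finite_measure set X -> \bar R})
   (A : set X) (J : set (measurableTypeR R)) (f p : X * measurableTypeR R -> R) (M m h : R) :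
  measurable A -> measurable J -> 0 < h -> mu A = m%:E -> lebesgue_measure J = h%:E ->
  measurable_fun setT f -> measurable_fun setT p ->
  (forall x, `|f x| <= M) -> (forall x, `|p x| <= M) ->
  (forall x s t, A x -> J s -> J t ->
    `|f (x, s) - f (x, t)| <= \int[lebesgue_measure]_(r in J) `|p (x, r)|) ->
  \int[lebesgue_measure]_(t in J) ((\int[mu]_(x in A) f (x, t)) ^+ 2) <=
  h^-1 * (\int[(mu \x lebesgue_measure)%E]_(z in A `*` J) f z) ^+ 2 +
  h ^+ 2 * m * \int[(mu \x lebesgue_measure)%E]_(z in A `*` J) (p z ^+ 2).
Proof.
move=> mA mJ h0 Am Jh mf mp fM pM fp.
have Afin : (mu A < +oo)%E by rewrite Am ltry.
have m0 : 0 <= m by rewrite -lee_fin -Am.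
pose np z := `|p z|.
have mnp : measurable_fun setT np by apply: measurableT_comp mp; exact: normr_measurable.
have npM z : `|np z| <= M by rewrite normr_id.
set D := \int[(mu \x lebesgue_measure)%E]_(z in A `*` J) np z.
have ift t : mu.-integrable A (EFin \o (fun x => f (x, t))).
  by apply: (@int_bnd _ _ _ _ _ M) => //; apply: measurable_funTS; exact: measurable_fun_pair1.
have H := @sqr_avg_le _ _ _ J (fun t => \int[mu]_(x in A) f (x, t)) h (m * M) D mJ h0 Jh.
apply: le_trans (H _ _ _) _.
- exact: (measurable_fubini_set mA mJ Am Jh mf fM).
- move=> t Jt; apply: le_Rint_bnd => //.
  by apply: measurable_funTS; exact: measurable_fun_pair1.
- move=> s t Js Jt; rewrite -RintegralB//.
  have ib : mu.-integrable A (EFin \o (fun x => f (x, s) - f (x, t))).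
    by have := integrableB mA (ift s) (ift t); apply: eq_integrable.
  apply: le_trans (le_normr_Rintegral _ ib) _ => //.
  rewrite /D (fubini_set1 mA mJ Am Jh mnp npM); apply: le_Rintegral => //.
  - exact: integrable_norm.
  - apply: (@int_bnd _ _ _ _ _ (h * M)) => //.
      have := measurable_fubini_set mJ mA Jh Am (f := fun z => np (z.2, z.1)).
      apply.
      + apply: measurableT_comp mnp _; exact: measurable_fun_pair.
      + by move=> x; exact: npM.
    move=> x Ax; apply: le_Rint_bnd => //.
    by apply: measurable_funTS; exact: measurable_fun_pair2.
  - by move=> x Ax; exact: fp.
rewrite (fubini_set2 mA mJ Am Jh mf fM) lerD2l.
have mAJ : measurable (A `*` J) by exact: measurableX.
have AJ := measure_setX mA mJ Am Jh.
have AJfin := EFin_lty AJ.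
have np2 z : `|np z ^+ 2| <= M ^+ 2.
  by rewrite normrX lerXn2r ?nnegrE//; exact: le_trans (npM z).
have sq1 : sqint (mu \x lebesgue_measure)%E (A `*` J) np.
  apply: sqint_of_sqr => //; first exact: measurable_funTS.
  by apply: (@int_bnd _ _ _ _ _ (M ^+ 2)) => //; apply: measurable_funX; exact: measurable_funTS.
have sq2 : sqint (mu \x lebesgue_measure)%E (A `*` J) (cst 1).
  apply: sqint_of_sqr => //; apply: (@int_bnd _ _ _ _ (fun=> 1 ^+ 2) 1) => //.
  by move=> z zA; rewrite expr1n normr1.
have := ip_cs mAJ sq1 sq2.
have -> : ip (mu \x lebesgue_measure)%E (A `*` J) np (cst 1) = D.
  by apply: eq_Rintegral => z _; rewrite mulr1.
have -> : ip (mu \x lebesgue_measure)%E (A `*` J) (cst 1) (cst 1) = m * h.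
  by rewrite /ip; under eq_Rintegral do rewrite mulr1; rewrite Rintegral_cst// mul1r; exact: (congr1 fine AJ).
have -> : ip (mu \x lebesgue_measure)%E (A `*` J) np np =
  \int[(mu \x lebesgue_measure)%E]_(z in A `*` J) (p z ^+ 2).
  by apply: eq_Rintegral => z _; rewrite /np -expr2 real_normK ?num_real.
set I := Rintegral _ _ _ => hh.
have -> : h ^+ 2 * m * I = h * (I * (m * h)) by ring.
by rewrite ler_pM2l.
Qed.

Record bm d (X : measurableType d) (A : set X) (g : X -> R) : Prop := BM {
  bm_m : measurable_fun A g ; bm_b : exists M, forall x, A x -> `|g x| <= M }.

Lemma bm_int d (X : measurableType d) (mu : {measure set X -> \bar R}) (A : set X) g a :
  measurable A -> mu A = a%:E -> bm A g -> mu.-integrable A (EFin \o g).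
Proof. by move=> mA Aa [mg [M gM]]; apply: int_bnd gM => //; rewrite Aa ltry. Qed.

Lemma bm_sqr d (X : measurableType d) (A : set X) g : bm A g -> bm A (fun x => g x ^+ 2).
Proof.
move=> [mg [M gM]]; split; first exact: measurable_funX.
by exists (M ^+ 2) => x Ax; rewrite normrX lerXn2r ?nnegrE ?gM//; exact: le_trans (gM x Ax).
Qed.

Lemma le_Rint3 d (X : measurableType d) (mu : {measure set X -> \bar R}) (A : set X)
    (g k1 k2 k3 : X -> R) a c1 c2 c3 :
  measurable A -> mu A = a%:E -> bm A g -> bm A k1 -> bm A k2 -> bm A k3 ->
  (forall x, A x -> g x <= c1 * k1 x + c2 * k2 x + c3 * k3 x) ->
  \int[mu]_(x in A) g x <= c1 * (\int[mu]_(x in A) k1 x) +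
     c2 * (\int[mu]_(x in A) k2 x) + c3 * (\int[mu]_(x in A) k3 x).
Proof.
move=> mA Aa bg b1 b2 b3 H.
have I k : bm A k -> mu.-integrable A (EFin \o k) by exact: (bm_int mA Aa).
have Z c k : bm A k -> mu.-integrable A (EFin \o (fun x => c * k x)).
  by move=> /I ik; have := integrableZl mA c ik; apply: eq_integrable.
have S : mu.-integrable A (EFin \o (fun x => c1 * k1 x + c2 * k2 x)).
  by have := integrableD mA (Z c1 _ b1) (Z c2 _ b2); apply: eq_integrable.
have S' : mu.-integrable A (EFin \o (fun x => c1 * k1 x + c2 * k2 x + c3 * k3 x)).
  by have := integrableD mA S (Z c3 _ b3); apply: eq_integrable.
rewrite -(RintegralZl c1 mA (I _ b1)) -(RintegralZl c2 mA (I _ b2)) -(RintegralZl c3 mA (I _ b3)).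
rewrite -(RintegralD mA (Z c1 _ b1) (Z c2 _ b2)) -(RintegralD mA S (Z c3 _ b3)).
by apply: le_Rintegral => //; exact: I.
Qed.

Lemma sqr_Rint_le d (X : measurableType d) (mu : {measure set X -> \bar R}) (A : set X)
    (g : X -> R) h : measurable A -> mu A = h%:E -> bm A g ->
  (\int[mu]_(x in A) `|g x|) ^+ 2 <= h * \int[mu]_(x in A) (g x ^+ 2).
Proof.
move=> mA Ah bg.
have i1 : bm A (fun=> 1 : R) by split => //; exists 1 => x _; rewrite normr1.
have sg : sqint mu A (fun x => `|g x|).
  by apply: sqint_abs; apply: sqint_of_sqr; [case: bg|exact: (bm_int mA Ah (bm_sqr bg))].
have s1 : sqint mu A (fun=> 1) by apply: sqint_of_sqr => //; exact: (bm_int mA Ah (bm_sqr i1)).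
have := ip_cs mA sg s1.
have -> : ip mu A (fun=> 1) (fun=> 1) = h.
  rewrite /ip; under eq_Rintegral do rewrite mulr1.
  by rewrite Rintegral_cst// mul1r; exact: (congr1 fine Ah).
rewrite ip_abs /ip; under eq_Rintegral do rewrite mulr1.
by under [X in _ <= X * _]eq_Rintegral do rewrite -expr2; rewrite mulrC.
Qed.

Notation leb := (@lebesgue_measure R).

(** Half-open, so that adjacent cubes of the grid are disjoint. *)
Definition itvh (a h : R) : set (measurableTypeR R) := `[a, a + h[%classic.

Lemma leb_itvh a h : 0 < h -> leb (itvh a h) = h%:E.
Proof.
move=> h0; rewrite /itvh lebesgue_measure_itv/= lte_fin ltrDl h0 -EFinD.
by rewrite addrAC subrr add0r.
Qed.

Definition cube (a : R * R * R) h : set (mR3 R) :=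
  ((itvh a.1.1 h `*` itvh a.1.2 h) `*` itvh a.2 h).

Lemma measurable_cube a h : measurable (cube a h).
Proof. by apply: measurableX; [apply: measurableX|]; exact: measurable_itv. Qed.

Lemma le_sl_itvh (Omega : set (R3 R)) f i x a h s t : C1c Omega f -> itvh a h s -> itvh a h t ->
  `|f (sl i x s) - f (sl i x t)| <= \int[leb]_(r in itvh a h) `|pd i f (sl i x r)|.
Proof.
move=> [cf df cpf f0 [M fM]]; rewrite /itvh /= !in_itv /= => /andP[as_ sh] /andP[at_ th].
have h0 : 0 < h by lra.
have cd : continuous (fun t => pd i f (sl i x t)).
  by move=> r; apply: continuous_comp; [exact: continuous_sl|exact: cpf].
have sab : a <= s <= a + h by lra.
have tab : a <= t <= a + h by lra.
have := @le_integral_derive _ (fun t => f (sl i x t)) (fun t => pd i f (sl i x t)) a (a + h) s t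
  (fun t => is_derive_sl (df i _)) cd sab tab.
have mI : measurable_fun setT (fun r => (`|pd i f (sl i x r)|)%:E).
  apply/measurable_EFinP; apply: measurableT_comp; first exact: normr_measurable.
  exact: continuous_measurable_fun.
rewrite -integral_itv_bndo_bndc; last exact: measurable_funTS.
rewrite -lee_fin /Rintegral fineK//.
apply: integrable_fin_num; first exact: measurable_itv.
apply: (@int_bnd _ _ _ _ _ M); first exact: measurable_itv.
- exact: (EFin_lty (leb_itvh a h0)).
- by apply/measurable_EFinP; exact: measurable_funTS.
- by move=> r _; rewrite normr_id; case: (fM (sl i x r)).
Qed.

Lemma bm_param d1 d2 (X : measurableType d1) (Y : measurableType d2)
    (mu : {sigma_finite_measure set X -> \bar R})
    (nu : {sigma_finite_measure set Y -> \bar R}) (A : set X) (B : set Y) (a b : R)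
    (f : X * Y -> R) M : measurable A -> measurable B -> mu A = a%:E -> nu B = b%:E ->
  measurable_fun setT f -> (forall x, `|f x| <= M) ->
  bm B (fun y => \int[mu]_(x in A) f (x, y)).
Proof.
move=> mA mB Aa Bb mf fM; split; first exact: (measurable_fubini_set mA mB Aa Bb mf fM).
exists (a * M) => y By; apply: le_Rint_bnd => //.
by apply: measurable_funTS; exact: measurable_fun_pair1.
Qed.

Lemma cube_arith (h I n0 n1 n2 : R) : 0 < h ->
  h ^- 2 * (h^-1 * I + h ^+ 4 * n2) + h ^+ 2 * n1 + h ^+ 2 * n0 =
  h ^- 3 * I + h ^+ 2 * (n0 + n1 + n2).
Proof. by move=> h0; field; rewrite gt_eqF. Qed.

(** One coordinate is averaged at a time: the squared average left by one step is what the next step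
    integrates. Each step brings a factor [h^-1] and, after collecting the powers of [h], costs
    [h^2] times the square of one partial derivative. *)
Lemma C1c_cube (Omega : set (R3 R)) f a h
    (N := fun i => \int[leb3]_(x in cube a h) (pd i f x ^+ 2)) :
  C1c Omega f -> 0 < h ->
  \int[leb3]_(x in cube a h) (f x ^+ 2) <=
  h ^- 3 * (\int[leb3]_(x in cube a h) f x) ^+ 2 +
  h ^+ 2 * (N (@Ordinal 3 0 isT) + N (@Ordinal 3 1 isT) + N (@Ordinal 3 2 isT)).
Proof.
move=> Cf h0; set i0 := @Ordinal 3 0 isT; set i1 := @Ordinal 3 1 isT; set i2 := @Ordinal 3 2 isT.
have [cf df cpf f0 [M fM]] := Cf.
have mf : measurable_fun setT (f : mR3 R -> R) by exact: continuous_measurable3.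
have mp i : measurable_fun setT (pd i f : mR3 R -> R) by exact: continuous_measurable3.
have bf x : `|f x| <= M by case: (fM x).
have bp i x : `|pd i f x| <= M by case: (fM x).
have mJ b : measurable (itvh b h) by exact: measurable_itv.
have Jh b := leb_itvh b h0.
set J0 := itvh a.1.1 h; set J1 := itvh a.1.2 h; set J2 := itvh a.2 h.
pose A := J0 `*` J1.
have mA : measurable A by exact: (measurableX (mJ _) (mJ _)).
have Ah : prod_sf leb leb A = (h * h)%:E by exact: (measure_setX (mJ _) (mJ _) (Jh _) (Jh _)).
have bm2 (g : mR3 R -> R) t : measurable_fun setT g -> (forall x, `|g x| <= M) ->
    bm A (fun p => g (p, t)).
  by move=> mg gM; split; [apply: measurable_funTS; exact: measurable_fun_pair1|exists M].
have bm1 (g : mR3 R -> R) y t : measurable_fun setT g -> (forall x, `|g x| <= M) ->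
    bm J0 (fun x => g (x, y, t)).
  move=> mg gM; split; [apply: measurable_funTS|by exists M].
  exact: (measurable_fun_pair1 _ (measurable_fun_pair1 _ mg)).
pose k1 t y := \int[leb]_(x in J0) f (x, y, t).
pose k2 t := \int[prod_sf leb leb]_(p in A) f (p, t).
pose P i t := \int[prod_sf leb leb]_(p in A) (pd i f (p, t) ^+ 2).
have S0 y t : \int[leb]_(x in J0) (f (x, y, t) ^+ 2) <=
    h^-1 * k1 t y ^+ 2 + h ^+ 2 * \int[leb]_(x in J0) (pd i0 f (x, y, t) ^+ 2).
  have b0 := bm1 _ y t mf bf.
  apply: le_trans (sqr_avg_le (mJ _) h0 (Jh _) _ _ (D := \int[leb]_(x in J0) `|pd i0 f (x, y, t)|) _) _.
  - by case: b0.
  - by move=> x _; exact: bf.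
  - by move=> s r Js Jr; exact: (le_sl_itvh i0 (0, y, t) Cf Js Jr).
  rewrite lerD2l expr2 -mulrA ler_pM2l//.
  exact: (sqr_Rint_le (mJ _) (Jh _) (bm1 _ y t (mp i0) (bp i0))).
have S1 t : \int[leb]_(y in J1) (k1 t y ^+ 2) <=
    h^-1 * k2 t ^+ 2 + h ^+ 3 * P i1 t.
  have := @sqr_avg_step _ _ leb J0 J1 (fun p => f (p, t)) (fun p => pd i1 f (p, t)) M h h
    (mJ _) (mJ _) h0 (Jh _) (Jh _) (measurable_fun_pair1 _ mf) (measurable_fun_pair1 _ (mp i1))
    (fun p => bf _) (fun p => bp _ _).
  rewrite -[h ^+ 2 * h]exprSr; apply.
  by move=> x s r _ Js Jr; exact: (le_sl_itvh i1 (x, 0, t) Cf Js Jr).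
have S2 : \int[leb]_(t in J2) (k2 t ^+ 2) <=
    h^-1 * (\int[leb3]_(x in cube a h) f x) ^+ 2 + h ^+ 4 * N i2.
  have := @sqr_avg_step _ _ (prod_sf leb leb) A J2 f (pd i2 f) M (h * h) h
    mA (mJ _) h0 Ah (Jh _) mf (mp i2) bf (bp i2).
  rewrite (_ : h ^+ 2 * (h * h) = h ^+ 4); last by ring.
  apply.
  by move=> -[x y] s r _ Js Jr; exact: (le_sl_itvh i2 (x, y, 0) Cf Js Jr).
have sqM (z : R) : `|z| <= M -> `|z ^+ 2| <= M ^+ 2.
  by move=> zM; rewrite normrX lerXn2r ?nnegrE//; exact: le_trans zM.
have S01 t : \int[prod_sf leb leb]_(p in A) (f (p, t) ^+ 2) <=
    h ^- 2 * k2 t ^+ 2 + h ^+ 2 * P i1 t + h ^+ 2 * P i0 t.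
  have f12 (g : mR3 R -> R) : measurable_fun setT g -> (forall x, `|g x| <= M) ->
      \int[prod_sf leb leb]_(p in A) (g (p, t) ^+ 2) =
      \int[leb]_(y in J1) \int[leb]_(x in J0) (g (x, y, t) ^+ 2).
    move=> mg gM.
    exact: (fubini_set2 (mJ _) (mJ _) (Jh _) (Jh _) (f := fun p => g (p, t) ^+ 2)
      (measurable_funX 2 (measurable_fun_pair1 _ mg)) (fun p => sqM _ (gM _))).
  have b12 (g : mR3 R -> R) : measurable_fun setT g -> (forall x, `|g x| <= M) ->
      bm J1 (fun y => \int[leb]_(x in J0) (g (x, y, t) ^+ 2)).
    move=> mg gM.
    exact: (bm_param (mJ _) (mJ _) (Jh _) (Jh _) (f := fun p => g (p, t) ^+ 2)
      (measurable_funX 2 (measurable_fun_pair1 _ mg)) (fun p => sqM _ (gM _))).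
  have bk1 : bm J1 (fun y => k1 t y ^+ 2).
    apply: bm_sqr.
    exact: (@bm_param _ _ _ _ leb leb J0 J1 h h (fun p => f (p, t)) M (mJ _) (mJ _) (Jh _) (Jh _)
      (measurable_fun_pair1 _ mf) (fun p => bf _)).
  have bz : bm J1 (fun=> 0 : R) by split => //; exists 0 => x _; rewrite normr0.
  rewrite (f12 f mf bf).
  have S0' y : J1 y -> \int[leb]_(x in J0) (f (x, y, t) ^+ 2) <=
    h^-1 * k1 t y ^+ 2 + h ^+ 2 * \int[leb]_(x in J0) (pd i0 f (x, y, t) ^+ 2) + 0 * 0.
    by move=> _; rewrite mul0r addr0; exact: S0.
  apply: le_trans (le_Rint3 (mJ _) (Jh _) (b12 _ mf bf) bk1 (b12 _ (mp i0) (bp i0)) bz S0') _.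
  rewrite mul0r addr0 -(f12 _ (mp i0) (bp i0)) -/(P i0 t).
  have hi : 0 < h^-1 by rewrite invr_gt0.
  rewrite lerD2r; have := S1 t; rewrite -(ler_pM2l hi) => /le_trans; apply.
  by rewrite le_eqVlt; apply/orP; left; apply/eqP; field; rewrite gt_eqF.
have bG (g : mR3 R -> R) : measurable_fun setT g -> (forall x, `|g x| <= M) ->
    bm J2 (fun t => \int[prod_sf leb leb]_(p in A) (g (p, t) ^+ 2)).
  move=> mg gM; exact: (bm_param mA (mJ _) Ah (Jh _) (f := fun x => g x ^+ 2)
    (measurable_funX 2 mg) (fun p => sqM _ (gM _))).
have bP i : bm J2 (P i) by exact: bG.
have bF : bm J2 (fun t => \int[prod_sf leb leb]_(p in A) (f (p, t) ^+ 2)) by exact: bG.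
have bk2 : bm J2 (fun t => k2 t ^+ 2).
  by apply: bm_sqr; exact: (bm_param mA (mJ _) Ah (Jh _) mf bf).
have fz (g : mR3 R -> R) : measurable_fun setT g -> (forall x, `|g x| <= M) ->
   \int[leb3]_(x in cube a h) (g x ^+ 2) = \int[leb]_(t in J2) \int[prod_sf leb leb]_(p in A) (g (p, t) ^+ 2).
  move=> mg gM; exact: (fubini_set2 mA (mJ _) Ah (Jh _) (f := fun x => g x ^+ 2)
    (measurable_funX 2 mg) (fun p => sqM _ (gM _))).
have e1 : N i1 = \int[leb]_(t in J2) P i1 t := fz _ (mp i1) (bp i1).
have e0 : N i0 = \int[leb]_(t in J2) P i0 t := fz _ (mp i0) (bp i0).
have L1 := le_Rint3 (mJ _) (Jh _) bF bk2 (bP i1) (bP i0) (fun t _ => S01 t).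
apply: (@le_trans _ _ (h ^- 2 * \int[leb]_(t in J2) (k2 t ^+ 2) + h ^+ 2 * N i1 + h ^+ 2 * N i0)).
  rewrite e1 e0; apply: le_trans L1.
  by rewrite le_eqVlt; apply/orP; left; apply/eqP; exact: (fz _ mf bf).
have h2 : 0 < h ^- 2 by rewrite invr_gt0 exprn_gt0.
move: S2; rewrite -(ler_pM2l h2) => S2.
apply: (@le_trans _ _ (h ^- 2 * (h^-1 * (\int[leb3]_(x in cube a h) f x) ^+ 2 + h ^+ 4 * N i2) + h ^+ 2 * N i1 + h ^+ 2 * N i0)).
  by rewrite !lerD2r.
by rewrite cube_arith.
Qed.

Section grid.
Variables (Omega : set (R3 R)) (L : R) (N : nat).
Hypotheses (OL : forall x, Omega x -> forall i, `|crd i x| <= L) (L0 : 0 < L) (N0 : (0 < N)%N).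

(** The grid fills [[- (L + 1), L + 1)] in each direction; the margin 1 keeps the closed interval
    [[- L, L]] away from the excluded right end. *)
Definition gh : R := 2 * (L + 1) / N%:R.
Definition gpt (i : nat) : R := - (L + 1) + i%:R * gh.
Definition gcube (q : 'I_N * 'I_N * 'I_N) : set (mR3 R) :=
  cube (gpt q.1.1, gpt q.1.2, gpt q.2) gh.

Lemma gh_gt0 : 0 < gh.
Proof. by rewrite /gh divr_gt0// ?ltr0n//; have := L0; nra. Qed.

Lemma grid_exists s : `|s| <= L -> exists i : 'I_N, itvh (gpt i) gh s.
Proof.
rewrite ler_norml => /andP[s1 s2].
have h0 := gh_gt0.
have H n : - (L + 1) <= s < gpt n -> exists i : nat, (i < n)%N /\ itvh (gpt i) gh s.
  elim: n => [|n ih].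
    by rewrite /gpt mul0r addr0 => /andP[h1 h2]; have := le_lt_trans h1 h2; rewrite ltxx.
  move=> /andP[h1 h2]; have [sn|ns] := ltP s (gpt n).
    by have [|i [i1 i2]] := ih _; [rewrite h1|exists i; split => //; exact: ltnW].
  exists n; split => //; rewrite /itvh /= in_itv /= ns /=.
  by move: h2; rewrite /gpt -natr1 mulrDl mul1r addrA.
have [|i [iN si]] := H N.
  rewrite /gpt /gh mulrC divfK ?pnatr_eq0 -?lt0n//; apply/andP; split; lra.
by exists (Ordinal iN).
Qed.

Lemma grid_uniq s (i j : 'I_N) : itvh (gpt i) gh s -> itvh (gpt j) gh s -> i = j.
Proof.
have h0 := gh_gt0.
have H (a b : nat) : itvh (gpt a) gh s -> itvh (gpt b) gh s -> (a <= b)%N.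
  rewrite /itvh /= !in_itv /= /gpt => /andP[a1 a2] /andP[b1 b2].
  rewrite leqNgt; apply/negP => ba.
  have : (b.+1%:R : R) <= a%:R by rewrite ler_nat.
  by rewrite -natr1 => h; nra.
by move=> si sj; apply/val_inj/eqP; rewrite eqn_leq !H.
Qed.

Lemma sum_gcube (g : mR3 R -> R) (M : R) : measurable_fun setT g -> (forall x, `|g x| <= M) ->
  (forall x, ~ Omega x -> g x = 0) ->
  \sum_q \int[leb3]_(x in gcube q) g x = \int[leb3]_x g x.
Proof.
move=> mg gM g0.
have ig : leb3.-integrable setT (EFin \o g) by exact: (integrable3_bs OL mg gM g0).
have mQ q : measurable (gcube q) by exact: measurable_cube.
have iq q : leb3.-integrable setT (fun x => ((g \_ (gcube q)) x)%:E).
  have := (integrable_mkcond (EFin \o g) (mQ q)).1 (integrableS measurableT (mQ q) (@subsetT _ _) ig).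
  by rewrite restrict_EFin.
have E x : \sum_q (g \_ (gcube q)) x = g x.
  have [Ox|/g0 gx] := pselect (Omega x); last first.
    by rewrite gx big1// => q _; rewrite patchE gx; case: ifP.
  have h0 := OL Ox (@Ordinal 3 0 isT); have h1 := OL Ox (@Ordinal 3 1 isT).
  have h2 := OL Ox (@Ordinal 3 2 isT).
  have [a ax] := grid_exists h0; have [b bx] := grid_exists h1; have [c cx] := grid_exists h2.
  rewrite (bigD1 (a, b, c))//= patchE mem_set; last by split; [split|].
  rewrite big1 ?addr0// => -[[a' b'] c'] /= /negP ne; rewrite patchE; case: ifPn => //.
  rewrite inE => -[[/= a'x b'x] c'x]; exfalso; apply: ne.
  by rewrite (grid_uniq a'x ax) (grid_uniq b'x bx) (grid_uniq c'x cx).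
under eq_bigr do rewrite Rintegral_mkcond.
apply: EFin_inj; rewrite -sumEFin.
rewrite [RHS](_ : _ = \int[leb3]_x (\sum_q ((g \_ (gcube q)) x)%:E))%E; last first.
  rewrite /Rintegral fineK; last exact: (integrable_fin_num measurableT ig).
  by apply: eq_integral => x _; rewrite sumEFin E.
rewrite integral_sum//; apply: eq_bigr => q _.
by rewrite /Rintegral fineK//; exact: (integrable_fin_num measurableT (iq q)).
Qed.

(** Finitely many averages control the [L^2] norm up to a multiple of the gradient that tends to 0
    as the grid is refined. This is the quantitative content of Rellich's theorem. *)
Lemma C1c_grid f : C1c Omega f ->
  ip leb3 setT (f : mR3 R -> R) f <=
  gh ^- 3 * (\sum_q (\int[leb3]_(x in gcube q) f x) ^+ 2) +
  gh ^+ 2 * \sum_i ip leb3 setT (pd i f : mR3 R -> R) (pd i f).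
Proof.
move=> Cf; have [cf df cpf f0 [M fM]] := Cf.
have sE (g : mR3 R -> R) : measurable_fun setT g -> (forall x, `|g x| <= M) ->
    (forall x, ~ Omega x -> g x = 0) ->
    ip leb3 setT g g = \sum_q \int[leb3]_(x in gcube q) (g x ^+ 2).
  move=> mg gM g0; rewrite (@sum_gcube _ (M ^+ 2)).
  - by apply: eq_Rintegral => x _; rewrite expr2.
  - exact: measurable_funX.
  - by move=> x; rewrite normrX lerXn2r ?nnegrE//; exact: le_trans (gM x).
  - by move=> x /g0 ->; rewrite expr0n.
rewrite sE; last 3 first.
- exact: continuous_measurable3.
- by move=> x; case: (fM x).
- by move=> x /f0[].
have pE i : ip leb3 setT (pd i f : mR3 R -> R) (pd i f) =
    \sum_q \int[leb3]_(x in gcube q) (pd i f x ^+ 2).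
  apply: sE; first exact: continuous_measurable3.
    by move=> x; case: (fM x).
  by move=> x /f0[].
under [X in _ + _ * X]eq_bigr do rewrite pE.
rewrite exchange_big /= !mulr_sumr -big_split /=; apply: ler_sum => q _.
apply: le_trans (C1c_cube _ Cf gh_gt0) _; rewrite lerD2l ler_pM2l ?exprn_gt0 ?gh_gt0//.
by rewrite sum3E; exact: lexx.
Qed.
End grid.
End averages.

(** * Uniqueness of weak derivatives *)

Section bump.
Context {R : realType}.

(* [flat n x = x ^- n * exp (- 1 / x)] for [x > 0]; the family is closed under
   differentiation. *)
Definition flat (n : nat) (x : R) : R := if 0 < x then x^-1 ^+ n * expR (- x^-1) else 0.

Lemma flat_ge0 n x : 0 <= flat n x.
Proof.
by rewrite /flat; case: ifP => // x0; rewrite mulr_ge0 ?expR_ge0// exprn_ge0// invr_ge0 ltW.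
Qed.

(** From [exp y = exp (y / (n+1)) ^ (n+1) >= (y / (n+1)) ^ (n+1)] at [y = 1 / x]. One power more
    than [n] is taken so that a factor [x] is left over and the function tends to 0 at the
    origin. *)
Lemma flat_le n x : 0 < x -> flat n x <= n.+1%:R ^+ n.+1 * x.
Proof.
move=> x0; rewrite /flat x0.
have e0 : 0 < n.+1%:R * x by rewrite mulr_gt0// ltr0n.
have h : (n.+1%:R * x)^-1 ^+ n.+1 <= expR (x^-1).
  have -> : x^-1 = n.+1%:R * (n.+1%:R * x)^-1.
    by rewrite invfM mulrA mulfV ?mul1r// pnatr_eq0.
  rewrite expRM_natl lerXn2r ?nnegrE ?invr_ge0 ?expR_ge0//; first exact: ltW.
  by apply: le_trans (expR_ge1Dx _); rewrite lerDr.
rewrite expRN; apply: (@le_trans _ _ (x^-1 ^+ n * ((n.+1%:R * x) ^+ n.+1))).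
  apply: ler_wpM2l; first by rewrite exprn_ge0// invr_ge0 ltW.
  rewrite invf_ple ?posrE ?expR_gt0 ?exprn_gt0//.
  by rewrite -exprVn.
have xn : x^-1 ^+ n * x ^+ n = 1 by rewrite -exprMn mulVf ?expr1n// gt_eqF.
suff -> : x^-1 ^+ n * (n.+1%:R * x) ^+ n.+1 = n.+1%:R ^+ n.+1 * x by [].
by rewrite exprMn mulrCA; congr (_ * _); rewrite exprSr mulrA xn mul1r.
Qed.

Lemma flat_gt0E n x : 0 < x -> flat n x = x^-1 ^+ n * expR (- x^-1).
Proof. by rewrite /flat => ->. Qed.

Lemma flat_le0E n x : x <= 0 -> flat n x = 0.
Proof. by rewrite /flat ltNge => ->. Qed.

Lemma flat_cvg0 n : flat n x @[x --> (0 : R)] --> (0 : R).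
Proof.
apply/cvgrPdist_le => e e0; near=> x; rewrite sub0r normrN ger0_norm ?flat_ge0//.
have [x0|x0] := ltP 0 x; last by rewrite flat_le0E// ltW.
apply: le_trans (flat_le n x0) _; rewrite mulrC -ler_pdivlMr ?exprn_gt0 ?ltr0n//.
near: x; have : 0 < e / n.+1%:R ^+ n.+1 by rewrite divr_gt0// exprn_gt0 ?ltr0n.
move=> d0; exists (e / n.+1%:R ^+ n.+1) => //= y /=; rewrite sub0r normrN => /ltW.
exact: le_trans (ler_norm _).
Unshelve. all: by end_near. Qed.

Lemma is_derive_flat n (x : R) : is_derive x 1 (flat n) (- n%:R * flat n.+1 x + flat n.+2 x).
Proof.
have [x0|x0|x0] := ltgtP 0 x.
- apply: (@near_eq_is_derive R R R (fun y => y^-1 ^+ n * expR (- y^-1))).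
    near=> y; rewrite flat_gt0E//; near: y; exact: lt_nbhsr.
  rewrite !flat_gt0E//.
  have xn : x != 0 by rewrite gt_eqF.
  have dV : is_derive x 1 (fun y : R => y^-1) (- x^-1 ^+ 2).
    apply: is_derive_eq (is_deriveV (f := id) xn (is_derive_id x 1)) _.
    by rewrite /GRing.scale /= mulr1 exprVn.
  have dX m : is_derive x 1 (fun y : R => y^-1 ^+ m) (- m%:R * x^-1 ^+ m.+1).
    elim: m => [|m ih]; first by rewrite oppr0 mul0r; exact: is_derive_cst.
    have -> : (fun y : R => y^-1 ^+ m.+1) = (fun y : R => y^-1) * (fun y : R => y^-1 ^+ m).
      by apply/funext => y; rewrite exprS.
    apply: is_derive_eq (is_deriveM dV ih) _.
    by rewrite /GRing.scale /= -natr1 !exprS; ring.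
  have dE : is_derive x 1 (fun y : R => expR (- y^-1)) (expR (- x^-1) * x^-1 ^+ 2).
    have dN : is_derive x 1 (fun y : R => - y^-1) (x^-1 ^+ 2).
      by apply: is_derive_eq (is_deriveN dV) _; rewrite opprK.
    exact: (@is_derive1_comp R expR (fun y : R => - y^-1) x _ _ (is_derive_expR (- x^-1)) dN).
  apply: is_derive_eq (is_deriveM (dX n) dE) _.
  by rewrite /GRing.scale /= !exprS; ring.
- apply: (@near_eq_is_derive R R R (cst 0)).
    near=> y; rewrite flat_le0E//; apply: ltW; near: y; exact: lt_nbhsl.
  rewrite !flat_le0E ?(ltW x0)// mulr0 addr0; exact: is_derive_cst.
- rewrite -x0 !flat_le0E// mulr0 addr0.
  have q : h^-1 *: (flat n (h *: 1 + 0) - flat n 0) @[h --> 0^'] --> (0 : R).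
    rewrite (flat_le0E n (lexx 0)).
    (* At the origin the difference quotient is exactly the next function of the family, which tends
       to 0 there. *)
    have E : (fun h : R => h^-1 *: (flat n (h *: 1 + 0) - 0)) = flat n.+1.
      apply/funext => h; rewrite /GRing.scale /= mulr1 addr0 subr0.
      have [h0|h0] := ltP 0 h; last by rewrite !flat_le0E// mulr0.
      by rewrite !flat_gt0E// mulrA exprS.
    by rewrite E; apply: cvg_within_filter; exact: flat_cvg0.
  split; first by apply/cvg_ex; exists 0; exact: q.
  exact: cvg_lim q.
Unshelve. all: by end_near. Qed.

Lemma continuous_flat n : continuous (flat n).
Proof.
by move=> x; apply: differentiable_continuous; apply/derivable1_diffP; case: (is_derive_flat n x).
Qed.

(** An algebra of functions stable under every [pd i]; smoothness, which quantifies over lists of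
    derivations, then follows by induction on the list. *)
Inductive bump_alg : (R3 R -> R) -> Prop :=
| bump_cst c : bump_alg (fun=> c)
| bump_flat n i a b : bump_alg (fun x => flat n (a * crd i x + b))
| bump_add f g : bump_alg f -> bump_alg g -> bump_alg (fun x => f x + g x)
| bump_mul f g : bump_alg f -> bump_alg g -> bump_alg (fun x => f x * g x).

Lemma continuous_crd i : continuous (@crd R i).
Proof.
case: i => -[|[|[|//]]] ip x; rewrite /crd /=.
- by apply: (@continuous_comp _ _ _ fst fst); exact: cvg_fst.
- by apply: (@continuous_comp _ _ _ fst snd); [exact: cvg_fst|exact: cvg_snd].
- exact: cvg_snd.
Qed.

Lemma crd_add i j (c : R) (x : R3 R) : crd i (c *: e3 j + x) = c * (i == j)%:R + crd i x.
Proof. by case: i => -[|[|[|//]]] ip; case: j => -[|[|[|//]]] jp. Qed.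

Lemma is_derive_crd i j (psi : R -> R) d x : is_derive (crd i x) 1 psi d ->
  is_derive x (e3 j) (fun y => psi (crd i y)) (d * (i == j)%:R).
Proof.
move=> [dpsi <-]; case: eqVneq => [<-|ij].
  have E : (fun c : R => c^-1 *: (psi (crd i (c *: e3 i + x)) - psi (crd i x))) =
     (fun c : R => c^-1 *: (psi (c *: 1 + crd i x) - psi (crd i x))).
    by apply/funext => c; rewrite crd_add eqxx.
  by rewrite mulr1; split; [rewrite /derivable /= E|rewrite /derive /= E].
have E : (fun c : R => c^-1 *: (psi (crd i (c *: e3 j + x)) - psi (crd i x))) = fun=> 0.
  by apply/funext => c; rewrite crd_add (negbTE ij) mulr0 add0r subrr scaler0.
rewrite mulr0; split; rewrite /derivable /derive /= E; first exact: is_cvg_cst.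
by rewrite lim_cst.
Qed.

Lemma bump_alg_derive f : bump_alg f ->
  [/\ continuous f, (forall i x, derivable f x (e3 i)) & forall i, bump_alg (pd i f)].
Proof.
elim=> [c|n i a b|{}f g _ [cf df bf] _ [cg dg bg]|{}f g bf0 [cf df bf] bg0 [cg dg bg]].
- split; first by move=> x; exact: cvg_cst.
    by move=> i x; exact: derivable_cst.
  move=> i; rewrite (_ : pd i _ = fun=> 0); first exact: bump_cst.
  by apply/funext => x; exact: derive_cst.
- have D j x : is_derive x (e3 j) (fun x => flat n (a * crd i x + b))
     (((- n%:R * flat n.+1 (a * crd i x + b) + flat n.+2 (a * crd i x + b)) * a) * (i == j)%:R).
    apply: (@is_derive_crd i j (fun t => flat n (a * t + b))).
    apply: (is_derive1_comp (is_derive_flat n _)).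
    have h : is_derive (crd i x) 1 (fun t : R => a * t + b) (a *: 1 + 0).
      by apply: is_deriveD; exact: is_deriveZ.
    by apply: is_derive_eq h _; rewrite addr0 /GRing.scale /= mulr1.
  split.
  + move=> x; apply: (@continuous_comp _ _ _ (fun x => a * crd i x + b) (flat n)).
      by apply: cvgD; [apply: cvgM; [exact: cvg_cst|exact: continuous_crd]|exact: cvg_cst].
    exact: continuous_flat.
  + by move=> j x; case: (D j x).
  + move=> j; rewrite (_ : pd j _ = fun x => ((- n%:R * flat n.+1 (a * crd i x + b) +
      flat n.+2 (a * crd i x + b)) * a) * (i == j)%:R); last first.
      by apply/funext => x; rewrite /pd; exact: (@derive_val _ _ _ _ _ _ _ (D j x)).
    apply: (@bump_mul _ (fun=> (i == j)%:R)); last exact: bump_cst.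
    apply: (@bump_mul _ (fun=> a)); last exact: bump_cst.
    apply: bump_add; last exact: bump_flat.
    by apply: (@bump_mul (fun=> - n%:R)); [exact: bump_cst|exact: bump_flat].
- split.
  + by move=> x; apply: cvgD; [exact: cf|exact: cg].
  + by move=> i x; exact: derivableD (df i x) (dg i x).
  + move=> i; rewrite (_ : pd i _ = fun x => pd i f x + pd i g x); first exact: bump_add.
    by apply/funext => x; exact: deriveD (df i x) (dg i x).
- split.
  + by move=> x; apply: cvgM; [exact: cf|exact: cg].
  + by move=> i x; exact: derivableM (df i x) (dg i x).
  + move=> i; rewrite (_ : pd i _ = fun x => f x * pd i g x + g x * pd i f x).
      by apply: bump_add; apply: bump_mul.
    by apply/funext => x; exact: deriveM (df i x) (dg i x).
Qed.

Lemma bump_alg_smooth f : bump_alg f -> smooth f.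
Proof.
move=> bf s; have : bump_alg (foldr pd f s).
  by elim: s => //= i s ih; have [_ _] := bump_alg_derive ih; apply.
by move=> /bump_alg_derive[].
Qed.

(** For [k > 0] this vanishes off the open box. Inside it each factor is [exp (- 1 / (k c))] with
    [c] the distance to a face, so the values tend to 1 as [k] grows: smooth approximations of the
    indicator. *)
Definition bump k (a b : R3 R) (x : R3 R) : R :=
  let g i := flat 0 (k * crd i x + - (k * crd i a)) * flat 0 (- k * crd i x + k * crd i b) in
  g (@Ordinal 3 0 isT) * g (@Ordinal 3 1 isT) * g (@Ordinal 3 2 isT).

Definition obox (a b : R3 R) : set (R3 R) := [set x | forall i, crd i a < crd i x < crd i b].
Definition cbox (a b : R3 R) : set (R3 R) := [set x | forall i, crd i a <= crd i x <= crd i b].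

Lemma bump_bump_alg k a b : bump_alg (bump k a b).
Proof. by do 2 apply: bump_mul; do ?apply: bump_mul; exact: bump_flat. Qed.

Lemma flat0_pos (x : R) : 0 < flat 0 x -> 0 < x.
Proof. by rewrite /flat; case: ifP => //; rewrite ltxx. Qed.

Lemma forall_I3 (P : 'I_3 -> Prop) : P (@Ordinal 3 0 isT) -> P (@Ordinal 3 1 isT) ->
  P (@Ordinal 3 2 isT) -> forall i, P i.
Proof. by move=> p0 p1 p2 [[|[|[|//]]] ip]; [move: p0|move: p1|move: p2]; congr P; exact/val_inj. Qed.

Lemma bump_neq0 k a b x : 0 < k -> bump k a b x != 0 -> obox a b x.
Proof.
move=> k0; rewrite /bump !mulf_eq0 !negb_or -!andbA.
have H (i : 'I_3) : flat 0 (k * crd i x + - (k * crd i a)) != 0 ->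
    flat 0 (- k * crd i x + k * crd i b) != 0 -> crd i a < crd i x < crd i b.
  move=> /(conj (flat_ge0 0 (k * crd i x + - (k * crd i a)))) h1.
  move=> /(conj (flat_ge0 0 (- k * crd i x + k * crd i b))) h2.
  have /flat0_pos : 0 < flat 0 (k * crd i x + - (k * crd i a)) by rewrite lt_def; case: h1 => -> ->.
  have /flat0_pos : 0 < flat 0 (- k * crd i x + k * crd i b) by rewrite lt_def; case: h2 => -> ->.
  by rewrite mulNr addrC subr_gt0 ltr_pM2l// subr_gt0 ltr_pM2l// => -> ->.
by move=> /and5P[h1 h2 h3 h4 /andP[h5 h6]]; apply: forall_I3; exact: H.
Qed.

Lemma compact_cbox a b : compact (cbox a b).
Proof.
have -> : cbox a b = (`[a.1.1, b.1.1]%classic `*` `[a.1.2, b.1.2]%classic) `*` `[a.2, b.2]%classic.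
  apply/seteqP; split => [x H|x [[x0 x1] x2]].
    split; [split|]; rewrite /= in_itv /=.
    + exact: (H (@Ordinal 3 0 isT)).
    + exact: (H (@Ordinal 3 1 isT)).
    + exact: (H (@Ordinal 3 2 isT)).
  by move: x0 x1 x2; rewrite /= !in_itv /= => x0 x1 x2; apply: forall_I3.
by apply: compact_setX; [apply: compact_setX|]; exact: segment_compact.
Qed.

Lemma closed_cbox a b : closed (cbox a b).
Proof. apply: compact_closed; [exact: norm_hausdorff|exact: compact_cbox]. Qed.

Lemma bump_Cc (Omega : set (R3 R)) k a b : 0 < k -> cbox a b `<=` Omega ->
  Cc_infty Omega (bump k a b).
Proof.
move=> k0 abO.
have sb : Defs.support (bump k a b) `<=` cbox a b.
  rewrite /Defs.support closureE => x; apply; split; first exact: closed_cbox.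
  by move=> y /= /(bump_neq0 k0) h i; have /andP[h1 h2] := h i; rewrite !ltW.
split.
- exact/bump_alg_smooth/bump_bump_alg.
- by apply: subclosed_compact sb; [exact: closed_closure|exact: compact_cbox].
- exact: subset_trans sb abO.
Qed.

Lemma flat0_cvg1 (c : R) : 0 < c -> flat 0 (n.+1%:R * c) @[n --> \oo] --> (1 : R).
Proof.
move=> c0.
have -> : (fun n => flat 0 (n.+1%:R * c)) = (fun n => expR (- (c^-1 * harmonic n))).
  apply/funext => n; rewrite flat_gt0E ?mulr_gt0 ?ltr0n// expr0 mul1r /harmonic.
  by rewrite invfM mulrC.
rewrite -expR0; apply: continuous_cvg; first exact: continuous_expR.
rewrite -oppr0; apply: cvgN; rewrite -[X in _ --> X](mulr0 c^-1).
by apply: cvgM; [exact: cvg_cst|exact: cvg_harmonic].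
Qed.

Lemma bump_cvg a b x : bump n.+1%:R a b x @[n --> \oo] --> (\1_(obox a b) x : R).
Proof.
have [ox|nx] := pselect (obox a b x); last first.
  have -> : (fun n => bump n.+1%:R a b x) = fun=> 0.
    apply/funext => n; apply/eqP; apply: contraT => /bump_neq0 h; exfalso.
    by apply: nx; apply: h; rewrite ltr0n.
  by rewrite indicE memNset//; exact: cvg_cst.
rewrite indicE mem_set// -[X in _ --> X]/(1 : R).
have H (i : 'I_3) : flat 0 (n.+1%:R * crd i x + - (n.+1%:R * crd i a)) *
    flat 0 (- n.+1%:R * crd i x + n.+1%:R * crd i b) @[n --> \oo] --> (1 : R).
  rewrite -[X in _ --> X](mulr1 1); have /andP[h1 h2] := ox i; apply: cvgM.
    under eq_fun do rewrite -mulrBr; by apply: flat0_cvg1; rewrite subr_gt0.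
  under eq_fun do rewrite mulNr addrC -mulrBr; by apply: flat0_cvg1; rewrite subr_gt0.
have h := cvgM (cvgM (H (@Ordinal 3 0 isT)) (H (@Ordinal 3 1 isT))) (H (@Ordinal 3 2 isT)).
by rewrite !mulr1 in h; exact: h.
Qed.

Lemma bump_le1 k a b x : `|bump k a b x| <= 1.
Proof.
have f1 t : `|flat 0 t| <= 1.
  rewrite ger0_norm ?flat_ge0//; have [t0|t0] := ltP 0 t; last by rewrite flat_le0E.
  by rewrite flat_gt0E// expr0 mul1r -expR0 ler_expR oppr_le0 invr_ge0 ltW.
have m1 u v : `|u| <= 1 -> `|v| <= 1 -> `|u * v : R| <= 1 by move=> u1 v1; rewrite normrM mulr_ile1.
exact: (m1 _ _ (m1 _ _ (m1 _ _ (f1 _) (f1 _)) (m1 _ _ (f1 _) (f1 _))) (m1 _ _ (f1 _) (f1 _))).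
Qed.

Lemma measurable_obox a b : measurable (obox a b : set (mR3 R)).
Proof.
have -> : obox a b = (`]a.1.1, b.1.1[%classic `*` `]a.1.2, b.1.2[%classic) `*` `]a.2, b.2[%classic.
  apply/seteqP; split => [x H|x [[x0 x1] x2]].
    split; [split|]; rewrite /= in_itv /=.
    + exact: (H (@Ordinal 3 0 isT)).
    + exact: (H (@Ordinal 3 1 isT)).
    + exact: (H (@Ordinal 3 2 isT)).
  by move: x0 x1 x2; rewrite /= !in_itv /= => x0 x1 x2; apply: forall_I3.
by apply: measurableX; [apply: measurableX|]; exact: measurable_itv.
Qed.

(* A lambda-system argument along the projection [pi]. *)
Lemma integral_preimage0 d d' (X : measurableType d) (T : measurableType d')
    (mu : {measure set X -> \bar R}) (h : X -> \bar R) (pi : X -> T) (G : set (set T)) :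
  @measurable _ T = <<s G >> -> setI_closed G -> measurable_fun setT pi ->
  mu.-integrable setT h -> (\int[mu]_x h x = 0)%E ->
  (forall A, G A -> \int[mu]_(x in pi @^-1` A) h x = 0)%E ->
  (forall A, measurable A -> \int[mu]_(x in pi @^-1` A) h x = 0)%E.
Proof.
move=> mG GI mpi ih hT hG A; rewrite {1}mG.
have mp B : measurable B -> measurable (pi @^-1` B).
  by move=> mB; rewrite -[X in measurable X]setTI; exact: mpi.
have iB B : measurable B -> mu.-integrable B h.
  by move=> mB; exact: (integrableS measurableT mB (@subsetT _ _) ih).
apply: (dynkin_induction (P := fun A => \int[mu]_(x in pi @^-1` A) h x = 0)%E) => //.
- move=> S mS S0; have : (\int[mu]_(x in pi @^-1` S `|` pi @^-1` (~` S)) h x = 0)%E.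
    by rewrite preimage_setC setUv.
  have mpC : measurable (pi @^-1` (~` S)) by apply: mp; exact: measurableC.
  rewrite integral_setU//; last 3 first.
  + exact: mp.
  + apply: measurable_funTS; exact: (measurable_int mu ih).
  + by apply/disj_setPS; rewrite preimage_setC setICr.
  + by rewrite S0 add0e.
- move=> F mF tF F0; rewrite preimage_bigcup integral_bigcup.
  + by apply: eseries0 => n _ _; exact: F0.
  + by apply/trivIsetP => i j _ _ ij; rewrite -preimage_setI (trivIsetP.1 tF _ _ I I ij) preimage_set0.
  + by move=> k; exact: mp.
  + by apply: iB; apply: bigcupT_measurable => k; exact: mp.
Qed.

Definition oitvs : set (set (measurableTypeR R)) := [set A | exists a b, A = `]a, b[%classic].

Lemma oitvsI : setI_closed oitvs.
Proof.
move=> _ _ [a [b ->]] [c [d ->]]; exists (Num.max a c), (Num.min b d).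
apply/seteqP; split => x /=; rewrite !in_itv /= gt_max lt_min.
  by case=> /andP[-> ->] /andP[-> ->].
by move=> /andP[/andP[-> ->] /andP[-> ->]].
Qed.

Lemma measurable_rectsI d1 d2 (T1 : measurableType d1) (T2 : measurableType d2) :
  setI_closed [set A `*` B | A in @measurable _ T1 & B in @measurable _ T2].
Proof.
move=> _ _ [A mA [B mB <-]] [A' mA' [B' mB' <-]]; rewrite -setXI.
by exists (A `&` A'); [exact: measurableI|exists (B `&` B') => //; exact: measurableI].
Qed.

(** Intervals are replaced by arbitrary measurable sets one projection at a time: the three
    coordinates, then the planar factor, then the whole space, each by [integral_preimage0]. A
    single pass would need the boxes as generators of the product sigma-algebra. *)
Lemma integral_oboxes0 (h : mR3 R -> \bar R) :
  leb3.-integrable setT h -> (\int[leb3]_x h x = 0)%E ->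
  (exists a b : R3 R, forall x, ~ obox a b x -> h x = 0%E) ->
  (forall a b, \int[leb3]_(x in obox a b) h x = 0)%E ->
  forall E : set (mR3 R), measurable E -> (\int[leb3]_(x in E) h x = 0)%E.
Proof.
move=> ih hT [a0 [b0 h0]] hb.
have mI : @measurable _ (measurableTypeR R) = <<s oitvs >> by exact: RGenOpens.measurableE.
have mx : measurable_fun setT (fun x : mR3 R => x.1.1) by exact: measurableT_comp measurable_fst measurable_fst.
have my : measurable_fun setT (fun x : mR3 R => x.1.2) by exact: measurableT_comp measurable_snd measurable_fst.
have mz : measurable_fun setT (fun x : mR3 R => x.2) by exact: measurable_snd.
have IR A : measurable A -> leb3.-integrable setT (h \_ A).
  by move=> mA; apply/(integrable_mkcond _ mA); exact: (integrableS measurableT mA (@subsetT _ _) ih).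
have RR (A B : set (mR3 R)) : (\int[leb3]_(x in A) (h \_ B) x = \int[leb3]_(x in A `&` B) h x)%E.
  by rewrite [RHS]integral_mkcondr.
pose S (A B C : set (measurableTypeR R)) : set (mR3 R) := (A `*` B) `*` C.
have mS A B C : measurable A -> measurable B -> measurable C -> measurable (S A B C).
  by move=> mA mB mC; apply: measurableX => //; exact: measurableX.
have S0 A B C : oitvs A -> oitvs B -> oitvs C -> (\int[leb3]_(x in S A B C) h x = 0)%E.
  move=> [a [b ->]] [c [d ->]] [e [f ->]].
  rewrite -(hb (a, c, e) (b, d, f)); congr (integral _ _ _).
  apply/seteqP; split => [x [[x0 x1] x2]|x H].
    by move: x0 x1 x2; rewrite /= !in_itv /= => x0 x1 x2; apply: forall_I3.
  split; [split|]; rewrite /= in_itv /=.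
  + exact: (H (@Ordinal 3 0 isT)).
  + exact: (H (@Ordinal 3 1 isT)).
  + exact: (H (@Ordinal 3 2 isT)).
have mO A : oitvs A -> measurable A by move=> [a [b ->]]; exact: measurable_itv.
(* the big interval in each direction stands for the whole line *)
have big (B : set (mR3 R)) : (\int[leb3]_(x in B) h x = \int[leb3]_(x in B `&` obox a0 b0) h x)%E.
  rewrite integral_mkcondr; apply: eq_integral => x _; rewrite patchE; case: ifPn => //.
  by rewrite notin_setE => /h0.
have S1 A B C : measurable A -> oitvs B -> oitvs C -> (\int[leb3]_(x in S A B C) h x = 0)%E.
  move=> mA oB oC; have mBC : measurable (S setT B C) by apply: mS => //; exact: mO.
  have -> : S A B C = ((fun x : mR3 R => x.1.1) @^-1` A) `&` S setT B C.
    by apply/seteqP; split => [x [[]]|x [? [[]]]].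
  rewrite -RR; move: A mA; apply: (integral_preimage0 mI oitvsI mx (IR _ mBC)).
    rewrite RR setTI big -[RHS](S0 `]a0.1.1, b0.1.1[%classic (`]a0.1.2, b0.1.2[%classic `&` B)
       (`]a0.2, b0.2[%classic `&` C)); last 3 first.
    - by exists a0.1.1, b0.1.1.
    - by apply: oitvsI => //; exists a0.1.2, b0.1.2.
    - by apply: oitvsI => //; exists a0.2, b0.2.
    rewrite [RHS]big; congr (integral _ _ _); apply/seteqP; split => x.
      move=> [[[_ xB] xC] ob]; split => //.
      have k0 := ob (@Ordinal 3 0 isT); have k1 := ob (@Ordinal 3 1 isT); have k2 := ob (@Ordinal 3 2 isT).
      by split; [split; [|split]|split] => //=; rewrite in_itv.
    by move=> [[[_ [_ xB]] [_ xC]] ob].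
  move=> A oA; rewrite RR -[RHS](S0 A B C oA oB oC); congr (integral _ _ _).
  by apply/seteqP; split => [x [? [[]]]|x [[]]].
have S2 A B C : measurable A -> measurable B -> oitvs C -> (\int[leb3]_(x in S A B C) h x = 0)%E.
  move=> mA mB oC; have mAC : measurable (S A setT C) by apply: mS => //; exact: mO.
  have -> : S A B C = ((fun x : mR3 R => x.1.2) @^-1` B) `&` S A setT C.
    by apply/seteqP; split => [x [[]]|x [? [[]]]].
  rewrite -RR; move: B mB; apply: (integral_preimage0 mI oitvsI my (IR _ mAC)).
    rewrite RR setTI big -[RHS](S1 A `]a0.1.2, b0.1.2[%classic
       (`]a0.2, b0.2[%classic `&` C)) => //; last 2 first.
    - by exists a0.1.2, b0.1.2.
    - by apply: oitvsI => //; exists a0.2, b0.2.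
    rewrite [RHS]big; congr (integral _ _ _); apply/seteqP; split => x.
      move=> [[[xA _] xC] ob]; split => //.
      have k0 := ob (@Ordinal 3 0 isT); have k1 := ob (@Ordinal 3 1 isT); have k2 := ob (@Ordinal 3 2 isT).
      by split; [split|split] => //=; rewrite in_itv.
    by move=> [[[xA _] [_ xC]] ob].
  move=> B oB; rewrite RR -[RHS](S1 A B C mA oB oC); congr (integral _ _ _).
  by apply/seteqP; split => [x [? [[]]]|x [[]]].
have S3 A B C : measurable A -> measurable B -> measurable C -> (\int[leb3]_(x in S A B C) h x = 0)%E.
  move=> mA mB mC; have mAB : measurable (S A B setT) by exact: mS.
  have -> : S A B C = ((fun x : mR3 R => x.2) @^-1` C) `&` S A B setT.
    by apply/seteqP; split => [x [[]]|x [? [[]]]].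
  rewrite -RR; move: C mC; apply: (integral_preimage0 mI oitvsI mz (IR _ mAB)).
    rewrite RR setTI big -[RHS](S2 A B `]a0.2, b0.2[%classic) => //; last first.
    - by exists a0.2, b0.2.
    rewrite [RHS]big; congr (integral _ _ _); apply/seteqP; split => x.
      move=> [[[xA xB] _] ob]; split => //.
      have k2 := ob (@Ordinal 3 2 isT).
      by split; [split|] => //=; rewrite in_itv.
    by move=> [[[xA xB] _] ob].
  move=> C oC; rewrite RR -[RHS](S2 A B C mA mB oC); congr (integral _ _ _).
  by apply/seteqP; split => [x [? [[]]]|x [[]]].
have S4 (P : set (measurableTypeR R * measurableTypeR R)) C : measurable P -> measurable C ->
    (\int[leb3]_(x in P `*` C) h x = 0)%E.
  move=> mP mC; have mTC : measurable ((setT : set (measurableTypeR R * measurableTypeR R)) `*` C).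
    exact: measurableX.
  have -> : P `*` C = ((fun x : mR3 R => x.1) @^-1` P) `&` (setT `*` C).
    by apply/seteqP; split => [x []|x [? []]].
  rewrite -RR; move: P mP.
  apply: (integral_preimage0 (measurable_prod_measurableType _ _) (@measurable_rectsI _ _ _ _) (@measurable_fst _ _ _ _) (IR _ mTC)).
    rewrite RR setTI -[RHS](S3 setT setT C) => //; congr (integral _ _ _).
    by rewrite /S setXTT.
  move=> _ [A mA [B mB <-]]; rewrite RR -[RHS](S3 A B C mA mB mC); congr (integral _ _ _).
  by apply/seteqP; split => [x [? []]|x []].
move=> E; apply: (integral_preimage0 (pi := id) (measurable_prod_measurableType _ _) (@measurable_rectsI _ _ _ _) _ ih hT) => //.
by move=> _ [P mP [C mC <-]]; exact: S4.
Qed.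

Lemma sqint_integrable d (T : measurableType d) (mu : {measure set T -> \bar R}) (D : set T) f :
  measurable D -> (mu D < +oo)%E -> sqint mu D f -> mu.-integrable D (EFin \o f).
Proof.
move=> mD Dfin sf.
have s1 : sqint mu D (fun=> 1 : R).
  by split => //; rewrite expr1n integral_cst// mul1e.
have := ip_integrable mD sf s1; apply: eq_integrable => // x _ /=.
by rewrite mulr1.
Qed.

Lemma oboxI a b c d : exists a' b', obox a b `&` obox c d = obox a' b' /\ cbox a' b' `<=` cbox a b.
Proof.
exists (Num.max a.1.1 c.1.1, Num.max a.1.2 c.1.2, Num.max a.2 c.2).
exists (Num.min b.1.1 d.1.1, Num.min b.1.2 d.1.2, Num.min b.2 d.2).
have crdE (op : R -> R -> R) (u v : R3 R) i :
    crd i (op u.1.1 v.1.1, op u.1.2 v.1.2, op u.2 v.2) = op (crd i u) (crd i v).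
  by case: i => -[|[|[|//]]] ip.
split.
  apply/seteqP; split => [x [h1 h2] i|x h].
    by rewrite (crdE Num.max) (crdE Num.min) gt_max lt_min; have /andP[-> ->] := h1 i; have /andP[-> ->] := h2 i.
  by split => i; have := h i; rewrite (crdE Num.max) (crdE Num.min) gt_max lt_min;
    move=> /andP[/andP[h1 h2] /andP[h3 h4]]; apply/andP.
move=> x h i; have := h i.
by rewrite (crdE Num.max) (crdE Num.min) ge_max le_min => /andP[/andP[-> _] /andP[-> _]].
Qed.

Lemma near_between (e y z p q : R) : p <= z <= q -> y - e < p < y -> y < q < y + e ->
  `|y - z| < e.
Proof.
by move=> /andP[? ?] /andP[? ?] /andP[? ?]; rewrite ltr_norml; apply/andP; split; lra.
Qed.

(** The fundamental lemma of the calculus of variations. Bumps converge boundedly to indicators of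
    boxes, so [g] has zero integral on every box inside [Omega] and vanishes almost everywhere on
    it; countably many rational boxes exhaust [Omega]. *)
Lemma test_function_unique (Omega : set (R3 R)) (L : R) (g : mR3 R -> R) : open Omega ->
  (forall x, Omega x -> forall i, `|crd i x| <= L) ->
  measurable_fun setT g -> sqint leb3 (Omega : set (mR3 R)) g ->
  (forall eta, Cc_infty Omega eta -> \int[leb3]_(x in Omega) (g x * eta x) = 0) ->
  {ae leb3, forall x, Omega x -> g x = 0}.
Proof.
move=> oO OL mg sg H.
have mO : measurable (Omega : set (mR3 R)) by exact: open_measurable3.
have Ofin : (leb3 (Omega : set (mR3 R)) < +oo)%E.
  apply: le_lt_trans (leb3_box L); apply: le_measure; rewrite ?inE//.
    by apply: measurableX; [apply: measurableX|]; exact: measurable_itv.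
  move=> x /OL h; split; [split|]; rewrite /boxR /= in_itv /= -ler_norml.
  + exact: (h (@Ordinal 3 0 isT)).
  + exact: (h (@Ordinal 3 1 isT)).
  + exact: (h (@Ordinal 3 2 isT)).
have ig : leb3.-integrable (Omega : set (mR3 R)) (EFin \o g) by exact: sqint_integrable.
have ob0 a b : cbox a b `<=` Omega -> (\int[leb3]_(x in obox a b) (g x)%:E = 0)%E.
  move=> abO.
  have obO : obox a b `<=` Omega.
    by move=> x h; apply: abO => i; have /andP[h1 h2] := h i; rewrite !ltW.
  have mb n : measurable_fun setT (bump n.+1%:R a b : mR3 R -> R).
    apply: continuous_measurable3; have [] := bump_alg_derive (bump_bump_alg n.+1%:R a b) => //.
  have mgb n : measurable_fun (Omega : set (mR3 R)) (fun x => (g x * bump n.+1%:R a b x)%:E).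
    by apply/measurable_EFinP; apply: measurable_funTS; exact: measurable_funM.
  have gb n x : (`|(g x * bump n.+1%:R a b x)%:E| <= `|(g x)%:E|)%E.
    by rewrite lee_fin normrM ler_piMr// bump_le1.
  have cv : (\int[leb3]_(x in Omega) (g x * bump n.+1%:R a b x)%:E @[n --> \oo] -->
      \int[leb3]_(x in Omega) (g x * \1_(obox a b) x)%:E)%E.
    apply: (@dominated_cvg _ _ _ leb3 _ mO _ _ (fun x => `|(g x)%:E|%E)) => //.
    - move=> x _; apply: cvg_EFin; first exact: nearW.
      by apply: cvgM; [exact: cvg_cst|exact: bump_cvg].
    - exact: integrable_abse.
  have z n : (\int[leb3]_(x in Omega) (g x * bump n.+1%:R a b x)%:E = 0)%E.
    rewrite -[LHS]fineK; first by congr EFin; apply: H; apply: bump_Cc => //; rewrite ltr0n.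
    by apply: integrable_fin_num => //; apply: (le_integrable mO _ _ ig) => //.
  have l0 : (\int[leb3]_(x in Omega) (g x * \1_(obox a b) x)%:E = 0)%E.
    apply: cvg_unique cv _ => //; rewrite (_ : (fun n => _) = fun=> 0%E); first exact: cvg_cst.
    by apply/funext => n; exact: z.
  rewrite -(setIidr obO) integral_mkcondr -[RHS]l0; apply: eq_integral => x _.
  by rewrite patchE indicE; case: ifP => _; rewrite ?mulr1 ?mulr0.
have aeb a b : cbox a b `<=` Omega -> leb3.-negligible ([set x | obox a b x /\ g x != 0] : set (mR3 R)).
  move=> abO.
  have obO : obox a b `<=` Omega.
    by move=> x h; apply: abO => i; have /andP[h1 h2] := h i; rewrite !ltW.
  have mob := measurable_obox a b.
  pose h := (EFin \o g) \_ (obox a b).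
  have ih : leb3.-integrable setT h.
    by apply/(integrable_mkcond _ mob); exact: (integrableS mO mob obO ig).
  have h0 : forall E : set (mR3 R), measurable E -> (\int[leb3]_(x in E) h x = 0)%E.
    apply: integral_oboxes0 => //.
    - by rewrite -integral_mkcond ob0.
    - by exists a, b => x nx; rewrite /h patchE memNset.
    - move=> c d; rewrite -integral_mkcondr setIC.
      have [a' [b' [-> s]]] := oboxI a b c d; apply: ob0; exact: subset_trans abO.
  have : ae_eq leb3 setT h (cst 0%E).
    apply: integral_ae_eq => //.
    by move=> E _ mE; rewrite h0// integral0.
  apply: negligibleS => x /= [ox gx]; apply/not_implyP; split => //.
  by rewrite /h patchE mem_set//= => -[]; apply/eqP.
pose tobox (q : rat * rat * rat * (rat * rat * rat)) : R3 R * R3 R :=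
  ((ratr q.1.1.1, ratr q.1.1.2, ratr q.1.2), (ratr q.2.1.1, ratr q.2.1.2, ratr q.2.2)).
pose F (n : nat) : set (mR3 R) := if unpickle n is Some q then
  (if `[< cbox (tobox q).1 (tobox q).2 `<=` Omega >] then
     [set x | obox (tobox q).1 (tobox q).2 x /\ g x != 0] else set0) else set0.
have nF n : leb3.-negligible (F n).
  rewrite /F; case: unpickle => [q|]; last exact: negligible_set0.
  by case: asboolP => [/aeb//|_]; exact: negligible_set0.
apply: negligibleS (negligible_bigcup nF) => x /= /not_implyP[Ox gx].
have /nbhs_ballP[e /= e0 eO] : nbhs x Omega by exact: open_nbhs_nbhs.
have lo (y : R) : exists q : rat, y - e < ratr q < y.
  have [q] := @rat_in_itvoo R (y - e) y ltac:(lra); by rewrite in_itv /=; exists q.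
have hi (y : R) : exists q : rat, y < ratr q < y + e.
  have [q] := @rat_in_itvoo R y (y + e) ltac:(lra); by rewrite in_itv /=; exists q.
have [a0 ha0] := lo x.1.1; have [a1 ha1] := lo x.1.2; have [a2 ha2] := lo x.2.
have [b0 hb0] := hi x.1.1; have [b1 hb1] := hi x.1.2; have [b2 hb2] := hi x.2.
have [n nE] : exists n, unpickle n = Some (a0, a1, a2, (b0, b1, b2)).
  by eexists; exact: pickleK.
exists n => //; rewrite /F nE.
case: asboolP => [_|]; last first.
  case=> y h; apply: eO.
  have k0 := h (@Ordinal 3 0 isT); have k1 := h (@Ordinal 3 1 isT); have k2 := h (@Ordinal 3 2 isT).
  rewrite /crd /= in k0 k1 k2.
  by split; [split|]; rewrite /ball /=;
    [exact: near_between k0 ha0 hb0|exact: near_between k1 ha1 hb1|exact: near_between k2 ha2 hb2].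
split; last exact/eqP.
by apply: forall_I3; rewrite /crd /=; [move: ha0 hb0|move: ha1 hb1|move: ha2 hb2];
  move=> /andP[_ ->] /andP[-> _].
Qed.

End bump.

Local Open Scope quotient_scope.

(** * The spaces H and V *)

Section inner_product.
Context {R : realType} {E : lmodType R}.
Variables (P : set E) (B : E -> E -> R).

(** A semi-inner product relative to a subset: integrals such as [dot] are bilinear only on
    square-integrable fields, and [gdot] only on fields with a weak gradient. Definiteness is
    recorded separately in [hp_eq0]. *)
Record inner_on : Prop := InnerOn {
  in_0 : P 0;
  in_D : forall u v, P u -> P v -> P (u + v);
  in_Z : forall a u, P u -> P (a *: u);
  in_C : forall u v, P u -> P v -> B u v = B v u;
  in_Dl : forall u v w, P u -> P v -> P w -> B (u + v) w = B u w + B v w;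
  in_Zl : forall a u v, P u -> P v -> B (a *: u) v = a * B u v;
  in_ge0 : forall u, P u -> 0 <= B u u }.

Definition nrm u := Num.sqrt (B u u).

Hypothesis ip : inner_on.

Lemma in_N u : P u -> P (- u).
Proof. by move=> /(in_Z ip (-1)); rewrite scaleN1r. Qed.

Lemma in_B u v : P u -> P v -> P (u - v).
Proof. by move=> Pu /in_N; exact: in_D. Qed.

Lemma in_Dr u v w : P u -> P v -> P w -> B w (u + v) = B w u + B w v.
Proof.
move=> Pu Pv Pw; have Puv := in_D ip Pu Pv.
by rewrite (in_C ip Pw Puv) (in_Dl ip)// (in_C ip Pu Pw) (in_C ip Pv Pw).
Qed.

Lemma in_Zr a u v : P u -> P v -> B u (a *: v) = a * B u v.
Proof.
move=> Pu Pv; have Pav := in_Z ip a Pv.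
by rewrite (in_C ip Pu Pav) (in_Zl ip)// (in_C ip Pu Pv).
Qed.

Lemma in_Nl u v : P u -> P v -> B (- u) v = - B u v.
Proof. by move=> Pu Pv; rewrite -scaleN1r (in_Zl ip)// mulN1r. Qed.

Lemma in_Nr u v : P u -> P v -> B u (- v) = - B u v.
Proof. by move=> Pu Pv; rewrite -scaleN1r in_Zr// mulN1r. Qed.

Lemma in_Bl u v w : P u -> P v -> P w -> B (u - v) w = B u w - B v w.
Proof. by move=> Pu Pv Pw; rewrite (in_Dl ip)// ?in_Nl//; exact: in_N. Qed.

Lemma nrm_ge0 u : 0 <= nrm u. Proof. exact: sqrtr_ge0. Qed.

Lemma nrm_sqr u : P u -> nrm u ^+ 2 = B u u.
Proof. by move=> Pu; rewrite sqr_sqrtr// in_ge0. Qed.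

Lemma in_sqrD u v : P u -> P v -> B (u + v) (u + v) = B u u + 2 * B u v + B v v.
Proof.
move=> Pu Pv; have Puv := in_D ip Pu Pv.
rewrite (in_Dl ip)// !in_Dr// (in_C ip Pv Pu); ring.
Qed.

Lemma in_cs u v : P u -> P v -> `|B u v| <= nrm u * nrm v.
Proof.
move=> Pu Pv.
rewrite -(ler_pXn2r (ltn0Sn 1)) ?nnegrE ?mulr_ge0 ?nrm_ge0//.
rewrite exprMn !nrm_sqr// real_normK ?num_real//.
have H a : 0 <= B u u + 2 * a * B u v + a ^+ 2 * B v v.
  have Pav := in_Z ip a Pv; have := in_ge0 ip (in_D ip Pu Pav).
  rewrite in_sqrD// (in_Zl ip)// !in_Zr//; congr (_ <= _); ring.
have [v0|v0] := eqVneq (B v v) 0.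
  have [->|uv] := eqVneq (B u v) 0; first by rewrite v0 mulr0 expr0n.
  have := H (- (B u u + 1) / (2 * B u v)); rewrite v0 mulr0 addr0.
  have -> : 2 * (- (B u u + 1) / (2 * B u v)) * B u v = - (B u u + 1) by field.
  by rewrite opprD addrA subrr add0r oppr_ge0 ler10.
have vp : 0 < B v v by rewrite lt_def v0 in_ge0.
have := H (- B u v / B v v).
have -> : B u u + 2 * (- B u v / B v v) * B u v + (- B u v / B v v) ^+ 2 * B v v
   = (B u u * B v v - B u v ^+ 2) / B v v by field.
by rewrite pmulr_lge0 ?invr_gt0// subr_ge0.
Qed.

Lemma nrmD u v : P u -> P v -> nrm (u + v) <= nrm u + nrm v.
Proof.
move=> Pu Pv; have u0 := nrm_ge0 u; have v0 := nrm_ge0 v.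
rewrite -(ler_pXn2r (ltn0Sn 1)) ?nnegrE ?addr_ge0 ?nrm_ge0//.
rewrite nrm_sqr; last exact: in_D.
rewrite in_sqrD// sqrrD -!nrm_sqr//.
have := le_trans (ler_norm _) (in_cs Pu Pv).
set x := nrm u; set y := nrm v; set z := B u v => zxy.
by rewrite mulr2n; lra.
Qed.

Lemma nrmZ a u : P u -> nrm (a *: u) = `|a| * nrm u.
Proof.
move=> Pu; rewrite /nrm (in_Zl ip)//; last exact: in_Z.
by rewrite in_Zr// mulrA -expr2 sqrtrM ?sqr_ge0// sqrtr_sqr.
Qed.

Lemma nrmN u : P u -> nrm (- u) = nrm u.
Proof. by move=> Pu; rewrite -scaleN1r nrmZ// normrN normr1 mul1r. Qed.

Lemma nrmBC u v : P u -> P v -> nrm (u - v) = nrm (v - u).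
Proof. by move=> Pu Pv; rewrite -(opprB u v) nrmN//; exact: in_B. Qed.

Lemma nrm0 : nrm 0 = 0.
Proof. by rewrite -(scale0r 0) nrmZ ?normr0 ?mul0r//; exact: in_0. Qed.

Lemma nrm_dist u v : P u -> P v -> `|nrm u - nrm v| <= nrm (u - v).
Proof.
move=> Pu Pv; rewrite ler_norml; apply/andP; split.
  have := nrmD (in_B Pv Pu) Pu; rewrite subrK nrmBC//; lra.
by have := nrmD (in_B Pu Pv) Pv; rewrite subrK; lra.
Qed.

Lemma nrm_triB u v w : P u -> P v -> P w -> nrm (u - w) <= nrm (u - v) + nrm (v - w).
Proof.
move=> Pu Pv Pw; rewrite (_ : u - w = (u - v) + (v - w)); last by rewrite addrA subrK.
by apply: nrmD; exact: in_B.
Qed.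

Lemma nrm_cvg (u_ : nat -> E) u : (forall n, P (u_ n)) -> P u ->
  nrm (u_ n - u) @[n --> \oo] --> 0 -> nrm (u_ n) @[n --> \oo] --> nrm u.
Proof.
move=> Pu_ Pu /cvgrPdist_le h; apply/cvgrPdist_le => e /h; apply: filterS => n.
rewrite sub0r normrN ger0_norm ?nrm_ge0// distrC; apply: le_trans.
exact: nrm_dist.
Qed.

Lemma in_cvg (u_ : nat -> E) u w : (forall n, P (u_ n)) -> P u -> P w ->
  nrm (u_ n - u) @[n --> \oo] --> 0 -> B (u_ n) w @[n --> \oo] --> B u w.
Proof.
move=> Pu_ Pu Pw h; apply/subr_cvg0.
have {}h : nrm (u_ n - u) * nrm w @[n --> \oo] --> 0.
  by rewrite -(mul0r (nrm w)); apply: cvgM => //; exact: cvg_cst.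
move/cvgrPdist_le: h => h; apply/cvgrPdist_le => e /h; apply: filterS => n.
rewrite !sub0r !normrN; apply: le_trans; rewrite -in_Bl//.
apply: le_trans (in_cs _ _) (ler_norm _) => //; exact: in_B.
Qed.

End inner_product.

Lemma cvg_sum0 {R : realType} (I : Type) (r : seq I) (a : I -> nat -> R) :
  (forall i, a i n @[n --> \oo] --> 0) ->
  \sum_(i <- r) a i n @[n --> \oo] --> 0.
Proof.
move=> h; elim: r => [|i r IH]; first by under eq_fun do rewrite big_nil; exact: cvg_cst.
rewrite (_ : (fun n => _) = fun n => a i n + \sum_(j <- r) a j n); last by apply/funext => n; rewrite big_cons.
by have := cvgD (h i) IH; rewrite addr0; exact.
Qed.

Section L0_facts.
Context {R : realType} (Omega : set (R3 R)).
Implicit Types u v : L0 Omega.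

Lemma ae3S (P Q : mR3 R -> Prop) : (forall x, P x -> Q x) ->
  {ae @leb3 R, forall x, P x} -> {ae @leb3 R, forall x, Q x}.
Proof. exact: (@filterS _ _ (ae_filter_ringOfSetsType leb3)). Qed.

Lemma ae3S2 (P Q S : mR3 R -> Prop) : (forall x, P x -> Q x -> S x) ->
  {ae @leb3 R, forall x, P x} -> {ae @leb3 R, forall x, Q x} ->
  {ae @leb3 R, forall x, S x}.
Proof. exact: (@filterS2 _ _ (ae_filter_ringOfSetsType leb3)). Qed.

Notation aeq f g := ({ae @leb3 R, forall x : mR3 R, Omega x -> f x = g x}).

Lemma aeq_trans (f g h : mR3 R -> R) : aeq f g -> aeq g h -> aeq f h.
Proof. by move=> fg gh; apply: ae3S2 fg gh => x {}fg {}gh Ox; rewrite fg// gh. Qed.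

Lemma aeq_sym (f g : mR3 R -> R) : aeq f g -> aeq g f.
Proof. by apply: ae3S => x h Ox; rewrite h. Qed.

Lemma measurable_rep u : measurable_fun setT (rep u).
Proof. exact: measurable_funPT. Qed.

Lemma rep_pi (f : {mfun mR3 R >-> R}) : aeq (rep (\pi_(L0 Omega) f)) f.
Proof.
have /asboolP := L0_repr_pi Omega f; apply: ae3S => x h Ox.
by have := h Ox; rewrite -[LHS]/(rep (\pi_(L0 Omega) f) x - f x) => /subr0_eq.
Qed.

Lemma rep_eq u v : aeq (rep u) (rep v) -> u = v.
Proof.
move=> uv; rewrite -[u]reprK -[v]reprK; apply: L0_piE; apply/asboolP.
by apply: ae3S uv => x h Ox; rewrite -[LHS]/(rep u x - rep v x) h// subrr.
Qed.

Lemma repD u v : aeq (rep (u + v)) (fun x => rep u x + rep v x).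
Proof.
have := rep_pi (repr u + repr v); rewrite L0_piD !reprK; exact.
Qed.

Lemma repZ a u : aeq (rep (a *: u)) (fun x => a * rep u x).
Proof. have := rep_pi (a *: repr u); rewrite -L0_scale_pi reprK; exact. Qed.

Lemma rep0 : aeq (rep (0 : L0 Omega)) (fun=> 0).
Proof. by have /asboolP := repr0_null Omega. Qed.

(** Made total with the default class [0] off measurable functions, so that classes of explicit
    functions can be written without a measurability proof inside the term. *)
Definition cls (f : mR3 R -> R) : L0 Omega :=
  if pselect (measurable_fun setT f) is left mf then
    \pi_(L0 Omega) (HB.pack f (isMeasurableFun.Build _ _ _ _ f mf) : {mfun mR3 R >-> R})
  else 0.

Lemma rep_cls f : measurable_fun setT f -> aeq (rep (cls f)) f.
Proof.
rewrite /cls; case: pselect => // mf _.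
exact: (rep_pi (HB.pack f (isMeasurableFun.Build _ _ _ _ f mf) : {mfun mR3 R >-> R})).
Qed.

Hypothesis mO : measurable (Omega : set (mR3 R)).
Notation O := (Omega : set (mR3 R)).

Definition sq u := sqint leb3 O (rep u).

Lemma sq_aeq (f g : mR3 R -> R) : measurable_fun O f -> aeq f g -> sqint leb3 O g -> sqint leb3 O f.
Proof.
move=> mf fg [mg ig]; split => //; rewrite (_ : integral _ _ _ = \int[leb3]_(x in O) (g x ^+ 2)%:E)%E//.
apply: ge0_ae_eq_integral => //.
- by apply/measurable_EFinP; exact: measurable_funX.
- by apply/measurable_EFinP; exact: measurable_funX.
- by move=> x _; rewrite lee_fin sqr_ge0.
- by move=> x _; rewrite lee_fin sqr_ge0.
- by apply: ae3S fg => x h Ox; rewrite h.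
Qed.

Lemma mrepO u : measurable_fun O (rep u).
Proof. by apply: measurable_funTS; exact: measurable_rep. Qed.

Lemma sqD u v : sq u -> sq v -> sq (u + v).
Proof. by move=> su sv; apply: sq_aeq (mrepO _) (repD _ _) _; exact: sqintD. Qed.

Lemma sqZ a u : sq u -> sq (a *: u).
Proof. by move=> su; apply: sq_aeq (mrepO _) (repZ _ _) _; exact: sqintZ. Qed.

Lemma sq0 : sq 0.
Proof.
apply: sq_aeq (mrepO _) rep0 _; split => //.
by rewrite integral0_eq// => x _; rewrite expr0n.
Qed.

Definition ipo u v : R := ip leb3 O (rep u) (rep v).

Lemma ipoDl u v w : sq u -> sq v -> sq w -> ipo (u + v) w = ipo u w + ipo v w.
Proof.
move=> su sv sw; rewrite /ipo -ipDl//; apply: ip_ae => //; first exact: sqD.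
- exact: sqintD.
- exact: repD.
- exact: nearW.
Qed.

Lemma ipoZl a u w : sq u -> sq w -> ipo (a *: u) w = a * ipo u w.
Proof.
move=> su sw; rewrite /ipo -ipZl//; apply: ip_ae => //; first exact: sqZ.
- exact: sqintZ.
- exact: repZ.
- exact: nearW.
Qed.

Section families.
Context {I : finType}.
Implicit Types U W : I -> L0 Omega.

Lemma L2E U : L2 U <-> forall i, sq (U i).
Proof. by split=> h i; [split; [exact: mrepO|exact: h]|case: (h i)]. Qed.

Lemma dotE U W : dot U W = \sum_i ipo (U i) (W i). Proof. by []. Qed.

Lemma inner_on_dot : inner_on (@L2 R Omega I) (@dot R Omega I).
Proof.
split.
- by apply/L2E => i; exact: sq0.
- by move=> u v /L2E su /L2E sv; apply/L2E => i; exact: sqD.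
- by move=> a u /L2E su; apply/L2E => i; exact: sqZ.
- by move=> u v _ _; apply: eq_bigr => i _; exact: ipC.
- move=> u v w /L2E su /L2E sv /L2E sw; rewrite !dotE -big_split; apply: eq_bigr => i _.
  exact: ipoDl.
- move=> a u v /L2E su /L2E sv; rewrite !dotE mulr_sumr; apply: eq_bigr => i _.
  exact: ipoZl.
- by move=> u _; apply: sumr_ge0 => i _; exact: ip_ge0.
Qed.

Lemma ipo_le_norm U i : L2 U -> ipo (U i) (U i) <= norm U ^+ 2.
Proof.
move=> /L2E sU; rewrite sqr_sqrtr; last by apply: sumr_ge0 => j _; exact: ip_ge0.
by rewrite dotE (bigD1 i)//= lerDl sumr_ge0// => j _; exact: ip_ge0.
Qed.

Lemma norm0_eq U : L2 U -> norm U = 0 -> U = 0.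
Proof.
move=> LU n0; apply/funext => i; have := ipo_le_norm i LU; rewrite n0 expr0n /= => h.
have /L2E sU := LU.
have e0 : ipo (U i) (U i) = 0 by apply/eqP; rewrite eq_le h ip_ge0.
apply: rep_eq; apply: aeq_trans (aeq_sym rep0).
exact: (ip0_ae mO (sU i) e0).
Qed.

Lemma norm_complete (U_ : nat -> I -> L0 Omega) : (forall n, L2 (U_ n)) ->
  (forall e, 0 < e -> exists N, forall n m, (N <= n)%N -> (N <= m)%N ->
    norm (U_ n - U_ m) <= e) ->
  exists U, L2 U /\ norm (U_ n - U) @[n --> \oo] --> 0.
Proof.
move=> LU CU.
have sU n i : sq (U_ n i) by have /L2E := LU n.
have subE u v : aeq (rep (u - v)) (fun x => rep u x - rep v x).
  have := aeq_trans (repD u (- v)) _; apply.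
  have := repZ (-1) v; rewrite scaleN1r; apply: ae3S => x h Ox.
  by rewrite h// mulN1r.
have sB u v : sq u -> sq v -> sq (u - v).
  by move=> su sv; apply: sqD => //; rewrite -scaleN1r; exact: sqZ.
have ipB u v : sq u -> sq v -> ipo (u - v) (u - v) = ip leb3 O (fun x => rep u x - rep v x) (fun x => rep u x - rep v x).
  by move=> su sv; apply: ip_ae => //; [exact: sB|exact: sqintB|exact: sB|exact: sqintB].
have /choice[f fP] : forall i, exists f, sqint leb3 O f /\
    ip leb3 O (fun x => rep (U_ n i) x - f x) (fun x => rep (U_ n i) x - f x) @[n --> \oo] --> 0.
  move=> i; apply: sqint_complete => //; first by move=> n; exact: sU.
  move=> e e0; have e1 : 0 < Num.min 1 e by rewrite lt_min ltr01.
  have [N NP] := CU _ e1; exists N => n m Nn Nm.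
  have LB : L2 (U_ n - U_ m) by apply: (in_B inner_on_dot).
  rewrite -ipB//; apply: le_trans (ipo_le_norm i LB) _.
  apply: le_trans (_ : Num.min 1 e ^+ 2 <= _).
    by rewrite lerXn2r ?nnegrE ?sqrtr_ge0 ?(ltW e1)// NP.
  by rewrite expr2; have [] := ltP 1 e; nra.
have mfT i : measurable_fun setT ((f i) \_ O).
  by apply: (measurable_restrictT (f i) mO).1; case: (fP i) => -[].
pose U i := cls (f i \_ O).
have UE i : aeq (rep (U i)) (f i).
  by apply: ae3S (rep_cls (mfT i)) => x h Ox; rewrite h// patchE mem_set.
have sUi i : sq (U i) by apply: sq_aeq (mrepO _) (UE i) _; case: (fP i).
have LUU : L2 U by apply/L2E.
exists U; split => //; apply: sqr_cvg0.
have E n : norm (U_ n - U) ^+ 2 = \sum_i ip leb3 O (fun x => rep (U_ n i) x - f i x) (fun x => rep (U_ n i) x - f i x).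
  have LB : L2 (U_ n - U) by apply: (in_B inner_on_dot).
  rewrite (nrm_sqr inner_on_dot LB) dotE; apply: eq_bigr => i _.
  have h : aeq (rep ((U_ n - U) i)) (fun x => rep (U_ n i) x - f i x).
    apply: aeq_trans (subE _ _) _; apply: ae3S (UE i) => x h Ox; by rewrite h.
  apply: ip_ae => //; [exact: sB| |exact: sB|].
  - by apply: sqintB => //; [exact: sU|case: (fP i)].
  - by apply: sqintB => //; [exact: sU|case: (fP i)].
under eq_fun do rewrite E.
by apply: cvg_sum0 => i; case: (fP i).
Qed.

End families.
End L0_facts.

Section V_facts.
Context {R : realType} (Omega : set (R3 R)) (L : R).
Hypotheses (Oo : open Omega) (OL : forall x, Omega x -> forall i, `|crd i x| <= L)
  (Lp : 0 < L).
Notation O := (Omega : set (mR3 R)).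
Notation V := (space_V Omega).
Implicit Types (u v w : vec Omega) (f g eta : R3 R -> R).

Let mO : measurable O. Proof. exact: open_measurable3. Qed.
Notation ip3 := (inner_on_dot mO (I := 'I_3)).
Notation ip9 := (inner_on_dot mO (I := ('I_3 * 'I_3)%type)).

Lemma sqint_sub (f : mR3 R -> R) : sqint leb3 setT f -> sqint leb3 O f.
Proof.
move=> [mf f2]; split; first exact: measurable_funTS.
apply: le_lt_trans f2; apply: ge0_subset_integral => //.
- by apply/measurable_EFinP; exact: measurable_funX.
- by move=> x _; rewrite lee_fin sqr_ge0.
Qed.

Lemma ip_off (f g : mR3 R -> R) : (forall x, ~ Omega x -> g x = 0) ->
  ip leb3 O f g = ip leb3 setT f g.
Proof.
move=> g0; congr fine; rewrite integral_mkcond.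
apply: eq_integral => x _; rewrite patchE; case: ifPn => //.
by rewrite notin_setE => /g0 ->; rewrite mulr0.
Qed.

Lemma sq_cls (g : mR3 R -> R) : sqint leb3 O g -> measurable_fun setT g -> sq (cls Omega g).
Proof. by move=> sg mg; apply: (@sq_aeq _ _ mO _ g) => //; [exact: mrepO|exact: rep_cls]. Qed.

Lemma ipo_cls (a : L0 Omega) (g : mR3 R -> R) : sq a -> sqint leb3 O g -> measurable_fun setT g ->
  ipo a (cls Omega g) = ip leb3 O (rep a) g.
Proof.
move=> sa sg mg; apply: ip_ae => //; first exact: sq_cls.
- exact: aeW.
- exact: (rep_cls Omega mg).
Qed.

Lemma ipo_cls2 (f g : mR3 R -> R) : sqint leb3 setT f -> sqint leb3 setT g ->
  (forall x, ~ Omega x -> f x = 0) -> ipo (cls Omega f) (cls Omega g) = ip leb3 setT f g.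
Proof.
move=> sf sg f0; have [mf mg] := (sf.1, sg.1).
rewrite [RHS]ipC -ip_off// ipC; apply: ip_ae => //; try exact: sqint_sub.
- by apply: sq_cls => //; exact: sqint_sub.
- by apply: sq_cls => //; exact: sqint_sub.
- exact: (rep_cls Omega mf).
- exact: (rep_cls Omega mg).
Qed.

Lemma C1c_measurable f : C1c Omega f -> measurable_fun setT (f : mR3 R -> R) /\
  forall i, measurable_fun setT (pd i f : mR3 R -> R).
Proof.
by case=> cf _ cpd _ _; split=> [|i]; apply: continuous_measurable3 => // x; exact: cpd.
Qed.

Lemma C1c_sq f : C1c Omega f -> sq (cls Omega f) /\ forall i, sq (cls Omega (pd i f)).
Proof.
move=> cf; have [sf spf] := C1c_sqint OL cf; have [mf mpf] := C1c_measurable cf.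
by split=> [|i]; apply: sq_cls => //; exact: sqint_sub.
Qed.

Lemma ipo0l (a : L0 Omega) : sq a -> ipo 0 a = 0.
Proof.
move=> sa; have s0 := sq0 mO.
by rewrite -[X in ipo X _](scale0r 0) ipoZl// mul0r.
Qed.

Lemma weak_gradE u (G : 'I_3 * 'I_3 -> L0 Omega) : L2 u -> L2 G ->
  weak_grad u G <-> forall i j eta, Cc_infty Omega eta ->
    ipo (u j) (cls Omega (pd i eta)) = - ipo (G (i, j)) (cls Omega eta).
Proof.
move=> /L2E su /L2E sG.
have E i j eta : Cc_infty Omega eta ->
   ipo (u j) (cls Omega (pd i eta)) = ip leb3 O (rep (u j)) (pd i eta) /\
   ipo (G (i, j)) (cls Omega eta) = ip leb3 O (rep (G (i, j))) eta.
  move=> /Cc_infty_C1c ce; have [se spe] := C1c_sqint OL ce; have [me mpe] := C1c_measurable ce.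
  by split; apply: ipo_cls => //; exact: sqint_sub.
split=> h i j eta ce; have [e1 e2] := E i j eta ce.
  by rewrite e1 e2; exact: h.
by have := h i j eta ce; rewrite e1 e2.
Qed.

(** The difference of two weak gradients integrates to 0 against every test function. Uniqueness is
    what makes [grad], a chosen witness, linear and computable. *)
Lemma weak_grad_uniq u G G' : L2 u -> L2 G -> L2 G' -> weak_grad u G -> weak_grad u G' -> G = G'.
Proof.
move=> Lu LG LG' /(weak_gradE Lu LG) h /(weak_gradE Lu LG') h'.
apply/funext => -[i j]; apply/eqP; rewrite -subr_eq0; apply/eqP.
move/L2E: LG => sG; move/L2E: LG' => sG'.
have sB : sq (G (i, j) - G' (i, j)).
  by apply: sqD => //; rewrite -scaleN1r; exact: sqZ.
apply: rep_eq; apply: aeq_trans (aeq_sym (rep0 Omega)).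
have mr := measurable_rep (G (i, j) - G' (i, j)).
refine (test_function_unique Oo OL mr sB _).
move=> eta ce; have [seta _] := C1c_sq (Cc_infty_C1c ce).
have [[se _] [me _]] := (C1c_sqint OL (Cc_infty_C1c ce), C1c_measurable (Cc_infty_C1c ce)).
rewrite -[LHS](ipo_cls sB (sqint_sub se) me) ipoDl//; last by rewrite -scaleN1r; exact: sqZ.
rewrite -scaleN1r ipoZl// mulN1r; apply/eqP; rewrite subr_eq0; apply/eqP.
by apply: oppr_inj; rewrite -h// -h'.
Qed.

Lemma gradP u : space_H1 u -> L2 u /\ L2 (grad u) /\ weak_grad u (grad u).
Proof.
move=> [Lu [G LG wG]]; split => //.
by case: (xgetPex 0 (ex_intro (fun G => [set G | L2 G /\ weak_grad u G] G) G (conj LG wG))).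
Qed.

Lemma grad_uniq u G : L2 u -> L2 G -> weak_grad u G -> space_H1 u /\ grad u = G.
Proof.
move=> Lu LG wG; have Hu : space_H1 u by split => //; exists G.
by split => //; have [_ [Lg wg]] := gradP Hu; exact: (weak_grad_uniq Lu).
Qed.

Lemma grad_D u v : space_H1 u -> space_H1 v ->
  space_H1 (u + v) /\ grad (u + v) = grad u + grad v.
Proof.
move=> /gradP[Lu [Lgu wu]] /gradP[Lv [Lgv wv]].
have Luv := in_D ip3 Lu Lv; have Lg := in_D ip9 Lgu Lgv.
apply: grad_uniq => //; apply/(weak_gradE Luv Lg) => i j eta ce.
move/(weak_gradE Lu Lgu): wu => wu; move/(weak_gradE Lv Lgv): wv => wv.
have [se spe] := C1c_sq (Cc_infty_C1c ce).
move/L2E: Lu => su; move/L2E: Lv => sv.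
move/L2E: Lgu => sgu; move/L2E: Lgv => sgv.
transitivity (ipo (u j) (cls Omega (pd i eta)) + ipo (v j) (cls Omega (pd i eta))).
  exact: (ipoDl mO (su j) (sv j) (spe i)).
rewrite wu// wv// -opprD; congr (- _); apply: esym.
exact: (ipoDl mO (sgu (i, j)) (sgv (i, j)) se).
Qed.

Lemma grad_Z a u : space_H1 u -> space_H1 (a *: u) /\ grad (a *: u) = a *: grad u.
Proof.
move=> /gradP[Lu [Lgu wu]].
have Lau := in_Z ip3 a Lu; have Lg := in_Z ip9 a Lgu.
apply: grad_uniq => //; apply/(weak_gradE Lau Lg) => i j eta ce.
move/(weak_gradE Lu Lgu): wu => wu.
have [se spe] := C1c_sq (Cc_infty_C1c ce).
move/L2E: Lu => su; move/L2E: Lgu => sgu.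
transitivity (a * ipo (u j) (cls Omega (pd i eta))).
  exact: (ipoZl mO a (su j) (spe i)).
rewrite wu// mulrN; congr (- _); apply: esym.
exact: (ipoZl mO a (sgu (i, j)) se).
Qed.

Definition gdot u v := dot (grad u) (grad v).

Lemma grad0 : space_H1 (0 : vec Omega) /\ grad (0 : vec Omega) = 0.
Proof.
have L0' := in_0 ip3; have L09 := in_0 ip9.
apply: grad_uniq => //; apply/(weak_gradE L0' L09) => i j eta ce.
have [se spe] := C1c_sq (Cc_infty_C1c ce).
have e1 := ipo0l (spe i); have e2 := ipo0l se.
by transitivity (0 : R); [exact: e1|rewrite -oppr0; congr (- _); exact: esym e2].
Qed.

Lemma inner_on_gdot1 : inner_on (@space_H1 R Omega) gdot.
Proof.
split.
- exact: grad0.1.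
- by move=> u v /grad_D h /h[].
- by move=> a u /(grad_Z a)[].
- move=> u v /gradP[_ [gu _]] /gradP[_ [gv _]]; exact: (in_C ip9 gu gv).
- move=> u v w Hu Hv Hw; rewrite /gdot (grad_D Hu Hv).2.
  by apply: (in_Dl ip9); [case: (gradP Hu) => _ []|case: (gradP Hv) => _ []|case: (gradP Hw) => _ []].
- move=> a u v Hu Hv; rewrite /gdot (grad_Z a Hu).2.
  by apply: (in_Zl ip9); [case: (gradP Hu) => _ []|case: (gradP Hv) => _ []].
- by move=> u Hu; apply: (in_ge0 ip9); case: (gradP Hu) => _ [].
Qed.

Definition Hdot u v := dot u v + gdot u v.

Lemma inner_on_Hdot : inner_on (@space_H1 R Omega) Hdot.
Proof.
have g := inner_on_gdot1; split.
- exact: in_0 g.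
- exact: in_D g.
- exact: in_Z g.
- by move=> u v Hu Hv; rewrite /Hdot (in_C g)// (in_C ip3)//; [case: Hu|case: Hv].
- move=> u v w Hu Hv Hw; rewrite /Hdot (in_Dl g)// (in_Dl ip3)//; [|by case: Hu|by case: Hv|by case: Hw].
  by rewrite addrACA.
- move=> a u v Hu Hv; rewrite /Hdot (in_Zl g)// (in_Zl ip3)//; [|by case: Hu|by case: Hv].
  by rewrite mulrDr.
- by move=> u Hu; rewrite addr_ge0// ?(in_ge0 g)// (in_ge0 ip3)//; case: Hu.
Qed.

Lemma H1normE u : space_H1 u -> H1norm u = nrm Hdot u.
Proof.
move=> Hu; have [Lu [Lg _]] := gradP Hu.
rewrite /H1norm /nrm /Hdot /norm !sqr_sqrtr//; first exact: (in_ge0 ip9).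
exact: (in_ge0 ip3).
Qed.

Lemma norm_le_H1norm u : space_H1 u -> norm u <= H1norm u /\ norm (grad u) <= H1norm u.
Proof.
move=> Hu; have [Lu [Lg _]] := gradP Hu.
by split; rewrite -[leLHS]ger0_norm ?sqrtr_ge0// -sqrtr_sqr ler_wsqrtr// ?lerDl ?lerDr sqr_ge0.
Qed.

(** Integration by parts shows that the classical derivatives form a weak gradient, and uniqueness
    identifies it with [grad]. *)
Lemma smooth_class u (h : 'I_3 -> R3 R -> R) :
  (forall i, Cc_infty Omega (h i) /\ is_class (u i) (h i)) ->
  [/\ forall i, Cc_infty Omega (h i), u = (fun i => cls Omega (h i)) &
      space_H1 u /\ grad u = (fun p => cls Omega (pd p.1 (h p.2)))].
Proof.
move=> hP; have ch i := Cc_infty_C1c (hP i).1.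
have uE : u = (fun i => cls Omega (h i)).
  apply/funext => i; apply: rep_eq; apply: aeq_trans (hP i).2 _.
  exact: (aeq_sym (rep_cls Omega (C1c_measurable (ch i)).1)).
split=> [i| |]; [by case: (hP i)|by []|].
have Lu : L2 u by rewrite uE; apply/L2E => i; exact: (C1c_sq (ch i)).1.
apply: grad_uniq => //.
  by apply/L2E => -[i j]; exact: (C1c_sq (ch j)).2.
apply/weak_gradE => //; first by apply/L2E => -[i j]; exact: (C1c_sq (ch j)).2.
move=> i j eta /Cc_infty_C1c ce; rewrite uE /=.
have [se spe] := C1c_sqint OL ce; have [me mpe] := C1c_measurable ce.
have [sh sph] := C1c_sqint OL (ch j); have [_ _ _ h0 _] := ch j.
rewrite !ipo_cls2//; try by move=> x /h0[].
exact: (C1c_by_parts OL).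
Qed.

Lemma smooth_classP u : Cc_infty3 u -> exists h : 'I_3 -> R3 R -> R,
  [/\ forall i, Cc_infty Omega (h i), u = (fun i => cls Omega (h i)) &
      space_H1 u /\ grad u = (fun p => cls Omega (pd p.1 (h p.2)))].
Proof. by move=> [h /smooth_class]; exists h. Qed.

(** Divergence-free approximants are in particular compactly supported smooth fields, so the same
    sequence witnesses membership in [space_H10]. *)
Lemma V_iff u : V u <-> space_H1 u /\
  forall e, 0 < e -> exists2 v, Cc_infty_div0 v & H1norm (u - v) < e.
Proof.
split=> [[[]]//|[Hu h]]; split => //; split => // e /h[v [g [gP _]] uv].
by exists v => //; exists g.
Qed.

Lemma Cc_div0_Cc3 u : Cc_infty_div0 u -> Cc_infty3 u.
Proof. by move=> [g [gP _]]; exists g. Qed.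

Lemma Cc_div0_H1 u : Cc_infty_div0 u -> space_H1 u.
Proof. by move=> /Cc_div0_Cc3/smooth_classP[h [_ _ []]]. Qed.

Lemma Cc_div0_V u : Cc_infty_div0 u -> V u.
Proof.
move=> cu; apply/V_iff; split; first exact: Cc_div0_H1.
move=> e e0; exists u => //; rewrite subrr H1normE; last exact: grad0.1.
by rewrite (nrm0 inner_on_Hdot).
Qed.

Lemma smooth_lin f g a s : smooth f -> smooth g ->
  foldr pd (fun x => f x + a * g x) s = fun x => foldr pd f s x + a * foldr pd g s x.
Proof.
move=> sf sg; elim: s => [//|i s IH] /=; apply/funext => x.
rewrite IH; have [_ df] := sf s; have [_ dg] := sg s.
have := @deriveD R _ R^o _ _ x (e3 i) (df i x) (derivableZ (dg i x) : derivable (a *: foldr pd g s) x _).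
by rewrite (deriveZ a (dg i x)).
Qed.

Lemma Cc_infty_lin f g a : Cc_infty Omega f -> Cc_infty Omega g ->
  Cc_infty Omega (fun x => f x + a * g x).
Proof.
move=> [sf cf Of] [sg cg Og].
have sup : Defs.support (fun x => f x + a * g x) `<=` Defs.support f `|` Defs.support g.
  rewrite /Defs.support -closureU; apply: closure_subset => x /= h.
  have [f0|] := eqVneq (f x) 0; last by left.
  by right; apply: contra_neq h => ->; rewrite f0 mulr0 addr0.
split.
- move=> s; rewrite smooth_lin//; have [c1 d1] := sf s; have [c2 d2] := sg s; split.
    by move=> x; apply: cvgD (c1 x) _; apply: cvgM (c2 x); exact: cvg_cst.
  move=> i x; exact: derivableD (d1 i x) (derivableZ (d2 i x)).
- apply: subclosed_compact sup; first exact: closed_closure.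
  exact: compactU.
- by move=> x /sup[/Of|/Og].
Qed.

Lemma Cc_div0_lin u v a : Cc_infty_div0 u -> Cc_infty_div0 v -> Cc_infty_div0 (u + a *: v).
Proof.
move=> [f [fP df]] [g [gP dg]]; exists (fun i x => f i x + a * g i x); split=> [i|x].
  have [[cf uf] [cg vg]] := (fP i, gP i); split; first exact: Cc_infty_lin.
  have h0 := repD (u i) (a *: v i); apply: aeq_trans h0 _.
  have h1 : {ae @leb3 R, forall x : mR3 R, Omega x -> rep (a *: v i) x = a * g i x}.
    by apply: ae3S2 vg (repZ a (v i)) => x h1 h2 Ox; rewrite h2// h1.
  by apply: ae3S2 uf h1 => x h2 h3 Ox; rewrite h2// h3.
transitivity (\sum_i (pd i (f i) x + a * pd i (g i) x)).
  apply: eq_bigr => i _.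
  have [[[sf _ _] _] [[sg _ _] _]] := (fP i, gP i).
  exact: (congr1 (fun h => h x) (smooth_lin a [:: i] sf sg)).
by rewrite big_split/= -mulr_sumr df dg mulr0 addr0.
Qed.

Lemma V_H1 u : V u -> space_H1 u. Proof. by move=> /V_iff[]. Qed.

Lemma V_seq u : V u -> exists v_ : nat -> vec Omega,
  (forall n, Cc_infty_div0 (v_ n)) /\ H1norm (u - v_ n) @[n --> \oo] --> 0.
Proof.
move=> /V_iff[Hu h].
have /choice[v vP] : forall n : nat, exists v, Cc_infty_div0 v /\ H1norm (u - v) < n.+1%:R^-1.
  by move=> n; have [|v] := h n.+1%:R^-1; [rewrite invr_gt0|exists v].
exists v; split=> [n|]; first by case: (vP n).
apply/(squeeze_cvgr _ _ (@cvg_harmonic R)); last exact: cvg_cst.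
by near=> n; rewrite sqrtr_ge0 /= /harmonic/= ltW//; case: (vP n).
Unshelve. all: by end_near. Qed.

Lemma V_lin u v a : V u -> V v -> V (u + a *: v).
Proof.
move=> Vu Vv; have [Hu hu] := (V_iff u).1 Vu; have [Hv hv] := (V_iff v).1 Vv.
have Hav := in_Z inner_on_Hdot a Hv.
apply/V_iff; split; first exact: (in_D inner_on_Hdot).
move=> e e0; have a0 : 0 < `|a| + 1 by rewrite ltr_wpDl.
have [u' cu' uu'] := hu (e / 2) (divr_gt0 e0 (ltr0n _ 2)).
have [v' cv' vv'] := hv (e / 2 / (`|a| + 1)) (divr_gt0 (divr_gt0 e0 (ltr0n _ 2)) a0).
have Hu' := Cc_div0_H1 cu'; have Hv' := Cc_div0_H1 cv'; have Hav' := in_Z inner_on_Hdot a Hv'.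
exists (u' + a *: v'); first exact: Cc_div0_lin.
have i := inner_on_Hdot.
have H1 := in_B i Hu Hu'; have H2 := in_B i Hv Hv'; have H3 := in_Z i a H2.
rewrite (_ : _ - _ = (u - u') + a *: (v - v')); last by rewrite scalerBr opprD addrACA.
rewrite H1normE; last exact: (in_D i).
apply: le_lt_trans (nrmD i H1 H3) _; rewrite (nrmZ i)// -!H1normE//.
rewrite [e]splitr; apply: ltr_leD => //.
  move/ltW: vv'; rewrite ler_pdivlMr//; have := sqrtr_ge0 (norm (v - v') ^+ 2 + norm (grad (v - v')) ^+ 2).
rewrite -/(H1norm (v - v')); set h := H1norm _ => h0; lra.
Qed.

End V_facts.

Lemma quarter_sqr {R : realType} (x y e : R) : x <= e / 4 -> y <= e / 4 -> 0 < e ->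
  0 <= x -> 0 <= y -> x ^+ 2 + y ^+ 2 <= (e / 2) ^+ 2.
Proof. by move=> *; nra. Qed.

Lemma half_quarter {R : realType} (x y e : R) : x <= e / 2 -> y < e / 4 -> 0 < e -> x + y < e.
Proof. by move=> *; lra. Qed.

Section V_analysis.
Context {R : realType} (Omega : set (R3 R)) (L : R).
Hypotheses (Oo : open Omega) (OL : forall x, Omega x -> forall i, `|crd i x| <= L)
  (Lp : 0 < L).
Notation O := (Omega : set (mR3 R)).
Notation V := (space_V Omega).
Implicit Types (u v w : vec Omega) (f g eta : R3 R -> R).

Let mO : measurable O. Proof. exact: open_measurable3. Qed.
Let ip3 := (inner_on_dot mO (I := 'I_3)).
Let ip9 := (inner_on_dot mO (I := ('I_3 * 'I_3)%type)).
Let ipg := inner_on_gdot1 Oo OL.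
Let ipH := inner_on_Hdot Oo OL.
Notation gn u := (norm (grad u)).

Lemma ipoB (a b : L0 Omega) : sq a -> sq b ->
  ipo (a - b) (a - b) = ip leb3 O (fun x => rep a x - rep b x) (fun x => rep a x - rep b x).
Proof.
move=> sa sb; have sB : sq (a - b) by apply: sqD => //; rewrite -scaleN1r; exact: sqZ.
have h : {ae @leb3 R, forall x : mR3 R, Omega x -> rep (a - b) x = rep a x - rep b x}.
  have h1 := repZ (-1) b; have h2 := repD a (- b); rewrite scaleN1r in h1.
  by apply: ae3S2 h1 h2 => x h1 h2 Ox; rewrite h2// h1// mulN1r.
by apply: ip_ae => //; exact: sqintB.
Qed.

Lemma V_lim u : V u -> exists v_ : nat -> vec Omega,
  [/\ (forall n, Cc_infty_div0 (v_ n)), norm (v_ n - u) @[n --> \oo] --> 0,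
      gn (v_ n - u) @[n --> \oo] --> 0, norm (v_ n) @[n --> \oo] --> norm u &
      gn (v_ n) @[n --> \oo] --> gn u].
Proof.
move=> Vu; have [v_ [cv hv]] := V_seq Vu; have Hu := V_H1 Vu.
have Hv n : space_H1 (v_ n) by exact: (Cc_div0_H1 Oo OL).
have Lu : L2 u by case: Hu.
have Lv n : L2 (v_ n) by case: (Hv n).
have sub (N : vec Omega -> R) : (forall w, space_H1 w -> 0 <= N w <= H1norm w) ->
    (forall n, N (v_ n - u) = N (u - v_ n)) -> N (v_ n - u) @[n --> \oo] --> 0.
  move=> NH Ns; apply/(squeeze_cvgr _ (@cvg_cst _ _ _ _ _) hv).
  by near=> n; rewrite Ns; apply: NH; exact: (in_B ipH Hu (Hv n)).
have n1 : norm (v_ n - u) @[n --> \oo] --> 0.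
  apply: sub => [w Hw|n]; last exact: (nrmBC ip3 (Lv n) Lu).
  by rewrite sqrtr_ge0 (norm_le_H1norm Hw).1.
have g1 : gn (v_ n - u) @[n --> \oo] --> 0.
  apply: (sub (fun w => gn w)) => [w Hw|n]; last exact: (nrmBC ipg (Hv n) Hu).
  by rewrite sqrtr_ge0 (norm_le_H1norm Hw).2.
exists v_; split => //.
- exact: (nrm_cvg ip3 Lv Lu n1).
- exact: (nrm_cvg ipg Hv Hu g1).
Unshelve. all: by end_near. Qed.

Lemma smooth_dots u (h : 'I_3 -> R3 R -> R) : (forall i, Cc_infty Omega (h i)) ->
  u = (fun i => cls Omega (h i)) -> grad u = (fun p => cls Omega (pd p.1 (h p.2))) ->
  dot u u = \sum_j ip leb3 setT (h j : mR3 R -> R) (h j) /\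
  gdot u u = \sum_j \sum_i ip leb3 setT (pd i (h j) : mR3 R -> R) (pd i (h j)).
Proof.
move=> ch uE gE; split.
  rewrite uE dotE; apply: eq_bigr => j _.
  have [_ _ _ h0 _] := Cc_infty_C1c (ch j); have [sh _] := C1c_sqint OL (Cc_infty_C1c (ch j)).
  by apply: ipo_cls2 => // x /h0[].
rewrite exchange_big pair_bigA /= /gdot gE dotE; apply: eq_bigr => -[i j] _ /=.
have [_ _ _ h0 _] := Cc_infty_C1c (ch j); have [_ sh] := C1c_sqint OL (Cc_infty_C1c (ch j)).
by apply: ipo_cls2 => // x /h0[].
Qed.

Lemma smooth_norm_le u : Cc_infty_div0 u -> norm u <= 4 * L * gn u.
Proof.
move=> /Cc_div0_Cc3 /(smooth_classP Oo OL)[h [ch uE [Hu gE]]].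
have [d1 d2] := smooth_dots ch uE gE.
have e : 4 * L * gn u = Num.sqrt (16 * L ^+ 2 * gdot u u).
  have -> : 16 * L ^+ 2 = (4 * L) ^+ 2 by ring.
  by rewrite sqrtrM ?sqr_ge0// sqrtr_sqr ger0_norm// mulr_ge0// ltW.
rewrite e; apply: ler_wsqrtr; rewrite d1 d2 mulr_sumr; apply: ler_sum => j _.
apply: le_trans (C1c_poincare OL Lp (Cc_infty_C1c (ch j))) _.
apply: ler_wpM2l; first by rewrite mulr_ge0// sqr_ge0.
by rewrite [leRHS](bigD1 ord_max)//= lerDl sumr_ge0// => i _; exact: ip_ge0.
Qed.

Lemma V_poincare u : V u -> norm u <= 4 * L * gn u.
Proof.
move=> /V_lim[v_ [cv _ _ nv gv]].
have gv' : 4 * L * gn (v_ n) @[n --> \oo] --> 4 * L * gn u by apply: cvgM => //; exact: cvg_cst.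
by apply: (ler_cvg_to nv gv'); near=> n; exact: smooth_norm_le.
Unshelve. all: by end_near. Qed.

Lemma V_0 : V 0.
Proof.
apply: (Cc_div0_V Oo OL); exists (fun=> cst 0); split=> [i|x].
  split; [exact: Cc_infty0|exact: rep0].
by rewrite big1// => i _; exact: derive_cst.
Qed.

Lemma V_L2 u : V u -> L2 u. Proof. by move=> /V_H1[]. Qed.

Lemma inner_on_V : inner_on V (@gdot R Omega).
Proof.
split.
- exact: V_0.
- by move=> u v Vu Vv; rewrite -[v]scale1r; exact: (V_lin Oo OL).
- by move=> a u Vu; have := V_lin Oo OL a V_0 Vu; rewrite (add0r (a *: u)).
- by move=> u v /V_H1 Hu /V_H1 Hv; exact: (in_C ipg).
- by move=> u v w /V_H1 Hu /V_H1 Hv /V_H1 Hw; exact: (in_Dl ipg).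
- by move=> a u v /V_H1 Hu /V_H1 Hv; exact: (in_Zl ipg).
- by move=> u /V_H1 Hu; exact: (in_ge0 ipg).
Qed.

Let ipV := inner_on_V.

Lemma gradB u v : space_H1 u -> space_H1 v -> grad (u - v) = grad u - grad v.
Proof.
move=> Hu Hv; have HNv := in_N ipH Hv; rewrite (grad_D Oo OL Hu HNv).2 -scaleN1r.
by rewrite (grad_Z Oo OL (-1) Hv).2 scaleN1r.
Qed.

Lemma inner_on_ipo : inner_on (@sq R Omega) (@ipo R Omega).
Proof.
split; [exact: sq0|exact: sqD|exact: sqZ| | | |].
- by move=> u v _ _; exact: ipC.
- by move=> u v w; exact: ipoDl.
- by move=> a u w; exact: ipoZl.
- by move=> u _; exact: ip_ge0.
Qed.

Lemma ipo_cvg (I : finType) (U_ : nat -> I -> L0 Omega) U i c : (forall n, L2 (U_ n)) -> L2 U ->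
  norm (U_ n - U) @[n --> \oo] --> 0 -> sq c -> ipo (U_ n i) c @[n --> \oo] --> ipo (U i) c.
Proof.
move=> LU_ LU h sc; have sU := (L2E U).1 LU; have sU_ n := (L2E (U_ n)).1 (LU_ n).
apply: (in_cvg inner_on_ipo (fun n => sU_ n i) (sU i) sc).
apply/(squeeze_cvgr _ (@cvg_cst _ _ _ _ _) h); near=> n; rewrite sqrtr_ge0 /=.
have LB := in_B (inner_on_dot mO) (LU_ n) LU.
have h1 := ipo_le_norm i LB.
apply: le_trans (ler_wsqrtr h1) _; rewrite sqrtr_sqr ger0_norm ?sqrtr_ge0//.
Unshelve. all: by end_near. Qed.

Lemma V_complete (u_ : nat -> vec Omega) : (forall n, V (u_ n)) ->
  (forall e, 0 < e -> exists N, forall n m, (N <= n)%N -> (N <= m)%N ->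
    gn (u_ n - u_ m) <= e) ->
  exists u, V u /\ gn (u_ n - u) @[n --> \oo] --> 0.
Proof.
move=> Vu_ Cu; have Hu_ n := V_H1 (Vu_ n).
have Lu_ n := V_L2 (Vu_ n).
have Lg_ n : L2 (grad (u_ n)) by have [_ []] := gradP (Hu_ n).
have [u [Lu nu]] : exists u, L2 u /\ norm (u_ n - u) @[n --> \oo] --> 0.
  apply: (norm_complete mO Lu_) => e e0.
  have c0 : 0 < 4 * L by rewrite mulr_gt0.
  have [N NP] := Cu _ (divr_gt0 e0 c0); exists N => n m Nn Nm.
  apply: le_trans (V_poincare (in_B ipV (Vu_ n) (Vu_ m))) _.
  by rewrite mulrC -ler_pdivlMr//; exact: NP.
have [G [LG nG]] : exists G, L2 G /\ norm (grad (u_ n) - G) @[n --> \oo] --> 0.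
  apply: (norm_complete mO Lg_) => e e0; have [N NP] := Cu _ e0.
  by exists N => n m Nn Nm; have := NP n m Nn Nm; rewrite gradB.
have wG : weak_grad u G.
  apply/(weak_gradE Oo OL Lu LG) => i j eta ce.
  have [se spe] := C1c_sq Oo OL (Cc_infty_C1c ce).
  have l1 := ipo_cvg (i := j) Lu_ Lu nu (spe i).
  have l2 := cvgN (ipo_cvg (i := (i, j)) Lg_ LG nG se).
  have E : (fun n => ipo (u_ n j) (cls Omega (pd i eta))) = (fun n => - ipo (grad (u_ n) (i, j)) (cls Omega eta)).
    apply/funext => n; have [_ [_ wg]] := gradP (Hu_ n).
    exact: (weak_gradE Oo OL (Lu_ n) (Lg_ n)).1.
  by rewrite E in l1; exact: (cvg_unique _ l1 (l2 _)).
have [Hu gu] := grad_uniq Oo OL Lu LG wG.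
have gc : gn (u_ n - u) @[n --> \oo] --> 0.
  have E n : norm (grad (u_ n) - G) = gn (u_ n - u) by rewrite (gradB (Hu_ n) Hu) gu.
  by move: nG; under eq_fun do rewrite E.
exists u; split => //; apply/V_iff; split => // e e0.
have e4 : 0 < e / 4 by rewrite divr_gt0.
have h1 : \forall n \near \oo, norm (u_ n - u) <= e / 4 by exact: cvgr_le nu _ e4.
have h2 : \forall n \near \oo, gn (u_ n - u) <= e / 4 by exact: cvgr_le gc _ e4.
have [n [h3 h4]] : exists n, norm (u_ n - u) <= e / 4 /\ gn (u_ n - u) <= e / 4.
  by have [n _] := filterI h1 h2 => /(_ n (leqnn n))[? ?]; exists n.
have [v cv vu] := ((V_iff (u_ n)).1 (Vu_ n)).2 _ e4.
have Hv := Cc_div0_H1 Oo OL cv; exists v => //.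
have H1 := in_B ipH Hu (Hu_ n); have H2 := in_B ipH (Hu_ n) Hv; have H3 := in_B ipH Hu Hv.
rewrite (H1normE Oo H3); apply: le_lt_trans (nrm_triB ipH Hu (Hu_ n) Hv) _.
rewrite -(H1normE Oo H2) (nrmBC ipH Hu (Hu_ n)) -(H1normE Oo (in_B ipH (Hu_ n) Hu)).
have h5 : H1norm (u_ n - u) <= e / 2.
  rewrite /H1norm; apply: le_trans (_ : Num.sqrt ((e / 2) ^+ 2) <= _); last first.
    by rewrite sqrtr_sqr ger0_norm// divr_ge0// ltW.
  by apply: ler_wsqrtr; exact: (quarter_sqr h3 h4 e0 (sqrtr_ge0 _) (sqrtr_ge0 _)).
exact: half_quarter h5 vu e0.
Qed.

End V_analysis.

Lemma leb3_cube {R : realType} (a : R * R * R) h : 0 < h -> (leb3 (cube a h) < +oo)%E.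
Proof.
move=> h0; have f x : (lebesgue_measure (itvh x h : set (measurableTypeR R)) < +oo)%E.
  by rewrite leb_itvh// ltry.
have mi x : measurable (itvh x h) by exact: measurable_itv.
rewrite [X in (X < _)%E](@product_measure1E _ _ _ _ _ ((@lebesgue_measure R) \x (@lebesgue_measure R))%E (@lebesgue_measure R))//.
- rewrite [X in (X * _ < _)%E](@product_measure1E _ _ _ _ _ (@lebesgue_measure R) (@lebesgue_measure R))//.
  apply: lte_mul_pinfty; [exact: mule_ge0| |exact: f].
  rewrite ge0_fin_numE; last exact: mule_ge0.
  apply: lte_mul_pinfty; [exact: measure_ge0| |exact: f].
  by rewrite ge0_fin_numE; [exact: f|exact: measure_ge0].
  all: by [exact: mi|apply: measurableX; exact: mi].
Qed.

Section V_rellich.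
Context {R : realType} (Omega : set (R3 R)) (L : R).
Hypotheses (Oo : open Omega) (OL : forall x, Omega x -> forall i, `|crd i x| <= L)
  (Lp : 0 < L).
Notation O := (Omega : set (mR3 R)).
Notation V := (space_V Omega).
Implicit Types (u v w : vec Omega) (f g eta : R3 R -> R).
Let mO : measurable O. Proof. exact: open_measurable3. Qed.
Let ip3 := (inner_on_dot mO (I := 'I_3)).
Let ip9 := (inner_on_dot mO (I := ('I_3 * 'I_3)%type)).
Let ipV := inner_on_V Oo OL.
Notation gn u := (norm (grad u)).

Lemma sqint_indic (A : set (mR3 R)) : measurable A -> (leb3 A < +oo)%E ->
  sqint leb3 setT (\1_A : mR3 R -> R).
Proof.
move=> mA lA; split; first exact: measurable_indic.
rewrite (_ : (fun x => _) = (fun x => (\1_A x)%:E)).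
  by rewrite integral_indic// setIT.
by apply/funext => x; rewrite indicE; case: (x \in A); rewrite ?expr1n ?expr0n.
Qed.

(** The indicator of one cube placed in one component: the inner product with it is an integral over
    the cube, which gives the grid estimate the form required by [hp_rellich]. *)
Definition cube_test N (k : 'I_3 * ('I_N * 'I_N * 'I_N)) : vec Omega :=
  fun i => if i == k.1 then cls Omega (\1_(gcube L k.2) : mR3 R -> R) else 0.

Lemma gcube_sqint N q : (0 < N)%N -> sqint leb3 setT (\1_(@gcube R L N q) : mR3 R -> R).
Proof.
move=> N0; apply: sqint_indic; first exact: measurable_cube.
by apply: leb3_cube; exact: gh_gt0.
Qed.

Lemma cube_test_L2 N k : (0 < N)%N -> L2 (@cube_test N k).
Proof.
move=> N0; apply/L2E => i; rewrite /cube_test; case: ifP => _; last exact: sq0.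
have s := gcube_sqint k.2 N0; apply: sq_cls => //; [exact: sqint_sub|exact: s.1].
Qed.

Lemma dot_cube_test N u k : (0 < N)%N -> L2 u ->
  dot u (@cube_test N k) = ipo (u k.1) (cls Omega (\1_(gcube L k.2) : mR3 R -> R)).
Proof.
move=> N0 Lu; have su := (L2E u).1 Lu; rewrite dotE (bigD1 k.1)//= {1}/cube_test eqxx big1 ?addr0// => i ik.
transitivity (ipo (cube_test k i) (u i)); first exact: ipC.
by rewrite /cube_test (negbTE ik); exact: (ipo0l Oo).
Qed.

Lemma smooth_grid N u : (0 < N)%N -> Cc_infty_div0 u ->
  norm u ^+ 2 <= gh L N ^- 3 * \sum_k dot u (@cube_test N k) ^+ 2 + gh L N ^+ 2 * gn u ^+ 2.
Proof.
move=> N0 cu; have Vu := Cc_div0_V Oo OL cu; have Lu := V_L2 Vu.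
have /(smooth_classP Oo OL)[h [ch uE [Hu gE]]] := Cc_div0_Cc3 cu.
have [d1 d2] := smooth_dots Oo OL ch uE gE.
rewrite [norm u ^+ 2](nrm_sqr ip3 Lu) [gn u ^+ 2](nrm_sqr ipV Vu) d1 d2.
have -> : \sum_k dot u (@cube_test N k) ^+ 2 = \sum_j \sum_q (\int[leb3]_(x in @gcube R L N q) h j x) ^+ 2.
  rewrite pair_bigA; apply: eq_bigr => -[j q] _ /=; congr (_ ^+ 2).
  rewrite (dot_cube_test (j, q) N0 Lu) uE /=.
  have [_ _ _ h0 _] := Cc_infty_C1c (ch j); have [sh _] := C1c_sqint OL (Cc_infty_C1c (ch j)).
  rewrite ipo_cls2//; last 2 first.
  - exact: gcube_sqint.
  - by move=> x /h0[].
  rewrite [RHS]Rintegral_mkcond; apply: eq_Rintegral => x _.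
  by rewrite patchE indicE; case: ifPn; rewrite ?mulr1 ?mulr0.
rewrite !mulr_sumr -big_split; apply: ler_sum => j _ /=.
exact: (C1c_grid OL Lp N0 (Cc_infty_C1c (ch j))).
Qed.

Lemma dot_cvg (u_ : nat -> vec Omega) u w : (forall n, L2 (u_ n)) -> L2 u -> L2 w ->
  norm (u_ n - u) @[n --> \oo] --> 0 -> dot (u_ n) w @[n --> \oo] --> dot u w.
Proof. exact: (in_cvg ip3). Qed.

(** A mesh [gh] below [min 1 e] has [gh^2 <= e]. The estimate holds for smooth fields by
    [smooth_grid], and all its terms are continuous along approximating sequences. *)
Lemma V_rellich e : 0 < e -> exists (I : finType) (w : I -> vec Omega) (C : R),
  [/\ forall k, L2 (w k), 0 <= C & forall u, V u ->
    norm u ^+ 2 <= e * gn u ^+ 2 + C * \sum_k dot u (w k) ^+ 2].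
Proof.
move=> e0; pose e1 := Num.min 1 e; have e10 : 0 < e1 by rewrite lt_min ltr01.
have c0 : 0 < 2 * (L + 1) / e1 by rewrite divr_gt0// mulr_gt0// addr_gt0.
have [N NP] : exists N : nat, 2 * (L + 1) / e1 < N%:R.
  by exists (Num.bound (2 * (L + 1) / e1)); apply: archi_boundP; exact: ltW.
have N0 : (0 < N)%N by rewrite -(ltr0n R); exact: lt_trans NP.
have g0 : 0 < gh L N by exact: gh_gt0.
have ge : gh L N ^+ 2 <= e.
  have h1 : gh L N <= e1.
    by rewrite /gh ler_pdivrMr ?ltr0n// [leRHS]mulrC -ler_pdivrMr//; exact: ltW.
  apply: le_trans (_ : e1 ^+ 2 <= _); first by rewrite lerXn2r ?nnegrE ?(ltW g0) ?(ltW e10).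
  rewrite expr2; apply: le_trans (_ : e1 * 1 <= _).
    by apply: ler_wpM2l; [exact: ltW|rewrite ge_min lexx].
  by rewrite mulr1 ge_min lexx orbT.
exists _, (@cube_test N), (gh L N ^- 3); split.
- by move=> k; exact: cube_test_L2.
- by rewrite invr_ge0 exprn_ge0// ltW.
move=> u Vu; have Lu := V_L2 Vu.
have [v_ [cv nv gv nnv ngv]] := V_lim Oo OL Vu.
have Lv n : L2 (v_ n) by apply: V_L2; exact: (Cc_div0_V Oo OL).
have sq (a : nat -> R) (l : R) : a n @[n --> \oo] --> l -> a n ^+ 2 @[n --> \oo] --> l ^+ 2.
  by move=> al; rewrite expr2; under eq_fun do rewrite expr2; exact: cvgM.
apply: le_trans (_ : gh L N ^- 3 * \sum_k dot u (@cube_test N k) ^+ 2 + gh L N ^+ 2 * gn u ^+ 2 <= _); last first.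
  by rewrite addrC lerD2r ler_wpM2r// sqr_ge0.
have c1 := sq _ _ nnv; have c2 := sq _ _ ngv.
have c3 : \sum_k dot (v_ n) (@cube_test N k) ^+ 2 @[n --> \oo] --> \sum_k dot u (@cube_test N k) ^+ 2.
  apply/subr_cvg0; under eq_fun do rewrite -sumrB.
  apply: cvg_sum0 => k; apply/subr_cvg0; apply: sq; exact: dot_cvg (cube_test_L2 k N0) nv.
have c4 : gh L N ^- 3 * (\sum_k dot (v_ n) (@cube_test N k) ^+ 2) + gh L N ^+ 2 * gn (v_ n) ^+ 2 @[n --> \oo] -->
   gh L N ^- 3 * (\sum_k dot u (@cube_test N k) ^+ 2) + gh L N ^+ 2 * gn u ^+ 2.
  by apply: cvgD; apply: cvgM => //; exact: cvg_cst.
by apply: (ler_cvg_to c1 c4); near=> n; exact: smooth_grid.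
Unshelve. all: by end_near. Qed.

End V_rellich.

(** * The convection term *)

Section trilinear.
Context {R : realType}.

Lemma cvg_sqr (a : nat -> R) (l : R) : a n @[n --> \oo] --> l -> a n ^+ 2 @[n --> \oo] --> l ^+ 2.
Proof. by move=> al; rewrite expr2; under eq_fun do rewrite expr2; exact: cvgM. Qed.

Lemma L4_bound (c g h n0 n1 n2 : R) : 0 <= c -> n0 + n1 + n2 <= g -> h <= c * g -> 0 <= h ->
  0 <= n0 -> 0 <= n1 -> 0 <= n2 -> 2 * (h + n2) * (n0 + n1) <= 2 * (c + 1) * g ^+ 2.
Proof.
move=> c0 ng hg h0 n00 n10 n20; rewrite -!mulrA ler_pM2l// expr2 mulrA.
by apply: ler_pM; [lra..|nra|lra].
Qed.

Lemma tri_root (K x y z C t : R) : t ^+ 4 <= C * x ^+ 4 * (C * z ^+ 4) * (y ^+ 2) ^+ 2 ->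
  0 <= C -> 0 <= x -> 0 <= y -> 0 <= z -> `|t| <= (C + 1) * x * y * z.
Proof.
move=> h C0 x0 y0 z0; rewrite -(ler_pXn2r (n := 4)) ?nnegrE ?mulr_ge0// ?addr_ge0//.
have -> : `|t| ^+ 4 = t ^+ 4 by rewrite (exprM _ 2 2) real_normK ?num_real// -exprM.
apply: le_trans h _.
have -> : C * x ^+ 4 * (C * z ^+ 4) * (y ^+ 2) ^+ 2 = C ^+ 2 * (x ^+ 4 * y ^+ 4 * z ^+ 4) by ring.
have -> : ((C + 1) * x * y * z) ^+ 4 = ((C + 1) ^+ 2) ^+ 2 * (x ^+ 4 * y ^+ 4 * z ^+ 4) by ring.
apply: ler_wpM2r; first by rewrite !mulr_ge0 ?exprn_ge0.
by rewrite lerXn2r ?nnegrE ?sqr_ge0//; nra.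
Qed.

Lemma le_exp4 (x t : R) : 0 <= x -> x <= t -> x ^+ 4 <= t ^+ 4.
Proof. by move=> x0 xt; rewrite lerXn2r ?nnegrE//; exact: le_trans xt. Qed.

Lemma le_nine (t K x y z : R) : t <= K * x * y * z *+ (3 * 3) -> t <= 9 * K * x * y * z.
Proof. by move=> h; apply: le_trans h _; rewrite -[leLHS]mulr_natl -!mulrA. Qed.

Lemma le_nine2 (t K x y : R) : t <= K * x * y *+ (3 * 3) -> t <= 9 * K * x * y.
Proof. by move=> h; apply: le_trans h _; rewrite -[leLHS]mulr_natl -!mulrA. Qed.

Lemma mul_two_sqr (a b c : R) : 2 * (a * b) * c = a * (b * c + b * c). Proof. by ring. Qed.

Lemma skew_telescope (a b c : R) : a = - (c + (-1) * a + (b + (-1) * c) + (0 + (-1) * b)).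
Proof. by ring. Qed.

Lemma skew_bound (C d x y a b c : R) : `|a| <= C * d * x * x -> `|b| <= C * y * d * x ->
  `|c| <= C * y * y * d -> `|a + b + c| <= C * d * (x * x + y * x + y * y).
Proof.
move=> ha hb hc; apply: le_trans (ler_normD _ _) _; apply: le_trans (lerD (ler_normD _ _) (lexx _)) _.
by apply: le_trans (lerD (lerD ha hb) hc) _; rewrite le_eqVlt; apply/orP; left; apply/eqP; ring.
Qed.

Lemma skew_cvg (C x : R) (x_ d_ : nat -> R) : x_ n @[n --> \oo] --> x -> d_ n @[n --> \oo] --> 0 ->
  C * d_ n * (x * x + x_ n * x + x_ n * x_ n) @[n --> \oo] --> 0.
Proof.
move=> xx dd; rewrite -(mul0r (x * x + x * x + x * x)) -(mulr0 C).
apply: cvgM; first by apply: cvgM => //; exact: cvg_cst.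
apply: cvgD; last exact: cvgM.
by apply: cvgD; [exact: cvg_cst|apply: cvgM => //; exact: cvg_cst].
Qed.

Lemma sqr_le_of_norm (b M : R) : `|b| <= M -> b ^+ 2 <= M ^+ 2.
Proof. by move=> bM; rewrite -real_normK ?num_real// lerXn2r ?nnegrE//; exact: le_trans bM. Qed.

Lemma tri_sqrt (t M n g a d : R) : t ^+ 2 <= M ^+ 2 * a * d -> d <= g ^+ 2 -> a <= n ^+ 2 ->
  0 <= M -> 0 <= n -> 0 <= g -> 0 <= a -> 0 <= d -> `|t| <= M * n * g.
Proof.
move=> h dg an M0 n0 g0 a0 d0.
rewrite -(ler_pXn2r (n := 2)) ?nnegrE ?mulr_ge0// real_normK ?num_real//.
apply: le_trans h _; rewrite !exprMn; apply: ler_pM => //; first by rewrite mulr_ge0// sqr_ge0.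
by rewrite ler_wpM2l// sqr_ge0.
Qed.

Lemma Rintegral_sum d (T : measurableType d) (mu : {measure set T -> \bar R}) (D : set T)
    (I : Type) (s : seq I) (g : I -> T -> R) : measurable D ->
  (forall i, mu.-integrable D (EFin \o g i)) ->
  mu.-integrable D (EFin \o (fun x => \sum_(i <- s) g i x)) /\
  \int[mu]_(x in D) (\sum_(i <- s) g i x) = \sum_(i <- s) \int[mu]_(x in D) g i x.
Proof.
move=> mD ig; elim: s => [|i s [IH1 IH2]].
  split.
    apply: (eq_integrable mD (cst 0%E)); last exact: integrable0.
    by move=> x _ /=; rewrite big_nil.
  rewrite big_nil /Rintegral integral0_eq// => x _; by rewrite big_nil.
have E x : \sum_(j <- i :: s) g j x = g i x + \sum_(j <- s) g j x by rewrite big_cons.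
rewrite big_cons -IH2 -RintegralD//; split; last by apply: eq_Rintegral => x _; rewrite E.
rewrite (_ : EFin \o _ = ((EFin \o g i) \+ (EFin \o (fun x => \sum_(j <- s) g j x)%R))%E).
  exact: integrableD.
by apply/funext => x /=; rewrite E EFinD.
Qed.

Variables (Omega : set (R3 R)) (L : R).
Hypotheses (Oo : open Omega) (OL : forall x, Omega x -> forall i, `|crd i x| <= L)
  (Lp : 0 < L).
Notation O := (Omega : set (mR3 R)).
Notation V := (space_V Omega).
Implicit Types (u v w : vec Omega) (a b D : L0 Omega) (f g eta : R3 R -> R).
Let mO : measurable O. Proof. exact: open_measurable3. Qed.
Let ip3 := (inner_on_dot mO (I := 'I_3)).
Let ip9 := (inner_on_dot mO (I := ('I_3 * 'I_3)%type)).
Let ipV := inner_on_V Oo OL.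
Notation gn u := (norm (grad u)).

(** [L^4] integrability phrased through [sqint] of the square, so that products of two such
    functions fall under Cauchy-Schwarz. *)
Definition quartic a := sqint leb3 O (fun x => rep a x ^+ 2).
Definition qint a := ip leb3 O (fun x => rep a x ^+ 2) (fun x => rep a x ^+ 2).

Lemma quartic_prod a b : quartic a -> quartic b ->
  sqint leb3 O (fun x => rep a x * rep b x) /\
  ip leb3 O (fun x => rep a x * rep b x) (fun x => rep a x * rep b x) ^+ 2 <= qint a * qint b.
Proof.
move=> qa qb; have E x : (rep a x * rep b x) * (rep a x * rep b x) = rep a x ^+ 2 * rep b x ^+ 2 by ring.
split.
  apply: sqint_of_sqr; first by apply: measurable_funM; exact: mrepO.
  by have := ip_integrable mO qa qb; apply: eq_integrable => // x _ /=; congr EFin; rewrite exprMn.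
rewrite (_ : ip _ _ _ _ = ip leb3 O (fun x => rep a x ^+ 2) (fun x => rep b x ^+ 2)); last first.
  by apply: eq_Rintegral => x _; exact: E.
exact: ip_cs.
Qed.

Definition tri a D b := ip leb3 O (fun x => rep a x * rep b x) (rep D).

Lemma tri_le a D b : quartic a -> quartic b -> sq D ->
  tri a D b ^+ 4 <= qint a * qint b * ipo D D ^+ 2.
Proof.
move=> qa qb sD; have [s h] := quartic_prod qa qb.
have h2 := ip_cs mO s sD; have h0 := ip_ge0 leb3 O (rep D).
rewrite (_ : 4 = 2 * 2)%N// exprM; apply: le_trans (_ : (ip leb3 O (fun x => rep a x * rep b x) (fun x => rep a x * rep b x) * ipo D D) ^+ 2 <= _).
  by rewrite lerXn2r ?nnegrE ?sqr_ge0// mulr_ge0// ip_ge0.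
by rewrite exprMn ler_wpM2r// sqr_ge0.
Qed.

Lemma smooth_qint u i : Cc_infty_div0 u ->
  (\int[leb3]_(x in O) ((rep (u i) x ^+ 2) ^+ 2)%:E <= ((2 * (16 * L ^+ 2 + 1)) * gn u ^+ 4)%:E)%E.
Proof.
move=> cu; have Vu := Cc_div0_V Oo OL cu.
have /(smooth_classP Oo OL)[h [ch uE [Hu gE]]] := Cc_div0_Cc3 cu.
have [d1 d2] := smooth_dots Oo OL ch uE gE.
have ci := Cc_infty_C1c (ch i).
have h1 : {ae @leb3 R, forall x : mR3 R, Omega x -> rep (u i) x = h i x}.
  by rewrite uE; exact: (rep_cls Omega (C1c_measurable ci).1).
have mh := (C1c_measurable ci).1.
rewrite (_ : integral _ _ _ = \int[leb3]_(x in O) ((h i x ^+ 2) ^+ 2)%:E)%E; last first.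
  apply: ge0_ae_eq_integral => //.
  - apply/measurable_EFinP; apply: measurable_funX; apply: measurable_funX; exact: mrepO.
  - by apply/measurable_EFinP; apply: measurable_funX; apply: measurable_funX; exact: measurable_funTS.
  - by move=> x _; rewrite lee_fin sqr_ge0.
  - by move=> x _; rewrite lee_fin sqr_ge0.
  - by apply: ae3S h1 => x h1 Ox; rewrite h1.
apply: le_trans (_ : \int[leb3]_x (h i x ^+ 4)%:E <= _)%E.
  rewrite (_ : (fun x => _) = fun x => (h i x ^+ 4)%:E).
    apply: ge0_subset_integral => //.
    - by apply/measurable_EFinP; exact: measurable_funX.
    - by move=> x _; rewrite lee_fin (exprM _ 2 2) sqr_ge0.
  by apply/funext => x; rewrite -exprM.
apply: le_trans (C1c_L4 OL ci) _; rewrite lee_fin.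
have -> : gn u ^+ 4 = gdot u u ^+ 2 by rewrite (exprM _ 2 2); congr (_ ^+ 2); exact: (nrm_sqr ipV Vu).
have d3 : \sum_j ip leb3 setT (pd j (h i) : mR3 R -> R) (pd j (h i)) <= gdot u u.
  rewrite d2 [leRHS](bigD1 i)//= lerDl sumr_ge0// => j _; apply: sumr_ge0 => k _; exact: ip_ge0.
rewrite sum3E in d3.
have h0 : ip leb3 setT (h i : mR3 R -> R) (h i) <= 16 * L ^+ 2 * gdot u u.
  apply: le_trans (C1c_poincare OL Lp ci) _; apply: ler_wpM2l; first by rewrite mulr_ge0// sqr_ge0.
  rewrite d2; apply: le_trans (_ : \sum_j ip leb3 setT (pd j (h i) : mR3 R -> R) (pd j (h i)) <= _).
    by rewrite [leRHS](bigD1 ord_max)//= lerDl sumr_ge0// => j _; exact: ip_ge0.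
  by rewrite [leRHS](bigD1 i)//= lerDl sumr_ge0// => j _; apply: sumr_ge0 => k _; exact: ip_ge0.
have p j := ip_ge0 leb3 setT (pd j (h i) : mR3 R -> R).
have p0 := ip_ge0 leb3 setT (h i : mR3 R -> R).
by apply: L4_bound => //; rewrite mulr_ge0// sqr_ge0.
Qed.

(** The bound [2 (|f|^2 + |d_3 f|^2) (|d_1 f|^2 + |d_2 f|^2)] of [C1c_L4], with
    [|f|^2 <= 16 L^2 |grad u|^2] from the Poincare inequality. *)
Definition C4 : R := 2 * (16 * L ^+ 2 + 1).

Lemma C4_ge0 : 0 <= C4.
Proof. by rewrite mulr_ge0// addr_ge0// mulr_ge0// sqr_ge0. Qed.

(** Smooth approximants converge almost everywhere along a subsequence, and Fatou's lemma transfers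
    their [L^4] bound. Any [t] above [gn u] eventually dominates their gradients; then [t] decreases
    to [gn u]. *)
Lemma V_quartic u i : V u -> quartic (u i) /\ qint (u i) <= C4 * gn u ^+ 4.
Proof.
move=> Vu; have Lu := V_L2 Vu.
have [v_ [cv nv _ _ ngv]] := V_lim Oo OL Vu.
have Lv n : L2 (v_ n) by apply: V_L2; exact: (Cc_div0_V Oo OL).
have su := (L2E u).1 Lu i; have sv n := (L2E (v_ n)).1 (Lv n) i.
have c : ip leb3 O (fun x => rep (v_ n i) x - rep (u i) x) (fun x => rep (v_ n i) x - rep (u i) x) @[n --> \oo] --> 0.
  have nv2 : norm (v_ n - u) ^+ 2 @[n --> \oo] --> 0.
    by have := cvg_sqr nv; rewrite expr0n.
  apply/(squeeze_cvgr _ (@cvg_cst _ _ _ _ _) nv2); near=> n.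
  rewrite ip_ge0 -(ipoB Oo (sv n) su)/=.
  exact: (ipo_le_norm i (in_B ip3 (Lv n) Lu)).
have [k [kn kP]] := ae_subseq mO su sv c.
have key t : gn u < t -> (\int[leb3]_(x in O) ((rep (u i) x ^+ 2) ^+ 2)%:E <= (C4 * t ^+ 4)%:E)%E.
  move=> ut; have [N _ NP] : \forall n \near \oo, gn (v_ n) <= t by exact: cvgr_le ngv _ ut.
  apply: (@fatou_ae _ _ _ _ _ mO (fun n x => (rep (v_ (k n) i) x ^+ 2) ^+ 2) _ N) => //.
  - by move=> n; apply: measurable_funX; apply: measurable_funX; exact: mrepO.
  - by apply: measurable_funX; apply: measurable_funX; exact: mrepO.
  - by move=> n x _; exact: sqr_ge0.
  - apply: ae3S kP => x h Ox; have {}h := h Ox.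
    by apply: cvg_sqr; apply: cvg_sqr.
  - move=> n Nn; apply: le_trans (smooth_qint i (cv (k n))) _; rewrite lee_fin.
    apply: ler_wpM2l; first exact: C4_ge0.
    exact: (le_exp4 (sqrtr_ge0 _) (NP _ (leq_trans Nn (kn n)))).
have q : quartic (u i).
  split; first by apply: measurable_funX; exact: mrepO.
  by apply: le_lt_trans (key (gn u + 1) _) _; rewrite ?ltry// ltrDl.
split => //.
have key2 t : gn u < t -> qint (u i) <= C4 * t ^+ 4.
  by move=> /key; rewrite (ip_sqrE mO q) lee_fin.
have ct : C4 * t ^+ 4 @[t --> (gn u)^'+] --> C4 * gn u ^+ 4.
  apply: cvg_at_right_filter; apply: cvgM; first exact: cvg_cst.
  exact: exprn_continuous.
by apply: (cvgr_to_ge ct); near=> t; exact: key2.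
Unshelve. all: by end_near. Qed.

Lemma quartic_sqint a b : quartic a -> quartic b -> sqint leb3 O (fun x => rep a x * rep b x).
Proof. by move=> qa qb; have [] := quartic_prod qa qb. Qed.

Lemma triC a D b : tri a D b = tri b D a.
Proof. by apply: eq_Rintegral => x _; rewrite [rep a x * _]mulrC. Qed.

Lemma tri_linl (c : R) a a' D b : sqint leb3 O (fun x => rep a x * rep b x) ->
  sqint leb3 O (fun x => rep a' x * rep b x) -> sq D ->
  tri (a + c *: a') D b = tri a D b + c * tri a' D b.
Proof.
move=> s s' sD; rewrite /tri.
have h : {ae @leb3 R, forall x : mR3 R, Omega x ->
    rep (a + c *: a') x * rep b x = rep a x * rep b x + c * (rep a' x * rep b x)}.
  have h1 := repD a (c *: a'); have h2 := repZ c a'.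
  by apply: ae3S2 h1 h2 => x h1 h2 Ox; rewrite h1// h2// mulrDl mulrA.
have s2 := sqintD mO s (sqintZ mO c s').
transitivity (ip leb3 O (fun x => rep a x * rep b x + c * (rep a' x * rep b x)) (rep D)).
  apply: (ip_ae mO _ s2 sD sD h); last exact: aeW.
  apply: (sq_aeq mO _ h s2).
  by apply: measurable_funM; exact: mrepO.
transitivity (ip leb3 O (fun x => rep a x * rep b x) (rep D) + ip leb3 O (fun x => c * (rep a' x * rep b x)) (rep D)).
  exact: (ipDl mO s (sqintZ mO c s') sD).
by congr (_ + _); exact: ipZl.
Qed.

Lemma tri_linm (c : R) a D D' b : sqint leb3 O (fun x => rep a x * rep b x) ->
  sq D -> sq D' -> tri a (D + c *: D') b = tri a D b + c * tri a D' b.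
Proof.
move=> s sD sD'; rewrite /tri.
have h : {ae @leb3 R, forall x : mR3 R, Omega x -> rep (D + c *: D') x = rep D x + c * rep D' x}.
  have h1 := repD D (c *: D'); have h2 := repZ c D'.
  by apply: ae3S2 h1 h2 => x h1 h2 Ox; rewrite h1// h2.
have s2 := sqintD mO sD (sqintZ mO c sD').
transitivity (ip leb3 O (fun x => rep D x + c * rep D' x) (fun x => rep a x * rep b x)).
  rewrite ipC; apply: (ip_ae mO _ s2 s s h); last exact: aeW.
  by apply: sqD => //; exact: sqZ.
transitivity (ip leb3 O (rep D) (fun x => rep a x * rep b x) + ip leb3 O (fun x => c * rep D' x) (fun x => rep a x * rep b x)).
  exact: (ipDl mO sD (sqintZ mO c sD') s).
by congr (_ + _); [exact: ipC|rewrite ipZl// ipC].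
Qed.

Lemma V_grad_sq u p : V u -> sq (grad u p) /\ ipo (grad u p) (grad u p) <= gn u ^+ 2.
Proof.
move=> Vu; have [_ [Lg _]] := gradP (V_H1 Vu).
by split; [exact: ((L2E _).1 Lg p)|exact: ipo_le_norm].
Qed.

Lemma conv_triE u v w : V u -> V v -> V w ->
  convection u v w = \sum_i \sum_j tri (u i) (grad v (i, j)) (w j).
Proof.
move=> Vu Vv Vw.
have int i j : leb3.-integrable O (EFin \o (fun x => rep (u i) x * rep (grad v (i, j)) x * rep (w j) x)).
  have := ip_integrable mO (quartic_sqint (V_quartic i Vu).1 (V_quartic j Vw).1) (V_grad_sq (i, j) Vv).1.
  by apply: eq_integrable => // x _ /=; congr EFin; exact: mulrAC.
have int2 i := Rintegral_sum (index_enum 'I_3) mO (int i).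
rewrite /convection (Rintegral_sum (index_enum 'I_3) mO (fun i => (int2 i).1)).2.
apply: eq_bigr => i _; rewrite (int2 i).2; apply: eq_bigr => j _.
by apply: eq_Rintegral => x _; exact: mulrAC.
Qed.

Lemma sum_le_const (I : finType) (g : I -> R) (c : R) : (forall i, `|g i| <= c) ->
  `|\sum_i g i| <= c *+ #|I|.
Proof.
move=> h; apply: le_trans (ler_norm_sum _ _ _) _.
by rewrite -sumr_const; apply: ler_sum.
Qed.

(** Nine terms indexed by [(i, j)], each with the constant [C4 + 1], a convenient majorant of the
    square root of [C4]. *)
Definition Cconv : R := 9 * (C4 + 1).

Lemma Cconv_ge0 : 0 <= Cconv.
Proof. by rewrite mulr_ge0// addr_ge0// C4_ge0. Qed.

Lemma conv_le u v w : V u -> V v -> V w -> `|convection u v w| <= Cconv * gn u * gn v * gn w.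
Proof.
move=> Vu Vv Vw; rewrite conv_triE//.
have h i j : `|tri (u i) (grad v (i, j)) (w j)| <= (C4 + 1) * gn u * gn v * gn w.
  have [[q1 h1] [q2 h2]] := (V_quartic i Vu, V_quartic j Vw).
  have [s3 h3] := V_grad_sq (i, j) Vv.
  apply: tri_root; rewrite ?sqrtr_ge0 ?C4_ge0//; apply: le_trans (tri_le q1 q2 s3) _.
  have g0 := ip_ge0 leb3 O; apply: (ler_pM (mulr_ge0 (g0 _) (g0 _)) (sqr_ge0 _)).
    exact: (ler_pM (g0 _) (g0 _) h1 h2).
  have := ler_pM (g0 _) (g0 _) h3 h3; rewrite -!expr2; exact.
have := sum_le_const (fun i => sum_le_const (h i)); rewrite !card_ord -mulrnA.
exact: le_nine.
Qed.

Lemma conv_linl c u u' v w : V u -> V u' -> V v -> V w ->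
  convection (u + c *: u') v w = convection u v w + c * convection u' v w.
Proof.
move=> Vu Vu' Vv Vw; have Vl := V_lin Oo OL c Vu Vu'.
rewrite !conv_triE// mulr_sumr -big_split; apply: eq_bigr => i _ /=.
rewrite mulr_sumr -big_split; apply: eq_bigr => j _ /=.
apply: tri_linl; last exact: (V_grad_sq (i, j) Vv).1.
- exact: quartic_sqint (V_quartic i Vu).1 (V_quartic j Vw).1.
- exact: quartic_sqint (V_quartic i Vu').1 (V_quartic j Vw).1.
Qed.

Lemma conv_linr c u v w w' : V u -> V v -> V w -> V w' ->
  convection u v (w + c *: w') = convection u v w + c * convection u v w'.
Proof.
move=> Vu Vv Vw Vw'; have Vl := V_lin Oo OL c Vw Vw'.
rewrite !conv_triE// mulr_sumr -big_split; apply: eq_bigr => i _ /=.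
rewrite mulr_sumr -big_split; apply: eq_bigr => j _ /=.
rewrite triC [tri (u i) _ (w j)]triC [tri (u i) _ (w' j)]triC.
apply: tri_linl; last exact: (V_grad_sq (i, j) Vv).1.
- exact: quartic_sqint (V_quartic j Vw).1 (V_quartic i Vu).1.
- exact: quartic_sqint (V_quartic j Vw').1 (V_quartic i Vu).1.
Qed.

Lemma grad_lin c u v : space_H1 u -> space_H1 v -> grad (u + c *: v) = grad u + c *: grad v.
Proof.
move=> Hu Hv; have [Hcv gcv] := grad_Z Oo OL c Hv.
by rewrite (grad_D Oo OL Hu Hcv).2 gcv.
Qed.

Lemma conv_linm c u v v' w : V u -> V v -> V v' -> V w ->
  convection u (v + c *: v') w = convection u v w + c * convection u v' w.
Proof.
move=> Vu Vv Vv' Vw; have Vl := V_lin Oo OL c Vv Vv'.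
rewrite !conv_triE// mulr_sumr -big_split; apply: eq_bigr => i _ /=.
rewrite mulr_sumr -big_split; apply: eq_bigr => j _ /=.
rewrite (grad_lin c (V_H1 Vv) (V_H1 Vv')).
apply: tri_linm; [|exact: (V_grad_sq (i, j) Vv).1|exact: (V_grad_sq (i, j) Vv').1].
exact: quartic_sqint (V_quartic i Vu).1 (V_quartic j Vw).1.
Qed.

Lemma tri_cls (h0 h1 h2 : mR3 R -> R) : sqint leb3 setT (fun x => h0 x * h2 x) ->
  sqint leb3 setT h1 -> measurable_fun setT h0 -> measurable_fun setT h2 ->
  (forall x, ~ Omega x -> h1 x = 0) ->
  tri (cls Omega h0) (cls Omega h1) (cls Omega h2) = ip leb3 setT (fun x => h0 x * h2 x) h1.
Proof.
move=> s02 s1 m0 m2 h10; rewrite -(ip_off _ h10).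
have a0 := rep_cls Omega m0; have a2 := rep_cls Omega m2; have a1 := rep_cls Omega s1.1.
have a : {ae @leb3 R, forall x : mR3 R, Omega x ->
    rep (cls Omega h0) x * rep (cls Omega h2) x = h0 x * h2 x}.
  by apply: ae3S2 a0 a2 => x e0 e2 Ox; rewrite e0// e2.
have s02' := sqint_sub Oo s02; have s1' := sqint_sub Oo s1.
apply: (ip_ae mO _ s02' _ s1' a a1).
- by apply: (sq_aeq mO _ a s02'); apply: measurable_funM; exact: mrepO.
- by apply: (sq_aeq mO _ a1 s1'); exact: mrepO.
Qed.

(** Twice the integrand is [u] dotted with the gradient of [|u|^2]; integration by parts moves the
    derivative onto [u], where the divergence vanishes. *)
Lemma conv_skew_smooth u : Cc_infty_div0 u -> convection u u u = 0.
Proof.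
move=> cu; have Vu := Cc_div0_V Oo OL cu.
rewrite conv_triE//; have [h [hP dh]] := cu.
have [ch uE [_ gE]] := smooth_class Oo OL hP; rewrite gE uE /=.
have cC i := Cc_infty_C1c (ch i).
rewrite exchange_big big1// => j _ /=.
have [cjj pjj] := C1cM (cC j) (cC j); have [sjj _] := C1c_sqint OL cjj.
have E i : 2 * tri (cls Omega (h i)) (cls Omega (pd i (h j))) (cls Omega (h j)) =
   - ip leb3 setT (pd i (h i) : mR3 R -> R) (fun x => h j x * h j x).
  have [cij _] := C1cM (cC i) (cC j); have [sij _] := C1c_sqint OL cij.
  have [_ sj] := C1c_sqint OL (cC j); have [_ _ _ j0 _] := cC j.
  rewrite (tri_cls sij (sj i) (C1c_measurable (cC i)).1 (C1c_measurable (cC j)).1); last by move=> x /j0[].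
  rewrite -(C1c_by_parts OL i (cC i) cjj) -(ipZl measurableT 2 sij (sj i)).
  apply: eq_Rintegral => x _; rewrite (pjj i x).
  exact: mul_two_sqr.
have : 2 * \sum_i tri (cls Omega (h i)) (cls Omega (pd i (h j))) (cls Omega (h j)) = 0.
  rewrite mulr_sumr (eq_bigr _ (fun i _ => E i)) sumrN; apply/eqP; rewrite oppr_eq0; apply/eqP.
  have int i : leb3.-integrable setT (EFin \o (fun x : mR3 R => pd i (h i) x * (h j x * h j x))).
    by have [_ si] := C1c_sqint OL (cC i); exact: (ip_integrable measurableT (si i) sjj).
  have [_ <-] := Rintegral_sum (index_enum 'I_3) measurableT int.
  rewrite /Rintegral integral0_eq// => x _.
  by rewrite -mulr_suml dh mul0r.
by move/eqP; rewrite mulf_eq0 pnatr_eq0 /= => /eqP.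
Qed.

(** Replacing the three arguments one by one by a smooth approximant leaves three error terms, each
    containing the difference once; [conv_le] makes them tend to 0. *)
Lemma conv_skew u : V u -> convection u u u = 0.
Proof.
move=> Vu; have [v_ [cv nv gv _ ngv]] := V_lim Oo OL Vu.
have Vv n : V (v_ n) := Cc_div0_V Oo OL (cv n).
have Vd n : V (v_ n - u) := in_B ipV (Vv n) Vu.
have E n : `|convection u u u| <= Cconv * gn (v_ n - u) * (gn u * gn u + gn (v_ n) * gn u + gn (v_ n) * gn (v_ n)).
  have e : convection u u u = - (convection (v_ n - u) u u + convection (v_ n) (v_ n - u) u + convection (v_ n) (v_ n) (v_ n - u)).
    have h1 := conv_linl (-1) (Vv n) Vu Vu Vu; have h2 := conv_linm (-1) (Vv n) (Vv n) Vu Vu.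
    have h3 := conv_linr (-1) (Vv n) (Vv n) (Vv n) Vu; rewrite scaleN1r in h1 h2 h3.
    rewrite h1 h2 h3 (conv_skew_smooth (cv n)); exact: skew_telescope.
  rewrite e normrN.
  have b1 := conv_le (Vd n) Vu Vu; have b2 := conv_le (Vv n) (Vd n) Vu; have b3 := conv_le (Vv n) (Vv n) (Vd n).
  exact: skew_bound b1 b2 b3.
have c := skew_cvg Cconv ngv gv.
apply/eqP; rewrite -normr_le0.
by apply: (cvgr_to_ge c); near=> n; exact: E.
Unshelve. all: by end_near. Qed.

Lemma smooth_bounded w : Cc_infty_div0 w -> exists M, 0 <= M /\
  forall i, {ae @leb3 R, forall x : mR3 R, Omega x -> `|rep (w i) x| <= M}.
Proof.
move=> [h [hP _]].
have /choice[M MP] : forall i, exists M, forall x, `|h i x| <= M.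
  by move=> i; have [_ _ _ _ [M MP]] := Cc_infty_C1c (hP i).1; exists M => x; case: (MP x).
exists (\sum_i `|M i|); split; first exact: sumr_ge0.
move=> i; apply: ae3S (hP i).2 => x e Ox; rewrite e//.
apply: le_trans (MP i x) _; apply: le_trans (ler_norm _) _.
by rewrite (bigD1 i)//= lerDl sumr_ge0.
Qed.

Lemma tri_le_bounded a D b (M : R) : 0 <= M -> sq a -> quartic a -> quartic b -> sq D ->
  {ae @leb3 R, forall x : mR3 R, Omega x -> `|rep b x| <= M} ->
  tri a D b ^+ 2 <= M ^+ 2 * ipo a a * ipo D D.
Proof.
move=> M0 sa qa qb sD bM; have s := quartic_sqint qa qb.
apply: le_trans (ip_cs mO s sD) _; apply: ler_wpM2r; first exact: ip_ge0.
have sM := sqintZ mO M sa.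
have -> : M ^+ 2 * ipo a a = ip leb3 O (fun x => M * rep a x) (fun x => M * rep a x).
  by rewrite (ipZl mO M sa sM) ipC (ipZl mO M sa sa) mulrA expr2.
rewrite -lee_fin -(ip_sqrE mO s) -(ip_sqrE mO sM).
apply: ae_ge0_le_integral => //.
- by move=> x _; rewrite lee_fin sqr_ge0.
- by apply/measurable_EFinP; apply: measurable_funX; exact: s.1.
- by move=> x _; rewrite lee_fin sqr_ge0.
- by apply/measurable_EFinP; apply: measurable_funX; exact: sM.1.
apply: ae3S bM => x h Ox; rewrite lee_fin !exprMn mulrC; apply: ler_wpM2r; first exact: sqr_ge0.
by have := h Ox; exact: sqr_le_of_norm.
Qed.

(** A smooth [w] is bounded, so no [L^4] factor is spent on it and [u] enters through its [L^2] norm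
    alone. This gives continuity under convergence in [H] with bounded gradients. *)
Lemma conv_le_smooth w : Cc_infty_div0 w -> exists C, 0 <= C /\ forall u v, V u -> V v ->
  `|convection u v w| <= C * norm u * gn v.
Proof.
move=> cw; have Vw := Cc_div0_V Oo OL cw; have [M [M0 MP]] := smooth_bounded cw.
exists (9 * M); split; first by rewrite mulr_ge0.
move=> u v Vu Vv; rewrite conv_triE//; have Lu := V_L2 Vu.
have h i j : `|tri (u i) (grad v (i, j)) (w j)| <= M * norm u * gn v.
  have [s3 h3] := V_grad_sq (i, j) Vv; have su := (L2E _).1 Lu i.
  have h := tri_le_bounded M0 su (V_quartic i Vu).1 (V_quartic j Vw).1 s3 (MP j).
  have h4 := ipo_le_norm i Lu; have g0 := ip_ge0 leb3 O.
  exact: (tri_sqrt h h3 h4 M0 (sqrtr_ge0 _) (sqrtr_ge0 _) (g0 _) (g0 _)).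
have := sum_le_const (fun i => sum_le_const (h i)); rewrite !card_ord -mulrnA.
exact: le_nine2.
Qed.

End trilinear.

(** All that the convex and measure-theoretic arguments use of the function spaces. Compactness of
    the embedding is stated as an inequality with finitely many functionals, the form that the grid
    estimate delivers directly. *)
Record hilbert_pair {R : realType} {E : lmodType R} (H V : set E) (h g : E -> E -> R) : Prop :=
  HilbertPair {
  hp_H : inner_on H h;
  hp_V : inner_on V g;
  hp_sub : forall u, V u -> H u;
  hp_eq0 : forall u, H u -> nrm h u = 0 -> u = 0;
  hp_poincare : exists C, 0 <= C /\ forall u, V u -> nrm h u <= C * nrm g u;
  hp_completeH : forall u_ : nat -> E, (forall n, H (u_ n)) ->
    (forall e, 0 < e -> exists N, forall n m, (N <= n)%N -> (N <= m)%N ->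
      nrm h (u_ n - u_ m) <= e) ->
    exists u, H u /\ nrm h (u_ n - u) @[n --> \oo] --> 0;
  hp_completeV : forall u_ : nat -> E, (forall n, V (u_ n)) ->
    (forall e, 0 < e -> exists N, forall n m, (N <= n)%N -> (N <= m)%N ->
      nrm g (u_ n - u_ m) <= e) ->
    exists u, V u /\ nrm g (u_ n - u) @[n --> \oo] --> 0;
  hp_rellich : forall e, 0 < e -> exists (I : finType) (w : I -> E) (C : R),
    [/\ forall k, H (w k), 0 <= C & forall u, V u ->
      nrm h u ^+ 2 <= e * nrm g u ^+ 2 + C * \sum_k h u (w k) ^+ 2] }.

(** * Weak compactness and Rellich compactness in a Hilbert pair *)

Section sequences.
Context {R : realType}.

Lemma cvg_subseq (a : nat -> R) (l : R) (k : nat -> nat) : a n @[n --> \oo] --> l ->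
  (forall n, (n <= k n)%N) -> a (k n) @[n --> \oo] --> l.
Proof.
move=> /cvgrPdist_le al nk; apply/cvgrPdist_le => e /al[N _ NP].
by exists N => // n /= Nn; apply: NP; exact: leq_trans Nn (nk n).
Qed.

Lemma subseq_choice (P : nat -> Prop) : (forall N, exists n, (N <= n)%N /\ P n) ->
  exists k : nat -> nat, forall n, (n <= k n)%N /\ P (k n).
Proof. by move=> /choice[k kP]; exists k. Qed.

(** The center is the limit of [a] along [U], obtained as the supremum of the levels that [a]
    exceeds on a set of [U]; the ultrafilter property bounds it from the other side. *)
Lemma ultra_center (U : set_system nat) (a : nat -> R) (M e : R) : UltraFilter U ->
  (forall n, `|a n| <= M) -> 0 < e -> exists c, U [set n | `|a n - c| <= e].
Proof.
move=> UU aM e0; pose S := [set x | U [set n | x <= a n]].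
have SM : S (- M).
  by apply: filterS filterT => n _ /=; have := aM n; rewrite ler_norml => /andP[].
have bS : has_sup S.
  split; first by exists (- M).
  exists M => x /filter_ex[n /=]; have := aM n; rewrite ler_norml => /andP[_] /[swap]; exact: le_trans.
exists (sup S); have [x Sx xs] := sup_adherent e0 bS.
have nS : ~ S (sup S + e).
  by move=> /(ub_le_sup bS.2); rewrite gerDl leNgt e0.
have : U (~` [set n | sup S + e <= a n]).
  by have [//|] := in_ultra_setVsetC [set n | sup S + e <= a n] UU.
apply: filterS2 Sx => n /= xa /negP; rewrite -ltNge => h.
by rewrite ler_norml; apply/andP; split; lra.
Qed.

End sequences.

Section convexity.
Context {R : realType} {E : lmodType R}.

Definition convex_set (P : set E) := forall x y t, 0 <= t -> t <= 1 -> P x -> P y ->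
  P (t *: x + (1 - t) *: y).

Lemma convex_ball (P : set E) (B : E -> E -> R) (v : E) r : inner_on P B -> P v ->
  convex_set [set x | P x /\ nrm B (x - v) <= r].
Proof.
move=> i Vv x y t t0 t1 [Vx xr] [Vy yr]; have Vtx := in_Z i t Vx.
have Vty := in_Z i (1 - t) Vy; split; first exact: (in_D i).
have -> : t *: x + (1 - t) *: y - v = t *: (x - v) + (1 - t) *: (y - v).
  rewrite !scalerBr addrACA -opprD -scalerDl addrC.
  by rewrite [t + _]addrC subrK scale1r addrC.
have Vxv := in_B i Vx Vv; have Vyv := in_B i Vy Vv.
apply: le_trans (nrmD i (in_Z i t Vxv) (in_Z i (1 - t) Vyv)) _.
rewrite !(nrmZ i)// ger0_norm// ger0_norm ?subr_ge0//; nra.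
Qed.

Lemma mazur_arith (a b dn dm D mid e r i1 i2 : R) : 0 <= dn -> dn <= mid -> dn <= a -> dn <= dm ->
  dm <= b -> a < dn + i1 -> i1 <= e -> b < dm + i2 -> i2 <= e -> dm <= D -> D - e < dn ->
  a <= r -> b <= r -> 0 < e -> 0 <= r ->
  2 * a ^+ 2 + 2 * b ^+ 2 - 4 * mid ^+ 2 <= e * (12 * r + 1).
Proof.
move=> d0 h2 h3 h4 h5 h6 h7 h8 h9 h10 h11 h12 h13 e0 r0.
have m2 : dn ^+ 2 <= mid ^+ 2 by rewrite lerXn2r ?nnegrE//; exact: le_trans h2.
have a2 : a ^+ 2 - dn ^+ 2 <= e * (2 * r).
  rewrite subr_sqr; apply: ler_pM; lra.
have b2 : b ^+ 2 - dn ^+ 2 <= 2 * e * (2 * r).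
  rewrite subr_sqr; apply: ler_pM; lra.
rewrite mulrDr mulr1; have : e * (12 * r) = 2 * (e * (2 * r)) + 2 * (2 * e * (2 * r)) by ring.
lra.
Qed.

End convexity.

Section compactness.
Context {R : realType} {E : lmodType R}.
Variables (H V : set E) (h g : E -> E -> R).
Hypothesis S : hilbert_pair H V h g.
Let iH := hp_H S.
Let iV := hp_V S.
Let VH := hp_sub S.
Notation nH := (nrm h).
Notation nV := (nrm g).

(** The convex hull of a tail, written as an intersection: to prove a property of its points it is
    enough to exhibit a convex set that contains the tail. *)
Definition tail_hull (u_ : nat -> E) n : set E :=
  [set x | forall P, convex_set P -> (forall k, (n <= k)%N -> P (u_ k)) -> P x].

Lemma tail_hull_midpoint u_ n m x y : (n <= m)%N -> tail_hull u_ n x -> tail_hull u_ m y ->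
  tail_hull u_ n (2^-1 *: (x + y)).
Proof.
move=> nm hx hy P cP Pu.
have Px := hx P cP Pu; have Py : P y by apply: hy => // k mk; apply: Pu; exact: leq_trans mk.
have := cP x y 2^-1; rewrite (_ : 1 - 2^-1 = 2^-1 :> R); last by field.
by rewrite -scalerDr; apply => //; rewrite ?invr_ge0// invf_le1// ler1n.
Qed.

Lemma parallelogram x y : V x -> V y ->
  nV (x - y) ^+ 2 = 2 * nV x ^+ 2 + 2 * nV y ^+ 2 - 4 * nV (2^-1 *: (x + y)) ^+ 2.
Proof.
move=> Vx Vy; have Vxy := in_D iV Vx Vy; have VNy := in_N iV Vy.
rewrite (nrmZ iV)// !exprMn real_normK ?num_real// !(nrm_sqr iV)//; last exact: (in_B iV).
rewrite !(in_sqrD iV)// (in_Nr iV)// (in_Nl iV)// (in_Nr iV)//; by field.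
Qed.

(** Near-minimizers of the norm in the shrinking hulls are Cauchy: the minimal norms [d n] increase
    to a limit, midpoints stay in the larger hull and have norm at least [d n], and the
    parallelogram identity bounds the distance. Convex combinations thus play the role of the weak
    topology. *)
Lemma mazur (u_ : nat -> E) r : (forall n, V (u_ n)) -> (forall n, nV (u_ n) <= r) ->
  exists (c_ : nat -> E) c, [/\ forall n, tail_hull u_ n (c_ n), forall n, V (c_ n), V c,
    nV c <= r & nV (c_ n - c) @[n --> \oo] --> 0].
Proof.
move=> Vu ur; have r0 : 0 <= r := le_trans (nrm_ge0 _ _) (ur 0).
have hullV n x : tail_hull u_ n x -> V x /\ nV x <= r.
  have cb := @convex_ball _ _ V g 0 r iV (in_0 iV).
  by move=> /(_ _ cb)[k _|]; rewrite /= subr0.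
pose D n := [set nV x | x in tail_hull u_ n].
have hu n : tail_hull u_ n (u_ n) by move=> P _; apply.
have D0 n : has_inf (D n).
  by split; [exists (nV (u_ n)); exists (u_ n)|exists 0 => _ [x _ <-]; exact: nrm_ge0].
pose d n := inf (D n).
have dle n x : tail_hull u_ n x -> d n <= nV x.
  by move=> hx; apply: (ge_inf (D0 n).2); exists x.
have dn n m : (n <= m)%N -> d n <= d m.
  move=> nm; apply: lb_le_inf; first exact: (D0 m).1.
  move=> _ [x hx <-]; apply: dle => P cP Pu; apply: hx => // k mk; apply: Pu; exact: leq_trans mk.
have d0 n : 0 <= d n by apply: lb_le_inf; [exact: (D0 n).1|move=> _ [x _ <-]; exact: nrm_ge0].
have dr n : d n <= r by apply: le_trans (dle n _ (hu n)) _.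
have hD : has_sup (range d) by split; [exists (d 0); exists 0|exists r => _ [n _ <-]].
have /choice[c cP] : forall n, exists c, tail_hull u_ n c /\ nV c < d n + n.+1%:R^-1.
  move=> n; have n0 : 0 < n.+1%:R^-1 :> R by rewrite invr_gt0.
  by have [_ [x hx <-] lt] := inf_adherent n0 (D0 n); exists x.
have Vc n : V (c n) by have [] := hullV n _ (cP n).1.
have cr n : nV (c n) <= r by have [] := hullV n _ (cP n).1.
have [|x [Vx cx]] := hp_completeV S Vc.
  move=> e e0.
  pose e1 := e ^+ 2 / (12 * r + 1); have e10 : 0 < e1 by rewrite divr_gt0 ?exprn_gt0//; lra.
  have [_ [N _ <-] Nd] := sup_adherent e10 hD.
  have [N2 N2P] : exists N2 : nat, e1^-1 < N2%:R.
    by exists (Num.bound e1^-1); apply: archi_boundP; rewrite invr_ge0 ltW.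
  have inv n : (N2 <= n)%N -> n.+1%:R^-1 <= e1.
    move=> Nn; rewrite -[leRHS]invrK lef_pV2 ?posrE ?invr_gt0//.
    by apply: le_trans (ltW N2P) _; rewrite ler_nat ltnW.
  have key n m : (maxn N N2 <= n)%N -> (n <= m)%N -> nV (c n - c m) <= e.
    rewrite geq_max => /andP[Nn N2n] nm.
    have h1 := tail_hull_midpoint nm (cP n).1 (cP m).1; have h2 := dle _ _ h1.
    have h3 := parallelogram (Vc n) (Vc m).
    have h4 := (cP n).2; have h5 := (cP m).2; have h6 := inv n N2n; have h7 := inv m (leq_trans N2n nm).
    have h8 : d m <= sup (range d) by apply: (ub_le_sup hD.2); exists m.
    have h9 := dn _ _ Nn; have h10 := d0 n; have h11 := cr n; have h12 := cr m; have h13 := dn _ _ nm.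
    rewrite -(ler_pXn2r (n := 2)) ?nnegrE ?nrm_ge0 ?(ltW e0)//.
    have h14 : e1 * (12 * r + 1) = e ^+ 2 by rewrite /e1 divfK// gt_eqF//; lra.
    rewrite h3 -h14; have := nrm_ge0 g (c n); have := nrm_ge0 g (c m).
    move=> _ _; apply: (@mazur_arith _ (nV (c n)) (nV (c m)) (d n) (d m) (sup (range d)) _ _ r n.+1%:R^-1 m.+1%:R^-1) => //.
    - exact: dle (cP n).1.
    - exact: dle (cP m).1.
    - exact: lt_le_trans h9.
  exists (maxn N N2) => n m Nn Nm; have [nm|mn] := leqP n m; first exact: key.
  by rewrite (nrmBC iV)//; apply: key => //; exact: ltnW.
exists c, x; split => //; first by move=> n; exact: (cP n).1.
have cc := nrm_cvg iV Vc Vx cx.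
by apply: (cvgr_to_le cc); near=> n; exact: cr.
Unshelve. all: by end_near. Qed.

(** Balls of [H] around [u] are convex, so the convex combinations given by [mazur] also converge to
    [u] in [H]; their limit in [V] must be [u]. *)
Lemma weak_limit (u_ : nat -> E) u r : (forall n, V (u_ n)) -> (forall n, nV (u_ n) <= r) ->
  H u -> nH (u_ n - u) @[n --> \oo] --> 0 ->
  exists c_ : nat -> E, [/\ forall n, tail_hull u_ n (c_ n), forall n, V (c_ n), V u,
    nV u <= r & nV (c_ n - u) @[n --> \oo] --> 0].
Proof.
move=> Vu ur Hu uu; have [c_ [c [hc Vc Vcc cr cc]]] := mazur Vu ur.
suff -> : u = c by exists c_.
have cu : nH (c_ n - u) @[n --> \oo] --> 0.
  apply/cvgrPdist_le => e e0; have [N _ NP] : \forall n \near \oo, `|0 - nH (u_ n - u)| <= e by move/cvgrPdist_le: uu; apply.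
  exists N => // n /= Nn; rewrite sub0r normrN ger0_norm ?nrm_ge0//.
  have [||//] := hc n [set x | H x /\ nH (x - u) <= e]; first exact: convex_ball.
  move=> k nk; split; first exact: VH.
  by have := NP k (leq_trans Nn nk); rewrite sub0r normrN ger0_norm ?nrm_ge0.
have [C [C0 CP]] := hp_poincare S.
have cc' : nH (c_ n - c) @[n --> \oo] --> 0.
  apply: (squeeze_cvgr _ (cvg_cst 0)).
    by near=> n; rewrite nrm_ge0 /=; apply: CP; exact: (in_B iV).
  by rewrite -(mulr0 C); apply: cvgM => //; exact: cvg_cst.
apply/eqP; rewrite -subr_eq0; apply/eqP; apply: (hp_eq0 S); first by apply: (in_B iH) => //; exact: VH.
apply/eqP; rewrite eq_le nrm_ge0 andbT.
have := cvgD cu cc'; rewrite addr0 => l.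
apply: (cvgr_to_ge (l _)); near=> n.
have Hc : H (c_ n) by exact: VH.
rewrite -[leRHS]/(nH (c_ n - u) + nH (c_ n - c)) (nrmBC iH Hc Hu).
exact: (nrm_triB iH Hu Hc (VH Vcc)).
Unshelve. all: by end_near. Qed.

Lemma weak_limit_le (u_ : nat -> E) u r : (forall n, V (u_ n)) -> (forall n, nV (u_ n) <= r) ->
  H u -> nH (u_ n - u) @[n --> \oo] --> 0 -> V u /\ nV u <= r.
Proof. by move=> Vu ur Hu /(weak_limit Vu ur Hu)[c [_ _]]. Qed.

Definition bounded_lin (k : E -> R) := (forall a b u v, V u -> V v ->
    k (a *: u + b *: v) = a * k u + b * k v) /\
  exists C, forall u, V u -> `|k u| <= C * nV u.

Lemma bounded_linN k : bounded_lin k -> bounded_lin (fun u => - k u).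
Proof.
move=> [kl [C kC]]; split; last by exists C => u Vu; rewrite normrN kC.
by move=> a b u v Vu Vv; rewrite kl// opprD !mulrN.
Qed.

(** A half-space is convex: if [k u + d <= k (u_ n)] holds along a subsequence, it holds for the
    convex combinations of its tails, which converge to [u] in [V], where [k] is continuous. *)
Lemma bounded_lin_liminf (k : E -> R) (u_ : nat -> E) u r d : bounded_lin k ->
  (forall n, V (u_ n)) -> (forall n, nV (u_ n) <= r) ->
  H u -> nH (u_ n - u) @[n --> \oo] --> 0 ->
  (forall N, exists n, (N <= n)%N /\ k u + d <= k (u_ n)) -> d <= 0.
Proof.
move=> [kl [C kC]] Vu ur Hu uu /subseq_choice[s sP].
have uu' := cvg_subseq uu (fun n => (sP n).1).
have [c_ [hc Vc Vu' _ cc]] := weak_limit (fun n => Vu (s n)) (fun n => ur (s n)) Hu uu'.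
have kB x y : V x -> V y -> k (x - y) = k x - k y.
  by move=> Vx Vy; have := kl 1 (-1) x y Vx Vy; rewrite !scale1r scaleN1r mul1r mulN1r.
have h1 n : d <= C * nV (c_ n - u).
  apply: le_trans (le_trans (ler_norm _) (kC _ (in_B iV (Vc n) Vu'))).
  rewrite kB// lerBrDl.
  have [|//|//] := hc n [set x | V x /\ k u + d <= k x].
    move=> x y t t0 t1 [Vx xd] [Vy yd] /=; rewrite kl//; split; last by nra.
    by apply: (in_D iV); exact: (in_Z iV).
  by move=> j _; split; [exact: Vu|exact: (sP j).2].
have l : C * nV (c_ n - u) @[n --> \oo] --> 0.
  by rewrite -(mulr0 C); apply: cvgM => //; exact: cvg_cst.
by apply: (cvgr_to_ge l); near=> n; exact: h1.
Unshelve. all: by end_near. Qed.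

Lemma bounded_lin_cvg (k : E -> R) (u_ : nat -> E) u r : bounded_lin k ->
  (forall n, V (u_ n)) -> (forall n, nV (u_ n) <= r) ->
  H u -> nH (u_ n - u) @[n --> \oo] --> 0 -> k (u_ n) @[n --> \oo] --> k u.
Proof.
move=> kb Vu ur Hu uu; have kN := bounded_linN kb.
have half (k' : E -> R) e : bounded_lin k' -> 0 < e -> exists N, forall n, (N <= n)%N -> k' (u_ n) < k' u + e.
  move=> bk e0; apply: contrapT => /forallNP nN.
  have : e <= 0; last by rewrite leNgt e0.
  apply: (bounded_lin_liminf bk Vu ur Hu uu) => N.
  have := nN N => /existsNP[n /not_implyP[Nn /negP]]; rewrite -leNgt => h1.
  by exists n.
apply/cvgrPdist_le => e e0; have [N1 N1P] := half _ _ kb e0; have [N2 N2P] := half _ _ kN e0.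
exists (maxn N1 N2) => // n /=; rewrite geq_max => /andP[/N1P h1 /N2P h2].
by rewrite ler_norml; apply/andP; split; lra.
Qed.

(** An ultrafilter makes the finitely many functionals of [hp_rellich] nearly constant at once, so
    at every scale some set of the ultrafilter has small diameter in [H]. Picking indices in finite
    intersections of these sets gives a Cauchy subsequence. *)
Lemma rellich_compact (u_ : nat -> E) r : (forall n, V (u_ n)) -> (forall n, nV (u_ n) <= r) ->
  exists (k : nat -> nat) u, [/\ forall n, (n <= k n)%N, V u, nV u <= r &
    nH (u_ (k n) - u) @[n --> \oo] --> 0].
Proof.
move=> Vu ur; have r0 : 0 <= r := le_trans (nrm_ge0 _ _) (ur 0).
have [U [UU sU]] := ultraFilterLemma eventually_filter.
have small e : 0 < e -> exists A, U A /\ forall n m, A n -> A m -> nH (u_ n - u_ m) <= e.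
  move=> e0; have e10 : 0 < e ^+ 2 / (8 * r ^+ 2 + 1).
    by rewrite divr_gt0 ?exprn_gt0//; have := sqr_ge0 r; lra.
  have [I [w [C [Hw C0 hw]]]] := hp_rellich S e10.
  (* The gradient term is at most [4 r^2] times the small coefficient, hence at most [e^2 / 2].
     Values of a functional differ by at most [2 t], and [t <= 1] bounds their squares by [4 t]; the
     factor 8 makes this sum at most [e^2 / 2] too. *)
  pose q := C * #|I|%:R * 8 + 1; have q0 : 0 < q.
    by rewrite ltr_wpDl// mulr_ge0// mulr_ge0.
  have t0 : 0 < Num.min 1 (e ^+ 2 / q) by rewrite lt_min ltr01 divr_gt0// exprn_gt0.
  set t := Num.min _ _ in t0.
  have [Cp [Cp0 CpP]] := hp_poincare S.
  have /choice[c cP] : forall k, exists c, U [set n | `|h (u_ n) (w k) - c| <= t].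
    move=> k; apply: (@ultra_center _ _ _ (Cp * r * nH (w k))) => // n.
    apply: le_trans (in_cs iH (VH (Vu n)) (Hw k)) _.
    by apply: ler_wpM2r; [exact: nrm_ge0|apply: le_trans (CpP _ (Vu n)) _; rewrite ler_wpM2l].
  have UA : U [set n | forall k, `|h (u_ n) (w k) - c k| <= t] by exact: filter_forall.
  exists [set n | forall k, `|h (u_ n) (w k) - c k| <= t]; split; first exact: UA.
  move=> n m hn hm; have Vnm := in_B iV (Vu n) (Vu m).
  have d2 : nV (u_ n - u_ m) ^+ 2 <= 4 * r ^+ 2.
    rewrite (_ : 4 * r ^+ 2 = (2 * r) ^+ 2); last by ring.
    rewrite lerXn2r ?nnegrE ?nrm_ge0 ?mulr_ge0//.
    apply: le_trans (nrmD iV (Vu n) (in_N iV (Vu m))) _; rewrite (nrmN iV)//.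
    by have := ur n; have := ur m; lra.
  have s2 : \sum_k h (u_ n - u_ m) (w k) ^+ 2 <= #|I|%:R * (4 * t).
    apply: le_trans (_ : \sum_(k : I) 4 * t <= _); last by rewrite sumr_const -[leLHS]mulr_natl.
    apply: ler_sum => k _; rewrite (in_Bl iH (VH (Vu n)) (VH (Vu m)) (Hw k)).
    have := hn k; have := hm k; rewrite !ler_norml => /andP[a1 a2] /andP[a3 a4].
    have t1 : t <= 1 by rewrite ge_min lexx.
    have : `|h (u_ n) (w k) - h (u_ m) (w k)| <= 2 * t by rewrite ler_norml; apply/andP; split; lra.
    by move=> /sqr_le_of_norm /le_trans; apply; nra.
  rewrite -(ler_pXn2r (n := 2)) ?nnegrE ?nrm_ge0 ?(ltW e0)//.
  apply: le_trans (hw _ Vnm) _.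
  have tq : t * q <= e ^+ 2 by rewrite -ler_pdivlMr// ge_min lexx orbT.
  have ee : e ^+ 2 / (8 * r ^+ 2 + 1) * (8 * r ^+ 2 + 1) = e ^+ 2.
    by rewrite divfK// gt_eqF//; have := sqr_ge0 r; lra.
  have s3 := ler_wpM2l C0 s2; have d3 := ler_wpM2l (ltW e10) d2.
  have n0 : 0 <= C * #|I|%:R * t by rewrite !mulr_ge0// ltW.
  move: ee d3 s3 tq n0 t0 e10; rewrite /q mulrDr; set X := e ^+ 2 / _; set Y := _ ^+ 2; set Z := \sum_k _.
  set i := #|I|%:R; move=> ee d3 s3; nra.
have /choice[A AP] : forall j : nat, exists A, U A /\ forall n m, A n -> A m -> nH (u_ n - u_ m) <= j.+1%:R^-1.
  by move=> j; apply: small; rewrite invr_gt0.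
have /choice[k kP] : forall j : nat, exists n, (j <= n)%N /\ forall i : 'I_j.+1, A i n.
  move=> j; have UB : U [set n | forall i : 'I_j.+1, A i n] by apply: filter_forall => i; case: (AP i).
  have UC : U [set n | (j <= n)%N] by apply: sU; exists j.
  by have [n [? ?]] := filter_ex (filterI UC UB); exists n.
have [|u [Hu uu]] := hp_completeH S (fun n => VH (Vu (k n))).
  move=> e e0; have [N NP] : exists N : nat, e^-1 < N%:R.
    by exists (Num.bound e^-1); apply: archi_boundP; rewrite invr_ge0 ltW.
  exists N => n m Nn Nm; apply: le_trans (_ : N.+1%:R^-1 <= _); last first.
    rewrite -[leRHS]invrK lef_pV2 ?posrE ?invr_gt0//.
    by apply: le_trans (ltW NP) _; rewrite ler_nat.
  by apply: (AP N).2; [have [_ /(_ (inord N))] := kP n|have [_ /(_ (inord N))] := kP m]; rewrite inordK.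
exists k, u; have [Vuu ul] := weak_limit_le (fun n => Vu (k n)) (fun n => ur (k n)) Hu uu.
by split => // n; case: (kP n).
Qed.

End compactness.

Lemma real_subseq {R : realType} (a : nat -> R) M : (forall n, `|a n| <= M) ->
  exists (k : nat -> nat) (l : R), (forall n, (n <= k n)%N) /\ a (k n) @[n --> \oo] --> l.
Proof.
move=> aM; pose S := [set x | forall N, exists n, (N <= n)%N /\ x <= a n].
have aM' n : - M <= a n <= M by rewrite -ler_norml.
have bS : has_sup S.
  split; first by exists (- M) => N; exists N; split => //; have /andP[] := aM' N.
  by exists M => x /(_ 0)[n [_ xa]]; apply: le_trans xa _; have /andP[] := aM' n.
pose s := sup S.
have near_s e : 0 < e -> forall N, exists n, (N <= n)%N /\ `|a n - s| <= e.
  move=> e0 N; have [x Sx xs] := sup_adherent e0 bS.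
  have : ~ S (s + e) by move=> /(ub_le_sup bS.2); rewrite gerDl leNgt e0.
  move=> /existsNP[N' /forallNP nN'].
  have [n [Nn xn]] := Sx (maxn N N'); exists n.
  move: Nn; rewrite geq_max => /andP[Nn N'n]; split => //.
  have /not_andP[//|/negP] := nN' n; rewrite -ltNge => h.
  by rewrite ler_norml; apply/andP; split; rewrite -/s in xs; lra.
have /choice[k kP] : forall n, exists k, (n <= k)%N /\ `|a k - s| <= n.+1%:R^-1.
  by move=> n; apply: near_s; rewrite invr_gt0.
exists k, s; split=> [n|]; first by case: (kP n).
apply/subr_cvg0; apply/norm_cvg0P.
apply: (squeeze_cvgr _ (cvg_cst 0)); last exact: (@cvg_harmonic R).
by near=> n; rewrite normr_ge0 /=; case: (kP n).
Unshelve. all: by end_near. Qed.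

Lemma cvg_near_le {R : realType} (a : nat -> R) (l z : R) : a n @[n --> \oo] --> l -> l < z ->
  exists N, forall n, (N <= n)%N -> a n <= z.
Proof. by move=> al lz; have [N _ NP] : \forall n \near \oo, a n <= z by [exact: cvgr_le al _ lz]; exists N. Qed.

Lemma le_sqrt {R : realType} (x a : R) : 0 <= x -> x ^+ 2 <= a -> x <= Num.sqrt a.
Proof. by move=> x0 xa; rewrite -[leLHS]ger0_norm// -sqrtr_sqr ler_wsqrtr. Qed.

Lemma sqr_le_sqrt {R : realType} (x a : R) : 0 <= x -> 0 <= a -> x <= Num.sqrt a -> x ^+ 2 <= a.
Proof. by move=> x0 a0 xa; rewrite -[leRHS]sqr_sqrtr// lerXn2r ?nnegrE// sqrtr_ge0. Qed.

Lemma continuous_bigsum {R : realType} {T : topologicalType} (I : Type) (s : seq I) (F : I -> T -> R) : (forall i, continuous (F i)) ->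
  continuous (fun t => \sum_(i <- s) F i t).
Proof.
move=> cF; elim: s => [|i s IH].
  by rewrite (_ : (fun t => _) = cst 0); [exact: cst_continuous|apply/funext => t; rewrite big_nil].
rewrite (_ : (fun t => _) = fun t => F i t + \sum_(j <- s) F j t); last by apply/funext => t; rewrite big_cons.
by move=> t; apply: cvgD; [exact: cF|exact: IH].
Qed.

(** * Two-point states and multipliers *)

Section control.
Context {R : realType} {E : lmodType R}.
Variables (H V : set E) (h g : E -> E -> R).
Hypothesis S : hilbert_pair H V h g.
Let iH := hp_H S.
Let iV := hp_V S.
Let VH := hp_sub S.
Notation nH := (nrm h).
Notation nV := (nrm g).
Variables (r0 nu : R) (f : E -> R).
Hypotheses (r0_ge0 : 0 <= r0) (nu0 : 0 < nu) (fb : bounded_lin V g f).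

Definition kset : set E := [set u | V u /\ nH u <= r0].

Definition energy u := nu * nV u ^+ 2 - f u.

(** Sequential weak continuity on [V], encoded by boundedness in [V] and convergence in [H]; by
    [bounded_lin_cvg] such sequences converge against every bounded linear form. *)
Definition admissible (G : E -> R) := forall (u_ : nat -> E) u r,
  (forall n, kset (u_ n)) -> kset u -> (forall n, nV (u_ n) <= r) ->
  nH (u_ n - u) @[n --> \oo] --> 0 -> G (u_ n) @[n --> \oo] --> G u.

Definition subquadratic (G : E -> R) := forall e, 0 < e ->
  exists C, forall u, kset u -> `|G u| <= e * nV u ^+ 2 + C.

(* A relaxation of [Bf] (weights may vanish, the mean energy may be negative),
   stable under the limits of [mixed_max]; [mixed_dominated] goes back to [Bf]. *)
Record mixed (t1 t2 : R) (u1 u2 : E) : Prop := Mixed {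
  mx_ge0 : 0 <= t1 /\ 0 <= t2;
  mx_sum : t1 + t2 = 1;
  mx_K : kset u1 /\ kset u2;
  mx_nrm : nH u1 = nH u2;
  mx_le0 : t1 * energy u1 + t2 * energy u2 <= 0 }.

Lemma energy_coercive : exists C, 0 <= C /\ forall u, V u -> nu / 2 * nV u ^+ 2 - C <= energy u.
Proof.
have [fl [C fC]] := fb; exists (C ^+ 2 / (2 * nu)).
split; first by rewrite divr_ge0 ?sqr_ge0// mulr_ge0// ltW.
move=> u Vu; rewrite /energy; have fu := le_trans (ler_norm _) (fC u Vu).
have : 0 <= (nu * nV u - C) ^+ 2 / (2 * nu) by rewrite divr_ge0 ?sqr_ge0// mulr_ge0// ltW.
have -> : (nu * nV u - C) ^+ 2 / (2 * nu) = nu / 2 * nV u ^+ 2 - C * nV u + C ^+ 2 / (2 * nu).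
  by field; rewrite gt_eqF.
set X := C ^+ 2 / _; set Y := nV u ^+ 2; lra.
Qed.

Lemma weak_limit_near (u_ : nat -> E) u N r : (forall n, V (u_ n)) -> H u ->
  nH (u_ n - u) @[n --> \oo] --> 0 -> (forall n, (N <= n)%N -> nV (u_ n) <= r) -> nV u <= r.
Proof.
move=> Vu Hu uu NP.
have uN : nH (u_ (n + N)%N - u) @[n --> \oo] --> 0.
  by apply: (@cvg_subseq _ (fun n => nH (u_ n - u)) 0 (fun n => (n + N)%N)) => // n; rewrite leq_addr.
by apply: (weak_limit_le S _ _ Hu uN).2 => n; [exact: Vu|apply: NP; rewrite leq_addl].
Qed.

Lemma f_cvg (u_ : nat -> E) u r : (forall n, kset (u_ n)) -> kset u ->
  (forall n, nV (u_ n) <= r) -> nH (u_ n - u) @[n --> \oo] --> 0 -> f (u_ n) @[n --> \oo] --> f u.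
Proof. by move=> Ku [Vu _] ur; apply: (bounded_lin_cvg S fb _ ur (VH Vu)) => n; case: (Ku n). Qed.

Lemma kset_seq (u_ : nat -> E) r : (forall n, kset (u_ n)) -> (forall n, nV (u_ n) <= r) ->
  exists (k : nat -> nat) u l, [/\ forall n, (n <= k n)%N, kset u, nV u <= l,
    nH (u_ (k n) - u) @[n --> \oo] --> 0 /\ nH (u_ (k n)) @[n --> \oo] --> nH u &
    nV (u_ (k n)) @[n --> \oo] --> l].
Proof.
move=> Ku ur; have Vu n := (Ku n).1.
have [k [u [nk Vuu uur uu]]] := rellich_compact S Vu ur.
have [j [l [nj vl]]] : exists (j : nat -> nat) (l : R), (forall n, (n <= j n)%N) /\
    nV (u_ (k (j n))) @[n --> \oo] --> l.
  by apply: (@real_subseq R (fun n => nV (u_ (k n))) r) => n; rewrite ger0_norm ?nrm_ge0.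
have uu' := cvg_subseq uu nj.
have nn := nrm_cvg iH (fun n => VH (Vu (k (j n)))) (VH Vuu) uu'.
exists (k \o j), u, l; split => //.
- by move=> n; apply: leq_trans (nj n) (nk (j n)).
- by split => //; apply: (cvgr_to_le nn); near=> n; case: (Ku (k (j n))).
- apply/ler_addgt0Pr => e e0.
  have le : l < l + e by rewrite ltrDl.
  have [N NP] := cvg_near_le vl le.
  exact: (weak_limit_near (fun n => Vu (k (j n))) (VH Vuu) uu' NP).
Unshelve. all: by end_near. Qed.

(** The forcing term passes to the limit, while the enstrophy is only lower semicontinuous, since
    balls of [V] are closed under such limits; upper bounds on the energy therefore survive. *)
Lemma energy_lsc (u_ : nat -> E) u r (a : nat -> R) (l : R) : (forall n, kset (u_ n)) -> kset u ->
  (forall n, nV (u_ n) <= r) -> nH (u_ n - u) @[n --> \oo] --> 0 ->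
  (forall n, energy (u_ n) <= a n) -> a n @[n --> \oo] --> l -> energy u <= l.
Proof.
move=> Ku Ku' ur uu ua al; have fu := f_cvg Ku Ku' ur uu.
have al' : a n + f (u_ n) @[n --> \oo] --> l + f u by apply: cvgD.
rewrite /energy lerBlDr; apply/ler_addgt0Pr => e e0.
have le : l + f u < l + f u + e by rewrite ltrDl.
have [N NP] := cvg_near_le al' le.
have h1 n : (N <= n)%N -> nu * nV (u_ n) ^+ 2 <= l + f u + e.
  by move=> /NP; apply: le_trans; have := ua n; rewrite /energy; lra.
have p : 0 <= (l + f u + e) / nu.
  rewrite divr_ge0 ?(ltW nu0)//; apply: le_trans (h1 N (leqnn N)).
  by rewrite mulr_ge0 ?sqr_ge0// ltW.
have h2 : nV u <= Num.sqrt ((l + f u + e) / nu).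
  apply: (weak_limit_near (fun n => (Ku n).1) (VH Ku'.1) uu (N := N)) => n Nn.
  by apply: le_sqrt; rewrite ?nrm_ge0// ler_pdivlMr// mulrC h1.
have : nV u ^+ 2 <= (l + f u + e) / nu.
  by apply: sqr_le_sqrt => //; exact: nrm_ge0.
by rewrite ler_pdivlMr// mulrC.
Qed.

Section multiplier.
Variables (G : E -> R) (m : R).
Hypotheses (Ga : admissible G) (Gs : subquadratic G).
Hypothesis Gm : forall t1 t2 u1 u2, mixed t1 t2 u1 u2 -> t1 * G u1 + t2 * G u2 <= m.

Lemma mixed1 u : kset u -> energy u <= 0 -> mixed 1 0 u u.
Proof. by move=> Ku lu; split; rewrite ?addr0// ?mul1r ?mul0r ?addr0. Qed.

Lemma G_le1 u : kset u -> energy u <= 0 -> G u <= m.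
Proof. by move=> Ku lu; have := Gm (mixed1 Ku lu); rewrite mul1r mul0r addr0. Qed.

Lemma G_le2 u1 u2 : kset u1 -> kset u2 -> nH u1 = nH u2 -> energy u1 < 0 -> 0 < energy u2 ->
  (G u2 - m) * - energy u1 <= (m - G u1) * energy u2.
Proof.
move=> K1 K2 n12 l1 l2; set x := energy u1 in l1 *; set y := energy u2 in l2 *.
have yx : 0 < y - x by rewrite subr_gt0; exact: lt_trans l2.
have : mixed (y / (y - x)) (- x / (y - x)) u1 u2.
  split => //.
  - by rewrite !divr_ge0 ?oppr_ge0 ?(ltW l1) ?(ltW l2)// ltW.
  - by rewrite -mulrDl divff// gt_eqF.
  - rewrite -/x -/y le_eqVlt; apply/orP; left; apply/eqP; field; rewrite gt_eqF//.
move/Gm; have -> : y / (y - x) * G u1 + - x / (y - x) * G u2 = (y * G u1 - x * G u2) / (y - x) by field; rewrite gt_eqF.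
rewrite ler_pdivrMr//; lra.
Qed.

(** Lagrange multiplier for one constraint on the sphere of radius [r]. By [G_le2], every slope
    [(G - m) / ell] at positive energy lies below every slope [(m - G) / (- ell)] at negative
    energy; [q0] separates the two families. If the energy is never negative on the sphere, a large
    penalty works up to [e] by compactness. *)
Lemma sphere_multiplier r e : 0 < e -> exists q, 0 < q /\
  forall u, kset u -> nH u = r -> G u <= m + e + q * energy u.
Proof.
move=> e0; have [Cl [Cl0 lC]] := energy_coercive.
have [[u1 [K1 n1 l1]]|nex] := pselect (exists u1, [/\ kset u1, nH u1 = r & energy u1 < 0]).
  pose A := [set x | x = 0 \/ exists u2, [/\ kset u2, nH u2 = r, 0 < energy u2 & x = (G u2 - m) / energy u2]].
  have A0 : A 0 by left.
  have ubA u : kset u -> nH u = r -> energy u < 0 -> ubound A ((m - G u) / - energy u).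
    move=> Ku nu' lu; have lu' : 0 < - energy u by rewrite oppr_gt0.
    move=> x [->|[u2 [K2 n2 l2 ->]]].
      by rewrite divr_ge0 ?(ltW lu')// subr_ge0 G_le1// ltW.
    by rewrite ler_pdivlMr// mulrAC ler_pdivrMr//; apply: G_le2 => //; rewrite nu' n2.
  have sA : has_sup A by split; [exists 0|exists ((m - G u1) / - energy u1); exact: ubA].
  pose q0 := sup A; have q00 : 0 <= q0 by apply: (ub_le_sup sA.2).
  have q0P u : kset u -> nH u = r -> G u <= m + q0 * energy u.
    move=> Ku nu'; have [lu|lu|lu] := ltgtP (energy u) 0.
    - have lu' : 0 < - energy u by rewrite oppr_gt0.
      have : q0 <= (m - G u) / - energy u by apply: ge_sup; [exists 0|exact: ubA].
      rewrite ler_pdivlMr//; lra.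
    - have : (G u - m) / energy u <= q0 by apply: (ub_le_sup sA.2); right; exists u.
      rewrite ler_pdivrMr//; lra.
    - by rewrite lu mulr0 addr0 G_le1// lu.
  (* A strictly positive multiplier is wanted; as the energy is at least [- Cl], adding [eta] to
     [q0] costs at most [e]. *)
  pose eta := e / (Cl + 1); have eta0 : 0 < eta by rewrite divr_gt0// ltr_wpDl.
  exists (q0 + eta); split; first by rewrite ltr_wpDl.
  move=> u Ku nu'; apply: le_trans (q0P u Ku nu') _.
  have h1 : - (Cl + 1) <= energy u.
    apply: le_trans (lC u Ku.1); have : 0 <= nu / 2 * nV u ^+ 2 by rewrite mulr_ge0 ?sqr_ge0// divr_ge0// ltW.
    lra.
  have h2 : eta * (Cl + 1) = e by rewrite /eta divfK// gt_eqF// ltr_wpDl.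
  have := ler_wpM2l (ltW eta0) h1; rewrite mulrN h2 mulrDl; lra.
have ge0 u : kset u -> nH u = r -> 0 <= energy u.
  by move=> Ku nu'; rewrite leNgt; apply/negP => lu; apply: nex; exists u.
apply: contrapT => /forallNP nq; have [C GC] := Gs ltr01.
(* The growing part of the penalty forces the energies of the counterexamples to 0. The fixed part
   [4 / nu] turns coercivity into twice the enstrophy, which beats the growth of [G] and bounds the
   sequence in [V]. *)
have /choice[u_ uP] : forall n : nat, exists u, [/\ kset u, nH u = r & m + e + (n.+1%:R + 4 / nu) * energy u < G u].
  move=> n; have p : 0 < n.+1%:R + 4 / nu by rewrite addr_gt0// divr_gt0.
  have /not_andP[//|/existsNP[u /not_implyP[Ku /not_implyP[un /negP]]]] := nq (n.+1%:R + 4 / nu).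
  by rewrite -ltNge => lt; exists u.
have Ku n : kset (u_ n) by case: (uP n).
pose B := `|C - m| + 4 * Cl / nu.
have uB n : nV (u_ n) ^+ 2 <= B.
  have [_ un lt] := uP n; have l0 := ge0 _ (Ku n) un.
  have h1 : 4 / nu * energy (u_ n) <= G (u_ n) - m.
    have : 0 <= n.+1%:R * energy (u_ n) by rewrite mulr_ge0.
    by move: lt; rewrite mulrDl; lra.
  have h2 := le_trans (ler_norm _) (GC _ (Ku n)); rewrite mul1r in h2.
  have p4 : 0 <= 4 / nu by rewrite divr_ge0// ltW.
  have h3 := ler_wpM2l p4 (lC _ (Ku n).1).
  have e1 : 4 / nu * (nu / 2 * nV (u_ n) ^+ 2 - Cl) = 2 * nV (u_ n) ^+ 2 - 4 * Cl / nu by field; rewrite gt_eqF.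
  rewrite e1 in h3; have := ler_norm (C - m); rewrite /B; lra.
have ur n : nV (u_ n) <= Num.sqrt B by apply: le_sqrt => //; exact: nrm_ge0.
have [k [u [l [nk Ku' _ [uu unn] _]]]] := kset_seq Ku ur.
have ur' n := ur (k n); have Ku_' n := Ku (k n).
have Gu := Ga Ku_' Ku' ur' uu.
have lu : energy u <= 0.
  apply: (energy_lsc (a := fun n => `|B + C - m| * n.+1%:R^-1) Ku_' Ku' ur' uu); last first.
    by rewrite -(mulr0 `|B + C - m|); apply: cvgM; [exact: cvg_cst|exact: cvg_harmonic].
  move=> n; have [_ un lt] := uP (k n); have l0 := ge0 _ (Ku (k n)) un.
  have h2 := le_trans (ler_norm _) (GC _ (Ku (k n))); rewrite mul1r in h2.
  have h3 := uB (k n); have h4 := ler_norm (B + C - m).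
  rewrite ler_pdivlMr// mulrC.
  have h5 : n.+1%:R <= (k n).+1%:R :> R by rewrite ler_nat ltnS.
  have h6 := ler_wpM2r l0 h5; have p4 : 0 <= 4 / nu by rewrite divr_ge0// ltW.
  have h7 := mulr_ge0 p4 l0; move: lt; rewrite mulrDl; lra.
have := G_le1 Ku' lu; apply/negP; rewrite -ltNge.
apply: lt_le_trans (_ : m + e <= _); first by rewrite ltrDl.
apply: (cvgr_to_ge Gu); near=> n; have [_ un lt] := uP (k n).
apply: le_trans (ltW lt); rewrite lerDl mulr_ge0//; first by rewrite addr_ge0// divr_ge0// ltW.
exact: ge0.
Unshelve. all: by end_near. Qed.

(** Counterexamples on spheres approaching radius [r] would be bounded in [V] because [q > 0] and
    the growth is sub-quadratic; their limit lies on the sphere itself and violates the bound there,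
    up to the extra [e]. *)
Lemma multiplier_open r q e : 0 <= r -> 0 < e -> 0 < q ->
  (forall u, kset u -> nH u = r -> G u <= m + e + q * energy u) ->
  exists2 d, 0 < d & forall u, kset u -> `|nH u ^+ 2 - r ^+ 2| < d -> G u <= m + 2 * e + q * energy u.
Proof.
move=> rp e0 q0 hq; apply: contrapT => /forall2NP nd; have [Cl [Cl0 lC]] := energy_coercive.
have q4 : 0 < q * nu / 4 by rewrite divr_gt0// mulr_gt0.
have [C GC] := Gs q4.
have /choice[u_ uP] : forall n : nat, exists u, [/\ kset u, `|nH u ^+ 2 - r ^+ 2| < n.+1%:R^-1 & m + 2 * e + q * energy u < G u].
  move=> n; have [|/existsNP[u /not_implyP[Ku /not_implyP[un /negP]]]] := nd n.+1%:R^-1.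
    by rewrite invr_gt0 ltr0n.
  by rewrite -ltNge => lt; exists u.
have Ku n : kset (u_ n) by case: (uP n).
pose B := `|C - m + q * Cl| / (q * nu / 4).
have uB n : nV (u_ n) ^+ 2 <= B.
  have [_ un lt] := uP n; have h1 := ler_wpM2l (ltW q0) (lC _ (Ku n).1).
  have h2 := le_trans (ler_norm _) (GC _ (Ku n)); have h3 := ler_norm (C - m + q * Cl).
  rewrite ler_pdivlMr// mulrC.
  have e1 : q * (nu / 2 * nV (u_ n) ^+ 2 - Cl) = 2 * (q * nu / 4 * nV (u_ n) ^+ 2) - q * Cl by field.
  rewrite e1 in h1; lra.
have ur n : nV (u_ n) <= Num.sqrt B by apply: le_sqrt => //; exact: nrm_ge0.
have [k [u [l [nk Ku' _ [uu unn] _]]]] := kset_seq Ku ur.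
have ur' n := ur (k n); have Ku_' n := Ku (k n).
have Gu := Ga Ku_' Ku' ur' uu.
have unr : nH u = r.
  have h1 := cvg_sqr unn.
  have h2 : nH (u_ (k n)) ^+ 2 @[n --> \oo] --> r ^+ 2.
    apply/subr_cvg0/norm_cvg0P; apply: (squeeze_cvgr _ (cvg_cst 0)); last exact: (@cvg_harmonic R).
    near=> n; rewrite normr_ge0 /=; have [_ lt _] := uP (k n); apply: ltW (lt_le_trans lt _).
    by rewrite lef_pV2 ?posrE// ler_nat ltnS.
  by apply/eqP; rewrite -(eqrXn2 (n := 2)) ?nrm_ge0//; apply/eqP; exact: (cvg_unique _ h1 h2).
have lu : energy u <= (G u - (m + 2 * e)) / q.
  apply: (energy_lsc (a := fun n => (G (u_ (k n)) - (m + 2 * e)) / q) Ku_' Ku' ur' uu).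
    move=> n; rewrite ler_pdivlMr// mulrC; have [_ _ lt] := uP (k n); lra.
  by apply: cvgM; [apply: cvgB => //; exact: cvg_cst|exact: cvg_cst].
rewrite ler_pdivlMr// in lu.
have := hq u Ku' unr; lra.
Unshelve. all: by end_near. Qed.

Definition tent (s d t : R) := Num.max 0 (d - `|t - s|).

Lemma tent_continuous s d : continuous (tent s d).
Proof.
move=> t; apply: (@continuous_max _ _ (fun=> 0) (fun t => d - `|t - s|) t); first exact: cst_continuous.
apply: cvgB; first exact: cvg_cst.
by apply: cvg_norm; apply: cvgB; [exact: cvg_id|exact: cvg_cst].
Qed.

Lemma tent_ge0 s d t : 0 <= tent s d t. Proof. by rewrite le_max lexx. Qed.

Lemma tent_gt0 s d t : (0 < tent s d t) = (`|t - s| < d).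
Proof. by rewrite lt_max ltxx/= subr_gt0. Qed.

(** The multipliers of the spheres are glued over the compact interval [[0, r0^2]] by a partition of
    unity. Continuity, positivity and boundedness make [lam] an admissible derivative in the energy
    inequality. *)
Lemma multiplier e : 0 < e -> exists lam : R -> R, [/\ continuous lam, forall t, 0 < lam t,
  exists B, forall t, lam t <= B &
  forall u, kset u -> G u <= m + e + lam (nH u ^+ 2) * energy u].
Proof.
move=> e0; have e1 : 0 < e / 2 by rewrite divr_gt0.
pose J := `[0, r0 ^+ 2]%classic.
have /choice[q qP] : forall s : R, exists q : R * R, [/\ 0 < q.1, 0 < q.2 & J s ->
    forall u, kset u -> `|nH u ^+ 2 - s| < q.2 -> G u <= m + e + q.1 * energy u].
  move=> s; have [Js|] := pselect (J s); last by exists (1, 1).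
  have s0 : 0 <= s by move: Js; rewrite /J /= in_itv /= => /andP[].
  have [q [q0 hq]] := sphere_multiplier (Num.sqrt s) e1.
  have [d d0 hd] := multiplier_open (sqrtr_ge0 s) e1 q0 hq.
  exists (q, d); split => //= _ u Ku; have := hd u Ku; rewrite sqr_sqrtr//.
  by have -> : 2 * (e / 2) = e by field.
have : compact J by exact: segment_compact.
rewrite compact_cover => /(_ R J (fun s => [set t | `|t - s| < (q s).2])).
have oB s : open [set t | `|t - s| < (q s).2].
  rewrite (_ : [set t | _] = ball s (q s).2); first by apply: ball_open; case: (qP s).
  by apply/seteqP; split => t; rewrite /ball /= distrC.
case=> [s _|t Jt|D0 DJ0 cJ0]; first exact: oB.
  by exists t => //=; rewrite subrr normr0; case: (qP t).
pose D : seq R := finmap.enum_fset D0.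
have DJ s : s \in D -> J s by move=> sD; have := DJ0 s sD; rewrite inE.
have cJ t : J t -> exists2 s, s \in D & `|t - s| < (q s).2.
  by move=> /cJ0[s sD ts]; exists s.
(* Retraction onto the interval: it extends the partition of unity to all reals, keeping the sum of
   the tents positive everywhere. *)
pose cl t := Num.min (Num.max 0 t) (r0 ^+ 2).
have clJ t : J (cl t).
  by rewrite /J /= in_itv /= /cl le_min le_max lexx/= sqr_ge0 ge_min lexx orbT.
have cc : continuous cl.
  move=> t; apply: continuous_min; last exact: cst_continuous.
  by apply: continuous_max; [exact: cst_continuous|exact: cvg_id].
pose w s t := tent s (q s).2 (cl t).
have cw s : continuous (w s) by move=> t; apply: (continuous_comp (cc t)); exact: tent_continuous.
pose N t := \sum_(s <- D) (q s).1 * w s t; pose W t := \sum_(s <- D) w s t.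
have W0 t : 0 < W t.
  have [s Ds st] := cJ _ (clJ t).
  rewrite /W (big_rem s) //= ltr_pwDl ?tent_gt0//; first by apply: sumr_ge0 => i _; exact: tent_ge0.
exists (fun t => N t / W t); split.
- move=> t; apply: cvgM.
    apply: continuous_bigsum => s {}t; apply: cvgM; [exact: cvg_cst|exact: cw].
  by apply: cvgV; [rewrite gt_eqF|exact: continuous_bigsum].
- move=> t; rewrite divr_gt0//.
  have [s Ds st] := cJ _ (clJ t); have [q0 _ _] := qP s.
  rewrite /N (big_rem s) //= ltr_pwDl ?mulr_gt0 ?tent_gt0//; apply: sumr_ge0 => i _.
  by rewrite mulr_ge0 ?tent_ge0//; case: (qP i) => /ltW.
- exists (\sum_(s <- D) (q s).1) => t; rewrite ler_pdivrMr// mulr_suml.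
  rewrite /N [leLHS]big_seq [leRHS]big_seq; apply: ler_sum => s Ds; apply: ler_wpM2l; first by apply: ltW; case: (qP s).
  by rewrite /W (big_rem s)//= lerDl sumr_ge0// => i _; exact: tent_ge0.
move=> u Ku; have Ju : J (nH u ^+ 2).
  by rewrite /J /= in_itv /= sqr_ge0 lerXn2r ?nnegrE ?nrm_ge0//; case: Ku.
have clu : cl (nH u ^+ 2) = nH u ^+ 2.
  by move: Ju; rewrite /J /= in_itv /= /cl => /andP[/max_r -> /min_l].
rewrite -(ler_pM2r (W0 (nH u ^+ 2))) mulrDl mulrAC divfK ?gt_eqF//.
rewrite /W /N !mulr_sumr mulr_suml -big_split /=.
rewrite big_seq [leRHS]big_seq; apply: ler_sum => s Ds.
rewrite /w clu; have [w0|] := eqVneq (tent s (q s).2 (nH u ^+ 2)) 0; first by rewrite w0 !mulr0 mul0r addr0.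
rewrite neq_lt ltNge tent_ge0/= => w0; have [_ _ qs] := qP s.
have := qs (DJ s Ds) u Ku; rewrite -tent_gt0 => /(_ w0) Gu.
rewrite [leRHS](_ : _ = (m + e + (q s).1 * energy u) * tent s (q s).2 (nH u ^+ 2)); last by ring.
by rewrite ler_pM2r.
Qed.

End multiplier.
End control.

Section attainment.
Context {R : realType} {E : lmodType R}.
Variables (H V : set E) (h g : E -> E -> R).
Hypothesis S : hilbert_pair H V h g.
Let iH := hp_H S.
Let iV := hp_V S.
Let VH := hp_sub S.
Notation nH := (nrm h).
Notation nV := (nrm g).
Variables (r0 nu : R) (f : E -> R).
Hypotheses (r0_ge0 : 0 <= r0) (nu0 : 0 < nu) (fb : bounded_lin V g f).
Notation K := (kset V h r0).
Notation ell := (energy g nu f).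
Notation mix := (mixed V h g r0 nu f).

Definition tight t1 t2 u1 u2 :=
  [/\ t1 = 1, t2 = 0, u1 = u2, K u1 & ell u1 <= 0] \/
  [/\ 0 < t1 < 1 /\ t2 = 1 - t1, K u1 /\ K u2, nH u1 = nH u2,
      ell u1 < 0 < ell u2 & t1 * ell u1 + t2 * ell u2 = 0].

Lemma tight_mixed t1 t2 u1 u2 : tight t1 t2 u1 u2 -> mix t1 t2 u1 u2.
Proof.
case=> [[-> -> <- Ku lu]|[[/andP[t0 t1'] ->] K12 n12 _ s0]]; first exact: mixed1.
by split => //; [rewrite !ltW ?subr_gt0|rewrite addrC subrK|rewrite s0].
Qed.

Lemma mixed_swap t1 t2 u1 u2 : mix t1 t2 u1 u2 -> mix t2 t1 u2 u1.
Proof.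
by case=> [[? ?] s [? ?] n l]; split => //; rewrite addrC.
Qed.

Section objective.
Variable (G : E -> R).
Notation obj t1 t2 u1 u2 := (t1 * G u1 + t2 * G u2).

(** If the point of lower energy has the larger value of [G], it alone does better. Otherwise weight
    is moved to the other point, which raises the mean, until the mean energy is exactly 0 or that
    point can stand alone. *)
Lemma mixed_dominated t1 t2 u1 u2 : mix t1 t2 u1 u2 ->
  exists s1 s2 v1 v2, tight s1 s2 v1 v2 /\ obj t1 t2 u1 u2 <= obj s1 s2 v1 v2.
Proof.
wlog l12 : t1 t2 u1 u2 / ell u1 <= ell u2.
  move=> hw mx; have [l12|l21] := leP (ell u1) (ell u2); first exact: hw.
  have [s1 [s2 [v1 [v2 [tg le]]]]] := hw _ _ _ _ (ltW l21) (mixed_swap mx).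
  by exists s1, s2, v1, v2; split => //; rewrite addrC.
move=> [[t10 t20] t1E [K1 K2] n12 le0].
have tE : t1 = 1 - t2 by rewrite -t1E addrK.
have single u : K u -> ell u <= 0 -> obj t1 t2 u1 u2 <= G u ->
    exists s1 s2 v1 v2, tight s1 s2 v1 v2 /\ obj t1 t2 u1 u2 <= obj s1 s2 v1 v2.
  by move=> Ku lu le; exists 1, 0, u, u; split; [left|rewrite mul1r mul0r addr0].
have l1 : ell u1 <= 0.
  have : ell u1 <= t1 * ell u1 + t2 * ell u2 by rewrite tE; nra.
  by move=> /le_trans; apply.
have [G21|G12] := leP (G u2) (G u1); first by apply: (single u1) => //; rewrite tE; nra.
have [l2|l2] := leP (ell u2) 0; first by apply: (single u2) => //; rewrite tE; nra.
have [l1'|l1'] := eqVneq (ell u1) 0.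
  apply: (single u1) => //; have : t2 = 0; last by rewrite tE => ->; lra.
  by apply/eqP; rewrite eq_le t20 andbT -(pmulr_lle0 _ l2); move: le0; rewrite l1' mulr0 add0r.
have {}l1 : ell u1 < 0 by rewrite lt_neqAle l1'.
set x := ell u1 in l1 l1' le0 *; set y := ell u2 in l2 le0 *.
have yx : 0 < y - x by rewrite subr_gt0; exact: lt_trans l2.
exists (y / (y - x)), (- x / (y - x)), u1, u2; split.
  right; split => //.
  - rewrite divr_gt0//= ltr_pdivrMr// mul1r; split; first by lra.
    by field; rewrite gt_eqF.
  - by rewrite l1 l2.
  - by rewrite -/x -/y; field; rewrite gt_eqF.
have t2x : t2 <= - x / (y - x) by rewrite ler_pdivlMr//; move: le0; rewrite tE; lra.
have -> : y / (y - x) = 1 - (- x / (y - x)) by field; rewrite gt_eqF.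
by rewrite tE; nra.
Qed.

Hypotheses (Ga : admissible V h g r0 G) (Gs : subquadratic V h g r0 G).

Lemma f_0 : f 0 = 0.
Proof.
have := fb.1 0 0 0 0 (in_0 iV) (in_0 iV).
by rewrite !scale0r !mul0r !addr0.
Qed.

Lemma kset0 : K 0.
Proof. by split; [exact: (in_0 iV)|rewrite (nrm0 iH)]. Qed.

Lemma energy0 : ell 0 = 0.
Proof. by rewrite /energy (nrm0 iV) expr0n mulr0 f_0 subr0. Qed.

Lemma mixed_enstrophy : exists B, 0 <= B /\ forall t1 t2 u1 u2, mix t1 t2 u1 u2 ->
  t1 * nV u1 ^+ 2 + t2 * nV u2 ^+ 2 <= B.
Proof.
have [Cl [Cl0 lC]] := energy_coercive nu0 fb; exists (2 * Cl / nu).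
split; first by rewrite divr_ge0 ?mulr_ge0// ltW.
move=> t1 t2 u1 u2 [[t10 t20] t1E [K1 K2] _ le0].
have h1 := ler_wpM2l t10 (lC _ K1.1); have h2 := ler_wpM2l t20 (lC _ K2.1).
have tE : t1 = 1 - t2 by rewrite -t1E addrK.
rewrite ler_pdivlMr//; rewrite tE in h1 h2 le0 *; lra.
Qed.

(** A maximizing sequence has bounded weighted enstrophy only. Either both points stay bounded in
    [V] along a subsequence and the limit is a mixed state, or the second point escapes, its weight
    and its contribution vanish, and the limit is a single point. *)
Lemma mixed_max : exists s1 s2 v1 v2, mix s1 s2 v1 v2 /\
  forall t1 t2 u1 u2, mix t1 t2 u1 u2 -> obj t1 t2 u1 u2 <= obj s1 s2 v1 v2.
Proof.
have [B [B0 BP]] := mixed_enstrophy; have [C GC] := Gs ltr01.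
have [Cl [Cl0 lC]] := energy_coercive nu0 fb.
pose A := [set x | exists t1 t2 u1 u2, mix t1 t2 u1 u2 /\ x = obj t1 t2 u1 u2].
have mx0 : mix 1 0 0 0 by apply: mixed1; [exact: kset0|rewrite energy0].
have sA : has_sup A.
  split; first by exists (obj 1 0 0 0), 1, 0, 0, 0.
  exists (B + C) => _ [t1 [t2 [u1 [u2 [mx ->]]]]].
  have [[t10 t20] t1E [K1 K2] _ le0] := mx.
  have h1 := ler_wpM2l t10 (le_trans (ler_norm _) (GC _ K1)).
  have h2 := ler_wpM2l t20 (le_trans (ler_norm _) (GC _ K2)).
  have := BP _ _ _ _ mx; have tE : t1 = 1 - t2 by rewrite -t1E addrK.
  rewrite tE in h1 h2 *; lra.
pose M := sup A.
suff [s1 [s2 [v1 [v2 [mv le]]]]] : exists s1 s2 v1 v2, mix s1 s2 v1 v2 /\ M <= obj s1 s2 v1 v2.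
  exists s1, s2, v1, v2; split => // t1 t2 u1 u2 mu; apply: le_trans le.
  by apply: (ub_le_sup sA.2); exists t1, t2, u1, u2.
have /choice[p pP] : forall n : nat, exists p : R * E * E,
    [/\ mix (1 - p.1.1) p.1.1 p.1.2 p.2, p.1.1 <= 1 / 2 & M - n.+1%:R^-1 < obj (1 - p.1.1) p.1.1 p.1.2 p.2].
  move=> n; have n0 : 0 < n.+1%:R^-1 :> R by rewrite invr_gt0.
  have [_ [t1 [t2 [u1 [u2 [mx ->]]]]] lt] := sup_adherent n0 sA.
  have [_ t1E _ _ _] := mx.
  (* The points are ordered so that the second weight is at most 1/2; the first weight is then at
     least 1/2, and the first point has enstrophy at most [2 B]. *)
  have [t2h|t2h] := leP t2 (1 / 2).
    by exists (t2, u1, u2); rewrite /= (_ : 1 - t2 = t1) //; rewrite -t1E addrK.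
  exists (t1, u2, u1); rewrite /= (_ : 1 - t1 = t2); last by rewrite -t1E addrAC subrr add0r.
  by split; [exact: mixed_swap|lra|rewrite (addrC (t2 * _)); exact: lt].
pose P (k : nat -> nat) := forall n, (n <= k n)%N.
have comp k j : P k -> P j -> P (k \o j) by move=> hk hj n; exact: leq_trans (hj n) (hk _).
pose T n := (p n).1.1; pose U1 n := (p n).1.2; pose U2 n := (p n).2.
have mxn n : mix (1 - T n) (T n) (U1 n) (U2 n) by case: (pP n).
have T0 n : 0 <= T n by have [[_ t20] _ _ _ _] := mxn n.
have Th n : T n <= 1 / 2 by case: (pP n).
have K1 n : K (U1 n) by have [_ _ [? _] _ _] := mxn n.
have K2 n : K (U2 n) by have [_ _ [_ ?] _ _] := mxn n.
have e1 n : nV (U1 n) <= Num.sqrt (2 * B).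
  apply: le_sqrt; first exact: nrm_ge0.
  have := BP _ _ _ _ (mxn n); have := Th n; have := T0 n.
  have := sqr_ge0 (nV (U1 n)); have := sqr_ge0 (nV (U2 n)).
  set x := nV (U1 n) ^+ 2; set y := nV (U2 n) ^+ 2; set t := T n; nra.
have [k1 [v1 [l1 [nk1 Kv1 vl1 [u1c n1c] l1c]]]] := kset_seq S K1 e1.
have [k2 [s [nk2 sc]]] : exists (k : nat -> nat) (s : R), P k /\ T (k1 (k n)) @[n --> \oo] --> s.
  by apply: (@real_subseq R (T \o k1) (1 / 2)) => n /=; rewrite ger0_norm//.
have objc (k : nat -> nat) (l : R) : P k ->
    obj (1 - T (k n)) (T (k n)) (U1 (k n)) (U2 (k n)) @[n --> \oo] --> l -> M <= l.
  move=> nk ol; have Mc : M - (k n).+1%:R^-1 @[n --> \oo] --> M - 0.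
    apply: cvgB; first exact: cvg_cst.
    exact: (cvg_subseq (@cvg_harmonic R) nk).
  rewrite subr0 in Mc; apply: (ler_cvg_to Mc ol); near=> n.
  by apply: ltW; case: (pP (k n)).
have [[r rP]|nr] := pselect (exists r, forall N, exists n, (N <= n)%N /\ nV (U2 (k1 (k2 n))) <= r).
  have [k3 k3P] := subseq_choice rP.
  have [k4 [v2 [l2 [nk4 Kv2 vl2 [u2c n2c] l2c]]]] := kset_seq S (fun n => K2 (k1 (k2 (k3 n)))) (fun n => (k3P n).2).
  have nk34 : P (k3 \o k4) by apply: comp => // n; case: (k3P n).
  pose k := k1 \o (k2 \o (k3 \o k4)).
  have nk234 : P (k2 \o (k3 \o k4)) by exact: comp.
  have nk : P k by exact: comp.
  have sc' : T (k n) @[n --> \oo] --> s by apply: (cvg_subseq sc nk34).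
  have u1c' : nH (U1 (k n) - v1) @[n --> \oo] --> 0 by apply: (cvg_subseq u1c nk234).
  have n1c' : nH (U1 (k n)) @[n --> \oo] --> nH v1 by apply: (cvg_subseq n1c nk234).
  have l1c' : nV (U1 (k n)) @[n --> \oo] --> l1 by apply: (cvg_subseq l1c nk234).
  have r2 n : nV (U2 (k n)) <= r by exact: (k3P (k4 n)).2.
  have G1 := Ga (fun n => K1 (k n)) Kv1 (fun n => e1 (k n)) u1c'.
  have G2 := Ga (fun n => K2 (k n)) Kv2 r2 u2c.
  have f1 := f_cvg S fb (fun n => K1 (k n)) Kv1 (fun n => e1 (k n)) u1c'.
  have f2 := f_cvg S fb (fun n => K2 (k n)) Kv2 r2 u2c.
  have s1c : 1 - T (k n) @[n --> \oo] --> 1 - s by apply: cvgB => //; exact: cvg_cst.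
  have s0 : 0 <= s by apply: (cvgr_to_ge sc'); near=> n; exact: T0.
  have sh : s <= 1 / 2 by apply: (cvgr_to_le sc'); near=> n; exact: Th.
  have c12 : (1 - T (k n)) * ell (U1 (k n)) + T (k n) * ell (U2 (k n)) @[n --> \oo] -->
      (1 - s) * (nu * l1 ^+ 2 - f v1) + s * (nu * l2 ^+ 2 - f v2).
    apply: cvgD; apply: cvgM => //; apply: cvgB => //; (apply: cvgM; first exact: cvg_cst); exact: cvg_sqr.
  exists (1 - s), s, v1, v2; split; last first.
    apply: (objc k _ nk); apply: cvgD; exact: cvgM.
  split => //; [split => //; lra|by rewrite subrK| |].
    have En : (fun n => nH (U1 (k n))) = (fun n => nH (U2 (k n))).
      by apply/funext => n; have [_ _ _ ->] := mxn (k n).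
    by rewrite En in n1c'; exact: (cvg_unique _ n1c' n2c).
  apply: le_trans (_ : (1 - s) * (nu * l1 ^+ 2 - f v1) + s * (nu * l2 ^+ 2 - f v2) <= _).
    have sq v l : nV v <= l -> nu * nV v ^+ 2 - f v <= nu * l ^+ 2 - f v.
      move=> vl; rewrite lerD2r ler_pM2l// lerXn2r ?nnegrE ?nrm_ge0//; exact: le_trans (nrm_ge0 _ _) vl.
    by rewrite /energy; apply: lerD; apply: ler_wpM2l; [lra|exact: sq|exact: s0|exact: sq].
  apply: (cvgr_to_le c12); near=> n.
  by have [_ _ _ _] := mxn (k n).
(* With no bounded subsequence, the enstrophy of the second point tends to infinity; since its
   product with the weight is at most [B], the weight tends to 0. *)
have inf r : exists N, forall n, (N <= n)%N -> r < nV (U2 (k1 (k2 n))).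
  apply: contrapT => /forallNP nN; apply: nr; exists r => N.
  by have := nN N => /existsNP[n /not_implyP[Nn /negP]]; rewrite -leNgt => h1; exists n.
pose k := k1 \o k2; have nk : P k by exact: comp.
have TB n : T n * nV (U2 n) ^+ 2 <= B.
  apply: le_trans (BP _ _ _ _ (mxn n)); rewrite lerDr mulr_ge0 ?sqr_ge0// subr_ge0.
  by apply: le_trans (Th n) _; lra.
have small e : 0 < e -> exists N, forall n, (N <= n)%N -> T (k n) <= e.
  move=> e0; have [N NP] := inf (Num.sqrt (B / e)); exists N => n /NP lt.
  have : B / e <= nV (U2 (k n)) ^+ 2.
    by rewrite leNgt; apply/negP => /ltW /(le_sqrt (nrm_ge0 _ _)); rewrite leNgt lt.
  rewrite ler_pdivrMr// => h1; have h2 := le_trans (TB (k n)) h1.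
  have n2 : 0 < nV (U2 (k n)) ^+ 2 by rewrite exprn_gt0//; exact: le_lt_trans (sqrtr_ge0 _) lt.
  by rewrite -(ler_pM2r n2) [leRHS]mulrC.
have T0c : T (k n) @[n --> \oo] --> 0.
  apply/cvgrPdist_le => e /small[N NP]; exists N => // n /= /NP.
  by rewrite sub0r normrN ger0_norm.
have u1c' : nH (U1 (k n) - v1) @[n --> \oo] --> 0 by apply: (cvg_subseq u1c nk2).
have G1 := Ga (fun n => K1 (k n)) Kv1 (fun n => e1 (k n)) u1c'.
(* Sub-quadratic growth with coefficient [d] bounds this by [d B + T Cd]: the first term is small by
   the choice of [d], the second because the weights tend to 0. *)
have G2 : T (k n) * G (U2 (k n)) @[n --> \oo] --> 0.
  apply/cvgrPdist_le => e e0; pose d := e / 2 / (B + 1).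
  have d0 : 0 < d by rewrite !divr_gt0// ltr_wpDl.
  have [Cd CdP] := Gs d0; pose d' := e / 2 / (`|Cd| + 1).
  have d'0 : 0 < d' by rewrite !divr_gt0// ltr_wpDl.
  have [N NP] := small _ d'0; exists N => // n /= Nn; rewrite sub0r normrN normrM ger0_norm//.
  have h1 := ler_wpM2l (T0 (k n)) (CdP _ (K2 (k n))); have h2 := TB (k n).
  have h3 := NP n Nn; apply: le_trans h1 _; rewrite mulrDr mulrCA.
  have h4 := ler_wpM2l (ltW d0) h2.
  have h5 : d * (B + 1) = e / 2 by rewrite /d divfK// gt_eqF// ltr_wpDl.
  have h6 : d' * (`|Cd| + 1) = e / 2 by rewrite /d' divfK// gt_eqF// ltr_wpDl.
  have h7 : T (k n) * Cd <= d' * (`|Cd| + 1).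
    apply: le_trans (_ : T (k n) * (`|Cd| + 1) <= _); last by rewrite ler_wpM2r// addr_ge0.
    by rewrite ler_wpM2l//; have := ler_norm Cd; lra.
  by rewrite mulrDr mulr1 in h5; lra.
(* The escaping point has energy at least [- Cl], so the first point has energy at most [2 Cl T],
   which tends to 0; lower semicontinuity concludes. *)
have lv1 : ell v1 <= 0.
  apply: (energy_lsc S nu0 fb (a := fun n => 2 * Cl * T (k n)) (fun n => K1 (k n)) Kv1 (fun n => e1 (k n)) u1c').
    move=> n; have [_ _ _ _ le0] := mxn (k n).
    have := lC _ (K2 (k n)).1; have := sqr_ge0 (nV (U2 (k n))); have := Th (k n); have := T0 (k n).
    move: le0; set x := ell (U1 _); set y := ell (U2 _); set z := _ ^+ 2; set t := T _ => le0 t0 th z0 yz.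
    have nz : 0 <= nu / 2 * z by rewrite mulr_ge0// divr_ge0// ltW.
    have [x0|x0] := leP x 0; first by apply: le_trans x0 _; rewrite mulr_ge0// mulr_ge0.
    have h1 : t * (- Cl) <= t * y by rewrite ler_wpM2l//; lra.
    have h2 : x / 2 <= (1 - t) * x by rewrite mulrC ler_wpM2r ?(ltW x0)//; lra.
    lra.
  by rewrite -(mulr0 (2 * Cl)); apply: cvgM => //; exact: cvg_cst.
exists 1, 0, v1, v1; split; first exact: mixed1.
rewrite mul1r mul0r addr0; apply: (objc k _ nk).
rewrite -[G v1]addr0; apply: cvgD => //; rewrite -[G v1]mul1r -{2}(subr0 1).
by apply: cvgM => //; apply: cvgB => //; exact: cvg_cst.
Unshelve. all: by end_near. Qed.

End objective.
End attainment.

(** * Hahn-Banach theorem for a sublinear form on a linear subset *)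

Section hahn_banach.
Context {R : realType} {E : lmodType R}.
Variable A : set E.
Hypotheses (A0 : A 0) (AD : forall x y, A x -> A y -> A (x + y))
  (AZ : forall a x, A x -> A (a *: x)).

Record sublinear (s : E -> R) : Prop := Sublinear {
  sl_D : forall x y, A x -> A y -> s (x + y) <= s x + s y;
  sl_Z : forall a x, 0 < a -> A x -> s (a *: x) <= a * s x }.

Let AN x : A x -> A (- x). Proof. by move=> /(AZ (-1)); rewrite scaleN1r. Qed.

Lemma sublinear0 s : sublinear s -> 0 <= s 0.
Proof. by move=> sl; have := sl_D sl A0 A0; rewrite addr0; lra. Qed.

Lemma sublinear_ge s x : sublinear s -> A x -> - s (- x) <= s x.
Proof.
move=> sl Ax; have := sl_D sl Ax (AN Ax); rewrite subrr; have := sublinear0 sl; lra.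
Qed.

(** Common scheme for three infima: lower bounds of chains in Zorn's lemma, the perturbation along
    one direction in the proof of linearity, and the sublinear form of the dual problem. The lower
    bound [b] keeps the infimum finite. *)
Lemma sublinear_inf (T : Type) (D : set T) (F : T -> E -> R) (b : E -> R) : D !=set0 ->
  (forall i x, D i -> A x -> b x <= F i x) ->
  (forall i j x y, D i -> D j -> A x -> A y -> exists2 k, D k & F k (x + y) <= F i x + F j y) ->
  (forall i a x, D i -> 0 < a -> A x -> exists2 k, D k & F k (a *: x) <= a * F i x) ->
  sublinear (fun x => inf [set F i x | i in D]) /\
  forall i x, D i -> A x -> inf [set F i x | i in D] <= F i x.
Proof.
move=> [i0 Di0] bF FD FZ.
have hi x : A x -> has_inf [set F i x | i in D].
  by move=> Ax; split; [exists (F i0 x), i0|exists (b x) => _ [i Di <-]; exact: bF].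
have le i x : D i -> A x -> inf [set F i x | i in D] <= F i x.
  by move=> Di Ax; apply: (ge_inf (hi x Ax).2); exists i.
split => //; split=> [x y Ax Ay|a x a0 Ax].
  apply/ler_addgt0Pr => e e0; have e2 : 0 < e / 2 by rewrite divr_gt0.
  have [_ [i Di <-] hx] := inf_adherent e2 (hi x Ax).
  have [_ [j Dj <-] hy] := inf_adherent e2 (hi y Ay).
  have [k Dk kP] := FD _ _ _ _ Di Dj Ax Ay.
  apply: le_trans (le _ _ Dk (AD Ax Ay)) _; apply: le_trans kP _; lra.
apply/ler_addgt0Pr => e e0; have ea : 0 < e / a by rewrite divr_gt0.
have [_ [i Di <-] hx] := inf_adherent ea (hi x Ax).
have [k Dk kP] := FZ _ _ _ Di a0 Ax.
apply: le_trans (le _ _ Dk (AZ a Ax)) _; apply: le_trans kP _.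
by move: hx => /ltW; rewrite -(ler_pM2l a0) mulrDr mulrCA divff ?gt_eqF// mulr1.
Qed.

(** A minimal sublinear form [l] below [q] is linear: the infimum over [a >= 0] of
    [l (z + a x) - a l x] is again sublinear and below [l], hence equal to it, and [a = 1] gives
    superadditivity. *)
Lemma hahn_banach q : sublinear q -> exists l : E -> R,
  [/\ forall x y, A x -> A y -> l (x + y) = l x + l y,
      forall a x, A x -> l (a *: x) = a * l x & forall x, A x -> l x <= q x].
Proof.
move=> slq; pose T := {s : E -> R | sublinear s /\ forall x, A x -> s x <= q x}.
pose rel_ (s t : T) := `[< forall x, A x -> sval t x <= sval s x >].
have qT : T by exists q.
have [||Q Qtot|t tmin] := @ZL_preorder T qT rel_.
- by move=> s; apply/asboolP.
- move=> r s t /asboolP rs /asboolP st; apply/asboolP => x Ax.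
  exact: le_trans (st x Ax) (rs x Ax).
- have [[s0 Qs0]|Q0] := pselect (Q !=set0); last first.
    by exists qT => s Qs; exfalso; apply: Q0; exists s.
  have bq (s : T) x : A x -> - q (- x) <= sval s x.
    move=> Ax; have [sl sq] := svalP s; apply: le_trans (sublinear_ge sl Ax).
    by rewrite lerN2; apply: sq; exact: AN.
  have [||||sl le] := @sublinear_inf T Q (fun s => sval s) (fun x => - q (- x)).
  + by exists s0.
  + by move=> s x _; exact: bq.
  + move=> s t x y Qs Qt Ax Ay; have [/asboolP h|/asboolP h] := Qtot _ _ Qs Qt.
      exists t => //; apply: le_trans (sl_D (svalP t).1 Ax Ay) _; rewrite lerD2r; exact: h.
    exists s => //; apply: le_trans (sl_D (svalP s).1 Ax Ay) _; rewrite lerD2l; exact: h.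
  + by move=> s a x Qs a0 Ax; exists s => //; exact: (sl_Z (svalP s).1).
  have tq x : A x -> inf [set sval s x | s in Q] <= q x.
    by move=> Ax; apply: le_trans (le _ _ Qs0 Ax) ((svalP s0).2 x Ax).
  pose t : T := exist _ _ (conj sl tq).
  exists t => s Qs; apply/asboolP => x Ax /=; exact: le.
have [slt tq] := svalP t; set l := sval t in slt tq.
have superadd x y : A x -> A y -> l y + l x <= l (y + x).
  move=> Ax Ay; pose F (a : R) z := l (z + a *: x) - a * l x.
  have [||||sl le] := @sublinear_inf R [set a | 0 <= a] F (fun z => - l (- z)).
  - by exists 0 => /=.
  - move=> a z /= a0 Az; rewrite /F; have Aax := AZ a Ax.
    have := sl_D slt (AD Az Aax) (AN Az); rewrite addrAC subrr add0r.
    have [->|/negbTE an0] := eqVneq a 0; first by rewrite !scale0r mul0r addr0 subr0; have := sublinear0 slt; lra.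
    have ap : 0 < a by rewrite lt_def an0.
    have ai : 0 < a^-1 by rewrite invr_gt0.
    have := sl_Z slt ai Aax; rewrite scalerA mulVf ?an0// scale1r.
    rewrite -(ler_pM2l ap) mulrA divff ?an0// mul1r; lra.
  - move=> a b z z' /= a0 b0 Az Az'; exists (a + b); first exact: addr_ge0.
    rewrite /F scalerDl addrACA mulrDl.
    have := sl_D slt (AD Az (AZ a Ax)) (AD Az' (AZ b Ax)); lra.
  - move=> a c z /= a0 c0 Az; exists (c * a); first by rewrite mulr_ge0// ltW.
    rewrite /F -scalerA -scalerDr -mulrA mulrBr; have := sl_Z slt c0 (AD Az (AZ a Ax)); lra.
  have sq z : A z -> inf [set F a z | a in [set a | 0 <= a]] <= l z.
    move=> Az; have := le 0 z (lexx _) Az; rewrite /F scale0r mul0r addr0 subr0; exact.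
  have sq' z : A z -> inf [set F a z | a in [set a | 0 <= a]] <= q z.
    by move=> Az; apply: le_trans (sq z Az) (tq z Az).
  pose s : T := exist _ _ (conj sl sq').
  have /tmin/asboolP/(_ y Ay) : rel_ t s by apply/asboolP.
  move=> /le_trans /(_ (le 1 y ler01 Ay)); rewrite /F scale1r mul1r -/l; lra.
have add x y : A x -> A y -> l (x + y) = l x + l y.
  by move=> Ax Ay; apply/eqP; rewrite eq_le (sl_D slt)// superadd.
have l0 : l 0 = 0 by have := add 0 0 A0 A0; rewrite addr0; lra.
have lN x : A x -> l (- x) = - l x.
  by move=> Ax; have := add x (- x) Ax (AN Ax); rewrite subrr l0; lra.
have lpos a x : 0 < a -> A x -> l (a *: x) = a * l x.
  move=> a0 Ax; apply/eqP; rewrite eq_le (sl_Z slt)//=.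
  have ai : 0 < a^-1 by rewrite invr_gt0.
  have := sl_Z slt ai (AZ a Ax); rewrite scalerA mulVf ?gt_eqF// scale1r.
  by rewrite -(ler_pM2l a0) mulrA divff ?gt_eqF// mul1r.
exists l; split => // a x Ax; have [a0|a0|->] := ltgtP a 0; last by rewrite scale0r mul0r.
- have na : 0 < - a by rewrite oppr_gt0.
  by have := lpos _ _ na Ax; rewrite scaleNr (lN _ (AZ a Ax)) mulNr => /oppr_inj.
- exact: lpos.
Qed.

End hahn_banach.

(** * Cylindrical functionals *)

Section rV_calculus.
Context {R : realType}.

Lemma nbhs_rV m (x : 'rV[R]_m) (P : set 'rV[R]_m) : nbhs x P ->
  exists2 d, 0 < d & forall z : 'rV[R]_m, (forall j, `|z 0 j - x 0 j| < d) -> P z.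
Proof.
move=> /nbhs_ballP[d /= d0 dP]; exists d => // z zx; apply: dP.
by split => // i j; rewrite (ord1 i) /ball /= distrC.
Qed.

Lemma continuous_rV m (D : 'rV[R]_m -> R) (x : 'rV[R]_m) e : continuous D -> 0 < e ->
  exists2 d, 0 < d & forall z : 'rV[R]_m, (forall j, `|z 0 j - x 0 j| < d) -> `|D z - D x| <= e.
Proof.
move=> /(_ x)/cvgrPdist_le /[apply] /nbhs_rV[d d0 dP]; exists d => // z /dP.
by rewrite distrC.
Qed.

Lemma is_derive_line m (psi : 'rV[R]_m -> R) (v : 'rV[R]_m) : (forall x, derivable psi x v) ->
  forall z (t : R), is_derive t 1 (fun s : R => psi (z + s *: v)) ('D_v psi (z + t *: v)).
Proof.
move=> dp z t.
have E : (fun s : R => s^-1 *: ((fun s : R => psi (z + s *: v)) (s *: 1 + t) - psi (z + t *: v))) =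
    (fun s => s^-1 *: (psi (s *: v + (z + t *: v)) - psi (z + t *: v))).
  apply/funext => s; congr (_ *: (psi _ - _)).
  by rewrite [s *: 1]mulr1 scalerDl addrCA.
apply: DeriveDef.
  rewrite /derivable E; exact: dp.
by rewrite /derive E.
Qed.

Lemma derive_increment m (psi : 'rV[R]_m -> R) (v : 'rV[R]_m) z (t : R) :
  (forall x, derivable psi x v) ->
  exists2 c : R, `|c| <= `|t| & psi (z + t *: v) - psi z = t * 'D_v psi (z + c *: v).
Proof.
move=> dp; have dl := is_derive_line dp z.
have cl (s : R) : {for s, continuous (fun s : R => psi (z + s *: v))}.
  by apply: differentiable_continuous; apply/derivable1_diffP; case: (dl s).
have z0 : psi z = psi (z + 0 *: v) by rewrite scale0r addr0.
have [t0|/ltW t0] := leP 0 t.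
  have [|c ci E] := MVT_segment t0 (fun s _ => dl s).
    by apply: continuous_subspaceT => s; exact: cl.
  exists c; last by rewrite z0 E subr0 mulrC.
  by move: ci; rewrite in_itv/= => /andP[c0 ct]; rewrite !ger0_norm.
have [|c ci E] := MVT_segment t0 (fun s _ => dl s).
  by apply: continuous_subspaceT => s; exact: cl.
exists c; last by rewrite z0 -opprB E sub0r mulrN opprK mulrC.
by move: ci; rewrite in_itv/= => /andP[c0 ct]; rewrite !ler0_norm// lerN2.
Qed.

Lemma expand_arith (a b c t y d0 d1 T : R) : a - b = t * y * d1 ->
  a - c - t * (y * d0 + T) = t * y * (d1 - d0) + (b - c - t * T).
Proof. by move=> e; rewrite -(subrK b a) e; ring. Qed.

(** Continuous partial derivatives give a first-order expansion in any direction: the increment is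
    split along the coordinates, and the mean value theorem is applied to each with the derivative
    taken at a nearby point. *)
Lemma C1_expand m (psi : 'rV[R]_m -> R) (x y : 'rV[R]_m) e :
  (forall j z, derivable psi z (delta_mx 0 j)) ->
  (forall j, continuous ('D_(delta_mx 0 j) psi)) -> 0 < e ->
  exists2 d, 0 < d & forall t, 0 < t -> t < d ->
    `|psi (x + t *: y) - psi x - t * \sum_j y 0 j * 'D_(delta_mx 0 j) psi x| <= e * t.
Proof.
move=> dp cd e0.
pose ys (s : seq 'I_m) : 'rV[R]_m := \sum_(j <- s) y 0 j *: delta_mx 0 j.
have ysle s (uniq_s : uniq s) j : `|ys s 0 j| <= `|y 0 j|.
  rewrite /ys summxE; have [js|js] := boolP (j \in s).
    rewrite (bigD1_seq j)//= !mxE !eqxx/= mulr1 big1 ?addr0// => i ij.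
    by rewrite !mxE eqxx/= eq_sym (negbTE ij) mulr0.
  rewrite big1_seq ?normr0// => i /andP[_ si]; rewrite !mxE eqxx/=.
  by have [ji|] := eqVneq j i; [move: js; rewrite ji si|rewrite mulr0].
suff key s : uniq s -> forall e, 0 < e -> exists2 d, 0 < d & forall t, 0 < t -> t < d ->
    `|psi (x + t *: ys s) - psi x - t * \sum_(j <- s) y 0 j * 'D_(delta_mx 0 j) psi x| <= e * t.
  have [d d0 dP] := key _ (index_enum_uniq 'I_m) _ e0; exists d => // t t0 td.
  have := dP t t0 td; suff -> : ys (index_enum 'I_m) = y by [].
  by rewrite /ys [RHS]row_sum_delta.
elim: s => [_ {}e {}e0|j s IH /= /andP[js us] {}e {}e0].
  by exists 1 => // t t0 _; rewrite /ys !big_nil scaler0 addr0 subrr mulr0 subr0 normr0 mulr_ge0 ?ltW.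
have e2 : 0 < e / 2 by rewrite divr_gt0.
have [d1 d10 d1P] := IH us _ e2.
have ye : 0 < e / 2 / (`|y 0 j| + 1) by rewrite divr_gt0// ltr_wpDl.
have [d2 d20 d2P] := continuous_rV x (cd j) ye.
pose N := \sum_i `|y 0 i|; have N0 : 0 <= N by apply: sumr_ge0.
have yN i : `|y 0 i| <= N by rewrite /N (bigD1 i)//= lerDl sumr_ge0.
have q0 : 0 < d2 / (2 * N + 1) by rewrite divr_gt0// ltr_wpDl// mulr_ge0.
exists (Num.min d1 (d2 / (2 * N + 1))); first by rewrite lt_min d10.
move=> t t0; rewrite lt_min => /andP[td1 td2].
have [c cle cE] := derive_increment (x + t *: ys s) (t * y 0 j) (dp j).
rewrite /ys !big_cons -/(ys s).
have -> : x + t *: (y 0 j *: delta_mx 0 j + ys s) = x + t *: ys s + (t * y 0 j) *: delta_mx 0 j.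
  by rewrite scalerDr scalerA [_ + t *: ys s]addrC addrA.
set T := \sum_(i <- s) _; set Dj := 'D_(delta_mx 0 j) psi.
have h1 := d1P t t0 td1; rewrite -/T in h1.
have h2 : `|Dj (x + t *: ys s + c *: delta_mx 0 j) - Dj x| <= e / 2 / (`|y 0 j| + 1).
  apply: d2P => i; have -> : (x + t *: ys s + c *: delta_mx 0 j) 0 i - x 0 i = t * ys s 0 i + c * (i == j)%:R.
    by rewrite !mxE eqxx /=; ring.
  apply: le_lt_trans (ler_normD _ _) _; rewrite !normrM (gtr0_norm t0).
  have : `|(i == j)%:R : R| <= 1 by case: (i == j); rewrite ?normr1 ?normr0.
  move: cle; rewrite normrM (gtr0_norm t0) => cle b1.
  have h3 : `|c| * `|(i == j)%:R| <= t * N.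
    apply: le_trans (_ : `|c| * 1 <= _); first by rewrite ler_wpM2l.
    by rewrite mulr1; apply: le_trans cle _; rewrite ler_wpM2l// ltW.
  have h4 : t * `|ys s 0 i| <= t * N.
    by rewrite ler_wpM2l ?(ltW t0)//; exact: le_trans (ysle s us i) (yN i).
  move: td2; rewrite ltr_pdivlMr; last by rewrite ltr_wpDl// mulr_ge0.
  rewrite mulrDr mulr1 mulrCA; lra.
have -> : psi (x + t *: ys s + (t * y 0 j) *: delta_mx 0 j) - psi x - t * (y 0 j * Dj x + T) =
   t * y 0 j * (Dj (x + t *: ys s + c *: delta_mx 0 j) - Dj x) + (psi (x + t *: ys s) - psi x - t * T).
  exact: expand_arith.
apply: le_trans (ler_normD _ _) _; rewrite 2!normrM (gtr0_norm t0).
have h5 : `|y 0 j| * `|Dj (x + t *: ys s + c *: delta_mx 0 j) - Dj x| <= e / 2.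
  apply: le_trans (ler_wpM2l (normr_ge0 _) h2) _.
  by rewrite mulrCA ger_pMr// ler_pdivrMr ?mul1r ?lerDl// ltr_wpDl.
have := ler_wpM2l (ltW t0) h5; rewrite mulrA; lra.
Qed.

Lemma antiderivative (lam : R -> R) : continuous lam -> exists Lam : R -> R,
  forall t : R, 0 <= t -> is_derive t 1 Lam (lam t).
Proof.
(* Integrating from [-1] puts the whole half-line [t >= 0] in the interior, so the derivative at 0
   is two-sided. *)
move=> cl; exists (fun x => \int[lebesgue_measure]_(t in `[-1, x]) lam t) => t t0.
have i : lebesgue_measure.-integrable `[-1, t + 1] (EFin \o lam).
  apply: continuous_compact_integrable; first exact: segment_compact.
  exact: continuous_subspaceT.
have h1 : t < t + 1 by rewrite ltrDl.
have h2 : -1 < t by apply: lt_le_trans t0; rewrite oppr_lt0.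
have [d e] := continuous_FTC1_closed h1 i h2 (cl t).
move: d e; set F := (fun x : R => _) => d e; apply: (DeriveDef d).
by rewrite -derive1E.
Qed.

End rV_calculus.

Section orthonormalization.
Context {R : realType} {E : lmodType R}.
Variables (P : set E) (B : E -> E -> R).
Hypothesis iP : inner_on P B.
Hypothesis eq0 : forall u, P u -> nrm B u = 0 -> u = 0.

Lemma in_sum (I : Type) (s : seq I) (c : I -> R) (e : I -> E) : (forall i, P (e i)) ->
  P (\sum_(i <- s) c i *: e i) /\
  forall v, P v -> B (\sum_(i <- s) c i *: e i) v = \sum_(i <- s) c i * B (e i) v.
Proof.
move=> Pe; elim: s => [|i s [IH1 IH2]].
  split=> [|v Pv]; first by rewrite big_nil; exact: in_0 iP.
  by rewrite !big_nil -(scale0r 0) (in_Zl iP) ?mul0r//; exact: in_0 iP.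
have Pi := in_Z iP (c i) (Pe i).
split=> [|v Pv]; rewrite !big_cons; first exact: (in_D iP).
by rewrite (in_Dl iP)// (in_Zl iP)// IH2.
Qed.

Lemma gram_schmidt (Q : set E) m (w : 'I_m -> E) : (forall u, Q u -> P u) ->
  Q 0 -> (forall a u v, Q u -> Q v -> Q (u + a *: v)) -> (forall j, Q (w j)) ->
  exists n (e : 'I_n -> E), [/\ forall k, Q (e k), forall k l, B (e k) (e l) = (k == l)%:R &
    forall j, exists c : 'I_n -> R, w j = \sum_k c k *: e k].
Proof.
move=> QP Q0 Ql Qw; have Qsum (I : finType) (c : I -> R) (e : I -> E) : (forall i, Q (e i)) -> Q (\sum_i c i *: e i).
  by move=> Qe; elim/big_ind: _ => // [x y Qx Qy|i _]; [rewrite -[y]scale1r; exact: Ql|rewrite -[_ *: _]add0r; exact: Ql].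
suff key (s : seq E) : (forall x, x \in s -> Q x) -> exists n (e : 'I_n -> E),
    [/\ forall k, Q (e k), forall k l, B (e k) (e l) = (k == l)%:R &
    forall x, x \in s -> exists c : 'I_n -> R, x = \sum_k c k *: e k].
  have [|n [e [Qe oe se]]] := key (codom w); first by move=> x /codomP[j ->].
  by exists n, e; split => // j; apply: se; exact: codom_f.
elim: s => [_|x s IH Qs].
  by exists 0, (fun=> 0); split => [k|k|//]; [by []|case: k].
have [|n [e [Qe oe se]]] := IH; first by move=> y ys; apply: Qs; rewrite in_cons ys orbT.
have Qx : Q x by apply: Qs; rewrite mem_head.
have Pe k := QP _ (Qe k); have Px := QP _ Qx.
pose p := \sum_k B x (e k) *: e k; have Qp : Q p by exact: Qsum.
have Pp := QP _ Qp; pose r := x - p.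
have Qr : Q r by rewrite /r -scaleN1r; exact: Ql.
have Pr := QP _ Qr.
have [r0|r0] := eqVneq (nrm B r) 0.
  exists n, e; split => // y; rewrite in_cons => /orP[/eqP ->|/se//]; exists (fun k => B x (e k)).
  by apply/eqP; rewrite -subr_eq0; apply/eqP; exact: eq0.
have re k : B r (e k) = 0.
  rewrite (in_Bl iP)// (in_sum _ _ Pe).2// (bigD1 k)//= oe eqxx mulr1 big1 ?addr0 ?subrr// => i ik.
  by rewrite oe (negbTE ik) mulr0.
pose f := (nrm B r)^-1 *: r; have Qf : Q f by rewrite /f -[_ *: _]add0r; exact: Ql.
pose e' (k : 'I_n.+1) := if unlift ord0 k is Some j then e j else f.
have e'0 : e' ord0 = f by rewrite /e' unlift_none.
have e'l j : e' (lift ord0 j) = e j by rewrite /e' liftK.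
have Q' k : Q (e' k) by rewrite /e'; case: unliftP => [j _|_].
have Pf := QP _ Qf.
have fe k : B f (e k) = 0 by rewrite /f (in_Zl iP)// re mulr0.
have ff : B f f = 1.
  rewrite /f (in_Zl iP)//; rewrite (in_Zr iP)// -(nrm_sqr iP Pr).
  by rewrite mulrA expr2 mulrACA mulVf// mulr1.
exists n.+1, e'; split => //.
- move=> k l; case: (unliftP ord0 k) => [i ->|->]; case: (unliftP ord0 l) => [j ->|->]; rewrite ?e'l ?e'0.
  + by rewrite oe (inj_eq lift_inj).
  + by rewrite (in_C iP)// fe.
  + by rewrite fe.
  + by rewrite ff eqxx.
- move=> y; rewrite in_cons => /orP[/eqP ->|/se[c ->]].
    exists (fun k => if unlift ord0 k is Some j then B x (e j) else nrm B r).
    rewrite big_ord_recl unlift_none e'0 /f scalerA divff// scale1r.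
    under eq_bigr do rewrite liftK e'l.
    by rewrite -/p subrK.
  exists (fun k => if unlift ord0 k is Some j then c j else 0).
  rewrite big_ord_recl unlift_none scale0r add0r.
  by apply: eq_bigr => k _; rewrite liftK e'l.
Qed.

End orthonormalization.

Section euclidean.
Context {R : realType}.

Lemma is_derive_expand (f : R -> R) (df e : R) : is_derive (0 : R) (1 : R) f df -> 0 < e ->
  exists2 d, 0 < d & forall t : R, 0 < t -> t < d -> `|f t - f 0 - t * df| <= e * t.
Proof.
move=> [dv dE] e0; have : (fun s : R => s^-1 *: (f (s *: 1 + 0) - f 0)) @ 0^' --> df.
  by rewrite -dE; exact: dv.
move=> /cvgrPdist_le /(_ e e0); rewrite near_withinE => /nbhs_ballP[d /= d0 dP].
exists d => // t t0 td; have := dP t; rewrite /ball /= sub0r normrN (gtr0_norm t0) => /(_ td).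
rewrite gt_eqF// => /(_ isT); rewrite addr0 [t *: 1]mulr1 => h.
have -> : f t - f 0 - t * df = - (t * (df - t^-1 *: (f t - f 0))).
  by rewrite -[_ *: _]/(_ * _); field; rewrite gt_eqF.
by rewrite normrN normrM (gtr0_norm t0) mulrC ler_wpM2r// ltW.
Qed.

Lemma is_derive_quadratic (Lam : R -> R) (x y z l : R) : is_derive x 1 Lam l ->
  is_derive (0 : R) (1 : R) (Lam \o (fun t : R => x + 2 * y * t + z * (t * t))) (l * (2 * y)).
Proof.
move=> dL; have d0 : is_derive (0 : R) (1 : R) (fun t : R => x + 2 * y * t + z * (t * t)) (2 * y).
  apply: is_derive_eq; rewrite /= !(mul0r, mulr0, scale0r, scaler0, add0r, addr0).
  by rewrite mul1r -[LHS]/(2 * y * 1) mulr1.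
have dL' : is_derive (x + 2 * y * 0 + z * (0 * 0)) 1 Lam l by rewrite !mulr0 !addr0.
have := @is_derive1_comp R Lam (fun t : R => x + 2 * y * t + z * (t * t)) 0 l (2 * y) dL' d0.
exact.
Qed.

Lemma descent_arith (t D1 l ad p p' L L' : R) : 0 < t -> D1 + l * ad < 0 ->
  p' - p - t * D1 <= - (D1 + l * ad) / 4 * t ->
  L' - L - t * (l * (2 * ad)) <= - (D1 + l * ad) / 4 * t ->
  p + 2^-1 * L <= p' + 2^-1 * L' -> False.
Proof.
move=> t0 D0 h1 h2 h3; have : t * (D1 + l * ad) < 0 by rewrite pmulr_rlt0.
lra.
Qed.

Definition dotv n (a b : 'rV[R]_n) : R := \sum_k a 0 k * b 0 k.

Lemma dotvC n (a b : 'rV[R]_n) : dotv a b = dotv b a.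
Proof. by apply: eq_bigr => k _; rewrite mulrC. Qed.

Lemma dotvDl n (a b c : 'rV[R]_n) : dotv (a + b) c = dotv a c + dotv b c.
Proof. by rewrite -big_split; apply: eq_bigr => k _; rewrite mxE mulrDl. Qed.

Lemma dotvZl n x (a b : 'rV[R]_n) : dotv (x *: a) b = x * dotv a b.
Proof. by rewrite mulr_sumr; apply: eq_bigr => k _; rewrite mxE mulrA. Qed.

Lemma dotvDr n (a b c : 'rV[R]_n) : dotv c (a + b) = dotv c a + dotv c b.
Proof. by rewrite dotvC dotvDl !(dotvC _ c). Qed.

Lemma dotvZr n x (a b : 'rV[R]_n) : dotv a (x *: b) = x * dotv a b.
Proof. by rewrite dotvC dotvZl dotvC. Qed.

Lemma dotvNl n (a b : 'rV[R]_n) : dotv (- a) b = - dotv a b.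
Proof. by rewrite -sumrN; apply: eq_bigr => k _; rewrite mxE mulNr. Qed.

Lemma dotvNr n (a b : 'rV[R]_n) : dotv a (- b) = - dotv a b.
Proof. by rewrite dotvC dotvNl dotvC. Qed.

Lemma dotv_ge0 n (a : 'rV[R]_n) : 0 <= dotv a a.
Proof. by apply: sumr_ge0 => k _; rewrite -expr2 sqr_ge0. Qed.

Lemma dotv_eq0 n (a : 'rV[R]_n) : dotv a a <= 0 -> a = 0.
Proof.
move=> h; apply/rowP => k; rewrite mxE; apply/eqP; rewrite -sqrf_eq0 eq_le sqr_ge0 andbT.
apply: le_trans h; rewrite /dotv (bigD1 k)//= expr2 lerDl sumr_ge0// => i _.
by rewrite -expr2 sqr_ge0.
Qed.

Lemma coordinate_continuous n (k : 'I_n) : continuous (fun a : 'rV[R]_n => a 0 k).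
Proof. exact: coord_continuous. Qed.

Lemma continuous_mul {T : topologicalType} (f g : T -> R) : continuous f -> continuous g ->
  continuous (fun x => f x * g x).
Proof. by move=> cf cg x; apply: cvgM; [exact: cf|exact: cg]. Qed.

Lemma dotv_continuous n : continuous (fun a : 'rV[R]_n => dotv a a).
Proof.
apply: continuous_bigsum => k; apply: continuous_mul; exact: coordinate_continuous.
Qed.

Lemma mulmx_rV_continuous n m (M : 'M[R]_(n, m)) (psi : 'rV[R]_m -> R) : continuous psi ->
  continuous (fun a : 'rV[R]_n => psi (a *m M)).
Proof.
move=> cp a; apply/(@cvgrPdist_le _ _ _ (nbhs a) (nbhs_filter a)) => e e0; have [d d0 dP] := continuous_rV (a *m M) cp e0.
have cj j : continuous (fun b : 'rV[R]_n => (b *m M) 0 j).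
  have -> : (fun b : 'rV[R]_n => (b *m M) 0 j) = fun b => \sum_k b 0 k * M k j.
    by apply/funext => b; rewrite mxE.
  apply: continuous_bigsum => k; apply: continuous_mul; [exact: coordinate_continuous|].
  exact: cst_continuous.
have : \forall b \near a, forall j, `|(a *m M) 0 j - (b *m M) 0 j| < d.
  by apply: (@filter_forall _ _ _ (nbhs a) (nbhs_filter a)) => j; move: (cj j a) => /(@cvgrPdist_lt _ _ _ (nbhs a) (nbhs_filter a)) /(_ d d0).
by apply: filterS => b hb; rewrite distrC; apply: dP => j; rewrite distrC.
Qed.

Lemma dotv_ball_closed n (r : R) : closed [set a : 'rV[R]_n | dotv a a <= r ^+ 2].
Proof.
apply: (@closed_comp _ _ (fun a : 'rV[R]_n => dotv a a) [set x | x <= r ^+ 2]); last exact: closed_le.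
by move=> a _; exact: dotv_continuous.
Qed.

Lemma dotv_ball_compact n (r : R) : compact [set a : 'rV[R]_n | dotv a a <= r ^+ 2].
Proof.
have cl := @dotv_ball_closed n r.
apply: (subclosed_compact cl (@rV_compact _ _ (fun=> `[- `|r|, `|r|]%classic) _)) => [k|a /= ar k].
  exact: segment_compact.
rewrite in_itv /= -ler_norml -(ler_pXn2r (n := 2)) ?nnegrE// !real_normK ?num_real//.
apply: le_trans ar; rewrite /dotv (bigD1 k)//= expr2 lerDl sumr_ge0// => i _.
by rewrite -expr2 sqr_ge0.
Qed.

(** First-order conditions at a minimum over a ball, with [p] the gradient: in the interior the
    direction [- p] is feasible; on the sphere only inward directions are, and [p] must point along
    the inner normal. *)
Lemma ball_kkt n (a p : 'rV[R]_n) (r : R) : 0 < r -> dotv a a <= r ^+ 2 ->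
  (forall d, (exists2 t0, 0 < t0 & forall t, 0 < t -> t < t0 ->
     dotv (a + t *: d) (a + t *: d) <= r ^+ 2) -> 0 <= dotv d p) ->
  p = 0 \/ dotv a a = r ^+ 2 /\ exists2 k, 0 <= k & p = - k *: a.
Proof.
move=> r0 ar fe; have expand d t : dotv (a + t *: d) (a + t *: d) = dotv a a + 2 * t * dotv a d + t ^+ 2 * dotv d d.
  by rewrite dotvDl !dotvDr !dotvZl !dotvZr (dotvC d a); ring.
have [alt|] := ltP (dotv a a) (r ^+ 2).
  left; apply: dotv_eq0; rewrite -oppr_ge0.
  rewrite -dotvNl; apply: fe; pose N := 2 * `|dotv a (- p)| + dotv (- p) (- p) + 1.
  have N0 : 0 < N by rewrite ltr_wpDl// addr_ge0 ?dotv_ge0// mulr_ge0.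
  have g0 : 0 < r ^+ 2 - dotv a a by rewrite subr_gt0.
  exists (Num.min 1 ((r ^+ 2 - dotv a a) / N)); first by rewrite lt_min ltr01 divr_gt0.
  move=> t t0; rewrite lt_min => /andP[t1]; rewrite ltr_pdivlMr// expand => tN.
  have := ler_norm (dotv a (- p)); have := dotv_ge0 (- p); move: tN; rewrite /N.
  set x := dotv a (- p); set y := dotv (- p) (- p) => tN y0 xle.
  have h1 : t * x <= t * `|x| by rewrite ler_wpM2l// ltW.
  have h2 : t ^+ 2 * y <= t * y by rewrite ler_wpM2r// expr2 ger_pMl// ltW.
  lra.
move=> ra; have {ra} aE : dotv a a = r ^+ 2 by apply/eqP; rewrite eq_le ar.
have r2 : 0 < r ^+ 2 by rewrite exprn_gt0.
pose k := dotv a p / r ^+ 2; pose q := p - k *: a.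
have aq : dotv a q = 0.
  by rewrite /q dotvDr dotvNr dotvZr aE /k divfK ?subrr// gt_eqF.
have pE : p = q + k *: a by rewrite subrK.
(* The tangential direction [- q] leaves the ball at second order; the inward correction [- eta a]
   restores feasibility, and its cost is removed by choosing [eta] small. *)
clearbody q; have h eta : 0 < eta -> 0 <= - dotv q q - eta * k * r ^+ 2.
  move=> e0; have <- : dotv (- q - eta *: a) p = - dotv q q - eta * k * r ^+ 2.
    rewrite pE dotvDl !dotvNl dotvZl !dotvDr !dotvZr (dotvC q a) aq aE; ring.
  apply: fe; set d := - q - eta *: a.
  have ad : dotv a d = - eta * r ^+ 2.
    by rewrite /d dotvDr !dotvNr dotvZr aq aE; ring.
  pose N := dotv d d + 1; have N0 : 0 < N by rewrite ltr_wpDl// dotv_ge0.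
  exists (eta * r ^+ 2 / N); first by rewrite divr_gt0// mulr_gt0.
  move=> t t0; rewrite ltr_pdivlMr// expand ad aE /N => tN; have := dotv_ge0 d.
  move: tN; set y := dotv d d; set z := r ^+ 2 => tN y0.
  have h1 : t * (t * y) <= t * (eta * z) by rewrite ler_wpM2l ?(ltW t0)//; lra.
  have h2 : 0 < t * (eta * z) by rewrite !mulr_gt0.
  lra.
right; split => //; have k0 : k <= 0.
  have := h 1 ltr01; rewrite mul1r; have := dotv_ge0 q => q0 h1.
  by rewrite -(pmulr_lle0 _ r2); lra.
exists (- k); first by rewrite oppr_ge0.
rewrite opprK; have : q = 0; last by rewrite pE => ->; rewrite add0r.
apply: dotv_eq0; apply/ler_addgt0Pr => e e0; rewrite add0r.
have [k0'|k0'] := eqVneq k 0.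
  by have := h 1 ltr01; rewrite k0' mulr0 mul0r; lra.
have kr : 0 < - k * r ^+ 2 by rewrite mulr_gt0// oppr_gt0 lt_neqAle k0'.
have := h (e / (- k * r ^+ 2)) (divr_gt0 e0 kr).
have -> : e / (- k * r ^+ 2) * k * r ^+ 2 = - e by field; rewrite k0' gt_eqF.
lra.
Qed.

End euclidean.

Section lyapunov.
Context {R : realType} {E : lmodType R}.
Variables (H V : set E) (h g : E -> E -> R).
Hypothesis S : hilbert_pair H V h g.
Let iH := hp_H S.
Let iV := hp_V S.
Let VH := hp_sub S.
Notation nH := (nrm h).
Notation nV := (nrm g).
Variables (r0 nu : R) (f : E -> R) (F : E -> E -> R).
Hypotheses (r0_ge0 : 0 <= r0) (nu0 : 0 < nu) (fb : bounded_lin V g f).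
Notation K := (kset V h r0).
Notation ell := (energy g nu f).
Hypothesis F_lin : forall u, V u -> forall a v w, V v -> V w -> F u (v + a *: w) = F u v + a * F u w.
Hypothesis F_self : forall u, V u -> F u u = - ell u.
Hypothesis F_zero : r0 = 0 -> forall w, V w -> F 0 w = 0.
Hypothesis ell_sphere : forall u, V u -> nH u = r0 -> 0 < r0 -> 0 <= ell u.
Variables (m : nat) (w : 'I_m -> E) (psi : 'rV[R]_m -> R).
Hypotheses (Vw : forall j, V (w j)) (cpsi : continuous psi).
Hypotheses (dpsi : forall j x, derivable psi x (delta_mx 0 j))
  (cdpsi : forall j, continuous ('D_(delta_mx 0 j) psi)).

Definition cyl_grad u : E := \sum_j 'D_(delta_mx 0 j) psi (\row_j h u (w j)) *: w j.

Lemma V_lcomb (I : Type) (s : seq I) (c : I -> R) (e : I -> E) : (forall i, V (e i)) ->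
  V (\sum_(i <- s) c i *: e i).
Proof. by move=> Ve; have [] := in_sum iV s c Ve. Qed.

Lemma F0r u : V u -> F u 0 = 0.
Proof.
move=> Vu; have := F_lin Vu 1 (in_0 iV) (in_0 iV); rewrite scale1r addr0 mul1r; lra.
Qed.

Hypotheses (Ga : admissible V h g r0 (fun u => F u (cyl_grad u)))
  (Gs : subquadratic V h g r0 (fun u => F u (cyl_grad u))).

(* Otherwise a multiplier makes [F u (cyl_grad u + lam (|u|^2) u)] negative on
   the ball of [span w], against [ball_kkt] at a minimizer of
   [psi + Lam (|u|^2) / 2], [Lam' = lam]. *)
Lemma lyapunov : exists t1 t2 u1 u2, mixed V h g r0 nu f t1 t2 u1 u2 /\
  0 <= t1 * F u1 (cyl_grad u1) + t2 * F u2 (cyl_grad u2).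
Proof.
have [s1 [s2 [v1 [v2 [mv mx]]]]] := mixed_max S r0_ge0 nu0 fb Ga Gs.
set m0 := _ + _ in mx; have [m00|m00] := leP 0 m0; first by exists s1, s2, v1, v2.
exfalso; have e0 : 0 < - m0 / 2 by rewrite divr_gt0// oppr_gt0.
(* With error [- m0 / 2] the bound is [m0 / 2 + lam ell], still negative once [F u u = - ell u]
   absorbs the multiplier term. *)
have [lam [cl lam0 _ Gle]] := multiplier S r0_ge0 nu0 fb Ga Gs mx e0.
have {}Gle u : K u -> F u (cyl_grad u + lam (nH u ^+ 2) *: u) < 0.
  move=> Ku; have Vu := Ku.1; have Vc : V (cyl_grad u) by exact: V_lcomb.
  rewrite F_lin// F_self//.
  have := Gle u Ku; lra.
have [n [e [Ve oe we]]] := gram_schmidt iH (hp_eq0 S) VH (in_0 iV)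
  (fun a u v Vu Vv => in_D iV Vu (in_Z iV a Vv)) Vw.
have [c cP] := choice we; have He k := VH (Ve k).
pose U (a : 'rV[R]_n) := \sum_k a 0 k *: e k.
have VU a : V (U a) by exact: V_lcomb.
have hU a v : H v -> h (U a) v = \sum_k a 0 k * h (e k) v by exact: (in_sum iH _ _ He).2.
have hUe a k : h (U a) (e k) = a 0 k.
  rewrite hU// (bigD1 k)//= oe eqxx mulr1 big1 ?addr0// => i ik.
  by rewrite oe (negbTE ik) mulr0.
have hUU a b : h (U a) (U b) = dotv a b.
  rewrite (in_C iH (VH (VU a)) (VH (VU b))) (hU b _ (VH (VU a))) /dotv; apply: eq_bigr => k _.
  by rewrite (in_C iH (He k) (VH (VU a))) hUe mulrC.
have nU a : nH (U a) ^+ 2 = dotv a a by rewrite (nrm_sqr iH (VH (VU a))) hUU.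
pose M := \matrix_(k < n, j < m) c j k.
have coordU a : \row_j h (U a) (w j) = a *m M.
  apply/rowP => j; rewrite !mxE (cP j) (in_C iH (VH (VU a))); last by apply: VH; exact: V_lcomb.
  rewrite (in_sum iH _ _ He).2; last exact: VH.
  by apply: eq_bigr => k _; rewrite (in_C iH (He k) (VH (VU a))) hUe mxE mulrC.
have [Lam LamP] := antiderivative cl.
pose Phi a := psi (a *m M) + 2^-1 * Lam (dotv a a).
have cPhi : continuous Phi.
  have c1 : continuous (fun a : 'rV[R]_n => psi (a *m M)) by exact: mulmx_rV_continuous.
  have c2 : continuous (fun a : 'rV[R]_n => Lam (dotv a a)).
    move=> a; apply: (continuous_comp (@dotv_continuous _ n a)).
    by apply: differentiable_continuous; apply/derivable1_diffP; case: (LamP _ (dotv_ge0 a)).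
  move=> a; apply: (@cvgD _ _ _ (nbhs a) (nbhs_filter a)); first exact: c1.
  by apply: (@cvgM _ _ (nbhs a) (nbhs_filter a)); [exact: cvg_cst|exact: c2].
pose A := [set a : 'rV[R]_n | dotv a a <= r0 ^+ 2].
have [|a aA amin] := @EVT_min_rV R n Phi A _ (@dotv_ball_compact _ n r0) (continuous_subspaceT cPhi).
  by exists 0; rewrite /A /= /dotv big1 ?sqr_ge0// => k _; rewrite mxE mul0r.
have {}aA : dotv a a <= r0 ^+ 2 by move: aA; rewrite inE.
have {}amin b : dotv b b <= r0 ^+ 2 -> Phi a <= Phi b by move=> bA; apply: amin; rewrite inE.
have KU : K (U a).
  by split => //; rewrite -(ler_pXn2r (n := 2)) ?nnegrE ?nrm_ge0// nU.
pose dpj j := 'D_(delta_mx 0 j) psi (a *m M).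
pose p : 'rV[R]_n := \row_k (\sum_j dpj j * c j k + lam (dotv a a) * a 0 k).
have pE : cyl_grad (U a) + lam (nH (U a) ^+ 2) *: U a = U p.
  rewrite nU /cyl_grad coordU /U scaler_sumr.
  rewrite (eq_bigr (fun j => \sum_k (dpj j * c j k) *: e k)); last first.
    by move=> j _; rewrite {1}(cP j) scaler_sumr; apply: eq_bigr => k _; rewrite scalerA.
  rewrite exchange_big -big_split; apply: eq_bigr => k _ /=.
  by rewrite mxE scalerDl scaler_suml scalerA.
have Fp := Gle _ KU; rewrite pE in Fp.
have fe d : (exists2 t0, 0 < t0 & forall t, 0 < t -> t < t0 ->
    dotv (a + t *: d) (a + t *: d) <= r0 ^+ 2) -> 0 <= dotv d p.
  move=> [t0 t00 t0P]; rewrite leNgt; apply/negP => dp0.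
  have e4 : 0 < - dotv d p / 4 by rewrite divr_gt0// oppr_gt0.
  have [d1 d10 d1P] := C1_expand (a *m M) (d *m M) dpsi cdpsi e4.
  have dl : is_derive (0 : R) (1 : R) (fun t : R => Lam (dotv (a + t *: d) (a + t *: d))) (lam (dotv a a) * (2 * dotv a d)).
    have -> : (fun t : R => Lam (dotv (a + t *: d) (a + t *: d))) =
        Lam \o (fun t : R => dotv a a + 2 * dotv a d * t + dotv d d * (t * t)).
      apply/funext => t /=; congr (Lam _).
      by rewrite dotvDl !dotvDr !dotvZl !dotvZr (dotvC d a); ring.
    exact: is_derive_quadratic (LamP _ (dotv_ge0 a)).
  have [d2 d20 d2P] := is_derive_expand dl e4.
  pose t := Num.min t0 (Num.min d1 d2) / 2.
  have t1 : 0 < t by rewrite divr_gt0// !lt_min t00 d10.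
  have tm : t < Num.min t0 (Num.min d1 d2) by rewrite ltr_pdivrMr// ltr_pMr ?ltr1n// !lt_min t00 d10.
  move: tm; rewrite !lt_min => /and3P[tt0 td1 td2].
  have h1 := d1P t t1 td1; have h2 := d2P t t1 td2.
  have h3 := amin _ (t0P t t1 tt0).
  have Sj : \sum_j (d *m M) 0 j * dpj j + lam (dotv a a) * dotv a d = dotv d p.
    rewrite /dotv mulr_sumr; under eq_bigr do rewrite mxE mulr_suml.
    rewrite exchange_big -big_split; apply: eq_bigr => k _ /=.
    rewrite mxE mulrDr mulr_sumr; congr (_ + _); last by ring.
    by apply: eq_bigr => j _; rewrite mxE; ring.
  move: h1 h2 h3; rewrite /Phi mulmxDl -scalemxAl scale0r addr0 !ler_norml -/(dpj _).
  move=> /andP[_ h1] /andP[_ h2] h3; rewrite -Sj in dp0 h1 h2.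
  exact: (descent_arith t1 dp0 h1 h2 h3).
(* [ball_kkt] needs a positive radius. A ball reduced to the origin is settled by [F_zero]. *)
have [r00|r0n] := eqVneq r0 0.
  have : U a = 0.
    by apply: (hp_eq0 S (VH (VU a))); apply/eqP; rewrite eq_le nrm_ge0 andbT -[leRHS]r00; case: KU.
  by move=> U0; move: Fp; rewrite U0 F_zero// ltxx.
have r0p : 0 < r0 by rewrite lt_def r0n.
have [p0|[ar [k k0 pk]]] := ball_kkt r0p aA fe.
  move: Fp; have -> : U p = 0 by rewrite /U big1// => k _; rewrite p0 mxE scale0r.
  by rewrite F0r// ltxx.
have nr : nH (U a) = r0.
  by apply/eqP; rewrite -(eqrXn2 (n := 2)) ?nrm_ge0// nU ar.
(* On the sphere the gradient is [- k] times the point, so [F] applied to it is [k ell], which is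
   nonnegative by [ell_sphere]: the ball is invariant under the Galerkin flow. *)
have UpE : U p = 0 + (- k) *: U a.
  by rewrite add0r /U pk scaler_sumr; apply: eq_bigr => j _; rewrite mxE scalerA.
move: Fp; rewrite UpE F_lin ?F0r ?F_self//; last exact: (in_0 iV).
rewrite add0r mulrNN ltNge => /negP; apply.
by rewrite mulr_ge0//; exact: ell_sphere.
Qed.

End lyapunov.

(** * A cutoff of class C1 and linear combinations of cylindrical functionals *)

Section cutoff.
Context {R : realType}.

Definition sqpos (t : R) := Num.max 0 t ^+ 2.

Lemma sqpos_increment (t s : R) : `|sqpos (t + s) - sqpos t - s * (2 * Num.max 0 t)| <= s ^+ 2.
Proof.
rewrite /sqpos ler_norml.
by have [t0|t0] := leP 0 t; have [ts|ts] := leP 0 (t + s); apply/andP; split; nra.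
Qed.

Lemma is_derive_sqpos (t : R) : is_derive t 1 sqpos (2 * Num.max 0 t).
Proof.
have c : (fun s : R => s^-1 *: (sqpos (s *: 1 + t) - sqpos t)) @ 0^' --> 2 * Num.max 0 t.
  apply/cvgrPdist_le => e e0; rewrite near_withinE; apply/nbhs_ballP; exists e => //= s.
  rewrite /ball /= sub0r normrN => se s0; rewrite [s *: 1]mulr1 [s + t]addrC.
  have := sqpos_increment t s.
  have -> : 2 * Num.max 0 t - s^-1 *: (sqpos (t + s) - sqpos t) =
      - (s^-1 * (sqpos (t + s) - sqpos t - s * (2 * Num.max 0 t))).
    by rewrite -[_ *: _]/(_ * _); field.
  rewrite normrN normrM normfV => h; rewrite ler_pdivrMl ?normr_gt0//.
  by apply: le_trans h _; rewrite -real_normK ?num_real// expr2 ler_wpM2l// ltW.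
apply: DeriveDef; first by apply/cvg_ex; exists (2 * Num.max 0 t).
exact: (cvg_lim _ c).
Qed.

(** The squared positive part is of class C1; composing it twice gives a C1 function equal to 1 for
    [t <= 0] and to 0 for [t >= 1], which is all that [Cc1] asks. *)
Definition cutoff (t : R) := sqpos (1 - sqpos t).
Definition cutoff' (t : R) := 2 * Num.max 0 (1 - sqpos t) * - (2 * Num.max 0 t).

Lemma is_derive_cutoff (t : R) : is_derive t 1 cutoff (cutoff' t).
Proof.
have d1 : is_derive t 1 (fun s => 1 - sqpos s) (- (2 * Num.max 0 t)).
  have := is_deriveB (is_derive_cst (1 : R) (t : R) (1 : R)) (is_derive_sqpos t); rewrite sub0r; exact.
exact: (@is_derive1_comp R sqpos (fun s => 1 - sqpos s) t _ _ (is_derive_sqpos _) d1).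
Qed.

Lemma continuous_max0 : continuous (fun t : R => Num.max 0 t).
Proof.
by move=> t; apply: (@continuous_max _ _ (fun=> 0) id t); [exact: cst_continuous|exact: cvg_id].
Qed.

Lemma continuous_sqpos : continuous sqpos.
Proof.
have -> : sqpos = fun t => Num.max 0 t * Num.max 0 t by apply/funext => t; rewrite /sqpos expr2.
by apply: continuous_mul; exact: continuous_max0.
Qed.

Lemma continuous_1sqpos : continuous (fun t => 1 - sqpos t).
Proof. by move=> t; apply: cvgB; [exact: cvg_cst|exact: continuous_sqpos]. Qed.

Lemma continuous_cutoff : continuous cutoff.
Proof.
by move=> t; apply: (continuous_comp (@continuous_1sqpos t)); exact: continuous_sqpos.
Qed.

Lemma continuous_cutoff' : continuous cutoff'.
Proof.
have c1 : continuous (fun t : R => Num.max 0 (1 - sqpos t)).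
  by move=> t; apply: (continuous_comp (@continuous_1sqpos t)); exact: continuous_max0.
move=> t; apply: cvgM; first by apply: cvgM; [exact: cvg_cst|exact: c1].
by apply: cvgN; apply: cvgM; [exact: cvg_cst|exact: continuous_max0].
Qed.

Lemma cutoff_le0 t : t <= 0 -> cutoff t = 1 /\ cutoff' t = 0.
Proof.
move=> t0; have m0 : Num.max 0 t = 0 by exact: max_l.
rewrite /cutoff /cutoff' /sqpos m0 expr0n /= subr0 !mulr0 oppr0 mulr0.
by rewrite max_r// expr1n.
Qed.

Lemma cutoff_ge1 t : 1 <= t -> cutoff t = 0.
Proof.
move=> t1; have t0 : 0 <= t by exact: le_trans t1.
rewrite /cutoff /sqpos (max_r t0) max_l ?expr0n// subr_le0.
by rewrite -[leLHS](expr1n _ 2) lerXn2r ?nnegrE.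
Qed.

Lemma is_derive_of_line m (psi : 'rV[R]_m -> R) (v x : 'rV[R]_m) (l : R) :
  is_derive (0 : R) (1 : R) (fun t : R => psi (x + t *: v)) l -> is_derive x v psi l.
Proof.
have E : (fun s : R => s^-1 *: ((fun t : R => psi (x + t *: v)) (s *: 1 + 0) - psi (x + 0 *: v))) =
    (fun s => s^-1 *: (psi (s *: v + x) - psi x)).
  apply/funext => s; rewrite scale0r !addr0; congr (_ *: (psi _ - _)).
  by rewrite [s *: 1]mulr1 addrC.
move=> [d dE]; apply: DeriveDef.
  by move: d; rewrite /derivable E.
by rewrite -dE /derive E.
Qed.

End cutoff.

Section tcyl_lin.
Context {R : realType} (Omega : set (R3 R)).
Variables (P1 P2 : Tcyl Omega) (c r : R).
Let m1 := cyl_m P1.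
Let m2 := cyl_m P2.

Let w (j : 'I_(m1 + m2)) : vec Omega := match fintype.split j with
  | inl i => @cyl_w _ _ P1 i | inr i => @cyl_w _ _ P2 i end.

Let spl (i : 'I_m1) : fintype.split (lshift m2 i) = inl i := unsplitK (inl i).
Let spr (i : 'I_m2) : fintype.split (rshift m1 i) = inr i := unsplitK (inr i).

Let wV j : space_V Omega (w j).
Proof. by rewrite /w; case: fintype.split => i; exact: cyl_wP. Qed.

Let M1 : 'M[R]_(m1 + m2, m1) := col_mx 1%:M 0.
Let M2 : 'M[R]_(m1 + m2, m2) := col_mx 0 1%:M.
(** By Cauchy-Schwarz, the coordinates of a field of norm at most [r] have squared length at most
    [A]; the argument of the cutoff is then nonpositive, where its value is 1 and its derivative
    0. *)
Let A := \sum_j (r * norm (w j)) ^+ 2.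
Let base (x : 'rV[R]_(m1 + m2)) := @cyl_psi _ _ P1 (x *m M1) + c * @cyl_psi _ _ P2 (x *m M2).
Let dbase (j : 'I_(m1 + m2)) (x : 'rV[R]_(m1 + m2)) : R := match fintype.split j with
  | inl i => 'D_(delta_mx 0 i) (@cyl_psi _ _ P1) (x *m M1)
  | inr i => c * 'D_(delta_mx 0 i) (@cyl_psi _ _ P2) (x *m M2) end.
Let psi x := cutoff (dotv x x - A) * base x.
Let dpsi j x := cutoff' (dotv x x - A) * (2 * x 0 j) * base x + cutoff (dotv x x - A) * dbase j x.

Let base_line j x : is_derive (0 : R) (1 : R) (fun t : R => base (x + t *: delta_mx 0 j)) (dbase j x).
Proof.
have [_ d1 _ _] := cyl_psiP P1; have [_ d2 _ _] := cyl_psiP P2.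
have L m (M : 'M[R]_(m1 + m2, m)) t : (x + t *: delta_mx 0 j) *m M = x *m M + t *: row j M.
  by rewrite mulmxDl -scalemxAl -rowE.
rewrite /base /dbase; under eq_fun do rewrite !L.
case: (split_ordP j) => i ->.
  have e2 t : @cyl_psi _ _ P2 (x *m M2 + t *: row (lshift m2 i) M2) = @cyl_psi _ _ P2 (x *m M2).
    by rewrite /M2 rowKu row0 scaler0 addr0.
  have e1 : row (lshift m2 i) M1 = delta_mx 0 i by rewrite /M1 rowKu row1.
  under eq_fun do rewrite e2 e1.
  have dl := is_derive_line (d1 i) (x *m M1) 0; rewrite scale0r addr0 in dl.
  have := is_deriveD dl (is_derive_cst (c * @cyl_psi _ _ P2 (x *m M2)) (0 : R) (1 : R)); rewrite addr0; exact.
have e1 t : @cyl_psi _ _ P1 (x *m M1 + t *: row (rshift m1 i) M1) = @cyl_psi _ _ P1 (x *m M1).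
  by rewrite /M1 rowKd row0 scaler0 addr0.
have e2 : row (rshift m1 i) M2 = delta_mx 0 i by rewrite /M2 rowKd row1.
under eq_fun do rewrite e1 e2.
have dl := is_derive_line (d2 i) (x *m M2) 0; rewrite scale0r addr0 in dl.
have := is_deriveD (is_derive_cst (@cyl_psi _ _ P1 (x *m M1)) (0 : R) (1 : R)) (is_deriveZ c dl); rewrite add0r; exact.
Qed.

Let psi_derive j x : is_derive x (delta_mx 0 j) psi (dpsi j x).
Proof.
apply: is_derive_of_line.
have dq : is_derive (0 : R) (1 : R) (fun t : R => cutoff (dotv (x + t *: delta_mx 0 j) (x + t *: delta_mx 0 j) - A))
    (cutoff' (dotv x x - A) * (2 * x 0 j)).
  have dj : dotv x (delta_mx 0 j) = x 0 j.
    rewrite /dotv (bigD1 j)//= mxE !eqxx mulr1 big1 ?addr0// => i ij.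
    by rewrite mxE eqxx /= (negbTE ij) mulr0.
  have -> : (fun t : R => cutoff (dotv (x + t *: delta_mx 0 j) (x + t *: delta_mx 0 j) - A)) =
      cutoff \o (fun t : R => (dotv x x - A) + 2 * x 0 j * t + dotv (delta_mx 0 j) (delta_mx 0 j) * (t * t)).
    apply/funext => t /=; congr cutoff.
    by rewrite dotvDl !dotvDr !dotvZl !dotvZr (dotvC (delta_mx 0 j) x) dj; ring.
  exact: is_derive_quadratic (is_derive_cutoff _).
have := is_deriveM dq (base_line j x); rewrite scale0r addr0 => h.
apply: (is_derive_eq h); rewrite /dpsi -![_ *: _]/(_ * _); ring.
Qed.

Let base_continuous : continuous base.
Proof.
have [c1 _ _ _] := cyl_psiP P1; have [c2 _ _ _] := cyl_psiP P2.
have k1 := mulmx_rV_continuous (M := M1) c1; have k2 := mulmx_rV_continuous (M := M2) c2.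
move=> x; apply: (@cvgD _ _ _ (nbhs x) (nbhs_filter x)); first exact: k1.
by apply: (@cvgM _ _ (nbhs x) (nbhs_filter x)); [exact: cvg_cst|exact: k2].
Qed.

Let dbase_continuous j : continuous (dbase j).
Proof.
have [_ _ c1 _] := cyl_psiP P1; have [_ _ c2 _] := cyl_psiP P2.
rewrite /dbase; case: fintype.split => i; first exact: mulmx_rV_continuous (c1 i).
by apply: continuous_mul; [exact: cst_continuous|exact: mulmx_rV_continuous (c2 i)].
Qed.

Let dotA_continuous (k : R -> R) : continuous k ->
  continuous (fun x : 'rV[R]_(m1 + m2) => k (dotv x x - A)).
Proof.
move=> ck x; have cA : continuous (fun x : 'rV[R]_(m1 + m2) => dotv x x - A).
  move=> y; apply: (@cvgB _ _ _ (nbhs y) (nbhs_filter y)); [exact: dotv_continuous|exact: cvg_cst].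
by apply: (continuous_comp (cA x)); exact: ck.
Qed.

Let psi_Cc1 : Cc1 psi.
Proof.
have cc := dotA_continuous continuous_cutoff; have cc' := dotA_continuous continuous_cutoff'.
split.
- exact: continuous_mul cc base_continuous.
- by move=> j x; case: (psi_derive j x).
- move=> j; have -> : 'D_(delta_mx 0 j) psi = dpsi j.
    by apply/funext => x; case: (psi_derive j x).
  move=> x; apply: (@cvgD _ _ _ (nbhs x) (nbhs_filter x)).
    apply: continuous_mul base_continuous x; apply: continuous_mul cc' _.
    by apply: continuous_mul; [exact: cst_continuous|exact: coordinate_continuous].
  have c3 := continuous_mul cc (@dbase_continuous j); exact: (c3 x).
- have A0 : 0 <= A + 1 by rewrite addr_ge0// sumr_ge0// => j _; exact: sqr_ge0.
  have cl : closed (closure [set x | psi x != 0]) by exact: closed_closure.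
  apply: (subclosed_compact cl (@dotv_ball_compact _ _ (Num.sqrt (A + 1)))).
  have cb : closed [set a : 'rV[R]_(m1 + m2) | dotv a a <= Num.sqrt (A + 1) ^+ 2].
    exact: dotv_ball_closed.
  rewrite closureE => x; apply; split => // y /=; rewrite sqr_sqrtr//.
  apply: contraNT; rewrite -ltNge => h; rewrite /psi cutoff_ge1 ?mul0r//; lra.
Qed.

(* A sum of functions of separate coordinates has no compact support, hence the
   cutoff, which is 1 for [|u| <= r]. *)
Definition tcyl_lin : Tcyl Omega := Build_Tcyl wV psi_Cc1.

Lemma tcyl_linE u : (forall v, space_V Omega v -> `|dot u v| <= r * norm v) ->
  cyl_diff tcyl_lin (L2_dual_V u) = cyl_diff P1 (L2_dual_V u) + c *: cyl_diff P2 (L2_dual_V u).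
Proof.
move=> ur; rewrite /cyl_diff; set X := cyl_coord tcyl_lin _.
have XE j : X 0 j = dot u (w j) by rewrite mxE.
have XA : dotv X X - A <= 0.
  rewrite subr_le0 /dotv; apply: ler_sum => j _; rewrite XE -expr2.
  by apply: sqr_le_of_norm; exact: ur.
have [k1 k2] := cutoff_le0 XA.
have dE j : 'D_(delta_mx 0 j) psi X = dbase j X.
  by have [_ ->] := psi_derive j X; rewrite /dpsi k1 k2 !mul0r add0r mul1r.
rewrite [LHS](eq_bigr (fun j => dbase j X *: w j)); last by move=> j _; rewrite dE.
have XM1 : X *m M1 = cyl_coord P1 (L2_dual_V u).
  rewrite -[X]hsubmxK mul_row_col mulmx1 mulmx0 addr0; apply/rowP => i.
  transitivity (X 0 (lshift m2 i)); first by rewrite mxE.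
  by rewrite XE /w spl [RHS]mxE.
have XM2 : X *m M2 = cyl_coord P2 (L2_dual_V u).
  rewrite -[X]hsubmxK mul_row_col mulmx1 mulmx0 add0r; apply/rowP => i.
  transitivity (X 0 (rshift m1 i)); first by rewrite mxE.
  by rewrite XE /w spr [RHS]mxE.
rewrite [LHS]big_split_ord /=; congr (_ + _).
  by apply: eq_bigr => i _; rewrite /dbase /w spl XM1.
rewrite [RHS]scaler_sumr; apply: eq_bigr => i _.
by rewrite /dbase /w spr XM2 scalerA.
Qed.

End tcyl_lin.

Section tcyl0.
Context {R : realType} (Omega : set (R3 R)).

Lemma Cc1_0 : Cc1 (cst 0 : 'rV[R]_0 -> R).
Proof.
split.
- exact: cst_continuous.
- by move=> j x; exact: derivable_cst.
- by case.
- rewrite /Defs.support (_ : [set x | _] = set0) ?closure0; first exact: compact0.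
  by apply/seteqP; split => x //=; rewrite eqxx.
Qed.

Definition tcyl0 : Tcyl Omega :=
  @Build_Tcyl R Omega 0 (fun=> 0) (fun j => match j with Ordinal _ h => False_ind _ (notF h) end) (cst 0) Cc1_0.

Lemma tcyl0E k : cyl_diff tcyl0 k = 0.
Proof. by rewrite /cyl_diff big_ord0. Qed.

End tcyl0.

(** * Daniell's construction *)

Section daniell.
Context {R : realType} {T : pointedType} (K : set T) (C : set (T -> R))
  (L : (T -> R) -> R).
Hypothesis C_1 : C (cst 1).
Hypothesis C_lin : forall f g (a : R), C f -> C g -> C (fun u => f u + a * g u).
Hypothesis C_mul : forall f g, C f -> C g -> C (fun u => f u * g u).
Hypothesis C_pos : forall f, C f -> C (fun u => Num.max 0 (f u)).
Hypothesis L_lin : forall f g (a : R), C f -> C g ->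
  L (fun u => f u + a * g u) = L f + a * L g.
Hypothesis L_1 : L (cst 1) = 1.
Hypothesis L_ge0 : forall f, C f -> (forall u, K u -> 0 <= f u) -> 0 <= L f.
Hypothesis L_dini : forall h : nat -> T -> R, (forall n, C (h n)) ->
  (forall n u, K u -> 0 <= h n u <= h n.+1 u) ->
  (forall u, K u -> exists n, 1 <= h n u) ->
  forall e, 0 < e -> exists n, 1 - e <= L (h n).

Lemma C_cst (a : R) : C (cst a).
Proof.
have -> : cst a = (fun u => (cst 1 : T -> R) u + (a - 1) * (cst 1 : T -> R) u).
  by apply/funext => u /=; ring.
exact: C_lin.
Qed.

Lemma C_D f g : C f -> C g -> C (fun u => f u + g u).
Proof.
move=> Cf Cg; rewrite (_ : (fun _ => _) = (fun u => f u + 1 * g u)).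
  exact: C_lin.
by apply/funext => u; ring.
Qed.

Lemma C_Z f (a : R) : C f -> C (fun u => a * f u).
Proof.
move=> Cf; rewrite (_ : (fun _ => _) = (fun u => cst 0 u + a * f u)).
  by apply: C_lin => //; exact: C_cst.
by apply/funext => u /=; ring.
Qed.

Lemma L_D f g : C f -> C g -> L (fun u => f u + g u) = L f + L g.
Proof.
move=> Cf Cg; rewrite (_ : (fun _ => _) = (fun u => f u + 1 * g u)).
  by rewrite L_lin// mul1r.
by apply/funext => u; ring.
Qed.

Lemma L_cst (a : R) : L (cst a) = a.
Proof.
have -> : cst a = (fun u => (cst 1 : T -> R) u + (a - 1) * (cst 1 : T -> R) u).
  by apply/funext => u /=; ring.
by rewrite L_lin// L_1; ring.
Qed.

Lemma L_Z f (a : R) : C f -> L (fun u => a * f u) = a * L f.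
Proof.
move=> Cf; rewrite (_ : (fun _ => _) = (fun u => cst 0 u + a * f u)).
  by rewrite L_lin//; [rewrite L_cst add0r|exact: C_cst].
by apply/funext => u /=; ring.
Qed.

Lemma L_le f g : C f -> C g -> (forall u, K u -> f u <= g u) -> L f <= L g.
Proof.
move=> Cf Cg fg; rewrite -subr_ge0.
have := @L_lin g f (-1) Cg Cf; rewrite mulN1r => <-.
by apply: L_ge0 => [|u Ku]; [exact: C_lin|have := fg u Ku; lra].
Qed.

Lemma L_sum (f : nat -> T -> R) n : (forall i, C (f i)) ->
  C (fun u => \sum_(i < n) f i u) /\
  L (fun u => \sum_(i < n) f i u) = \sum_(i < n) L (f i).
Proof.
move=> Cf; elim: n => [|n [CS LS]].
  rewrite (_ : (fun _ => _) = cst 0); last first.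
    by apply/funext => u; rewrite big_ord0.
  by rewrite big_ord0 L_cst; split => //; exact: C_cst.
rewrite (_ : (fun _ => _) = (fun u => (\sum_(i < n) f i u) + f n u)).
  by rewrite big_ord_recr /= L_D// LS; split => //; exact: C_D.
by apply/funext => u; rewrite big_ord_recr.
Qed.

Definition clamp (t : R) : R := Num.min 1 (Num.max 0 t).

Lemma clampE t : clamp t = 1 - Num.max 0 (1 - Num.max 0 t).
Proof.
rewrite /clamp; case: (leP 0 t) => t0.
  case: (leP 1 t) => t1; first by rewrite (max_l (_ : 1 - t <= 0)) ?subr0//; lra.
  by rewrite (max_r (_ : 0 <= 1 - t)); lra.
by rewrite subr0 (max_r (ler01 : 0 <= 1 :> R)) (min_r (ler01 : 0 <= 1 :> R)) subrr. Qed.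

Lemma clamp_itv t : 0 <= clamp t <= 1.
Proof. rewrite /clamp; case: (leP 0 t) => ?; [case: (leP 1 t)|rewrite (min_r (ler01 : 0 <= 1 :> R))]; lra. Qed.

Lemma clamp_ge1 t : 1 <= t -> clamp t = 1.
Proof. by move=> ?; rewrite /clamp max_r ?min_l//; lra. Qed.

Lemma clamp_le0 t : t <= 0 -> clamp t = 0.
Proof. by move=> ?; rewrite /clamp max_l ?min_r. Qed.

Lemma clamp_le s t : s <= t -> clamp s <= clamp t.
Proof. by move=> st; rewrite /clamp le_min2// le_max2. Qed.

Lemma C_clamp f : C f -> C (fun u => clamp (f u)).
Proof.
move=> Cf; rewrite (_ : (fun _ => _) =
  (fun u => cst 1 u + -1 * Num.max 0 (cst 1 u + -1 * Num.max 0 (f u)))).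
  by apply: C_lin => //; apply: C_pos; apply: C_lin => //; exact: C_pos.
by apply/funext => u; rewrite clampE /=; do !rewrite mulN1r.
Qed.

(* [c] bounds [L] along an increasing sequence of [C] reaching [1] on [A `&` K]. *)
Definition cover (A : set T) (h : nat -> T -> R) (c : R) :=
  [/\ forall n, C (h n),
      forall n u, K u -> 0 <= h n u <= h n.+1 u,
      forall u, A u -> K u -> exists n, 1 <= h n u &
      forall n, L (h n) <= c].

Lemma cover_mono A h c : cover A h c ->
  forall m n u, (m <= n)%N -> K u -> h m u <= h n u.
Proof.
move=> [_ hm _ _] m n u + Ku; elim: n => [|n ih]; first by rewrite leqn0 => /eqP->.
rewrite leq_eqVlt => /orP[/eqP-> //|/ih/le_trans]; apply.
by have /andP[] := hm n u Ku.
Qed.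

Lemma cover_ge0 A h c : cover A h c -> 0 <= c.
Proof.
move=> [Ch hm _ hc]; apply: le_trans (hc 0%N); apply: L_ge0 => // u Ku.
by have /andP[] := hm 0%N u Ku.
Qed.

Definition daniell_mu (A : set T) : \bar R :=
  ereal_inf [set c%:E | c in [set c | exists h, cover A h c]].

Lemma daniell_le A h c : cover A h c -> (daniell_mu A <= c%:E)%E.
Proof. by move=> hc; apply: ereal_inf_lbound; exists c => //; exists h. Qed.

Lemma daniell_ge0 A : (0 <= daniell_mu A)%E.
Proof.
apply: le_ereal_inf_tmp => _ [c [h hc] <-]; rewrite lee_fin.
exact: cover_ge0 hc.
Qed.

Lemma daniell_cst A : cover A (fun=> cst 1) 1.
Proof.
split=> // [n u _|u _ _|n]; first by rewrite /= ler01 lexx.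
  by exists 0%N.
by rewrite L_1.
Qed.

Lemma daniell_fin A : daniell_mu A \is a fin_num.
Proof.
rewrite ge0_fin_numE ?daniell_ge0//.
by apply: le_lt_trans (daniell_le (daniell_cst A)) _; rewrite ltry.
Qed.

(** Covers are tested on [K] only, so the zero sequence covers such a set. The outer measure is
    thereby carried by [K]. *)
Lemma daniell_off A : A `&` K = set0 -> daniell_mu A = 0%E.
Proof.
move=> AK; apply/eqP; rewrite eq_le daniell_ge0 andbT.
apply: (@daniell_le A (fun=> cst 0)); split=> [n|n u _|u Au Ku|n].
- exact: C_cst.
- by rewrite /= lexx.
- by have : (A `&` K) u by []; rewrite AK.
- by rewrite L_cst.
Qed.

Lemma daniell_mono : {homo daniell_mu : A B / A `<=` B >-> (A <= B)%E}.
Proof.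
move=> A B AB; apply: le_ereal_inf_tmp => _ [c [h [a b d e]] <-].
by apply: (@daniell_le _ h); split=> // u Au; apply: d; exact: AB.
Qed.

Lemma daniell_approx A (e : R) : 0 < e ->
  exists h c, cover A h c /\ (c%:E <= daniell_mu A + e%:E)%E.
Proof.
move=> e0; have [_ [c [h hc] <-] cl] := lb_ereal_inf_adherent e0 (daniell_fin A).
by exists h, c; split=> //; exact: ltW.
Qed.

Lemma daniell_subadd : sigma_subadditive daniell_mu.
Proof.
move=> A; apply/lee_addgt0Pr => e e0.
apply: le_trans (epsilon_trick _ _ (ltW e0)); last by move=> n; exact: daniell_ge0.
have en n : 0 < e / (2 ^ n.+1)%:R by rewrite divr_gt0// ltr0n expn_gt0.
have /choice[h hP] : forall n, exists h, exists c, cover (A n) h c /\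
    (c%:E <= daniell_mu (A n) + (e / (2 ^ n.+1)%:R)%:E)%E.
  by move=> n; exact: daniell_approx.
have {hP}/choice[c hc] := hP.
set S := (X in (_ <= X)%E).
have cS n : ((\sum_(i < n) c i)%:E <= S)%E.
  rewrite -sumEFin; apply: (@le_trans _ _
    (\sum_(0 <= i < n) (daniell_mu (A i) + (e / (2 ^ i.+1)%:R)%:E))%E).
    by rewrite big_mkord; apply: lee_sum => i _; exact: (hc i).2.
  rewrite /S; apply: nneseries_lim_ge => i _ _; apply: adde_ge0.
    exact: daniell_ge0.
  by rewrite lee_fin ltW.
have S0 : (0 <= S)%E by have := cS 0%N; rewrite big_ord0.
case SE : S => [s| |]; [|by rewrite leey|by rewrite SE in S0].
(* Diagonal cover: stage [n] adds the [n]-th terms of the first [n] covers, so it increases both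
   through more summands and through larger ones. *)
apply: (@daniell_le _ (fun n u => \sum_(i < n) h i n u)).
split=> [n|n u Ku|u [i _ Au] Ku|n].
- by have [] := @L_sum (fun i => h i n) n (fun i => let: And4 q _ _ _ := (hc i).1 in q n).
- have h01 i : 0 <= h i n u <= h i n.+1 u by have [_ q _ _] := (hc i).1; exact: q.
  apply/andP; split; first by apply: sumr_ge0 => i _; have /andP[] := h01 i.
  rewrite big_ord_recr /= -[leLHS]addr0 lerD//.
    by apply: ler_sum => i _; have /andP[] := h01 i.
  by have /andP[/le_trans q /q] := h01 n.
- have [_ q /(_ u Au Ku)[n hn] _] := (hc i).1.
  exists (maxn n i.+1); have im : (i < maxn n i.+1)%N by rewrite leq_max leqnn orbT.
  rewrite (bigD1 (Ordinal im))//= -[leLHS]addr0 lerD//.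
    apply: le_trans hn _; apply: (cover_mono (hc i).1) => //.
    by rewrite leq_maxl.
  apply: sumr_ge0 => j _; have [_ q' _ _] := (hc j).1.
  by have /andP[] := q' (maxn n i.+1) u Ku.
- have [_ ->] := @L_sum (fun i => h i n) n (fun i => let: And4 q _ _ _ := (hc i).1 in q n).
  rewrite -lee_fin -SE; apply: le_trans (cS n); rewrite lee_fin.
  by apply: ler_sum => i _; have [] := (hc i).1.
Qed.

HB.instance Definition _ := isOuterMeasure.Build R T daniell_mu
  (daniell_off (set0I K)) daniell_ge0 daniell_mono daniell_subadd.

Definition cozero (U : set T) := exists f,
  [/\ C f, forall u, K u -> 0 <= f u & forall u, K u -> (U u <-> 0 < f u)].

(** The truncations [ph n] of [n f] increase to the indicator of [U] on [K]. A cover [h] of [X]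
    splits into [h n ph n], which covers the part in [U], and [h n (1 - ph N)], which covers the
    rest; linearity of [L] makes the two bounds add up to [c + e]. *)
Lemma cozero_caratheodory U : cozero U -> daniell_mu.-caratheodory U.
Proof.
move=> [f [Cf f0 Uf]]; apply: le_caratheodory_measurable => X.
apply: le_ereal_inf_tmp => _ [c [h hc] <-].
pose ph n u := clamp (n%:R * f u).
have Cph n : C (ph n) by apply: C_clamp; exact: C_Z.
have [Ch hm hA hL] := hc.
have ph01 n u : 0 <= ph n u <= 1 by exact: clamp_itv.
have phm m n u : (m <= n)%N -> K u -> ph m u <= ph n u.
  by move=> mn Ku; apply: clamp_le; rewrite ler_wpM2r ?ler_nat// f0.
pose a n u := h n u * ph n u.
have Ca n : C (a n) by exact: C_mul.
have h0 n u : K u -> 0 <= h n u by move=> Ku; have /andP[] := hm n u Ku.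
have am n u : K u -> 0 <= a n u <= a n.+1 u.
  move=> Ku; have /andP[p0 p1] := ph01 n u; have /andP[q0 q1] := hm n u Ku.
  by rewrite /a mulr_ge0//= ler_pM// phm.
have aLm m n : (m <= n)%N -> L (a m) <= L (a n).
  move=> mn; apply: L_le => // u Ku.
  by rewrite /a ler_pM ?h0 ?phm//; [have /andP[] := ph01 m u|exact: (cover_mono hc)].
have aLc n : L (a n) <= c.
  apply: le_trans (hL n); apply: L_le => // u Ku.
  by rewrite /a -[leRHS]mulr1 ler_wpM2l ?h0//; have /andP[] := ph01 n u.
pose s := sup [set L (a n) | n in setT].
have hs : has_sup [set L (a n) | n in setT].
  by split; [exists (L (a 0%N)), 0%N|exists c => _ [n _ <-]].
have as_ n : L (a n) <= s by apply: ub_le_sup; [exact: hs.2|exists n].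
have c1 : cover (X `&` U) a s.
  split=> // u [Xu Uu] Ku; have [n hn] := hA u Xu Ku.
  have fu : 0 < f u by apply/Uf.
  have [m mf] : exists m : nat, (f u)^-1 <= m%:R.
    exists (Num.truncn (f u)^-1).+1; apply/ltW/truncnS_gt.
  exists (maxn m n).
  rewrite /a (_ : ph _ u = 1) ?mulr1.
    by apply: le_trans hn _; apply: (cover_mono hc) => //; exact: leq_maxr.
  apply: clamp_ge1; rewrite -ler_pdivrMr// mul1r; apply: le_trans mf _.
  by rewrite ler_nat leq_maxl.
apply/lee_addgt0Pr => e e0.
have [_ [N _ <-] Ns] := sup_adherent e0 hs.
pose b n u := h n u + -1 * (h n u * ph N u).
have Cb n : C (b n) by apply: C_lin => //; exact: C_mul.
have c2 : cover (X `&` ~` U) b (c - s + e).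
  split=> // [n u Ku|u [Xu Uu] Ku|n].
  - have /andP[p0 p1] := ph01 N u; have /andP[q0 q1] := hm n u Ku.
    have E k : b k u = h k u * (1 - ph N u) by rewrite /b; ring.
    by rewrite !E mulr_ge0 ?subr_ge0//= ler_wpM2r// subr_ge0.
  - have [n hn] := hA u Xu Ku; exists n; rewrite /b /ph clamp_le0 ?mulr0 ?addr0//.
    suff -> : f u = 0 by rewrite mulr0.
    apply/eqP; rewrite eq_le f0// andbT leNgt; apply/negP => fu.
    by apply: Uu; apply/Uf.
  - have bm m k : (m <= k)%N -> L (b m) <= L (b k).
      move=> mk; apply: L_le => // u Ku; have /andP[p0 p1] := ph01 N u.
      have q := cover_mono hc mk Ku.
      have E j : b j u = h j u * (1 - ph N u) by rewrite /b; ring.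
      by rewrite !E ler_wpM2r// subr_ge0.
    apply: le_trans (bm n (maxn n N) (leq_maxl _ _)) _.
    rewrite /b L_lin//; last exact: C_mul.
    have : L (a N) <= L (fun u => h (maxn n N) u * ph N u).
      apply: L_le => //; first exact: C_mul.
      move=> u Ku; rewrite /a ler_wpM2r//; first by have /andP[] := ph01 N u.
      by apply: (cover_mono hc) => //; exact: leq_maxr.
    by have := hL (maxn n N); move: Ns; rewrite -/s; lra.
apply: le_trans (leeD (daniell_le c1) (daniell_le c2)) _.
by rewrite -!EFinD lee_fin; lra.
Qed.

Variable G : set (set T).
Hypothesis G_cozero : G `<=` cozero.

Let I : measurableType _ := g_sigma_algebraType G.

Lemma daniell_caratheodory : <<s G >> `<=` daniell_mu.-cara.-measurable.
Proof.
apply: smallest_sub; last by move=> A /G_cozero; exact: cozero_caratheodory.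
by split=> // [A mA|F mF]; [rewrite setTD; exact: measurableC|exact: bigcupT_measurable].
Qed.

Definition daniell_measure : set I -> \bar R := daniell_mu.

Lemma daniell_measure_additive : semi_sigma_additive daniell_measure.
Proof.
move=> F mF tF mUF; rewrite /daniell_measure.
apply: caratheodory_measure_sigma_additive => //; last exact: daniell_caratheodory.
by move=> i; exact: (daniell_caratheodory (mF i)).
Qed.

HB.instance Definition _ := isMeasure.Build _ _ _ daniell_measure
  (daniell_off (set0I K)) daniell_ge0 daniell_measure_additive.

(** Here the Dini condition enters: a cover of the whole space has values of [L] arbitrarily close
    to 1, so no mass is lost. *)
Lemma daniell_measureT : daniell_measure setT = 1%E.
Proof.
apply/eqP; rewrite eq_le (daniell_le (daniell_cst setT))/=.
apply: le_ereal_inf_tmp => _ [c [h [Ch hm hA hL]] <-].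
rewrite lee_fin; apply/ler_addgt0Pr => e e0.
have [n] := L_dini Ch hm (fun u => hA u Logic.I) e0.
by have := hL n; lra.
Qed.

HB.instance Definition _ := Measure_isProbability.Build _ _ _ daniell_measure
  daniell_measureT.

Definition daniell_prob : probability I R := daniell_measure.

Lemma le_sum_step n (x : R) : x <= n%:R -> x <= \sum_(i < n) ((i%:R < x)%R : nat)%:R.
Proof.
suff : Num.min n%:R x <= \sum_(i < n) ((i%:R < x)%R : nat)%:R by move=> + xn; rewrite min_r.
elim: n => [|n ih]; first by rewrite big_ord0 ge_min lexx.
rewrite big_ord_recr /=; have [nx|nx] := ltP n%:R x.
  rewrite mulr1n; move: ih; rewrite min_l ?(ltW nx)// => ih.
  by rewrite ge_min -natr1 lerD2r ih.
rewrite addr0; apply: le_trans ih; rewrite !min_r//.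
by rewrite (le_trans nx)// ler_nat.
Qed.

Lemma sum_clamp_le n (x : R) : 0 <= x ->
  \sum_(i < n) clamp (x - i%:R + 1) <= x + 1.
Proof.
move=> x0.
suff : \sum_(i < n) clamp (x - i%:R + 1) <= Num.min n%:R (x + 1).
  by rewrite le_min => /andP[].
elim: n => [|n ih]; first by rewrite big_ord0 le_min lexx /=; lra.
move: ih; rewrite big_ord_recr /= !le_min -natr1 => /andP[i1 i2].
have /andP[c0 c1] := clamp_itv (x - n%:R + 1).
apply/andP; split; first by lra.
have [xn|xn] := leP (x - n%:R + 1) 0; first by rewrite clamp_le0//; lra.
suff : clamp (x - n%:R + 1) <= x - n%:R + 1 by lra.
by rewrite /clamp max_r ?ge_min ?lexx ?orbT// ltW.
Qed.

Hypothesis mK : measurable (K : set I).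

Lemma daniell_probC : daniell_prob (~` K) = 0%E.
Proof. by apply: daniell_off; rewrite setICl. Qed.

Lemma daniell_probK : daniell_prob K = 1%E.
Proof.
by have := probability_setC daniell_prob (measurableC mK); rewrite setCK daniell_probC sube0.
Qed.

(** Layer-cake with [n + 1] levels. The function [ph i] of [C] is 1 on the level set [A i], which
    bounds its measure; the sum of the [ph i] exceeds [(n + 1) g] by at most 1, hence the error
    [1 / (n + 1)]. *)
Lemma daniell_integral_le g n : C g -> measurable_fun (K : set I) (g : I -> R) ->
  (forall u, K u -> 0 <= g u <= 1) ->
  (\int[daniell_prob]_(u in K) (g u)%:E <= (L g + n.+1%:R^-1)%:E)%E.
Proof.
move=> Cg mg g01.
pose A i : set I := K `&` [set u | i%:R < n.+1%:R * g u].
have mA i : measurable (A i).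
  rewrite (_ : A i = K `&` g @^-1` `](n.+1%:R^-1 * i%:R), +oo[%classic).
    by apply: mg => //; exact: measurable_itv.
  apply/seteqP; split=> u [Ku] /=; rewrite in_itv/= andbT ltr_pdivrMl//; split.
pose ph i u := clamp (n.+1%:R * g u + (1 - i%:R)).
have Cph i : C (ph i) by apply: C_clamp; apply: C_D (C_cst _); exact: C_Z.
have PA i : (daniell_prob (A i) <= (L (ph i))%:E)%E.
  apply: (@daniell_le _ (fun=> ph i)); split=> // [_ u _|u [Ku /= Au] _].
    by have /andP[-> _] := clamp_itv (n.+1%:R * g u + (1 - i%:R)); rewrite /= lexx.
  by exists 0%N; rewrite /ph clamp_ge1//; move: Au; lra.
apply: (@le_trans _ _ (\int[daniell_prob]_(u in K)
   (\sum_(i < n.+1) (n.+1%:R^-1)%:E * (\1_(A i) u)%:E))%E).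
  apply: ge0_le_integral => //.
  - by move=> u /g01 /andP[? _]; rewrite lee_fin.
  - exact/measurable_EFinP.
  - apply: emeasurable_sum => i _; apply: emeasurable_funM => //.
    exact/measurable_EFinP.
  - move=> u Ku; under eq_bigr do rewrite -EFinM.
    rewrite sumEFin lee_fin -mulr_sumr mulrC ler_pdivlMr// mulrC.
    apply: le_trans (@le_sum_step n.+1 _ _) _.
      by rewrite -[leRHS]mulr1 ler_wpM2l//; have /andP[] := g01 u Ku.
    apply: ler_sum => i _; rewrite indicE; case: ltP => //= ? .
    by rewrite mem_set.
rewrite ge0_integral_sum//; first last.
- move=> i; apply: emeasurable_funM => //; exact/measurable_EFinP.
have [CS LS] := @L_sum ph n.+1 Cph.
apply: (@le_trans _ _ (n.+1%:R^-1 * \sum_(i < n.+1) L (ph i))%:E).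
  rewrite mulr_sumr -sumEFin; apply: lee_sum => i _.
  rewrite ge0_integralZl_EFin ?invr_ge0//; last exact/measurable_EFinP.
  rewrite integral_indic// EFinM; apply: lee_wpmul2l; first by rewrite lee_fin invr_ge0.
  by rewrite (_ : A i `&` _ = A i); [exact: PA|by apply/seteqP; split=> [u []//|u Au]; split=> //; case: Au].
rewrite lee_fin -LS mulrC ler_pdivrMr// mulrDl mulVf ?pnatr_eq0// mulrC -L_Z//.
rewrite -[X in _ + X]L_1.
rewrite -L_D//; last exact: C_Z.
apply: L_le => //; first by apply: C_D => //; exact: C_Z.
move=> u Ku /=; apply: le_trans (@sum_clamp_le n.+1 _ _).
  by apply: ler_sum => i _; rewrite /ph (_ : _ + (1 - _) = n.+1%:R * g u - i%:R + 1)//; ring.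
by rewrite mulr_ge0//; have /andP[] := g01 u Ku.
Qed.

(** The upper bound applied to [g] and to [1 - g]; both integrals add up to 1 and so do the values
    of [L], so both bounds are equalities. *)
Lemma daniell_integral01 g : C g -> measurable_fun (K : set I) (g : I -> R) ->
  (forall u, K u -> 0 <= g u <= 1) ->
  (\int[daniell_prob]_(u in K) (g u)%:E = (L g)%:E)%E.
Proof.
have le h : C h -> measurable_fun (K : set I) (h : I -> R) ->
    (forall u, K u -> 0 <= h u <= 1) ->
    (\int[daniell_prob]_(u in K) (h u)%:E <= (L h)%:E)%E.
  move=> Ch mh h01; apply/lee_addgt0Pr => e e0.
  have [n ne] : exists n : nat, n.+1%:R^-1 <= e.
    exists (Num.truncn e^-1); rewrite invf_ple ?posrE//.
    exact/ltW/truncnS_gt.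
  by apply: le_trans (@daniell_integral_le h n Ch mh h01) _; rewrite -EFinD lee_fin lerD2l.
move=> Cg mg g01; apply/eqP; rewrite eq_le le//=.
pose g' u := 1 + -1 * g u.
have Cg' : C g' by exact: (C_lin (-1) C_1 Cg).
have mg' : measurable_fun (K : set I) (g' : I -> R).
  by apply: measurable_funD => //; exact: measurable_funM.
have g'01 u : K u -> 0 <= g' u <= 1 by move=> /g01 /andP[a b]; rewrite /g'; apply/andP; split; lra.
have := le _ Cg' mg' g'01.
have -> : L g' = 1 - L g by have := L_lin (-1) C_1 Cg; rewrite L_1 mulN1r.
have S : (\int[daniell_prob]_(u in K) (g u)%:E +
    \int[daniell_prob]_(u in K) (g' u)%:E = 1%:E)%E.
  rewrite -ge0_integralD//; first last.
  - exact/measurable_EFinP.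
  - by move=> u /g'01 /andP[? _]; rewrite lee_fin.
  - exact/measurable_EFinP.
  - by move=> u /g01 /andP[? _]; rewrite lee_fin.
  rewrite (eq_integral (cst 1%E)); last first.
    by move=> u _; rewrite -EFinD /g'; congr (_%:E); ring.
  by rewrite integral_cst//= daniell_probK mule1.
have a0 : (0 <= \int[daniell_prob]_(u in K) (g u)%:E)%E.
  by apply: integral_ge0 => u /g01 /andP[? _]; rewrite lee_fin.
have b0 : (0 <= \int[daniell_prob]_(u in K) (g' u)%:E)%E.
  by apply: integral_ge0 => u /g'01 /andP[? _]; rewrite lee_fin.
move: S a0 b0; case: (\int[_]_(_ in _) (g _)%:E)%E => [a| |]; last by [].
- case: (\int[_]_(_ in _) (g' _)%:E)%E => [b [S] _ _| |] //.
  by rewrite !lee_fin; lra.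
- by case: (\int[_]_(_ in _) (g' _)%:E)%E.
Qed.

Lemma daniell_integral g b : C g -> measurable_fun (K : set I) (g : I -> R) ->
  (forall u, K u -> `|g u| <= b) ->
  (\int[daniell_prob]_(u in K) (g u)%:E = (L g)%:E)%E.
Proof.
move=> Cg mg gb; pose B := `|b| + 1.
have B0 : 0 < B by rewrite /B ltr_wpDl.
have gB u : K u -> - B <= g u <= B.
  by move=> /gb q; rewrite -ler_norml; apply: le_trans q _; rewrite /B ler_wpDr// ler_norm.
pose s := (2 * B)^-1; have s0 : 0 < s by rewrite invr_gt0 mulr_gt0.
pose g' u := cst (2^-1) u + s * g u.
have Cg' : C g' by apply: C_lin => //; exact: C_cst.
have mg' : measurable_fun (K : set I) (g' : I -> R).
  by apply: measurable_funD => //; exact: measurable_funM.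
have sB : s * B = 2^-1 by rewrite /s; field; rewrite gt_eqF.
have g'01 u : K u -> 0 <= g' u <= 1.
  move=> /gB /andP[l r]; rewrite /g' /=.
  have : s * - B <= s * g u by rewrite ler_wpM2l// ltW.
  have : s * g u <= s * B by rewrite ler_wpM2l// ltW.
  by rewrite mulrN sB => ? ?; apply/andP; split; lra.
have Pf : (daniell_prob K < +oo)%E by rewrite daniell_probK ltry.
have ig' : daniell_prob.-integrable K (EFin \o g').
  apply: measurable_bounded_integrable => //; exists 1; split => // x x1 u /g'01.
  by move=> /andP[l r] /=; rewrite ger0_norm//; apply: le_trans r _; exact: ltW.
have -> : g = (fun u => cst (- B) u + (2 * B) * g' u).
  by apply/funext => u; rewrite /g' /= mulrDr mulrA /s divff ?mul1r ?gt_eqF ?mulr_gt0//; field.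
rewrite L_lin//; [rewrite L_cst|exact: C_cst].
rewrite EFinD EFinM -(daniell_integral01 Cg' mg' g'01).
under eq_integral do rewrite EFinD EFinM.
rewrite integralD//; [|exact: finite_measure_integrable_cst|exact: integrableZl].
rewrite -[X in (X + _)%E]/(\int[daniell_prob]_(x in K) cst (- B)%:E x)%E.
rewrite integral_cst//= daniell_probK mule1 integralZl//.
Qed.

Lemma daniell_representation : exists P : probability I R, P (~` K) = 0%E /\
  forall g b, C g -> measurable_fun (K : set I) (g : I -> R) ->
    (forall u, K u -> `|g u| <= b) ->
    (\int[P]_(u in K) (g u)%:E = (L g)%:E)%E.
Proof. by exists daniell_prob; split; [exact: daniell_probC|exact: daniell_integral]. Qed.

End daniell.

(** * The dual functional and its representing measure *)

Section dual_functional.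
Context {R : realType} {E : lmodType R}.
Variables (H V : set E) (h g : E -> E -> R).
Hypothesis S : hilbert_pair H V h g.
Notation nH := (nrm h).
Notation nV := (nrm g).
Variables (r0 nu : R) (f : E -> R).
Hypotheses (r0_ge0 : 0 <= r0) (nu0 : 0 < nu) (fb : bounded_lin V g f).
Notation K := (kset V h r0).
Notation ell := (energy g nu f).
Notation mix := (mixed V h g r0 nu f).

(** This growth admits the enstrophy itself, on which the linear form must be bounded to satisfy the
    Dini condition. The codomain [R^o] supplies the module structure used by [hahn_banach]. *)
Definition quadratic : set (E -> R^o) :=
  [set G | exists C, forall u, K u -> `|G u| <= C * (1 + nV u ^+ 2)].

Lemma quadratic_D (G1 G2 : E -> R^o) : quadratic G1 -> quadratic G2 -> quadratic (G1 + G2).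
Proof.
move=> [C1 h1] [C2 h2]; exists (C1 + C2) => u Ku; rewrite mulrDl.
by apply: le_trans (ler_normD _ _) (lerD _ _); [exact: h1|exact: h2].
Qed.

Lemma quadratic_Z a (G : E -> R^o) : quadratic G -> quadratic (a *: G).
Proof.
move=> [C hC]; exists (`|a| * C) => u Ku; rewrite -mulrA.
by apply: le_trans (_ : _ <= `|a| * `|G u|) _; [rewrite -normrM|rewrite ler_wpM2l// hC].
Qed.

Lemma quadratic_bounded (G : E -> R^o) b : (forall u, K u -> `|G u| <= b) -> quadratic G.
Proof.
move=> Gb; exists `|b| => u Ku; apply: le_trans (Gb u Ku) _.
apply: le_trans (ler_norm b) _; rewrite -[leLHS]mulr1 ler_wpM2l// lerDl.
exact: sqr_ge0.
Qed.

Lemma quadratic_sub (G : E -> R^o) : subquadratic V h g r0 G -> quadratic G.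
Proof.
move=> /(_ 1 ltr01)[C GC]; exists (1 + `|C|) => u Ku; apply: le_trans (GC u Ku) _.
rewrite mul1r mulrDr mulr1 mulrDl mul1r.
have := ler_norm C; have : 0 <= `|C| * nV u ^+ 2 by rewrite mulr_ge0 ?sqr_ge0.
lra.
Qed.

Lemma quadratic_nV : quadratic (fun u => nV u ^+ 2).
Proof. by exists 1 => u _; rewrite mul1r ger0_norm ?sqr_ge0// lerDr. Qed.

Definition mean_sup (G : E -> R^o) : R := sup [set y | exists t1 t2 u1 u2,
  mix t1 t2 u1 u2 /\ y = t1 * G u1 + t2 * G u2].

Let mix0 : mix 1 0 0 0.
Proof. by apply: mixed1; [exact: (kset0 S r0_ge0)|rewrite (energy0 S nu fb)]. Qed.

Lemma mean_bound (G : E -> R^o) : quadratic G -> exists B, forall t1 t2 u1 u2,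
  mix t1 t2 u1 u2 -> `|t1 * G u1 + t2 * G u2| <= B.
Proof.
have [B [B0 BP]] := mixed_enstrophy h r0 nu0 fb.
move=> [C GC]; exists (`|C| * (1 + B)) => t1 t2 u1 u2 mx.
have := BP _ _ _ _ mx; case: mx => [[t10 t20] t12 [K1 K2] _ _] eB.
apply: le_trans (ler_normD _ _) _; rewrite !normrM (ger0_norm t10) (ger0_norm t20).
have q u : K u -> `|G u| <= `|C| * (1 + nV u ^+ 2).
  by move=> /GC /le_trans; apply; rewrite ler_wpM2r ?ler_norm// addr_ge0 ?sqr_ge0.
apply: (@le_trans _ _ (`|C| * (1 + (t1 * nV u1 ^+ 2 + t2 * nV u2 ^+ 2)))).
  have h1 := ler_wpM2l t10 (q _ K1); have h2 := ler_wpM2l t20 (q _ K2).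
  apply: le_trans (lerD h1 h2) _.
  have -> x a b : t1 * (x * (1 + a)) + t2 * (x * (1 + b)) =
    x * (t1 + t2 + (t1 * a + t2 * b)) :> R by ring.
  by rewrite t12.
by rewrite ler_wpM2l// lerD2l.
Qed.

Lemma mean_sup_ub G t1 t2 u1 u2 : quadratic G -> mix t1 t2 u1 u2 ->
  t1 * G u1 + t2 * G u2 <= mean_sup G.
Proof.
move=> /mean_bound[B hB] mx; apply: ub_le_sup; last by exists t1, t2, u1, u2.
by exists B => _ [s1 [s2 [v1 [v2 [my ->]]]]]; apply: le_trans (ler_norm _) (hB _ _ _ _ my).
Qed.

Lemma mean_sup_le G b : (forall t1 t2 u1 u2, mix t1 t2 u1 u2 ->
  t1 * G u1 + t2 * G u2 <= b) -> mean_sup G <= b.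
Proof.
move=> Gb; apply: ge_sup.
  by exists (1 * G 0 + 0 * G 0), 1, 0, 0, 0; split; first exact: mix0.
by move=> _ [t1 [t2 [u1 [u2 [mx ->]]]]]; exact: Gb.
Qed.

Variables (D : set (E -> R^o)) (phi : E -> R^o) (M : R).
Hypothesis D_quadratic : D `<=` quadratic.
Hypothesis D_0 : D 0.
Hypothesis D_lin : forall P Q a, D P -> D Q -> D (P + a *: Q).
Hypothesis D_lyapunov : forall P, D P -> exists t1 t2 u1 u2,
  mix t1 t2 u1 u2 /\ 0 <= t1 * P u1 + t2 * P u2.
Hypothesis phi_quadratic : quadratic phi.
Hypothesis phi_M : forall P, D P -> exists t1 t2 u1 u2,
  mix t1 t2 u1 u2 /\ M <= t1 * (phi u1 + P u1) + t2 * (phi u2 + P u2).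

(* Hahn-Banach below the infimum over [t >= 0] and [P] in [D] of
   [mean_sup (G + t phi + P) - t M], where [D_lyapunov] handles [t = 0]. *)
Lemma dual_functional : exists L : (E -> R) -> R, [/\
  forall G1 G2 a, quadratic G1 -> quadratic G2 ->
    L (fun u => G1 u + a * G2 u) = L G1 + a * L G2,
  forall G b, quadratic G -> (forall t1 t2 u1 u2, mix t1 t2 u1 u2 ->
    t1 * G u1 + t2 * G u2 <= b) -> L G <= b,
  M <= L phi & forall P, D P -> L P = 0].
Proof.
pose I : set (R * (E -> R^o)) := [set i | 0 <= i.1 /\ D i.2].
pose F (i : R * (E -> R^o)) (G : E -> R^o) := mean_sup (G + i.1 *: phi + i.2) - i.1 * M.
pose low (G : E -> R^o) := - mean_sup (- G).
have A0 : quadratic 0 by apply: (@quadratic_bounded _ 0) => u _; rewrite normr0.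
have AF i G : I i -> quadratic G -> quadratic (G + i.1 *: phi + i.2).
  by move=> [_ Di] AG; do 2?[apply: quadratic_D => //]; [exact: quadratic_Z|exact: D_quadratic].
have lowF i G : I i -> quadratic G -> low G <= F i G.
  move=> [i0 Di] AG; have AiG := AF i G (conj i0 Di) AG.
  have [t1 [t2 [u1 [u2 [mx le]]]]] : exists t1 t2 u1 u2, mix t1 t2 u1 u2 /\
      i.1 * M <= t1 * (i.1 * phi u1 + i.2 u1) + t2 * (i.1 * phi u2 + i.2 u2).
    have [->|ip] := eqVneq i.1 0.
      have [t1 [t2 [u1 [u2 [mx le]]]]] := D_lyapunov Di; exists t1, t2, u1, u2.
      by rewrite !mul0r !add0r.
    (* For [t > 0] the hypothesis on [M] is applied to the test function divided by [t], then
       multiplied by [t]. *)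
    have {}ip : 0 < i.1 by rewrite lt_def ip.
    have [t1 [t2 [u1 [u2 [mx le]]]]] := phi_M (D_lin i.1^-1 D_0 Di).
    exists t1, t2, u1, u2; split => //.
    have := ler_wpM2l i0 le; have E1 u : i.1 * (phi u + (0 + i.1^-1 *: i.2) u) = i.1 * phi u + i.2 u.
      transitivity (i.1 * (phi u + (0 + i.1^-1 * i.2 u))) => //.
      by rewrite add0r mulrDr mulrA divff ?mul1r// gt_eqF.
    by rewrite mulrDr mulrCA (mulrCA i.1) !E1.
  have AG' : quadratic (- G) by rewrite -scaleN1r; exact: quadratic_Z.
  have h1 := mean_sup_ub AiG mx; have h2 := mean_sup_ub AG' mx.
  rewrite /F /low.
  have E2 u : (G + i.1 *: phi + i.2) u = G u + (i.1 * phi u + i.2 u).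
    by transitivity (G u + i.1 * phi u + i.2 u) => //; rewrite addrA.
  have E3 u : (- G) u = - G u by [].
  by rewrite !E2 in h1; rewrite !E3 in h2; lra.
have I0 : I !=set0 by exists (0, 0).
have FD i j x y : I i -> I j -> quadratic x -> quadratic y ->
    exists2 k, I k & F k (x + y) <= F i x + F j y.
  move=> Ii Ij Ax Ay; exists (i.1 + j.1, i.2 + j.2).
    split; first by rewrite /= addr_ge0//; [case: Ii|case: Ij].
    by rewrite /= -[j.2]scale1r; apply: D_lin; [case: Ii|case: Ij].
  rewrite /F /= mulrDl opprD [leRHS]addrACA lerD2r; apply: mean_sup_le => t1 t2 u1 u2 mx.
  have h1 := mean_sup_ub (AF i x Ii Ax) mx; have h2 := mean_sup_ub (AF j y Ij Ay) mx.
  apply: le_trans (lerD h1 h2).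
  have E2 u : (x + y + (i.1 + j.1) *: phi + (i.2 + j.2)) u =
      (x + i.1 *: phi + i.2) u + (y + j.1 *: phi + j.2) u.
    by rewrite scalerDl (addrACA x y) (addrACA _ _ i.2 j.2).
  by rewrite !E2 !mulrDr addrACA.
have FZ i a x : I i -> 0 < a -> quadratic x -> exists2 k, I k & F k (a *: x) <= a * F i x.
  move=> Ii a0 Ax; exists (a * i.1, a *: i.2).
    split; first by rewrite /= mulr_ge0// ?(ltW a0)//; case: Ii.
    by rewrite /= -[_ *: _]add0r; apply: D_lin => //; case: Ii.
  rewrite /F /= mulrBr mulrA lerD2r; apply: mean_sup_le => t1 t2 u1 u2 mx.
  have E2 u : (a *: x + (a * i.1) *: phi + a *: i.2) u = a * (x + i.1 *: phi + i.2) u.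
    by rewrite -scalerA -!scalerDr.
  rewrite !E2 !(mulrCA _ a) -mulrDr ler_pM2l//.
  exact: mean_sup_ub (AF i x Ii Ax) mx.
have [slq Fq] := sublinear_inf quadratic_D quadratic_Z I0 lowF FD FZ.
have [L [LD LZ Lq]] := hahn_banach A0 quadratic_D quadratic_Z slq.
have Llin G1 G2 a : quadratic G1 -> quadratic G2 ->
    L (fun u => G1 u + a * G2 u) = L G1 + a * L G2.
  move=> A1 A2; rewrite -LZ// -LD//; exact: quadratic_Z.
have LF i G : I i -> quadratic G -> L G <= F i G.
  by move=> Ii AG; apply: le_trans (Lq _ AG) (Fq _ _ Ii AG).
exists L; split=> // [G b AG Gb||P DP].
- have Ii : I (0, 0) by [].
  apply: le_trans (LF _ _ Ii AG) _; rewrite /F /= mul0r subr0 scale0r !addr0.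
  exact: mean_sup_le.
(* At [- phi] with [t = 1] the two occurrences of [phi] cancel, and the bound reads
   [- L phi <= mean_sup 0 - M]. *)
- have Ii : I (1, 0) by [].
  have Aphi' : quadratic (- phi) by rewrite -scaleN1r; exact: quadratic_Z.
  have := LF _ _ Ii Aphi'; rewrite -scaleN1r LZ// mulN1r /F /= scaleN1r scale1r addNr addr0 mul1r.
  have : mean_sup 0 <= 0 by apply: mean_sup_le => *; rewrite !mulr0 addr0.
  lra.
- have le P' : D P' -> L P' <= 0.
    move=> DP'; have Ii : I (0, - P').
      by split => //=; rewrite -scaleN1r -[_ *: _]add0r; exact: D_lin.
    apply: le_trans (LF _ _ Ii (D_quadratic DP')) _.
    rewrite /F /= mul0r subr0 scale0r addr0 subrr.
    by apply: mean_sup_le => *; rewrite !mulr0 addr0.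
  apply/eqP; rewrite eq_le le//=.
  have := le _ (D_lin (-1) D_0 DP); rewrite add0r LZ ?mulN1r; last exact: D_quadratic.
  lra.
Qed.

End dual_functional.

(** * Admissible functions and regularization of the enstrophy *)

Section admissible_functions.
Context {R : realType} {E : lmodType R}.
Variables (H V : set E) (h g : E -> E -> R).
Hypothesis S : hilbert_pair H V h g.
Let iH := hp_H S.
Let VH := hp_sub S.
Notation nH := (nrm h).
Notation nV := (nrm g).
Variables (r0 : R).
Notation K := (kset V h r0).
Notation adm := (admissible V h g r0).

Lemma admissible_ext (G1 G2 : E -> R) : (forall u, K u -> G1 u = G2 u) -> adm G1 -> adm G2.
Proof.
move=> G12 a1 u_ u r Ku Ku' ur uu; rewrite -G12// (_ : (fun n => _) = fun n => G1 (u_ n)).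
  exact: a1 uu.
by apply/funext => n; rewrite G12.
Qed.

Lemma admissible_cst (a : R) : adm (fun=> a).
Proof. by move=> *; exact: cvg_cst. Qed.

Lemma admissible_D (G1 G2 : E -> R) : adm G1 -> adm G2 -> adm (fun u => G1 u + G2 u).
Proof. by move=> a1 a2 u_ u r *; apply: cvgD; [exact: a1|exact: a2]. Qed.

Lemma admissible_M (G1 G2 : E -> R) : adm G1 -> adm G2 -> adm (fun u => G1 u * G2 u).
Proof. by move=> a1 a2 u_ u r *; apply: cvgM; [exact: a1|exact: a2]. Qed.

Lemma admissible_Z (a : R) (G : E -> R) : adm G -> adm (fun u => a * G u).
Proof. by move=> aG; exact: (@admissible_M (fun=> a) G (@admissible_cst a) aG). Qed.

Lemma admissible_comp (c : R -> R) (G : E -> R) : continuous c -> adm G -> adm (fun u => c (G u)).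
Proof.
move=> cc aG u_ u r *; apply: (@cvg_comp _ _ _ (fun n => G (u_ n)) c _ (nbhs (G u))).
  exact: aG.
exact: cc.
Qed.

Lemma admissible_lipschitz (k : R) (G : E -> R) :
  (forall u w, K u -> K w -> G u <= G w + k * nH (u - w)) -> adm G.
Proof.
move=> Gk u_ u r Ku Ku' ur uu; have KH w : K w -> H w by move=> [/VH].
apply/subr_cvg0; apply/norm_cvg0P.
apply: (squeeze_cvgr (_ : \forall n \near \oo, 0 <= `|G (u_ n) - G u| <= k * nH (u_ n - u)) (cvg_cst 0)).
  near=> n; rewrite normr_ge0 ler_norml /=.
  have := Gk _ _ (Ku n) Ku'; have := Gk _ _ Ku' (Ku n).
  by rewrite (nrmBC iH (KH _ Ku') (KH _ (Ku n))) => ? ?; apply/andP; split; lra.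
rewrite -[X in _ --> X](mulr0 k); apply: cvgM => //; exact: cvg_cst.
Unshelve. all: by end_near. Qed.

Lemma admissible_radial (c : R -> R) :
  {within `[0, +oo[%classic, continuous c} -> adm (fun u => c (nH u ^+ 2)).
Proof.
move=> cc u_ u r Ku Ku' ur uu; have KH w : K w -> H w by move=> [/VH].
pose x n := nH (u_ n) ^+ 2.
have xu : x n @[n --> \oo] --> nH u ^+ 2.
  by apply: cvg_sqr; apply: (nrm_cvg iH) => // [n|]; exact: KH.
have {}cc := (subspace_continuousP _ c).1 cc (nH u ^+ 2) _.
apply: (@cvg_comp _ _ _ x c _ (within `[0, +oo[%classic (nbhs (nH u ^+ 2)))); last first.
  by apply: cc; rewrite /= in_itv/= andbT; exact: sqr_ge0.
move=> A /= [e e0 eA].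
have : \forall n \near \oo, ball (nH u ^+ 2) e (x n) := xu _ (nbhsx_ballx _ _ e0).
apply: filterS => n /eA; apply; rewrite /= in_itv/= andbT; exact: sqr_ge0.
Qed.

(** The penalty is the norm itself rather than its square: the infimum is then [k]-Lipschitz for the
    norm of [H] and at most [k r0] on the ball, so it is a bounded admissible function that the
    measure represents. *)
Definition yosida (k : nat) (u : E) : R :=
  inf [set x | exists w, V w /\ x = nV w ^+ 2 + k%:R * nH (u - w)].

Lemma yosida_lb k u : has_lbound [set x | exists w, V w /\ x = nV w ^+ 2 + k%:R * nH (u - w)].
Proof. by exists 0 => _ [w [_ ->]]; rewrite addr_ge0 ?sqr_ge0// mulr_ge0// nrm_ge0. Qed.

Lemma yosida_le k u w : V w -> yosida k u <= nV w ^+ 2 + k%:R * nH (u - w).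
Proof. by move=> Vw; apply: ge_inf; [exact: yosida_lb|exists w]. Qed.

Let V0 : V 0 := in_0 (hp_V S).

Lemma yosida_ge k u b : (forall w, V w -> b <= nV w ^+ 2 + k%:R * nH (u - w)) -> b <= yosida k u.
Proof.
move=> hb; apply: lb_le_inf => [|_ [w [Vw ->]]]; last exact: hb.
by exists (nV 0 ^+ 2 + k%:R * nH (u - 0)), 0.
Qed.

Lemma yosida_ge0 k u : 0 <= yosida k u.
Proof. by apply: yosida_ge => w _; rewrite addr_ge0 ?sqr_ge0// mulr_ge0// nrm_ge0. Qed.

Lemma yosida_le_sqr k u : V u -> yosida k u <= nV u ^+ 2.
Proof. by move=> Vu; have := yosida_le k u Vu; rewrite subrr (nrm0 iH) mulr0 addr0. Qed.

Lemma yosida_bounded k u : K u -> yosida k u <= k%:R * r0.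
Proof.
move=> [Vu ur]; apply: le_trans (yosida_le k u V0) _.
by rewrite (nrm0 (hp_V S)) expr0n add0r subr0 ler_wpM2l.
Qed.

Lemma yosida_mono k l u : (k <= l)%N -> yosida k u <= yosida l u.
Proof.
move=> kl; apply: yosida_ge => w Vw; apply: le_trans (yosida_le k u Vw) _.
by rewrite lerD2l ler_wpM2r ?nrm_ge0// ler_nat.
Qed.

Lemma yosida_admissible k : adm (yosida k).
Proof.
apply: (@admissible_lipschitz k%:R) => u w Ku Kw; rewrite -lerBlDr.
apply: yosida_ge => z Vz; rewrite lerBlDr; apply: le_trans (yosida_le k u Vz) _.
have [Hu Hw Hz] : [/\ H u, H w & H z] by split; apply: VH; [case: Ku|case: Kw|].
by rewrite -addrA lerD2l -mulrDr ler_wpM2l// [leRHS]addrC; exact: (nrm_triB iH).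
Qed.

(* Lower semicontinuity of [nV] for the norm [nH]: near-minimizers of the
   infima defining [yosida k u] converge to [u] with bounded [nV]. *)
Lemma yosida_cvg u : V u -> yosida k u @[k --> \oo] --> nV u ^+ 2.
Proof.
move=> Vu; pose s := sup [set yosida k u | k in setT].
have hs : has_sup [set yosida k u | k in setT].
  split; first by exists (yosida 0 u), 0%N.
  by exists (nV u ^+ 2) => _ [k _ <-]; exact: yosida_le_sqr.
have ks k : yosida k u <= s by apply: ub_le_sup; [exact: hs.2|exists k].
have s0 : 0 <= s := le_trans (yosida_ge0 0 u) (ks 0%N).
have : nondecreasing_seq (fun k => yosida k u) by move=> k l; exact: yosida_mono.
move=> /nondecreasing_cvgn /(_ hs.2); rewrite -/s.
suff -> : s = nV u ^+ 2 by [].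
apply/eqP; rewrite eq_le; apply/andP; split.
  by apply: ge_sup; [exact: hs.1|move=> _ [k _ <-]; exact: yosida_le_sqr].
have /choice[w wP] : forall k : nat, exists w, V w /\
    nV w ^+ 2 + k%:R * nH (u - w) < s + k.+1%:R^-1.
  move=> k; apply: contrapT => /forallNP nw.
  have : s + k.+1%:R^-1 <= yosida k u.
    by apply: yosida_ge => w Vw; have /not_andP[//|/negP] := nw w; rewrite -leNgt.
  by move=> /le_trans/(_ (ks k)); rewrite gerDl leNgt invr_gt0 ltr0n.
have kpos (k : nat) : 0 <= k%:R :> R by [].
have wV k : nV (w k) ^+ 2 <= s + k.+1%:R^-1.
  have [_ /ltW q] := wP k; apply: le_trans q.
  by rewrite lerDl mulr_ge0// nrm_ge0.
have wH k : nH (w k.+1 - u) <= k.+1%:R^-1 * (s + 1).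
  have [Vw /ltW q] := wP k.+1; rewrite (nrmBC iH (VH Vw) (VH Vu)).
  rewrite mulrC ler_pdivlMr// mulrC.
  have : k.+2%:R^-1 <= 1 :> R by rewrite invf_le1// ler1n.
  move=> k1; apply: le_trans (_ : _ <= s + k.+2%:R^-1) _; last by rewrite lerD2l.
  by apply: le_trans q; rewrite lerDr sqr_ge0.
have wu : nH (w k.+1 - u) @[k --> \oo] --> 0.
  apply: (squeeze_cvgr _ (cvg_cst 0)); last first.
    rewrite -[X in _ --> X](mul0r (s + 1)); apply: cvgM; last exact: cvg_cst.
    exact: (@cvg_harmonic R).
  by near=> k; rewrite nrm_ge0 wH.
apply/ler_addgt0Pr => e e0.
have [N NP] : exists N : nat, forall k, (N <= k)%N -> k.+1%:R^-1 <= e.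
  exists (Num.truncn e^-1) => k Nk; rewrite invf_ple ?posrE//.
  by apply/ltW; apply: lt_le_trans (truncnS_gt _) _; rewrite ler_nat ltnS.
apply: sqr_le_sqrt; [exact: nrm_ge0|exact: addr_ge0 (ltW e0)|].
apply: (@weak_limit_near _ _ _ _ _ _ S (fun k => w k.+1) u N) => //.
- by move=> k; have [] := wP k.+1.
- exact: VH.
- move=> k Nk; apply: le_sqrt; first exact: nrm_ge0.
  apply: le_trans (wV _) _; rewrite lerD2l; apply: NP.
  exact: leq_trans Nk _.
Unshelve. all: by end_near. Qed.

End admissible_functions.

(** * Borel structure of H and the representing measure *)

Section norm_borel.
Context {R : realType} {E : lmodType R}.
Variables (H V : set E) (h g : E -> E -> R).
Hypothesis S : hilbert_pair H V h g.
Let iH := hp_H S.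
Let VH := hp_sub S.
Notation nH := (nrm h).
Notation nV := (nrm g).
Variables (T : pointedType) (v : T -> E).
Hypothesis vH : forall t, H (v t).

Definition norm_open : set (set T) :=
  [set U | forall t, U t -> exists2 e : R, 0 < e &
     forall s, nH (v s - v t) < e -> U s].

Notation B := (g_sigma_algebraType norm_open).

Lemma closed_measurable (Z : set B) :
  (forall (z : nat -> T) t, (forall n, Z (z n)) ->
     nH (v (z n) - v t) @[n --> \oo] --> 0 -> Z t) -> measurable Z.
Proof.
move=> Zc; rewrite -[Z]setCK; apply: measurableC; apply: sub_sigma_algebra => t nZt.
apply: contrapT => /forall2NP nU; apply: nZt.
have /choice[z zP] : forall n : nat, exists s, nH (v s - v t) < n.+1%:R^-1 /\ Z s.
  move=> n; have [|/existsNP[s /not_implyP[st /contrapT Zs]]] := nU n.+1%:R^-1; first by rewrite invr_gt0.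
  by exists s.
apply: (Zc z) => [n|]; first by case: (zP n).
apply: (squeeze_cvgr _ (cvg_cst 0)); last exact: (@cvg_harmonic R).
by near=> n; rewrite nrm_ge0 ltW//; case: (zP n).
Unshelve. all: by end_near. Qed.

Lemma measurable_fun_upper (D : set B) (G : B -> R) : measurable D ->
  (forall a, measurable (D `&` [set t | a <= G t])) -> measurable_fun D G.
Proof.
move=> mD mG; apply: (measurability (@RGenCInfty.G R)) => [|/= _ [_ [a ->] <-]].
  exact: RGenCInfty.measurableE.
have -> : G @^-1` `[a, +oo[%classic = [set t | a <= G t].
  by apply/seteqP; split=> t /=; rewrite in_itv/= andbT.
exact: (mG a).
Qed.

Definition enstrophy_le (a : R) : set B := [set t | V (v t) /\ nV (v t) <= a].

(** Balls of [V] are closed for the norm of [H] by weak compactness; hence [V], their countable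
    union, is a Borel set. *)
Lemma measurable_enstrophy_le a : measurable (enstrophy_le a).
Proof.
apply: closed_measurable => z t Zz zt.
by apply: (weak_limit_le S _ _ (vH t) zt) => n; have [] := Zz n.
Qed.

Definition Vset : set B := [set t | V (v t)].

Lemma bigcup_enstrophy_le : Vset = \bigcup_(n : nat) enstrophy_le n%:R.
Proof.
apply/seteqP; split=> [t Vt|t [n _ []]//].
exists (Num.truncn (nV (v t))).+1 => //; split=> //.
exact/ltW/truncnS_gt.
Qed.

Lemma measurable_Vset : measurable Vset.
Proof.
by rewrite bigcup_enstrophy_le; apply: bigcupT_measurable => n; exact: measurable_enstrophy_le.
Qed.

Lemma measurable_nV : measurable_fun Vset (fun t : B => nV (v t)).
Proof.
rewrite (_ : (fun t => _) = \- (fun t : B => - nV (v t))); last first.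
  by apply/funext => t /=; rewrite opprK.
apply: measurable_funN; apply: measurable_fun_upper => [|a]; first exact: measurable_Vset.
rewrite (_ : _ `&` _ = enstrophy_le (- a)); first exact: measurable_enstrophy_le.
by apply/seteqP; split=> t [Vt] /=; rewrite lerNr.
Qed.

Lemma measurable_nH : measurable_fun setT (fun t : B => nH (v t)).
Proof.
apply: measurable_fun_upper => // a; rewrite setTI.
apply: closed_measurable => z t Zz zt.
have /ler_cvg_to : (cst a : nat -> R) @ \oo --> a by exact: cvg_cst.
apply; first exact: (nrm_cvg iH (fun n => vH (z n)) (vH t) zt).
by apply: nearW => n; exact: Zz.
Qed.

Variable r0 : R.
Notation K := (kset V h r0).
Notation adm := (admissible V h g r0).

Definition Kset : set B := [set t | K (v t)].

Lemma KsetE : Kset = Vset `&` [set t | nH (v t) <= r0].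
Proof. by []. Qed.

Lemma measurable_Kset : measurable Kset.
Proof.
rewrite KsetE; apply: measurableI; first exact: measurable_Vset.
rewrite (_ : [set t | _] = setT `&` (fun t : B => nH (v t)) @^-1` `]-oo, r0]%classic).
  by apply: measurable_nH => //; exact: measurable_itv.
by apply/seteqP; split=> t /=; rewrite in_itv/= => // [[]].
Qed.

Lemma bigcup_Kset : Kset = \bigcup_(n : nat) (Kset `&` enstrophy_le n%:R).
Proof.
rewrite -setI_bigcupr -bigcup_enstrophy_le; apply/seteqP; split=> [t Kt|t []//].
by split => //; case: Kt.
Qed.

(** On a piece with bounded enstrophy, convergence in [H] is all that admissibility asks for, so
    superlevel sets of [G] are closed there; countably many pieces exhaust the ball. *)
Lemma measurable_admissible (G : E -> R) : adm G ->
  measurable_fun Kset (fun t : B => G (v t)).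
Proof.
move=> aG; rewrite bigcup_Kset.
have mKn n : measurable (Kset `&` enstrophy_le n%:R).
  by apply: measurableI; [exact: measurable_Kset|exact: measurable_enstrophy_le].
apply/measurable_fun_bigcup => // n; apply: measurable_fun_upper => // a.
apply: closed_measurable => z t Zz zt.
have [Vt Vtn] : enstrophy_le n%:R t.
  by apply: (weak_limit_le S _ _ (vH t) zt) => m; have [[_ []]] := Zz m.
have Kt : K (v t).
  split => //; have /ler_cvg_to := nrm_cvg iH (fun n => vH (z n)) (vH t) zt.
  move=> /(_ (cst r0) r0); apply; first exact: cvg_cst.
  by apply: nearW => m; have [[[_ ?] _] _] := Zz m.
split => //=.
have /ler_cvg_to : (cst a : nat -> R) @ \oo --> a by exact: cvg_cst.
apply; first apply: (aG (fun m => v (z m)) (v t) n%:R) => //.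
- by move=> m; have [[Km _] _] := Zz m.
- by move=> m; have [[_ [_ ?]] _] := Zz m.
by apply: nearW => m; have [_] := Zz m.
Qed.

(** The distance to the complement. The value 1 is put among the candidates of the infimum to bound
    the function and to keep the set nonempty when [U] is everything. *)
Lemma norm_open_cozero (U : set T) : norm_open U -> exists G : E -> R,
  [/\ adm G, forall u, K u -> 0 <= G u <= 1 & forall t, U t <-> 0 < G (v t)].
Proof.
move=> oU; pose A u := [set x : R | x = 1 \/ exists2 s, ~ U s & x = nH (u - v s)].
have lA u : lbound (A u) 0 by move=> _ [->//|[s _ ->]]; exact: nrm_ge0.
have A1 u : A u 1 by left.
exists (fun u => inf (A u)); split.
- apply: (@admissible_lipschitz _ _ _ _ _ _ S _ 1) => u w Ku Kw.
  rewrite mul1r -lerBlDr; apply: lb_le_inf => [|_ [->|[s nUs ->]]]; first by exists 1.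
    by rewrite lerBlDr; apply: le_trans (_ : _ <= 1) _;
      [apply: ge_inf => //; exists 0|rewrite lerDl nrm_ge0].
  rewrite lerBlDr; apply: (@le_trans _ _ (nH (u - v s))).
    by apply: ge_inf; [exists 0|right; exists s].
  rewrite [leRHS]addrC; apply: (nrm_triB iH) => //; apply: VH; [by case: Ku|by case: Kw].
- move=> u _; rewrite lb_le_inf//=; [|by exists 1].
  by apply: ge_inf => //; exists 0.
- move=> t; split=> [Ut|]; last first.
    apply: contraPP => nUt; apply/negP; rewrite -leNgt; apply: ge_inf; first by exists 0.
    by right; exists t => //; rewrite subrr (nrm0 iH).
  have [e e0 eU] := oU t Ut; apply: (@lt_le_trans _ _ (Num.min e 1)).
    by rewrite lt_min e0 ltr01.
  apply: lb_le_inf => [|_ [->|[s nUs ->]]]; [by exists 1|by rewrite ge_min lexx orbT|].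
  rewrite ge_min (nrmBC iH) ?vH//; apply/orP; left; rewrite leNgt; apply/negP => /eU.
  exact: nUs.
Qed.

End norm_borel.

Section representing_measure.
Context {R : realType} {E : lmodType R}.
Variables (H V : set E) (h g : E -> E -> R).
Hypothesis S : hilbert_pair H V h g.
Let iH := hp_H S.
Let VH := hp_sub S.
Notation nH := (nrm h).
Notation nV := (nrm g).
Variables (r0 nu : R) (f : E -> R).
Hypotheses (r0_ge0 : 0 <= r0) (nu0 : 0 < nu) (fb : bounded_lin V g f).
Notation K := (kset V h r0).
Notation ell := (energy g nu f).
Notation mix := (mixed V h g r0 nu f).
Notation adm := (admissible V h g r0).
Notation quadr := (quadratic V h g r0).
Variable L : (E -> R) -> R.
Hypothesis L_lin : forall (G1 G2 : E -> R) a, quadr G1 -> quadr G2 ->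
    L (fun u => G1 u + a * G2 u) = L G1 + a * L G2.
Hypothesis L_mean : forall (G : E -> R) b, quadr G -> (forall t1 t2 u1 u2, mix t1 t2 u1 u2 ->
    t1 * G u1 + t2 * G u2 <= b) -> L G <= b.

Lemma quadr_lin (G1 G2 : E -> R) a : quadr G1 -> quadr G2 -> quadr (fun u => G1 u + a * G2 u).
Proof. by move=> q1 q2; apply: (quadratic_D q1); exact: (quadratic_Z a q2). Qed.

Lemma quadr_cst (a : R) : quadr (fun=> a).
Proof. by apply: (@quadratic_bounded _ _ _ _ _ _ _ `|a|). Qed.

Lemma dual_mono (G1 G2 : E -> R) : quadr G1 -> quadr G2 ->
  (forall u, K u -> G1 u <= G2 u) -> L G1 <= L G2.
Proof.
move=> q1 q2 le; have : L (fun u => G1 u + -1 * G2 u) <= 0.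
  apply: L_mean; first exact: quadr_lin.
  move=> t1 t2 u1 u2 [[t10 t20] _ [K1 K2] _ _].
  rewrite !mulN1r -[leRHS]addr0 lerD// mulr_ge0_le0// subr_le0 le//.
by rewrite L_lin// mulN1r subr_le0.
Qed.

Lemma dual_ext (G1 G2 : E -> R) : quadr G1 -> (forall u, K u -> G1 u = G2 u) -> L G1 = L G2.
Proof.
move=> q1 e; have q2 : quadr G2 by have [C hC] := q1; exists C => u Ku; rewrite -e// hC.
by apply/eqP; rewrite eq_le !dual_mono// => u /e ->.
Qed.

Lemma dual0 : L (fun=> 0) = 0.
Proof.
have := @L_lin (fun=> 0) (fun=> 0) 1 (quadr_cst 0) (quadr_cst 0).
rewrite (_ : (fun _ => _) = fun=> 0); last by apply/funext => u; rewrite mulr0 addr0.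
by lra.
Qed.

Lemma dualZ (G : E -> R) a : quadr G -> L (fun u => a * G u) = a * L G.
Proof.
move=> qG; have := L_lin a (quadr_cst 0) qG; rewrite dual0 add0r => <-.
by congr L; apply/funext => u; rewrite add0r.
Qed.

Lemma dual1 : L (fun=> 1) = 1.
Proof.
apply/eqP; rewrite eq_le; apply/andP; split.
  by apply: L_mean => [|t1 t2 u1 u2 [_ t12 _ _ _]]; [exact: quadr_cst|rewrite !mulr1 t12].
have := dualZ (-1) (quadr_cst 1); have : L (fun=> -1 * 1) <= -1.
  apply: L_mean => [|t1 t2 u1 u2 [_ t12 _ _ _]]; first exact: quadr_cst.
  by rewrite mulr1 !mulrN1 -opprD t12.
by move=> l1 l2; move: l1; rewrite l2 mulN1r lerN2.
Qed.

Lemma dual_enstrophy : exists2 B, 0 <= B & L (fun u => nV u ^+ 2) <= B.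
Proof.
have [B [B0 BP]] := mixed_enstrophy h r0 nu0 fb; exists B => //.
apply: L_mean => //; exact: quadratic_nV.
Qed.

(** [K] is unbounded in [V], so uniform convergence is replaced by [G n >= 1 - e / 2 - d |grad u|^2]
    for some [n]: violators for every [n] would have bounded enstrophy and a Rellich limit
    contradicting pointwise convergence. As [L] is at most [B] on the enstrophy, the last term costs
    [e / 2]. *)
Lemma dual_dini (G : nat -> E -> R) : (forall n, adm (G n)) ->
  (forall n, quadr (G n)) ->
  (forall n u, K u -> 0 <= G n u <= G n.+1 u) ->
  (forall u, K u -> exists n, 1 <= G n u) ->
  forall e, 0 < e -> exists n, 1 - e <= L (G n).
Proof.
move=> aG qG Gm G1 e e0.
have [B B0 LB] := dual_enstrophy.
have mono m n u : (m <= n)%N -> K u -> G m u <= G n u.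
  move=> + Ku; elim: n => [|n ih]; first by rewrite leqn0 => /eqP->.
  rewrite leq_eqVlt => /orP[/eqP-> //|/ih/le_trans]; apply.
  by have /andP[] := Gm n u Ku.
pose d := e / (2 * (B + 1)); have B1 : 0 < B + 1 by rewrite ltr_wpDl.
have d0 : 0 < d by rewrite divr_gt0// mulr_gt0.
suff [n nP] : exists n, forall u, K u -> 1 - e / 2 - d * nV u ^+ 2 <= G n u.
  exists n.
  have : L (fun u => (fun=> 1 - e / 2) u + - d * nV u ^+ 2) <= L (G n).
    apply: dual_mono => //; first exact: (quadr_lin _ (quadr_cst _) (quadratic_nV V h g r0)).
    by move=> u /nP; rewrite mulNr.
  rewrite L_lin; [|exact: quadr_cst|exact: quadratic_nV].
  have -> : L (fun=> 1 - e / 2) = 1 - e / 2.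
    transitivity (L (fun=> (1 - e / 2) * 1)); first by rewrite mulr1.
    by rewrite (dualZ _ (quadr_cst 1)) dual1 mulr1.
  have : d * L (fun u => nV u ^+ 2) <= e / 2.
    apply: (@le_trans _ _ (d * (B + 1))).
      by rewrite ler_wpM2l ?(ltW d0)// (le_trans LB)// lerDl.
    by rewrite /d invfM !mulrA -mulrA mulVf ?mulr1// gt_eqF.
  lra.
apply: contrapT => /forallNP nG.
have /choice[u_ uP] : forall n, exists u, K u /\ G n u < 1 - e / 2 - d * nV u ^+ 2.
  by move=> n; have /existsNP[u /not_implyP[Ku /negP]] := nG n; rewrite -ltNge; exists u.
have ub n : nV (u_ n) <= Num.sqrt d^-1.
  apply: le_sqrt; first exact: nrm_ge0.
  have [Ku lt] := uP n; have /andP[G0 _] := Gm n _ Ku.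
  rewrite -[leRHS]mul1r ler_pdivlMr// mulrC; move: lt G0 e0; lra.
have [k [u [l [nk Ku ul [uu _] _]]]] := kset_seq S (fun n => (uP n).1) ub.
have [m Gm1] := G1 u Ku.
have Gc := aG m _ _ _ (fun n => (uP (k n)).1) Ku (fun n => ub (k n)) uu.
have : G m u <= 1 - e / 2.
  have := ler_cvg_to Gc (cvg_cst (1 - e / 2)); apply; exists m => // n /= mn.
  apply: le_trans (mono m (k n) _ (leq_trans mn (nk n)) (uP (k n)).1) _.
  apply: le_trans (ltW (uP (k n)).2) _; rewrite gerDl oppr_le0 mulr_ge0 ?sqr_ge0//.
  exact: ltW.
by move: Gm1 e0; lra.
Qed.

Variables (T : pointedType) (v : T -> E) (ret : E -> T).
Hypotheses (vH : forall t, H (v t)) (retK : forall u, V u -> v (ret u) = u).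

Notation B := (g_sigma_algebraType (norm_open h v)).
Notation KT := (@Kset R E V h T v r0).

Let KH u : K u -> V u. Proof. by case. Qed.

Lemma representing_measure : exists P : probability B R, P (~` KT) = 0%E /\
  forall (G : E -> R) b, adm G -> (forall u, K u -> `|G u| <= b) ->
    (\int[P]_(t in KT) (G (v t))%:E = (L G)%:E)%E.
Proof.
(* Functions on the carrier [T] are read on [E] through [ret], a right inverse of [v] on [V]. Only
   bounded functions are represented here; unbounded ones come later by truncation. *)
pose C : set (T -> R) := [set F : T -> R | adm (F \o ret) /\
  exists b, forall u, K u -> `|F (ret u)| <= b].
pose LL (F : T -> R) := L (F \o ret).
have Cq F : C F -> quadr (F \o ret) by move=> [_ [b hb]]; exact: quadratic_bounded hb.
have [||||||||||P [PK PL]] := @daniell_representation R T KT C LL _ _ _ _ _ _ _ _ (norm_open h v).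
- by split; [exact: admissible_cst|exists 1 => u _; rewrite normr1].
- move=> F1 F2 a [a1 [b1 h1]] [a2 [b2 h2]]; split.
    by apply: admissible_D => //; exact: admissible_Z.
  exists (b1 + `|a| * b2) => u Ku; apply: le_trans (ler_normD _ _) _.
  by rewrite lerD ?h1// normrM ler_wpM2l// h2.
- move=> F1 F2 [a1 [b1 h1]] [a2 [b2 h2]]; split; first exact: admissible_M.
  by exists (b1 * b2) => u Ku; rewrite normrM ler_pM ?h1 ?h2.
- move=> F [a1 [b1 h1]]; split.
    apply: (@admissible_comp _ _ _ _ _ _ (Num.max 0)) a1.
    by move=> t; apply: (@continuous_max _ _ (fun=> 0) id t); [exact: cst_continuous|exact: cvg_id].
  exists b1 => u Ku; apply: le_trans (h1 u Ku).
  by have [x0|x0] := leP 0 (F (ret u)); rewrite ?normr0.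
- by move=> F1 F2 a C1 C2; rewrite /LL -L_lin//; exact: Cq.
- exact: dual1.
- move=> F CF F0; rewrite -dual0; apply: dual_mono => [||u Ku]; [exact: quadr_cst|exact: Cq|].
  by apply: F0; rewrite /Kset /= retK//; exact: KH.
- move=> F CF Fm F1; apply: dual_dini => [n|n|n u Ku|u Ku].
  + by case: (CF n).
  + exact: Cq.
  + by apply: Fm; rewrite /Kset /= retK//; exact: KH.
  + by apply: F1; rewrite /Kset /= retK//; exact: KH.
- move=> U /(norm_open_cozero S vH r0)[G [aG G01 UG]]; exists (G \o v); split.
  + split; last by exists 1 => u Ku /=; rewrite (retK (KH Ku)); have /andP[? ?] := G01 u Ku; rewrite ger0_norm.
    by apply: (admissible_ext _ aG) => u Ku /=; rewrite retK//; exact: KH.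
  + by move=> t Kt /=; have /andP[] := G01 _ Kt.
  + by move=> t _; exact: UG.
- exact: (measurable_Kset S vH r0).
exists P; split => // G b aG Gb.
have GE u : K u -> G u = G (v (ret u)) by move=> /KH Hu; rewrite retK.
rewrite (PL (G \o v) b).
- congr (_%:E); apply/esym/dual_ext => //; exact: quadratic_bounded Gb.
- split; first by apply: (admissible_ext _ aG) => u Ku; exact: GE.
  by exists b => u Ku /=; rewrite -GE// Gb.
- exact: (measurable_admissible S vH aG).
- by move=> t Kt; exact: Gb.
Qed.

End representing_measure.

Section represented_integrals.
Context {R : realType} {E : lmodType R}.
Variables (H V : set E) (h g : E -> E -> R).
Hypothesis S : hilbert_pair H V h g.
Let iH := hp_H S.
Let VH := hp_sub S.
Notation nH := (nrm h).
Notation nV := (nrm g).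
Variables (r0 nu : R) (f : E -> R).
Hypotheses (r0_ge0 : 0 <= r0) (nu0 : 0 < nu) (fb : bounded_lin V g f).
Notation K := (kset V h r0).
Notation ell := (energy g nu f).
Notation mix := (mixed V h g r0 nu f).
Notation adm := (admissible V h g r0).
Notation subq := (subquadratic V h g r0).
Notation quadr := (quadratic V h g r0).
Variable L : (E -> R) -> R.
Hypothesis L_lin : forall (G1 G2 : E -> R) a, quadr G1 -> quadr G2 ->
    L (fun u => G1 u + a * G2 u) = L G1 + a * L G2.
Hypothesis L_mean : forall (G : E -> R) b, quadr G -> (forall t1 t2 u1 u2, mix t1 t2 u1 u2 ->
    t1 * G u1 + t2 * G u2 <= b) -> L G <= b.
Variables (T : pointedType) (v : T -> E).
Hypotheses (vH : forall t, H (v t)).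
Notation B := (g_sigma_algebraType (norm_open h v)).
Notation KT := (@Kset R E V h T v r0).
Variable P : probability B R.
Hypothesis PL : forall (G : E -> R) b, adm G -> (forall u, K u -> `|G u| <= b) ->
    (\int[P]_(t in KT) (G (v t))%:E = (L G)%:E)%E.

Let mK : measurable KT := measurable_Kset S vH r0.
Let mA (G : E -> R) (aG : adm G) : measurable_fun KT (fun t : B => G (v t)) :=
  measurable_admissible S vH aG.
Let qnV : quadr (fun u => nV u ^+ 2) := quadratic_nV V h g r0.
Let qZ G a : quadr G -> quadr (fun u => a * G u) := @quadratic_Z R E V h g r0 a G.

Lemma measurable_sqr_nV : measurable_fun KT (fun t : B => nV (v t) ^+ 2).
Proof.
apply: measurable_funX; apply: measurable_funS (measurable_nV S vH).
  exact: (measurable_Vset S vH).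
by move=> t [].
Qed.

(** Monotone convergence along [X] times [yosida k], for which integral and [L] agree. Only an
    inequality results: the linear form may keep a part of the enstrophy that the measure does not
    see. *)
Lemma integral_enstrophy_le (X : E -> R) b : adm X -> (forall u, K u -> 0 <= X u <= b) ->
  (\int[P]_(t in KT) (X (v t) * nV (v t) ^+ 2)%:E <= (L (fun u => X u * nV u ^+ 2))%:E)%E.
Proof.
move=> aX Xb.
have X0 u : K u -> 0 <= X u by move=> /Xb /andP[].
have XB u : K u -> X u <= b by move=> /Xb /andP[].
have qX : quadr (fun u => X u * nV u ^+ 2).
  exists b => u Ku; rewrite ger0_norm; last by apply: mulr_ge0; [exact: X0|exact: sqr_ge0].
  apply: (@le_trans _ _ (b * nV u ^+ 2)); first by rewrite ler_wpM2r ?sqr_ge0// XB.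
  by rewrite ler_wpM2l ?lerDr// (le_trans (X0 _ Ku) (XB _ Ku)).
pose Y k u := X u * yosida V h g k u.
have aY k : adm (Y k) by apply: admissible_M => //; exact: (@yosida_admissible _ _ _ _ _ _ S r0 k).
have Y0 k u : K u -> 0 <= Y k u by move=> /X0 ?; exact: (mulr_ge0 _ (yosida_ge0 S k u)).
have Yb k u : K u -> `|Y k u| <= b * (k%:R * r0).
  move=> Ku; rewrite ger0_norm ?Y0//; apply: ler_pM.
  - exact: X0.
  - exact: (yosida_ge0 S).
  - exact: XB.
  - exact: (yosida_bounded S k Ku).
have lim t : KT t -> (limn (fun k => (Y k (v t))%:E) = (X (v t) * nV (v t) ^+ 2)%:E)%E.
  move=> Kt; apply/cvg_lim => //; apply: cvg_EFin; first exact: nearW.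
  apply: cvgM; first exact: cvg_cst.
  by apply: (yosida_cvg S); case: Kt.
rewrite (eq_integral (fun t : B => limn (fun k => (Y k (v t))%:E))); last first.
  by move=> t; rewrite inE => Kt; rewrite lim.
have mY k : measurable_fun KT (fun t : B => (Y k (v t))%:E).
  by apply/measurable_EFinP; exact: mA.
have nd t : KT t -> nondecreasing_seq (fun k => (Y k (v t))%:E).
  move=> Kt k l kl; rewrite lee_fin; apply: ler_wpM2l; first exact: X0.
  exact: (yosida_mono S).
have Y0' k (t : B) : KT t -> (0 <= (Y k (v t))%:E)%E by move=> Kt; rewrite lee_fin Y0.
have := @cvg_monotone_convergence _ _ _ P KT mK _ mY Y0' nd.
move=> /cvg_lim <- //; apply: lime_le.
  apply: ereal_nondecreasing_is_cvgn => k l kl; apply: ge0_le_integral => //.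
  - by move=> t Kt; exact: Y0'.
  - by move=> t Kt; exact: nd.
apply: nearW => k; rewrite (PL (aY k) (Yb k)) lee_fin.
apply: (dual_mono L_lin L_mean) => //; first exact: quadratic_bounded (Yb k).
move=> u Ku; apply: ler_wpM2l; first exact: X0.
by apply: (yosida_le_sqr S); case: Ku.
Qed.

Let a1 : adm (fun=> 1). Proof. exact: admissible_cst. Qed.

Lemma enstrophy_integrable : P.-integrable KT (fun t => (nV (v t) ^+ 2)%:E).
Proof.
apply/integrableP; split; first by apply/measurable_EFinP; exact: measurable_sqr_nV.
rewrite (eq_integral (fun t : B => (1 * nV (v t) ^+ 2)%:E)); last first.
  by move=> t _; rewrite mul1r gee0_abs// lee_fin sqr_ge0.
apply: le_lt_trans (@integral_enstrophy_le (fun=> 1) 1 a1 _) _; last exact: ltry.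
by move=> u _; rewrite ler01 lexx.
Qed.

Lemma subquadratic_integrable (G : E -> R) : adm G -> subq G ->
  P.-integrable KT (fun t => (G (v t))%:E).
Proof.
move=> aG /(_ 1 ltr01)[C GC].
have ic : P.-integrable KT (fun t => ((nV (v t) ^+ 2)%:E + (EFin \o cst C) t)%E).
  by apply: integrableD => //; [exact: enstrophy_integrable|exact: finite_measure_integrable_cst].
apply: le_integrable ic => //; first by apply/measurable_EFinP; exact: mA.
move=> t Kt; rewrite -EFinD !abse_EFin lee_fin; apply: le_trans (ler_norm _).
by have := GC _ Kt; rewrite mul1r.
Qed.

(** Truncating [G] at [|C|] changes it by at most [d |grad u|^2], and both the integral and [L] of
    the enstrophy are at most [b]; the two errors together stay below [e]. Applying the bound to
    [- G] gives equality. *)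
Lemma integral_subquadratic (G : E -> R) : adm G -> subq G ->
  (\int[P]_(t in KT) (G (v t))%:E = (L G)%:E)%E.
Proof.
have le G' : adm G' -> subq G' -> (\int[P]_(t in KT) (G' (v t))%:E <= (L G')%:E)%E.
  move=> aG sG; have qG := quadratic_sub sG.
  have [b b0 Lb] := dual_enstrophy nu0 fb L_mean.
  apply/lee_addgt0Pr => e e0.
  pose d := e / (2 * (b + 1)); have b1 : 0 < b + 1 by rewrite ltr_wpDl.
  have d0 : 0 < d by rewrite divr_gt0// mulr_gt0.
  have [C GC] := sG d d0.
  pose c (t : R) := Num.max (- `|C|) (Num.min `|C| t).
  have cc : continuous c.
    move=> t; apply: (@continuous_max _ _ (fun=> - `|C|) (fun t => Num.min `|C| t) t).
      exact: cst_continuous.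
    by apply: (@continuous_min _ _ (fun=> `|C|) id t); [exact: cst_continuous|exact: cvg_id].
  have cb t : `|c t| <= `|C|.
    rewrite ler_norml /c le_max lexx /= ge_max ge_min lexx /=.
    by have := normr_ge0 C; lra.
  have cd x t : 0 <= x -> `|t| <= x + C -> t <= c t + x /\ c t <= t + x.
    rewrite ler_norml => x0 /andP[l r]; have := ler_norm C.
    rewrite /c => Cn; have [t1|t1] := leP `|C| t; have C0 := normr_ge0 C.
      by rewrite max_r; [split; lra|lra].
    by have [t2|t2] := leP (- `|C|) t; split; lra.
  have acG : adm (fun u => c (G' u)) by exact: admissible_comp.
  have cGb u : K u -> `|c (G' u)| <= `|C| by [].
  have qc : quadr (fun u => c (G' u)) by exact: quadratic_bounded cGb.
  have ge u : K u -> G' u <= c (G' u) + d * nV u ^+ 2 /\ c (G' u) <= G' u + d * nV u ^+ 2.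
    by move=> Ku; apply: cd; [apply: mulr_ge0; [exact: ltW|exact: sqr_ge0]|exact: GC].
  have ie := enstrophy_integrable.
  have icG : P.-integrable KT (fun t => (c (G' (v t)))%:E).
    by apply: (@subquadratic_integrable (fun u => c (G' u))) => // e' e'0; exists `|C| => u Ku;
      rewrite -[leLHS]add0r lerD// mulr_ge0 ?sqr_ge0 ?(ltW e'0).
  apply: (@le_trans _ _ (\int[P]_(t in KT) ((c (G' (v t)))%:E + d%:E * (nV (v t) ^+ 2)%:E))%E).
    apply: le_integral => //; first exact: subquadratic_integrable.
      by apply: integrableD => //; exact: integrableZl.
    by move=> t; rewrite inE => Kt; rewrite -EFinM -EFinD lee_fin; have [] := ge _ Kt.
  rewrite integralD//; last exact: integrableZl.
  rewrite integralZl// (PL acG cGb).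
  have E1 : (\int[P]_(t in KT) (nV (v t) ^+ 2)%:E <= b%:E)%E.
    have := @integral_enstrophy_le (fun=> 1) 1 a1 (fun u _ => _ : 0 <= 1 <= 1).
    rewrite ler01 lexx => /(_ isT).
    rewrite (eq_integral (fun t : B => (nV (v t) ^+ 2)%:E)); last by move=> t _; rewrite mul1r.
    move=> /le_trans; apply; rewrite lee_fin (_ : (fun _ => _) = fun u => nV u ^+ 2)//.
    by apply/funext => u; rewrite mul1r.
  have E2 : L (fun u => c (G' u)) <= L G' + d * L (fun u => nV u ^+ 2).
    rewrite -L_lin//; apply: (dual_mono L_lin L_mean) => //.
      exact: (quadr_lin _ qG qnV).
    by move=> u Ku; have [] := ge _ Ku.
  have db : d * b <= e / 2.
    apply: (@le_trans _ _ (d * (b + 1))); first by rewrite ler_wpM2l ?(ltW d0)// lerDl.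
    by rewrite /d invfM !mulrA -mulrA mulVf ?mulr1// gt_eqF.
  apply: (@le_trans _ _ ((L (fun u => c (G' u)))%:E + d%:E * b%:E)%E).
    by rewrite leeD2l// lee_wpmul2l// lee_fin ltW.
  rewrite -EFinM -!EFinD lee_fin.
  have : d * L (fun u => nV u ^+ 2) <= d * b by rewrite ler_wpM2l// ltW.
  lra.
move=> aG sG; apply/eqP; rewrite eq_le le//=.
have aG' : adm (fun u => -1 * G u) by exact: admissible_Z.
have sG' : subq (fun u => -1 * G u).
  by move=> e /sG[C GC]; exists C => u Ku; rewrite mulN1r normrN GC.
have := le _ aG' sG'; rewrite (dualZ L_lin)//; last exact: quadratic_sub.
under eq_integral do rewrite EFinM.
rewrite integralZl//; last exact: subquadratic_integrable.
by rewrite [in leRHS]EFinM !mulN1e leeN2.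
Qed.

(** The inequality for the enstrophy goes the favourable way because [nu > 0]. It remains to bound
    [L] at [X ell], whose mean over a mixed state is [X] at the common norm times the mean energy:
    this is where the two points must have equal norm. *)
Lemma energy_integral_le0 (X : E -> R) b : adm X -> (forall u, K u -> 0 <= X u <= b) ->
  (forall u w, nH u = nH w -> X u = X w) ->
  (\int[P]_(t in KT) (X (v t) * ell (v t))%:E <= 0)%E.
Proof.
move=> aX Xb Xr.
have X0 u : K u -> 0 <= X u by move=> /Xb /andP[].
have XB u : K u -> X u <= b by move=> /Xb /andP[].
have qX : quadr (fun u => X u * nV u ^+ 2).
  exists b => u Ku; rewrite ger0_norm; last by apply: mulr_ge0; [exact: X0|exact: sqr_ge0].
  apply: (@le_trans _ _ (b * nV u ^+ 2)); first by rewrite ler_wpM2r ?sqr_ge0// XB.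
  by rewrite ler_wpM2l ?lerDr// (le_trans (X0 _ Ku) (XB _ Ku)).
have af : adm f by move=> u_ u r Ku Ku' ur uu; exact: (f_cvg S fb Ku Ku' ur uu).
have aXf : adm (fun u => X u * f u) by exact: admissible_M.
have sXf : subq (fun u => X u * f u).
  have [_ [c fc]] := fb; move=> e e0; exists ((b * c) ^+ 2 / (4 * e)) => u Ku.
  rewrite normrM (ger0_norm (X0 _ Ku)).
  have b0 : 0 <= b := le_trans (X0 _ Ku) (XB _ Ku).
  apply: (@le_trans _ _ (b * (c * nV u))).
    by apply: ler_pM; rewrite ?X0 ?XB//; apply: fc; case: Ku.
  have : 0 <= (2 * e * nV u - b * c) ^+ 2 / (4 * e) by rewrite divr_ge0 ?sqr_ge0// mulr_ge0// ltW.
  have -> : (2 * e * nV u - b * c) ^+ 2 / (4 * e) =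
     e * nV u ^+ 2 - b * (c * nV u) + (b * c) ^+ 2 / (4 * e) by field; rewrite gt_eqF.
  lra.
have iXe : P.-integrable KT (fun t => (X (v t) * nV (v t) ^+ 2)%:E).
  apply: le_integrable (integrableZl mK b enstrophy_integrable) => //.
    by apply/measurable_EFinP; apply: measurable_funM; [exact: mA|exact: measurable_sqr_nV].
  move=> t Kt; rewrite -EFinM !abse_EFin lee_fin !normrM ler_wpM2r//.
  by rewrite (ger0_norm (X0 _ Kt)) (le_trans (XB _ Kt))// ler_norm.
rewrite (eq_integral (fun t : B => (nu%:E * (X (v t) * nV (v t) ^+ 2)%:E - (X (v t) * f (v t))%:E)%E)); last first.
  by move=> t _; rewrite -EFinM -EFinB /energy; congr (_%:E); ring.
rewrite integralB//; [|exact: integrableZl|exact: (subquadratic_integrable aXf sXf)].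
rewrite integralZl// (integral_subquadratic aXf sXf).
apply: (@le_trans _ _ (nu%:E * (L (fun u => X u * nV u ^+ 2))%:E - (L (fun u => X u * f u))%:E)%E).
  by rewrite leeB// lee_wpmul2l ?lee_fin ?(ltW nu0)//; exact: integral_enstrophy_le Xb.
have qXf := quadratic_sub sXf.
have -> : (nu%:E * (L (fun u => X u * nV u ^+ 2))%:E - (L (fun u => X u * f u))%:E)%E =
   (L (fun u => nu * (X u * nV u ^+ 2) + -1 * (X u * f u)))%:E.
  rewrite (L_lin (G1 := fun u => nu * _)) ?(dualZ L_lin)//; last exact: qZ.
  by rewrite -EFinM -EFinB mulN1r.
rewrite lee_fin; apply: L_mean; first by apply: (quadr_lin _ _ qXf); exact: qZ.
move=> t1 t2 u1 u2 [_ _ [K1 K2] n12 le0].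
have -> : t1 * (nu * (X u1 * nV u1 ^+ 2) + -1 * (X u1 * f u1)) +
    t2 * (nu * (X u2 * nV u2 ^+ 2) + -1 * (X u2 * f u2)) =
    X u1 * (t1 * ell u1 + t2 * ell u2) by rewrite (Xr _ _ n12) /energy; ring.
by rewrite mulr_ge0_le0// X0.
Qed.

End represented_integrals.

(** * Closure properties of admissible and sub-quadratic functions *)

Section control_closure.
Context {R : realType} {E : lmodType R}.
Variables (H V : set E) (h g : E -> E -> R).
Hypothesis S : hilbert_pair H V h g.
Let iH := hp_H S.
Let VH := hp_sub S.
Notation nH := (nrm h).
Notation nV := (nrm g).
Variables (r0 : R).
Notation K := (kset V h r0).
Notation adm := (admissible V h g r0).
Notation subq := (subquadratic V h g r0).

(** Along a sequence bounded in [V] the weight [1 + |grad u|^2] is bounded, so weighted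
    approximation becomes uniform and continuity passes to the limit. *)
Lemma admissible_approx (G : E -> R) :
  (forall e, 0 < e -> exists2 G', adm G' &
     forall u, K u -> `|G u - G' u| <= e * (1 + nV u ^+ 2)) -> adm G.
Proof.
move=> hG u_ u r Ku Ku' ur uu.
pose rr := Num.max r (nV u); have r1 n : nV (u_ n) <= rr by rewrite le_max ur.
have r2 : nV u <= rr by rewrite le_max lexx orbT.
have rr0 : 0 <= rr := le_trans (nrm_ge0 _ _) r2.
have q0 : 0 < 1 + rr ^+ 2 by rewrite ltr_wpDr ?sqr_ge0.
apply/cvgrPdist_le => e e0; pose d := e / (3 * (1 + rr ^+ 2)).
have d0 : 0 < d by rewrite divr_gt0// mulr_gt0.
have [G' aG' GG'] := hG d d0.
have e3 : 0 < e / 3 by rewrite divr_gt0.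
have := aG' _ _ _ Ku Ku' ur uu => /cvgrPdist_le/(_ _ e3).
apply: filterS => n hn.
have dE : d * (1 + rr ^+ 2) = e / 3 by rewrite /d; field; rewrite gt_eqF.
have bd w : K w -> nV w <= rr -> `|G w - G' w| <= e / 3.
  move=> Kw wr; apply: le_trans (GG' _ Kw) _; rewrite -dE ler_wpM2l ?(ltW d0)//.
  by rewrite lerD2l lerXn2r ?nnegrE// nrm_ge0.
have b1 := bd _ Ku' r2; have b2 := bd _ (Ku n) (r1 n).
rewrite (_ : G u - G (u_ n) = (G u - G' u) + (G' u - G' (u_ n)) - (G (u_ n) - G' (u_ n))); last by ring.
apply: le_trans (ler_normB _ _) _; apply: le_trans (lerD (ler_normD _ _) (lexx _)) _.
by apply: le_trans (lerD (lerD b1 hn) b2) _; lra.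
Qed.

Lemma subquadratic_approx (G : E -> R) :
  (forall e, 0 < e -> exists2 G', subq G' &
     forall u, K u -> `|G u - G' u| <= e * (1 + nV u ^+ 2)) -> subq G.
Proof.
move=> hG e e0; have e2 : 0 < e / 2 by rewrite divr_gt0.
have [G' sG' GG'] := hG _ e2; have [C GC] := sG' _ e2.
exists (C + e / 2) => u Ku; rewrite -(subrK (G' u) (G u)).
apply: le_trans (ler_normD _ _) _; apply: le_trans (lerD (GG' _ Ku) (GC _ Ku)) _.
by set X := nV u ^+ 2; lra.
Qed.

Lemma subquadratic_D (G1 G2 : E -> R) : subq G1 -> subq G2 -> subq (fun u => G1 u + G2 u).
Proof.
move=> s1 s2 e e0; have e2 : 0 < e / 2 by rewrite divr_gt0.
have [C1 h1] := s1 _ e2; have [C2 h2] := s2 _ e2; exists (C1 + C2) => u Ku.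
apply: le_trans (ler_normD _ _) _; apply: le_trans (lerD (h1 _ Ku) (h2 _ Ku)) _.
by set X := nV u ^+ 2; lra.
Qed.

Lemma subquadratic_Mb (X G : E -> R) b : (forall u, K u -> `|X u| <= b) -> subq G ->
  subq (fun u => X u * G u).
Proof.
move=> Xb sG e e0; have b1 : 0 < `|b| + 1 by rewrite ltr_wpDl.
have [C GC] := sG _ (divr_gt0 e0 b1); exists (`|(`|b| + 1) * C|) => u Ku.
rewrite normrM; apply: (@le_trans _ _ ((`|b| + 1) * (e / (`|b| + 1) * nV u ^+ 2 + C))).
  apply: ler_pM => //; last exact: GC.
  by apply: le_trans (Xb _ Ku) _; apply: le_trans (ler_norm b) _; rewrite lerDl.
have -> x : (`|b| + 1) * (e / (`|b| + 1) * x + C) = e * x + (`|b| + 1) * C.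
  by field; rewrite gt_eqF.
by rewrite lerD2l; exact: ler_norm.
Qed.

Lemma subquadratic_linear (G : E -> R) a b : (forall u, K u -> `|G u| <= a * nV u + b) -> subq G.
Proof.
move=> Gab e e0; exists (a ^+ 2 / (4 * e) + b) => u Ku; apply: le_trans (Gab _ Ku) _.
rewrite addrA lerD2r.
have : 0 <= (2 * e * nV u - a) ^+ 2 / (4 * e) by rewrite divr_ge0 ?sqr_ge0// mulr_ge0// ltW.
have -> : (2 * e * nV u - a) ^+ 2 / (4 * e) = e * nV u ^+ 2 - a * nV u + a ^+ 2 / (4 * e).
  by field; rewrite gt_eqF.
lra.
Qed.

Lemma bounded_lin_admissible k : bounded_lin V g k -> adm k.
Proof.
move=> kb u_ u r Ku Ku' ur uu.
by apply: (bounded_lin_cvg S kb (fun n => (Ku n).1) ur (VH Ku'.1)).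
Qed.

Lemma subquadratic_powR (G : E -> R) C0 C1 d : 0 <= C1 -> 0 < d <= 2 ->
  (forall u, K u -> `|G u| <= C0 + C1 * nV u `^ (2 - d)) -> subq G.
Proof.
move=> C10 /andP[d0 d2] hG e e0; pose M := (C1 / e + 1) `^ d^-1.
have M0 : 0 <= M by exact: powR_ge0.
have Md : C1 <= e * M `^ d.
  rewrite -powRrM mulVf ?gt_eqF// powRr1; last by rewrite addr_ge0// divr_ge0// ltW.
  by rewrite mulrDr mulrCA divff ?gt_eqF// !mulr1 lerDl ltW.
have dd : 0 <= 2 - d by rewrite subr_ge0.
exists (C0 + C1 * M `^ (2 - d)) => u Ku; apply: le_trans (hG u Ku) _.
have x0 : 0 <= nV u by exact: nrm_ge0.
have [xM|/ltW Mx] := leP (nV u) M.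
  have : C1 * nV u `^ (2 - d) <= C1 * M `^ (2 - d).
    by rewrite ler_wpM2l// ge0_ler_powR.
  have : 0 <= e * nV u ^+ 2 by rewrite mulr_ge0 ?sqr_ge0// ltW.
  set X := _ * M `^ _; lra.
have : C1 * nV u `^ (2 - d) <= e * nV u ^+ 2.
  have -> : nV u ^+ 2 = nV u `^ d * nV u `^ (2 - d).
    rewrite -powRD; last by rewrite addrC subrK (_ : (2 == 0 :> R) = false)// pnatr_eq0.
    by rewrite addrC subrK powR_mulrn.
  rewrite mulrA ler_wpM2r ?powR_ge0//; apply: le_trans Md _; rewrite ler_wpM2l ?(ltW e0)//.
  by rewrite ge0_ler_powR// ltW.
have : 0 <= C1 * M `^ (2 - d) by rewrite mulr_ge0// powR_ge0.
set X := _ * M `^ _; lra.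
Qed.

Lemma row_admissible m (D : 'rV[R]_m -> R) (w : 'I_m -> E) : continuous D -> (forall j, H (w j)) ->
  adm (fun u => D (\row_j h u (w j))).
Proof.
move=> cD Hw u_ u r Ku Ku' ur uu; apply/cvgrPdist_le => e e0.
have [d d0 dP] := continuous_rV (\row_j h u (w j)) cD e0.
have KH v : K v -> H v by move=> [/VH].
have : \forall n \near \oo, forall j, `|h (u_ n) (w j) - h u (w j)| < d.
  apply: filter_forall => j; have : h (u_ n) (w j) @[n --> \oo] --> h u (w j).
    apply/subr_cvg0; apply/norm_cvg0P.
    apply: (squeeze_cvgr (_ : \forall n \near \oo, 0 <= `|h (u_ n) (w j) - h u (w j)| <= nH (u_ n - u) * nH (w j)) (cvg_cst 0)).
      near=> n; rewrite normr_ge0/= -(in_Bl iH (KH _ (Ku n)) (KH _ Ku') (Hw j)).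
      by apply: (in_cs iH) => //; apply: (in_B iH); exact: KH.
    rewrite -[X in _ --> X](mul0r (nH (w j))); apply: cvgM => //; exact: cvg_cst.
  by move=> /cvgrPdist_lt/(_ _ d0); apply: filterS => n; rewrite distrC.
apply: filterS => n hn; rewrite distrC; apply: dP => j; rewrite !mxE; exact: hn.
Unshelve. all: by end_near. Qed.

Lemma row_bounded m (D : 'rV[R]_m -> R) (w : 'I_m -> E) : continuous D -> (forall j, H (w j)) ->
  exists b, forall u, K u -> `|D (\row_j h u (w j))| <= b.
Proof.
move=> cD Hw; pose c := `|r0| * \sum_j nH (w j).
have cA : compact [set z : 'rV[R]_m | forall i, `[- c, c]%classic (z ord0 i)].
  by apply: (@rV_compact _ _ (fun=> `[- c, c]%classic)) => i; exact: segment_compact.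
have [b [_ bP]] := compact_bounded (continuous_compact (continuous_subspaceT cD) cA).
exists (b + 1) => u [Vu ur]; apply: (bP (b + 1)); first by rewrite ltrDl.
exists (\row_j h u (w j)) => // j /=; rewrite mxE in_itv/= -ler_norml.
apply: le_trans (in_cs iH (VH Vu) (Hw j)) _; apply: ler_pM; rewrite ?nrm_ge0//.
  exact: le_trans ur (ler_norm _).
by rewrite (bigD1 j)//= lerDl sumr_ge0// => i _; rewrite nrm_ge0.
Qed.

End control_closure.

Section arith.
Context {R : realType}.

Lemma sub_split (a b c : R) : a - c = a + -1 * b + (b - c). Proof. by ring. Qed.

Lemma opp_lin (a b : R) : a - b = - (b + -1 * a). Proof. by ring. Qed.

Lemma eq_double (c : R) : c = c + c -> c = 0. Proof. by lra. Qed.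

Lemma sub_lin (a n b c : R) : a + - n * b + -1 * c = a - n * b - c. Proof. by ring. Qed.

Lemma F_arith (a n f1 f2 g1 g2 c1 c2 : R) :
  f1 + a * f2 - n * (g1 + a * g2) - (c1 + a * c2) = f1 - n * g1 - c1 + a * (f2 - n * g2 - c2).
Proof. by ring. Qed.

Lemma le_swap (x a b c d : R) : x <= a * b * c * d -> x <= a * b * d * c.
Proof. by rewrite mulrAC. Qed.

Lemma le_small (x c y d e : R) : 0 <= c -> 0 < e -> 0 <= d -> d <= e / (c + 1) ->
  x <= c * y * y * d -> x <= e * (1 + y ^+ 2).
Proof.
move=> c0 e0 d0 de /le_trans; apply; have y2 := sqr_ge0 y; have c1 : 0 < c + 1 by lra.
have -> : c * y * y * d = c * d * y ^+ 2 by ring.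
apply: ler_pM => //; rewrite ?mulr_ge0// ?lerDr//.
apply: (@le_trans _ _ ((c + 1) * (e / (c + 1)))); first by apply: ler_pM => //; lra.
by rewrite mulrC divfK// gt_eqF.
Qed.

End arith.

(** * The Navier-Stokes system *)

Section navier_stokes_control.
Context {R : realType} (Omega : set (R3 R)) (L : R).
Hypotheses (Oo : open Omega) (OL : forall x, Omega x -> forall i, `|crd i x| <= L)
  (Lp : 0 < L).
Notation O := (Omega : set (mR3 R)).
Notation V := (space_V Omega).
Notation Hs := (@L2 R Omega 'I_3).
Notation h := (@dot R Omega 'I_3).
Notation g := (@gdot R Omega).
Notation gn u := (norm (grad u)).
Implicit Types (u v w : vec Omega).

Let mO : measurable O. Proof. exact: open_measurable3. Qed.
Let iV := inner_on_V Oo OL.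
Let iH := inner_on_dot mO (I := 'I_3).

(** The larger space is all of [L2]: the indicator fields of [V_rellich] lie in it, with no
    condition on their divergence, and completeness is direct. The return to [space_H] is through
    [V_space_H]. *)
Lemma flow_pair : hilbert_pair Hs V h g.
Proof.
split.
- exact: iH.
- exact: iV.
- exact: V_L2.
- by move=> u; exact: (norm0_eq mO).
- exists (4 * L); split; first by rewrite mulr_ge0// ltW.
  exact: (V_poincare Oo OL Lp).
- by move=> u_ hu cu; exact: (norm_complete mO hu cu).
- exact: (V_complete Oo OL Lp).
- exact: (V_rellich Oo OL Lp).
Qed.
Notation S := flow_pair.

Lemma V_space_H u : V u -> space_H Omega u.
Proof.
move=> Vu; split; first exact: V_L2.
move=> e e0; have [Hu /(_ e e0)[v cv uv]] := (V_iff u).1 Vu; exists v => //.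
have Vd : V (u - v) := in_B iV Vu (Cc_div0_V Oo OL cv).
exact: le_lt_trans (norm_le_H1norm (V_H1 Vd)).1 uv.
Qed.

Variables (nu : R) (f : vec Omega -> R).
Hypotheses (nu0 : 0 < nu) (fd : dual_V f).
Notation r0 := (Defs.r0 nu f).
Notation lam := (lambda1 Omega).
Notation dn := (dual_V_norm f).

Lemma kset_ball u : kset V h r0 u <-> (V `&` ball_H r0) u.
Proof. by split=> [[Vu ur]|[Vu [_ ur]]]; split=> //; split=> //; exact: V_space_H. Qed.

Lemma norm_V0 u : V u -> norm u = 0 -> u = 0.
Proof. by move=> /V_L2; exact: (norm0_eq mO). Qed.

Let lamS := [set c : R | forall u, V u -> c * norm u ^+ 2 <= gn u ^+ 2].

Lemma lamS_bound u : V u -> norm u != 0 -> ubound lamS (gn u ^+ 2 / norm u ^+ 2).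
Proof.
by move=> Vu n0 c cS; rewrite ler_pdivlMr ?cS// exprn_gt0// lt_def n0 sqrtr_ge0.
Qed.

Lemma lamS_poincare : lamS ((4 * L) ^- 2).
Proof.
move=> u Vu; rewrite mulrC ler_pdivrMr; last by rewrite exprn_gt0// mulr_gt0.
rewrite mulrC -exprMn lerXn2r ?nnegrE ?sqrtr_ge0 ?mulr_ge0 ?sqrtr_ge0 ?(ltW Lp)//.
exact: (V_poincare Oo OL Lp).
Qed.

Lemma lambda1_le u : V u -> lam * norm u ^+ 2 <= gn u ^+ 2.
Proof.
move=> Vu; have [->|n0] := eqVneq (norm u) 0; first by rewrite expr0n mulr0 sqr_ge0.
rewrite -ler_pdivlMr; last by rewrite exprn_gt0// lt_def n0 sqrtr_ge0.
by apply: ge_sup; [exists ((4 * L) ^- 2); exact: lamS_poincare|exact: lamS_bound].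
Qed.

(** A nonzero field bounds the set of constants, so its supremum is genuine, and Poincare puts a
    positive constant in it. If [V] were trivial the set would be unbounded and [sup] would take its
    default value 0. *)
Lemma lambda1_gt0 u : V u -> norm u != 0 -> 0 < lam.
Proof.
move=> Vu n0; apply: (@lt_le_trans _ _ ((4 * L) ^- 2)).
  by rewrite invr_gt0 exprn_gt0// mulr_gt0.
by apply: ub_le_sup; [eexists; exact: lamS_bound n0|exact: lamS_poincare].
Qed.

Lemma f_bounded : bounded_lin V g f.
Proof. exact: fd. Qed.

Lemma f0 : f 0 = 0. Proof. exact: (f_0 S f_bounded). Qed.

Lemma gn0 : gn (0 : vec Omega) = 0. Proof. exact: (nrm0 iV). Qed.

Lemma dual_has_sup : has_sup [set `|f u| | u in [set u | V u /\ gn u <= 1]].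
Proof.
have [_ [C fC]] := fd; split.
  by exists `|f 0|, 0 => //; split; [exact: (in_0 iV)|rewrite gn0].
exists `|C| => _ [u [Vu u1] <-]; apply: le_trans (fC u Vu) _.
apply: (@le_trans _ _ (`|C| * gn u)); first by rewrite ler_wpM2r ?ler_norm// sqrtr_ge0.
by rewrite -[leRHS]mulr1 ler_wpM2l.
Qed.

Lemma dual_norm_ge0 : 0 <= dn.
Proof.
apply: le_trans (_ : `|f 0| <= _); first exact: normr_ge0.
apply: ub_le_sup; first exact: dual_has_sup.2.
by exists 0 => //; split; [exact: (in_0 iV)|rewrite gn0].
Qed.

Lemma dual_norm_le u : V u -> `|f u| <= dn * gn u.
Proof.
move=> Vu; have [fl [C fC]] := fd.
have [g0|g0] := eqVneq (gn u) 0; first by have := fC u Vu; rewrite g0 !mulr0.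
have gp : 0 < gn u by rewrite lt_def g0 sqrtr_ge0.
rewrite -ler_pdivrMr//; have -> : `|f u| / gn u = `|f ((gn u)^-1 *: u)|.
  have := fl (gn u)^-1 0 u u Vu Vu; rewrite scale0r mul0r !addr0 => ->.
  by rewrite normrM ger0_norm ?invr_ge0 ?sqrtr_ge0// mulrC.
apply: ub_le_sup; first exact: dual_has_sup.2.
exists ((gn u)^-1 *: u); last by [].
split; first exact: (in_Z iV (gn u)^-1 Vu).
have -> : gn ((gn u)^-1 *: u) = `|(gn u)^-1| * gn u := nrmZ iV (gn u)^-1 Vu.
by rewrite ger0_norm ?invr_ge0 ?sqrtr_ge0// mulVf.
Qed.

Lemma r0_ge0 : 0 <= r0.
Proof. by rewrite divr_ge0 ?dual_norm_ge0// mulr_ge0 ?sqrtr_ge0// ltW. Qed.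

(** By definition of the radius, the dual norm of [f] is [nu sqrt(lam) r0]; combined with
    [sqrt(lam) |u| <= |grad u|] this compares [ell] with the distance to the sphere. It serves
    twice: positivity outside the ball and nonnegativity on its boundary. *)
Lemma ell_lower u : V u -> norm u != 0 ->
  nu * gn u * (Num.sqrt lam * (norm u - r0)) <= ell nu f u.
Proof.
move=> Vu n0; have lp := lambda1_gt0 Vu n0; set s := Num.sqrt lam.
have sp : 0 < s by rewrite sqrtr_gt0.
have dnE : dn = nu * (s * r0) by rewrite /Defs.r0 -/s; field; rewrite !gt_eqF.
have gs : s * norm u <= gn u.
  rewrite -(ler_pXn2r (n := 2)) ?nnegrE ?sqrtr_ge0 ?mulr_ge0 ?sqrtr_ge0//.
  rewrite exprMn sqr_sqrtr ?(ltW lp)//; exact: lambda1_le.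
have fu := le_trans (ler_norm _) (dual_norm_le Vu).
have g0 : 0 <= nu * gn u by rewrite mulr_ge0 ?sqrtr_ge0// ltW.
have h1 := ler_wpM2l g0 gs; rewrite /ell; rewrite dnE in fu.
have -> : nu * gn u * (s * (norm u - r0)) = nu * gn u * (s * norm u) - nu * (s * r0) * gn u by ring.
have e2 : nu * gn u * gn u = nu * gn u ^+ 2 by ring.
by rewrite e2 in h1; lra.
Qed.

Lemma ell_gt0 u : V u -> r0 < norm u -> 0 < ell nu f u.
Proof.
move=> Vu ur; have np : 0 < norm u := le_lt_trans r0_ge0 ur.
apply: lt_le_trans (ell_lower Vu _); last by rewrite gt_eqF.
have lp : 0 < lam by apply: (lambda1_gt0 Vu); rewrite gt_eqF.
have gp : 0 < gn u.
  rewrite lt_def sqrtr_ge0 andbT; apply/eqP => g0; have := lambda1_le Vu.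
  by rewrite g0 expr0n leNgt mulr_gt0// exprn_gt0.
apply: mulr_gt0; first exact: mulr_gt0.
by apply: mulr_gt0; [rewrite sqrtr_gt0|rewrite subr_gt0].
Qed.

Lemma ell_sphere u : V u -> norm u = r0 -> 0 < r0 -> 0 <= ell nu f u.
Proof.
move=> Vu ur rp; apply: le_trans (ell_lower Vu _); last by rewrite ur gt_eqF.
by rewrite ur subrr !mulr0.
Qed.

Lemma F_lin u : V u -> forall a v w, V v -> V w ->
  F nu f u (v + a *: w) = F nu f u v + a * F nu f u w.
Proof.
move=> Vu a v w Vv Vw; rewrite /F (conv_linr Oo OL)//.
have [fl _] := fd; have := fl 1 a v w Vv Vw; rewrite scale1r mul1r => ->.
have -> : dot (grad u) (grad (v + a *: w)) = g u v + a * g u w.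
  by have := in_Dr iV Vv (in_Z iV a Vw) Vu; rewrite (in_Zr iV a Vu Vw).
exact: F_arith.
Qed.

Lemma F_self u : V u -> F nu f u u = - energy g nu f u.
Proof.
move=> Vu; rewrite /F (conv_skew Oo OL Lp Vu) subr0 /energy (nrm_sqr iV Vu) opprB.
by rewrite /gdot.
Qed.

(** At the origin only the forcing survives. As soon as some field is nonzero, [lambda1] is positive
    and a vanishing radius forces the dual norm of [f] to vanish. *)
Lemma F_zero : r0 = 0 -> forall w, V w -> F nu f 0 w = 0.
Proof.
move=> r00 w Vw; have V0 := in_0 iV; rewrite /F.
have -> : convection 0 0 w = 0.
  have := conv_le Oo OL Lp V0 V0 Vw; rewrite gn0 mulr0 !mul0r normr_le0.
  by move=> /eqP.
have -> : dot (grad 0) (grad w) = 0.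
  have := in_Zl iV 0 V0 Vw; rewrite scale0r mul0r; exact.
rewrite mulr0 !subr0; have [n0|n0] := eqVneq (norm w) 0; first by rewrite (norm_V0 Vw n0) f0.
have lp := lambda1_gt0 Vw n0; have dn0 : dn = 0.
  have : dn = r0 * (nu * Num.sqrt lam) by rewrite /Defs.r0 mulfVK// gt_eqF// mulr_gt0// sqrtr_gt0.
  by rewrite r00 mul0r.
by apply/eqP; rewrite -normr_le0; apply: le_trans (dual_norm_le Vw) _; rewrite dn0 mul0r.
Qed.

Section radius.
Variable rad : R.
Notation K := (kset V h rad).
Notation adm := (admissible V h g rad).
Notation subq := (subquadratic V h g rad).

Lemma F_sum u (I : Type) (s : seq I) (c : I -> R) (w : I -> vec Omega) :
  V u -> (forall j, V (w j)) ->
  F nu f u (\sum_(j <- s) c j *: w j) = \sum_(j <- s) c j * F nu f u (w j).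
Proof.
move=> Vu Vw; elim: s => [|j s IH].
  have := F_lin Vu 1 (in_0 iV) (in_0 iV); rewrite scale1r addr0 !big_nil mul1r; exact: eq_double.
have VS : V (\sum_(j <- s) c j *: w j) by have [] := in_sum iV s c Vw.
rewrite !big_cons -IH [LHS](_ : _ = F nu f u (\sum_(j <- s) c j *: w j + c j *: w j)); last by rewrite addrC.
by rewrite (F_lin Vu (c j) VS (Vw j)); exact: addrC.
Qed.

Lemma conv_lin2 w : Cc_infty_div0 w -> forall u v, V u -> V v ->
  convection u u w - convection v v w = convection (u - v) u w + (convection v u w - convection v v w).
Proof.
move=> cw u v Vu Vv; have Vw := Cc_div0_V Oo OL cw.
have := conv_linl Oo OL Lp (-1) Vu Vv Vu Vw; rewrite scaleN1r => ->.
exact: sub_split.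
Qed.

Lemma conv_bounded_lin v w : V v -> V w -> bounded_lin V g (fun u => convection v u w).
Proof.
move=> Vv Vw; split=> [a b u u' Vu Vu'|].
  have h1 := conv_linm Oo OL Lp b Vv (in_Z iV a Vu) Vu' Vw.
  have h2 := conv_linm Oo OL Lp a Vv (in_0 iV) Vu Vw.
  have h3 := conv_linm Oo OL Lp 1 Vv (in_0 iV) (in_0 iV) Vw.
  rewrite scale1r addr0 mul1r in h3; rewrite (add0r (a *: u)) in h2.
  by rewrite (eq_double h3) add0r in h2; rewrite h2 in h1.
exists (Cconv L * gn v * gn w) => u Vu; have := conv_le Oo OL Lp Vv Vu Vw.
exact: le_swap.
Qed.

(** The difference splits into a term with [u_ n - u] in the first slot, small in [L^2] since [w] is
    smooth, and a term linear in [u_ n], which converges weakly. *)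
Lemma conv_smooth_admissible w : Cc_infty_div0 w -> adm (fun u => convection u u w).
Proof.
move=> cw u_ u r Ku Ku' ur uu; have Vw := Cc_div0_V Oo OL cw.
have [C [C0 CP]] := conv_le_smooth Oo OL Lp cw.
apply/subr_cvg0.
rewrite (_ : (fun n => _) = fun n => convection (u_ n - u) (u_ n) w +
    (convection u (u_ n) w - convection u u w)); last first.
  by apply/funext => n; exact: (conv_lin2 cw (Ku n).1 Ku'.1).
rewrite -[X in _ --> X](addr0 0); apply: cvgD; last first.
  by apply/subr_cvg0; exact: (bounded_lin_admissible S (conv_bounded_lin Ku'.1 Vw) Ku Ku' ur uu).
apply/norm_cvg0P.
apply: (squeeze_cvgr (_ : \forall n \near \oo, 0 <= `|convection (u_ n - u) (u_ n) w| <= C * norm (u_ n - u) * r) (cvg_cst 0)).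
  near=> n; rewrite normr_ge0/=; apply: le_trans (CP _ _ _ (Ku n).1) _.
    by apply: (in_B iV); [exact: (Ku n).1|exact: Ku'.1].
  by apply: ler_wpM2l; [apply: mulr_ge0 => //; exact: sqrtr_ge0|exact: ur].
rewrite -[X in _ --> X](mul0r r) -[in X in _ --> X](mulr0 C).
by apply: cvgM; [apply: cvgM; [exact: cvg_cst|exact: uu]|exact: cvg_cst].
Unshelve. all: by end_near. Qed.

Lemma conv_smooth_subquadratic w : Cc_infty_div0 w -> subq (fun u => convection u u w).
Proof.
move=> cw; have [C [C0 CP]] := conv_le_smooth Oo OL Lp cw.
apply: (@subquadratic_linear _ _ _ _ _ _ _ (C * rad) 0) => u [Vu ur]; rewrite addr0.
apply: le_trans (CP _ _ Vu Vu) _; apply: ler_wpM2r; first exact: sqrtr_ge0.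
by apply: ler_wpM2l.
Qed.

(** Replacing [w] by a smooth field costs a constant times [|grad u|^2 |grad (w - w')|], which is
    exactly the tolerance allowed by [admissible_approx] and [subquadratic_approx]. *)
Lemma conv_approx w : V w -> forall e, 0 < e -> exists2 w', Cc_infty_div0 w' &
  forall u, K u -> `|convection u u w - convection u u w'| <= e * (1 + gn u ^+ 2).
Proof.
move=> Vw e e0; have [w_ [cw _ gw _ _]] := V_lim Oo OL Vw.
have Cc : 0 <= Cconv L := Cconv_ge0 L.
have c0 : 0 < Cconv L + 1 by rewrite ltr_wpDl.
have : 0 < e / (Cconv L + 1) by rewrite divr_gt0.
move=> /(cvg_near_le gw)[N /(_ N (leqnn _)) hN].
exists (w_ N) => // u [Vu _]; have VN := Cc_div0_V Oo OL (cw N).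
have h1 := conv_linr Oo OL Lp (-1) Vu Vu VN Vw; rewrite scaleN1r in h1.
have h2 := conv_le Oo OL Lp Vu Vu (in_B iV VN Vw).
rewrite (opp_lin (convection u u w)) -h1 normrN.
exact: (le_small Cc e0 (sqrtr_ge0 _) hN h2).
Qed.

Lemma conv_admissible w : V w -> adm (fun u => convection u u w).
Proof.
move=> Vw; apply: (@admissible_approx _ _ V h g rad) => e /(conv_approx Vw)[w' cw' H].
by exists (fun u => convection u u w') => //; exact: conv_smooth_admissible.
Qed.

Lemma conv_subquadratic w : V w -> subq (fun u => convection u u w).
Proof.
move=> Vw; apply: (@subquadratic_approx _ _ V h g rad) => e /(conv_approx Vw)[w' cw' H].
by exists (fun u => convection u u w') => //; exact: conv_smooth_subquadratic.
Qed.

Lemma gdot_bounded_lin w : V w -> bounded_lin V g (fun u => g u w).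
Proof.
move=> Vw; split=> [a b u u' Vu Vu'|].
  have h1 := in_Dl iV (in_Z iV a Vu) (in_Z iV b Vu') Vw.
  by rewrite (in_Zl iV a Vu Vw) (in_Zl iV b Vu' Vw) in h1.
by exists (gn w) => u Vu; rewrite mulrC; exact: (in_cs iV).
Qed.

Lemma F_admissible w : V w -> adm (fun u => F nu f u w).
Proof.
move=> Vw; apply: (@admissible_ext _ _ _ _ _ _
  (fun u => (f w + - nu * g u w) + -1 * convection u u w)).
  by move=> u _; exact: sub_lin.
apply: admissible_D; last by apply: admissible_Z; exact: conv_admissible.
apply: admissible_D; first exact: admissible_cst.
by apply: admissible_Z; apply: (bounded_lin_admissible S); exact: gdot_bounded_lin.
Qed.

Lemma F_subquadratic w : V w -> subq (fun u => F nu f u w).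
Proof.
move=> Vw.
have s1 : subq (fun u => (f w - nu * g u w) + -1 * convection u u w).
  apply: subquadratic_D; last first.
    apply: (@subquadratic_Mb _ _ _ _ _ _ (fun=> -1) _ 1) => [u _|]; last exact: conv_subquadratic.
    by rewrite normrN1.
  apply: (@subquadratic_linear _ _ _ _ _ _ _ (nu * gn w) `|f w|) => u [Vu _].
  rewrite addrC; apply: le_trans (ler_normD _ _) _; rewrite lerD2r normrN normrM (gtr0_norm nu0).
  by rewrite -mulrA (mulrC (gn w)) ler_wpM2l ?(ltW nu0)//; exact: (in_cs iV).
move=> e /s1[C hC]; exists C => u Ku; apply: le_trans (hC u Ku).
by rewrite mulN1r.
Qed.

Section test_functional.
Variable Psi : Tcyl Omega.
Notation GPsi := (fun u => F nu f u (cyl_diff Psi (L2_dual_V u))).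
Let wV := @cyl_wP R Omega Psi.
Let cD j : continuous ('D_(delta_mx 0 j) (@cyl_psi _ _ Psi)).
Proof. by case: (cyl_psiP Psi). Qed.

Lemma GPsiE u : V u -> GPsi u =
  \sum_j 'D_(delta_mx 0 j) (@cyl_psi _ _ Psi) (\row_j h u (cyl_w j)) * F nu f u (cyl_w j).
Proof. by move=> Vu; rewrite /cyl_diff F_sum. Qed.

Let bigK (Pr : (vec Omega -> R) -> Prop) (I : Type) (s : seq I) (G : I -> vec Omega -> R) :
  Pr (fun=> 0) -> (forall G1 G2, Pr G1 -> Pr G2 -> Pr (fun u => G1 u + G2 u)) ->
  (forall i, Pr (G i)) -> Pr (fun u => \sum_(i <- s) G i u).
Proof.
move=> P0 PD PG; elim: s => [|i s IH].
  by rewrite (_ : (fun u => _) = fun=> 0)//; apply/funext => u; rewrite big_nil.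
rewrite (_ : (fun u => _) = fun u => G i u + \sum_(j <- s) G j u); first exact: PD.
by apply/funext => u; rewrite big_cons.
Qed.

Lemma GPsi_admissible : adm GPsi.
Proof.
apply: (@admissible_ext _ _ _ _ _ _ (fun u => \sum_j 'D_(delta_mx 0 j) (@cyl_psi _ _ Psi)
  (\row_j h u (cyl_w j)) * F nu f u (cyl_w j))).
  by move=> u [Vu _]; rewrite GPsiE.
apply: (@bigK adm) => [|G1 G2|j]; [exact: admissible_cst|exact: admissible_D|].
apply: admissible_M; last by apply: F_admissible; exact: wV.
exact: (@row_admissible _ _ Hs V h g S rad _ _ (@cyl_w _ _ Psi) (@cD j) (fun i => V_L2 (wV i))).
Qed.

Lemma GPsi_subquadratic : subq GPsi.
Proof.
have : subq (fun u => \sum_j 'D_(delta_mx 0 j) (@cyl_psi _ _ Psi)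
  (\row_j h u (cyl_w j)) * F nu f u (cyl_w j)).
  apply: (@bigK subq) => [|G1 G2|j].
  - by apply: (@subquadratic_linear _ _ _ _ _ _ _ 0 0) => u _; rewrite normr0 mul0r addr0.
  - exact: subquadratic_D.
  have [b hb] := row_bounded S rad (@cD j) (fun i => V_L2 (wV i)).
  by apply: (subquadratic_Mb hb); apply: F_subquadratic; exact: wV.
by move=> s e /s[C hC]; exists C => u Ku; rewrite GPsiE ?hC//; case: Ku.
Qed.

End test_functional.

End radius.

Lemma GPsi_lyapunov (Psi : Tcyl Omega) (GPsi := fun u => F nu f u (cyl_diff Psi (L2_dual_V u))) : exists t1 t2 u1 u2, mixed V h g r0 nu f t1 t2 u1 u2 /\
  0 <= t1 * GPsi u1 + t2 * GPsi u2.
Proof.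
have [c1 d1 cd1 _] := cyl_psiP Psi.
have := lyapunov S r0_ge0 nu0 f_bounded F_lin F_self F_zero ell_sphere
  (@cyl_wP R Omega Psi) c1
  (fun j x => d1 j x) cd1.
by apply; [exact: (@GPsi_admissible r0 Psi)|exact: (@GPsi_subquadratic r0 Psi)].
Qed.

End navier_stokes_control.

(** * Stationary solutions *)

Section energy_tests.
Context {R : realType}.

Lemma integral_carrier d (T : measurableType d) (mu : {measure set T -> \bar R})
    (D C : set T) (G : T -> \bar R) :
  measurable D -> measurable C -> C `<=` D -> mu (D `\` C) = 0%E ->
  measurable_fun D G -> (\int[mu]_(x in D) G x = \int[mu]_(x in C) G x)%E.
Proof.
move=> mD mC CD DC0 mG; rewrite -[in RHS](setIidr CD) integral_mkcondr.
apply: ae_eq_integral => //.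
  apply/measurable_restrict => //; rewrite setIC; exact: measurable_funS mG.
exists (D `\` C); split => //; first exact: measurableD.
move=> x /= /not_implyP[Dx nG]; split => // Cx; apply: nG.
by rewrite patchE mem_set.
Qed.

Lemma energy_test_primitive (lam : R -> R) b : continuous lam ->
  (forall t, 0 <= lam t <= b) -> exists psi, energy_test psi lam.
Proof.
move=> cl lb; have [Lam LamP] := antiderivative cl.
have mono s t : 0 <= s -> s <= t -> Lam s <= Lam t.
  move=> s0 st.
  have [||c ci E] := @MVT_segment _ Lam lam s t st.
  - move=> x; rewrite in_itv/= => /andP[sx _]; apply: LamP.
    by apply: le_trans s0 _; exact: ltW.
  - apply: derivable_within_continuous => x; rewrite in_itv/= => /andP[sx _].
    by have [] := LamP x (le_trans s0 sx).
  rewrite -subr_ge0 E mulr_ge0 ?subr_ge0//; by have /andP[] := lb c.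
(* Subtracting the value at 0 makes the non-decreasing primitive nonnegative on the half-line. *)
exists (fun t => Lam t - Lam 0); split.
- split=> [t t0|]; last exact: continuous_subspaceT.
  have [dv dE] := LamP t t0.
  have : (fun s : R => s^-1 *: (Lam (s *: 1 + t) - Lam t)) @ 0^' --> lam t by rewrite -dE; exact: dv.
  move=> /cvgrPdist_le dc; apply/cvgrPdist_le => e e0; have := dc e e0.
  rewrite near_withinE => /nbhs_ballP[d /= d0 dP]; exists d => //= s ts st _.
  have sN : s - t != 0 by rewrite subr_eq0.
  have := dP (s - t); rewrite /ball /= sub0r normrN distrC => /(_ ts sN).
  rewrite [(s - t) *: 1]mulr1 subrK mulrC.
  by rewrite (_ : Lam s - Lam 0 - (Lam t - Lam 0) = Lam s - Lam t)//; ring.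
- by move=> t t0; rewrite subr_ge0 mono.
- by move=> s t s0 st; rewrite lerD2r mono.
- by exists b => t t0; have /andP[l0 l1] := lb t; rewrite ger0_norm.
Qed.

(** A negative derivative would make a difference quotient on the right negative, against
    monotonicity; only points to the right are used, so [t = 0] is covered. *)
Lemma energy_test_ge0 (psi dpsi : R -> R) t : energy_test psi dpsi -> 0 <= t -> 0 <= dpsi t.
Proof.
move=> [[dP _] _ mono _] t0; rewrite leNgt; apply/negP => dn.
have := dP t t0 => /cvgrPdist_lt /(_ (- dpsi t)); rewrite oppr_gt0 => /(_ dn).
move=> [d /= d0 /= /(_ (t + d / 2))].
have d2 : 0 < d / 2 by rewrite divr_gt0.
have td : t + d / 2 - t = d / 2 by ring.
have ball : `|t - (t + d / 2)| < d by rewrite distrC td gtr0_norm//; lra.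
move=> /(_ ball); rewrite gt_eqF ?ltrDl//= => /(_ isT).
rewrite in_itv/= andbT addr_ge0 ?(ltW d2)// => /(_ isT).
have q0 : 0 <= (psi (t + d / 2) - psi t) / (t + d / 2 - t).
  by rewrite td divr_ge0 ?(ltW d2)// subr_ge0 mono// lerDl ltW.
rewrite ltr_norml => /andP[+ _]; move: q0; set q := _ / _; lra.
Qed.

End energy_tests.

Section stationary.
Context {R : realType} {E : lmodType R}.
Variables (H V : set E) (h g : E -> E -> R).
Hypothesis S : hilbert_pair H V h g.
Let iH := hp_H S.
Let iV := hp_V S.
Notation nH := (nrm h).
Notation nV := (nrm g).
Variables (r0 nu : R) (f : E -> R).
Hypotheses (r0_ge0 : 0 <= r0) (nu0 : 0 < nu) (fb : bounded_lin V g f).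
Hypothesis ell_gt0 : forall u, V u -> r0 < nH u -> 0 < energy g nu f u.
Notation K := (kset V h r0).
Notation ell := (energy g nu f).
Notation mix := (mixed V h g r0 nu f).
Variables (T : pointedType) (v : T -> E).
Hypotheses (vH : forall t, H (v t)).
Notation B := (g_sigma_algebraType (norm_open h v)).
Notation KT := (@Kset R E V h T v r0).
Notation VT := (@Vset R E V h T v).

Let mKT : measurable KT := measurable_Kset S vH r0.
Let mVT : measurable VT := measurable_Vset S vH.

Definition enst u : \bar R := if `[< V u >] then (nV u ^+ 2)%:E else +oo%E.

Definition stationary (D : set (E -> R)) (mu : probability B R) :=
  [/\ (\int[mu]_t enst (v t) < +oo)%E,
      forall psi dpsi, energy_test psi dpsi ->
        (\int[mu]_(t in VT) (dpsi (nH (v t) ^+ 2) * ell (v t))%:E <= 0)%E &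
      forall Q, D Q -> (\int[mu]_(t in VT) (Q (v t))%:E = 0)%E].

Lemma enstV u : V u -> enst u = (nV u ^+ 2)%:E.
Proof. by move=> Vu; rewrite /enst asboolT. Qed.

Lemma enst_ge0 u : (0 <= enst u)%E.
Proof. by rewrite /enst; case: asboolP => _; rewrite ?leey// lee_fin sqr_ge0. Qed.

Let mnV2 : measurable_fun VT (fun t : B => nV (v t) ^+ 2).
Proof. by apply: measurable_funX; exact: (measurable_nV S vH). Qed.

(** The integrals of the statement run over all of [V], which is a union of balls of growing radius;
    hence admissibility is required for every radius, not just for [r0]. *)
Lemma measurable_VT_adm (G : E -> R) : (forall r, admissible V h g r G) ->
  measurable_fun VT (fun t : B => G (v t)).
Proof.
move=> aG; have -> : VT = \bigcup_(n : nat) (@Kset R E V h T v n%:R).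
  apply/seteqP; split=> [t Vt|t [n _ []]//].
  by exists (Num.truncn (nH (v t))).+1 => //; split => //; exact/ltW/truncnS_gt.
apply/measurable_fun_bigcup => n; first exact: (measurable_Kset S vH n%:R).
exact: (measurable_admissible S vH (aG n%:R)).
Qed.

Lemma measurable_ell : measurable_fun VT (fun t : B => ell (v t)).
Proof.
apply: measurable_funB; first by apply: measurable_funM.
by apply: measurable_VT_adm => r; exact: (bounded_lin_admissible S fb).
Qed.

Lemma measurable_enst : measurable_fun setT (fun t : B => enst (v t)).
Proof.
rewrite -(setUv VT); apply/measurable_funU => //; first exact: measurableC.
split.
  apply: (@eq_measurable_fun _ _ _ _ _ (fun t : B => (nV (v t) ^+ 2)%:E)).
    by move=> t; rewrite inE => Vt; rewrite enstV.
  exact/measurable_EFinP.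
apply: (@eq_measurable_fun _ _ _ _ _ (fun t : B => +oo%E)) => [t|]; last exact: measurable_cst.
by rewrite inE => Vt; rewrite /enst asboolF.
Qed.

Section one_measure.
Variable mu : probability B R.

Lemma carried_integral (G : E -> R) : mu (~` KT) = 0%E -> (measurable_fun VT (fun t : B => G (v t))) ->
  (\int[mu]_(t in VT) (G (v t))%:E = \int[mu]_(t in KT) (G (v t))%:E)%E.
Proof.
move=> muK mG; apply: integral_carrier => //; [by move=> t []| |exact/measurable_EFinP].
apply/eqP; rewrite -measure_le0 -muK; apply: le_measure; rewrite ?inE.
- exact: measurableD.
- exact: measurableC.
- by move=> t [].
Qed.

Variable D : set (E -> R).
Hypothesis muP : stationary D mu.

Lemma stationary_VT : mu (~` VT) = 0%E.
Proof.
have [fin _ _] := muP; apply/eqP; rewrite -measure_le0 leNgt; apply/negP => pos.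
have : (\int[mu]_(t in ~` VT) (cst +oo%E t) <= \int[mu]_t enst (v t))%E.
  rewrite (eq_integral (fun t : B => enst (v t))); last first.
    by move=> t; rewrite inE => Vt; rewrite /enst asboolF.
  apply: ge0_subset_integral => //; [exact: measurableC|exact: measurable_enst|].
  by move=> t _; exact: enst_ge0.
rewrite integral_cst; last exact: measurableC.
by rewrite gt0_mulye// => /le_lt_trans/(_ fin).
Qed.

Lemma stationary_enstrophy : mu.-integrable KT (fun t => (nV (v t) ^+ 2)%:E).
Proof.
have [fin _ _] := muP; apply/integrableP; split.
  by apply/measurable_EFinP; apply: measurable_funS mnV2 => // t [].
apply: le_lt_trans fin.
rewrite (eq_integral (fun t : B => enst (v t))); last first.
  by move=> t; rewrite inE => -[Vt _]; rewrite enstV// gee0_abs// lee_fin sqr_ge0.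
apply: ge0_subset_integral => //; first exact: measurable_enst.
by move=> t _; exact: enst_ge0.
Qed.

(** The energy inequality with [psi'] vanishing on [[0, r0^2]] and positive beyond: the integrand is
    zero on the ball and positive outside, where [ell > 0], yet its integral is at most 0. *)
Lemma stationary_carried : mu (~` KT) = 0%E.
Proof.
have V0 := stationary_VT; have [_ en _] := muP.
pose lam (t : R) := clamp (t - r0 ^+ 2).
have lb t : 0 <= lam t <= 1 by exact: clamp_itv.
have cl : continuous lam.
  move=> t; apply: (@continuous_min _ _ (fun=> 1) (fun t => Num.max 0 (t - r0 ^+ 2)) t).
    exact: cst_continuous.
  apply: (@continuous_max _ _ (fun=> 0) (fun t => t - r0 ^+ 2) t); first exact: cst_continuous.
  by apply: cvgB; [exact: cvg_id|exact: cvg_cst].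
have [psi psiP] := energy_test_primitive cl lb.
pose X (t : B) := lam (nH (v t) ^+ 2) * ell (v t).
have mX : measurable_fun VT X.
  apply: measurable_funM; last exact: measurable_ell.
  apply: (measurableT_comp (continuous_measurable_fun cl)).
  by apply: measurable_funX; apply: measurable_funTS; exact: (measurable_nH S vH).
have out t : VT t -> ~ KT t -> 0 < X t.
  move=> Vt nK; have rn : r0 < nH (v t).
    by rewrite ltNge; apply/negP => rn; apply: nK.
  rewrite mulr_gt0 ?ell_gt0//.
  have : 0 < nH (v t) ^+ 2 - r0 ^+ 2 by rewrite subr_gt0 ltrXn2r// ?nnegrE ?nrm_ge0.
  by move=> q; rewrite /lam /clamp lt_min ltr01 lt_max q orbT.
have X0 t : VT t -> 0 <= X t.
  move=> Vt; have [[_ rn]|nK] := pselect (KT t); last exact/ltW/out.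
  by rewrite /X /lam clamp_le0 ?mul0r// subr_le0 lerXn2r// ?nnegrE ?nrm_ge0.
have iX : (\int[mu]_(t in VT) (X t)%:E = 0)%E.
  apply/eqP; rewrite eq_le (en _ _ psiP) /=.
  by apply: integral_ge0 => t Vt; rewrite lee_fin X0.
have mXE : measurable_fun VT (EFin \o X) by exact/measurable_EFinP.
have := (ae_eq_integral_abs mu mVT mXE).1.
rewrite (eq_integral (EFin \o X)); last first.
  by move=> t; rewrite inE => Vt; rewrite gee0_abs// lee_fin X0.
move=> /(_ iX) [N [mN N0 NP]].
apply/eqP; rewrite -measure_le0.
have sub : ~` KT `<=` ~` VT `|` N.
  move=> t nK; have [Vt|nV] := pselect (VT t); last by left.
  by right; apply: NP => /= /(_ Vt) /eqP; rewrite eqe gt_eqF// out.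
apply: (@le_trans _ _ (mu (~` VT `|` N))).
  apply: le_measure; rewrite ?inE//; first exact: measurableC.
  by apply: measurableU => //; exact: measurableC.
apply: (@le_trans _ _ (mu (~` VT) + mu N)%E); last by rewrite V0 N0 adde0.
by apply: measureU2 => //; exact: measurableC.
Qed.

Lemma stationary_KT : mu KT = 1%E.
Proof. by have := probability_setC mu (measurableC mKT); rewrite setCK stationary_carried sube0. Qed.

Lemma stationary_integrable (G : E -> R) : admissible V h g r0 G -> subquadratic V h g r0 G ->
  mu.-integrable KT (fun t => (G (v t))%:E).
Proof.
move=> aG /(_ 1 ltr01)[C GC].
have ic : mu.-integrable KT (fun t => ((nV (v t) ^+ 2)%:E + (EFin \o cst C) t)%E).
  by apply: integrableD => //; [exact: stationary_enstrophy|exact: finite_measure_integrable_cst].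
apply: le_integrable ic => //.
  by apply/measurable_EFinP; exact: (measurable_admissible S vH aG).
move=> t Kt; rewrite -EFinD !abse_EFin lee_fin; apply: le_trans (ler_norm _).
by have := GC _ Kt; rewrite mul1r.
Qed.

(* A multiplier turns the bound of the Lagrangian on mixed states into the
   pointwise bound [phi + Q <= m + e + lam(|u|^2) ell(u)], and the last term
   has nonpositive mean by the energy inequality. *)
Lemma stationary_le (phi Q : E -> R) m : admissible V h g r0 phi -> subquadratic V h g r0 phi ->
  (forall r, admissible V h g r Q) -> subquadratic V h g r0 Q -> D Q ->
  (forall t1 t2 u1 u2, mix t1 t2 u1 u2 -> t1 * (phi u1 + Q u1) + t2 * (phi u2 + Q u2) <= m) ->
  (\int[mu]_(t in KT) (phi (v t))%:E <= m%:E)%E.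
Proof.
move=> ap sp aQ sQ DQ mP; have [_ en Q0] := muP; have muK := stationary_carried.
have aG : admissible V h g r0 (fun u => phi u + Q u) by apply: admissible_D.
have sG : subquadratic V h g r0 (fun u => phi u + Q u) by exact: subquadratic_D.
have iphi := stationary_integrable ap sp; have iQ := stationary_integrable (aQ r0) sQ.
have iQ0 : (\int[mu]_(t in KT) (Q (v t))%:E = 0)%E.
  by rewrite -carried_integral ?Q0//; exact: measurable_VT_adm.
apply/lee_addgt0Pr => e e0.
have [lam [cl l0 [b lb] lP]] := multiplier S r0_ge0 nu0 fb aG sG mP e0.
have lb' t : 0 <= lam t <= b by rewrite ltW//= lb.
have [psi psiP] := energy_test_primitive cl lb'.
pose X (u : E) := lam (nH u ^+ 2) * ell u.
have mX : measurable_fun VT (fun t : B => X (v t)).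
  apply: measurable_funM; last exact: measurable_ell.
  apply: (measurableT_comp (continuous_measurable_fun cl)).
  by apply: measurable_funX; apply: measurable_funTS; exact: (measurable_nH S vH).
have iX0 : (\int[mu]_(t in KT) (X (v t))%:E <= 0)%E.
  by rewrite -carried_integral//; exact: en psiP.
have iell : mu.-integrable KT (fun t => (ell (v t))%:E).
  rewrite (_ : (fun t => _) = (fun t : B => nu%:E * (nV (v t) ^+ 2)%:E - (f (v t))%:E)%E).
    apply: integrableB => //; first by apply: integrableZl => //; exact: stationary_enstrophy.
    apply: stationary_integrable; first exact: (bounded_lin_admissible S fb).
    have [_ [c fc]] := fb; apply: (@subquadratic_linear _ _ _ _ _ _ _ c 0) => u [Vu _].
    by rewrite addr0; exact: fc.
  by apply/funext => t; rewrite -EFinM -EFinB.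
have b0 : 0 <= b by have /andP[/le_trans] := lb' 0; apply.
have iX : mu.-integrable KT (fun t => (X (v t))%:E).
  apply: le_integrable (integrableZl mKT b iell) => //.
    by apply/measurable_EFinP; apply: measurable_funS mX => // t [].
  move=> t Kt; rewrite -EFinM !abse_EFin lee_fin !normrM ler_wpM2r// (ger0_norm b0).
  by have /andP[? ?] := lb' (nH (v t) ^+ 2); rewrite ger0_norm.
have le1 : (\int[mu]_(t in KT) ((phi (v t))%:E + (Q (v t))%:E) <=
    \int[mu]_(t in KT) ((cst (m + e) t)%:E + (X (v t))%:E))%E.
  apply: le_integral => //; first exact: integrableD.
    apply: integrableD => //; exact: finite_measure_integrable_cst.
  by move=> t; rewrite inE => Kt; rewrite -!EFinD lee_fin; exact: lP.
rewrite integralD// iQ0 adde0 in le1; apply: le_trans le1 _.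
rewrite integralD//; last exact: finite_measure_integrable_cst.
have -> : (\int[mu]_(t in KT) (cst (m + e) t)%:E = (m + e)%:E * mu KT)%E by exact: (@integral_cst _ _ _ mu KT mKT (m + e)%:E).
by rewrite stationary_KT mule1 EFinD -[leRHS]adde0 leeD2l.
Qed.

End one_measure.

Section existence.
Variables (D : set (E -> R)) (mu : probability B R) (L : (E -> R) -> R).
Hypothesis L_lin : forall (G1 G2 : E -> R) a,
  quadratic V h g r0 G1 -> quadratic V h g r0 G2 ->
  L (fun u => G1 u + a * G2 u) = L G1 + a * L G2.
Hypothesis L_mean : forall (G : E -> R) b, quadratic V h g r0 G ->
  (forall t1 t2 u1 u2, mix t1 t2 u1 u2 -> t1 * G u1 + t2 * G u2 <= b) -> L G <= b.
Hypothesis muK : mu (~` KT) = 0%E.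
Hypothesis PL : forall (G : E -> R) b, admissible V h g r0 G -> (forall u, K u -> `|G u| <= b) ->
    (\int[mu]_(t in KT) (G (v t))%:E = (L G)%:E)%E.
Hypothesis D_adm : forall Q, D Q -> forall r, admissible V h g r Q.
Hypothesis D_sub : forall Q, D Q -> subquadratic V h g r0 Q.
Hypothesis D_0 : forall Q, D Q -> L Q = 0.

(** The three conditions use three strengths of representation: an upper bound for the enstrophy,
    the sign for radially weighted energy, and equality for the sub-quadratic tests, on which [L]
    vanishes. *)
Lemma representing_stationary : stationary D mu.
Proof.
split=> [|psi dpsi psiP|Q DQ].
- rewrite (@integral_carrier _ _ _ _ setT KT)//; last 2 first.
  + by rewrite setTD.
  + exact: measurable_enst.
  have /integrableP[_] := enstrophy_integrable S L_lin L_mean vH PL.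
  apply: le_lt_trans; rewrite le_eqVlt; apply/orP; left; apply/eqP.
  apply: eq_integral => t; rewrite inE => -[Vt _].
  by rewrite enstV// gee0_abs// lee_fin sqr_ge0.
- have [_ _ _ [C dC]] := psiP; have [[_ cd] _ _ _] := psiP.
  have mX : measurable_fun VT (fun t : B => dpsi (nH (v t) ^+ 2) * ell (v t)).
    apply: measurable_funM; last exact: measurable_ell.
    by apply: (@measurable_VT_adm (fun u => dpsi (nH u ^+ 2))) => r; exact: (admissible_radial S cd).
  rewrite (carried_integral (G := fun u => dpsi (nH u ^+ 2) * ell u))//.
  apply: (energy_integral_le0 S nu0 fb L_lin L_mean vH PL
    (X := fun u => dpsi (nH u ^+ 2)) (b := C)).
  + exact: (admissible_radial S cd).
  + move=> u _; have d0 := energy_test_ge0 psiP (sqr_ge0 (nH u)).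
    by rewrite d0 -[leLHS]ger0_norm// dC// sqr_ge0.
  + by move=> u w ->.
- rewrite carried_integral//; last by apply: measurable_VT_adm => r; exact: D_adm.
  rewrite (integral_subquadratic S nu0 fb L_lin L_mean vH PL) ?D_0//.
    exact: D_adm.
  exact: D_sub.
Qed.

End existence.

End stationary.

(** * The duality in abstract form *)

Section minimax.
Context {R : realType} {E : lmodType R}.
Variables (H V : set E) (h g : E -> E -> R).
Hypothesis S : hilbert_pair H V h g.
Notation nH := (nrm h).
Notation nV := (nrm g).
Variables (r0 nu : R) (f : E -> R).
Hypotheses (r0_ge0 : 0 <= r0) (nu0 : 0 < nu) (fb : bounded_lin V g f).
Hypothesis ell_gt0 : forall u, V u -> r0 < nH u -> 0 < energy g nu f u.
Notation K := (kset V h r0).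
Notation ell := (energy g nu f).
Notation mix := (mixed V h g r0 nu f).
Variables (T : pointedType) (v : T -> E) (ret : E -> T).
Hypotheses (vH : forall t, H (v t)) (retK : forall u, V u -> v (ret u) = u).
Variable D : set (E -> R).
Hypothesis D_adm : forall Q, D Q -> forall r, admissible V h g r Q.
Hypothesis D_sub : forall Q, D Q -> subquadratic V h g r0 Q.
Hypothesis D_0 : exists2 Q, D Q & forall u, K u -> Q u = 0.
Hypothesis D_lin : forall P Q a, D P -> D Q ->
  exists2 W, D W & forall u, K u -> W u = P u + a * Q u.
Hypothesis D_lyapunov : forall P, D P -> exists t1 t2 u1 u2,
  mix t1 t2 u1 u2 /\ 0 <= t1 * P u1 + t2 * P u2.
Variable phi : E -> R.
Hypotheses (ap : admissible V h g r0 phi) (sp : subquadratic V h g r0 phi).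

Lemma stationary_exists M : (forall P, D P -> exists t1 t2 u1 u2,
    mix t1 t2 u1 u2 /\ M <= t1 * (phi u1 + P u1) + t2 * (phi u2 + P u2)) ->
  exists mu : probability (g_sigma_algebraType (norm_open h v)) R,
    stationary V g nu f D mu /\ exists2 x, M <= x &
    (\int[mu]_(t in @Kset R E V h T v r0) (phi (v t))%:E = x%:E)%E.
Proof.
move=> phiM.
(* The tests form a linear space only up to equality on [K], because of the cutoff in their sums;
   saturating under this equality makes linearity hold literally. *)
pose D' : set (E -> R^o) := [set P | exists2 Q, D Q & forall u, K u -> P u = Q u].
have mK t1 t2 u1 u2 : mix t1 t2 u1 u2 -> K u1 /\ K u2 by case.
have [||||||L [L_lin L_mean ML L0]] := @dual_functional R E H V h g S r0 nu f r0_ge0 nu0 fb D' phi M.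
- move=> P [Q DQ PQ]; have [C QC] := quadratic_sub (D_sub DQ).
  by exists C => u Ku; rewrite PQ// QC.
- by have [Q DQ Q0] := D_0; exists Q => // u Ku; rewrite Q0.
- move=> P1 P2 a [Q1 DQ1 PQ1] [Q2 DQ2 PQ2]; have [W DW WE] := D_lin a DQ1 DQ2.
  by exists W => // u Ku; rewrite WE// -PQ1// -PQ2.
- move=> P [Q DQ PQ]; have [t1 [t2 [u1 [u2 [mx le]]]]] := D_lyapunov DQ.
  exists t1, t2, u1, u2; split => //; have [K1 K2] := mK _ _ _ _ mx.
  by rewrite !PQ.
- exact: quadratic_sub.
- move=> P [Q DQ PQ]; have [t1 [t2 [u1 [u2 [mx le]]]]] := phiM _ DQ.
  exists t1, t2, u1, u2; split => //; have [K1 K2] := mK _ _ _ _ mx.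
  by rewrite !PQ.
have [P [PK PL]] := representing_measure S nu0 fb L_lin L_mean vH retK.
exists P; split.
  apply: (representing_stationary S nu0 fb vH L_lin L_mean PK PL D_adm D_sub).
  by move=> Q DQ; apply: L0; exists Q.
exists (L phi) => //.
exact: (integral_subquadratic S nu0 fb L_lin L_mean vH PL ap sp).
Qed.

Variable G : set (set T).
Hypothesis GE : G = norm_open h v.

(** The generator [G] is a parameter, identified with [norm_open h v] by [GE]; substitution
    transfers the results to a sigma-algebra whose generator is spelled differently. *)
Definition stationary_for (mu : probability (g_sigma_algebraType G) R) :=
  [/\ (\int[mu]_t enst V g (v t) < +oo)%E,
      forall psi dpsi, energy_test psi dpsi ->
        (\int[mu]_(t in [set t | V (v t)]) (dpsi (nH (v t) ^+ 2) * ell (v t))%:E <= 0)%E &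
      forall Q, D Q -> (\int[mu]_(t in [set t | V (v t)]) (Q (v t))%:E = 0)%E].

Lemma stationary_for_exists M : (forall P, D P -> exists t1 t2 u1 u2,
    mix t1 t2 u1 u2 /\ M <= t1 * (phi u1 + P u1) + t2 * (phi u2 + P u2)) ->
  exists mu, stationary_for mu /\ exists2 x, M <= x &
    (\int[mu]_(t in [set t | K (v t)]) (phi (v t))%:E = x%:E)%E.
Proof. by rewrite /stationary_for; subst G; exact: stationary_exists. Qed.

Lemma stationary_for_le mu Q m : stationary_for mu -> D Q ->
  (forall t1 t2 u1 u2, mix t1 t2 u1 u2 -> t1 * (phi u1 + Q u1) + t2 * (phi u2 + Q u2) <= m) ->
  exists2 x, x <= m & (\int[mu]_(t in [set t | K (v t)]) (phi (v t))%:E = x%:E)%E.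
Proof.
move: mu; rewrite /stationary_for; subst G => mu muP DQ mP.
have i := stationary_integrable S vH muP ap sp.
have := stationary_le S r0_ge0 nu0 fb ell_gt0 vH muP ap sp (D_adm DQ) (D_sub DQ) DQ mP.
have /fineK <- := integrable_fin_num (measurable_Kset S vH r0) i.
by rewrite lee_fin; set x := fine _; exists x.
Qed.

End minimax.

Lemma bounded_crd {R : realType} (Omega : set (R3 R)) : bounded_set Omega ->
  exists2 L : R, 0 < L & forall x, Omega x -> forall i, `|crd i x| <= L.
Proof.
move=> [M [_ MP]]; exists (`|M| + 1); first by rewrite ltr_wpDl.
have MM : M < `|M| + 1 by rewrite (le_lt_trans (ler_norm M))// ltrDl.
move=> x Ox i; apply: le_trans (MP _ MM x Ox).
have h1 : `|x| = Num.max `|x.1| `|x.2| by [].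
have h2 : `|x.1| = Num.max `|x.1.1| `|x.1.2| by [].
rewrite h1 h2 /crd; case: ifP => _; [|case: ifP => _]; by rewrite !le_max lexx ?orbT.
Qed.

Lemma mixD {R : realType} (t1 t2 a1 a2 b1 b2 : R) :
  t1 * (a1 + b1) + t2 * (a2 + b2) = (t1 * a1 + t2 * a2) + (t1 * b1 + t2 * b2).
Proof. by ring. Qed.

Theorem corollary5p1 (R : realType) (Omega : set (R3 R))
  (Omega_domain : domain Omega) (Omega_bounded : bounded_set Omega)
  (nu : R) (nu_gt0 : 0 < nu) (f : vec Omega -> R) (f_dual : dual_V f)
  (phi : vec Omega -> R)
  (phi_continuous : forall (u_ : nat -> vec Omega) (u : vec Omega),
     (forall n, (space_V Omega `&` ball_H (r0 nu f)) (u_ n)) ->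
     (space_V Omega `&` ball_H (r0 nu f)) u ->
     weakly_cvg_V u_ u -> phi (u_ n) @[n --> \oo] --> phi u)
  (phi_growth : exists C0 C1 delta : R,
     [/\ 0 <= C0, 0 <= C1, 0 < delta <= 2 &
         forall u, (space_V Omega `&` ball_H (r0 nu f)) u ->
           `|phi u| <= C0 + C1 * norm (grad u) `^ (2 - delta)]) :
  exists (M : R) (m : Tcyl Omega -> R),
    [/\ is_max
          [set \int[mu]_(u in @Hval _ _ @^-1`
                                (space_V Omega `&` ball_H (r0 nu f)))
                  phi (Hval u) | mu in fpsss nu f] M,
        forall Psi,
          is_max [set objective nu f phi Psi p
                    | p in Bf nu f (ball_H (r0 nu f))] (m Psi) &
        M%:E = ereal_inf (range (fun Psi => (m Psi)%:E))].
Proof.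
have [Oo _ _] := Omega_domain; have [L Lp OL] := bounded_crd Omega_bounded.
pose V := space_V Omega; pose h := @dot R Omega 'I_3; pose g := @gdot R Omega.
pose r := r0 nu f; have S : hilbert_pair (@L2 R Omega 'I_3) V h g := flow_pair Oo OL Lp.
have rge0 : 0 <= r := r0_ge0 Oo OL nu_gt0 f_dual.
have fb : bounded_lin V g f := f_bounded f_dual.
have KB u : kset V h r u <-> (V `&` ball_H r) u := kset_ball Oo OL nu f u.
(* Boundedness in [V] with convergence in [H] gives convergence against each element of [dual_V],
   which is the weak convergence assumed for [phi]. *)
have ap : admissible V h g r phi.
  move=> u_ u b Ku Ku' ub uu; apply: phi_continuous => [n||k kd]; [exact/KB|exact/KB|].
  apply: (bounded_lin_cvg S (f_bounded kd) (fun n => (Ku n).1) ub _ uu).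
  by apply: (hp_sub S); case: Ku'.
have sp : subquadratic V h g r phi.
  have [C0 [C1 [d [_ C10 dd hphi]]]] := phi_growth.
  by apply: (subquadratic_powR C10 dd) => u /KB; exact: hphi.
pose GP (Psi : Tcyl Omega) u := F nu f u (cyl_diff Psi (L2_dual_V u)).
have aGP Psi b : admissible V h g b (GP Psi) by exact: (@GPsi_admissible _ _ _ Oo OL Lp _ _ f_dual b Psi).
have sGP Psi : subquadratic V h g r (GP Psi) by exact: (@GPsi_subquadratic _ _ _ Oo OL Lp _ _ nu_gt0 f_dual r Psi).
have GPl Psi := GPsi_lyapunov Oo OL Lp nu_gt0 f_dual Psi.
have tightBf t1 t2 u1 u2 : tight V h g r nu f t1 t2 u1 u2 <-> Bf nu f (ball_H r) (t1, t2, u1, u2).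
  split=> [[[-> -> <- /KB[Vu Bu] lu]|[[t01 ->] [/KB[V1 B1] /KB[V2 B2]] n12 l12 l0]]|].
  - by left; exists u1.
  - right; exact: (And5 (conj t01 erefl) (conj (conj B1 V1) (conj B2 V2)) n12 l12 l0).
  - case=> [[u [[-> -> -> ->] Bu Vu lu]]|[[t01 t2E] [[B1 V1] [B2 V2]] n12 l12 l0]].
      by left; split => //; exact/KB.
    right; have K1 := (KB u1).2 (conj V1 B1); have K2 := (KB u2).2 (conj V2 B2).
    exact: (And5 (conj t01 t2E) (conj K1 K2) n12 l12 l0).
(* The maximum over mixed states is moved into [Bf] by [mixed_dominated]; the value then bounds the
   larger family as well, the form used by both inequalities. *)
have /choice[m mP] : forall Psi, exists m, [/\
    is_max [set objective nu f phi Psi p | p in Bf nu f (ball_H r)] m,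
    forall t1 t2 u1 u2, mixed V h g r nu f t1 t2 u1 u2 ->
      t1 * (phi u1 + GP Psi u1) + t2 * (phi u2 + GP Psi u2) <= m &
    exists t1 t2 u1 u2, mixed V h g r nu f t1 t2 u1 u2 /\
      m <= t1 * (phi u1 + GP Psi u1) + t2 * (phi u2 + GP Psi u2)].
  move=> Psi; have aG : admissible V h g r (fun u => phi u + GP Psi u) by apply: admissible_D.
  have sG : subquadratic V h g r (fun u => phi u + GP Psi u) by exact: subquadratic_D.
  have [s1 [s2 [v1 [v2 [mv mx]]]]] := mixed_max S rge0 nu_gt0 fb aG sG.
  have [a1 [a2 [w1 [w2 [tw le]]]]] := mixed_dominated (fun u => phi u + GP Psi u) mv.
  exists (a1 * (phi w1 + GP Psi w1) + a2 * (phi w2 + GP Psi w2)); split.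
  - split; first by exists (a1, a2, w1, w2) => //; exact/tightBf.
    move=> _ [[[[t1 t2] u1] u2] /tightBf/tight_mixed mu12 <-].
    exact: le_trans (mx _ _ _ _ mu12) le.
  - by move=> t1 t2 u1 u2 mu12; exact: le_trans (mx _ _ _ _ mu12) le.
  - by exists a1, a2, w1, w2; split; [exact: tight_mixed tw|exact: lexx].
have [b bP] := mean_bound nu_gt0 fb (quadratic_sub sp).
(* The infimum is finite: each maximum is at least the mean at a state where [<F, DPsi>] has
   nonnegative mean, and there the mean of [phi] is at least [- b]. *)
have mlb : has_lbound (range m).
  exists (- b) => _ [Psi _ <-]; have [_ mu _] := mP Psi.
  have [t1 [t2 [u1 [u2 [mx ge]]]]] := GPl Psi.
  apply: le_trans (mu _ _ _ _ mx); rewrite mixD -[leLHS]addr0; apply: lerD; last exact: ge.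
  by have := bP _ _ _ _ mx; rewrite ler_norml => /andP[].
have m0 : range m !=set0 by exists (m (tcyl0 Omega)), (tcyl0 Omega).
pose M := inf (range m).
pose D : set (vec Omega -> R) := [set GP Psi | Psi in setT].
have D_adm Q : D Q -> forall b, admissible V h g b Q by move=> [Psi _ <-].
have D_sub Q : D Q -> subquadratic V h g r Q by move=> [Psi _ <-].
have iV := hp_V S.
have VD Psi u : V (cyl_diff Psi (L2_dual_V u)).
  by apply: (V_lcomb S) => j; exact: cyl_wP.
have FL := F_lin Oo OL Lp nu f_dual.
have D_0 : exists2 Q, D Q & forall u, kset V h r u -> Q u = 0.
  exists (GP (tcyl0 Omega)); first by exists (tcyl0 Omega).
  by move=> u [Vu _]; rewrite /GP tcyl0E; exact: (F0r S FL Vu).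
(* The cutoff radius of [tcyl_lin] is taken equal to [r], so the combination is exact on the whole
   ball. *)
have D_lin P Q a : D P -> D Q -> exists2 W, D W & forall u, kset V h r u -> W u = P u + a * Q u.
  move=> [Psi1 _ <-] [Psi2 _ <-]; exists (GP (tcyl_lin Psi1 Psi2 a r)).
    by exists (tcyl_lin Psi1 Psi2 a r).
  move=> u [Vu ur]; rewrite /GP tcyl_linE; first exact: (FL u Vu a _ _ (VD Psi1 u) (VD Psi2 u)).
  move=> w Vw; apply: le_trans (in_cs (hp_H S) (hp_sub S Vu) (hp_sub S Vw)) _.
  by apply: ler_wpM2r => //; exact: sqrtr_ge0.
have D_ly P : D P -> exists t1 t2 u1 u2,
    mixed V h g r nu f t1 t2 u1 u2 /\ 0 <= t1 * P u1 + t2 * P u2.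
  by move=> [Psi _ <-]; exact: GPl.
pose v : Hspace Omega -> vec Omega := @Hval R Omega.
have vH t : @L2 R Omega 'I_3 (v t) by have := valP t; rewrite inE => -[].
have /choice[ret retP] : forall u : vec Omega, exists t : Hspace Omega, V u -> v t = u.
  move=> u; have [Vu|nV] := pselect (V u); last by exists point.
  by exists (exist _ u (mem_set (V_space_H Oo OL Vu))).
have GE : @H_open R Omega = norm_open h v by [].
have setE : @Hval _ _ @^-1` (space_V Omega `&` ball_H (r0 nu f)) = [set t | kset V h r (v t)].
  by apply/seteqP; split=> t /KB.
have ellp u : V u -> r < nrm h u -> 0 < energy g nu f u by exact: (ell_gt0 Oo OL Lp nu_gt0 f_dual).
exists M, m; split; last 2 first.
- by move=> Psi; have [] := mP Psi.
- by rewrite -(ereal_inf_EFin mlb m0) image_comp.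
(* The integral does not depend on [Psi], so its bound by every [m Psi] is a bound by their
   infimum. *)
have upper mu : fpsss nu f mu -> exists2 x, x <= M &
    (\int[mu]_(t in [set t | kset V h r (v t)]) (phi (v t))%:E = x%:E)%E.
  move=> [m1 m2 m3].
  have st : stationary_for V h g nu f v D mu by split; [exact: m1|exact: m2|move=> Q [Psi _ <-]; exact: (m3 Psi)].
  have xP Psi := stationary_for_le S rge0 nu_gt0 fb ellp vH D_adm D_sub ap sp GE st
    (ex_intro2 _ _ Psi Logic.I erefl : D (GP Psi)) (let: And3 _ q _ := mP Psi in q).
  have [x _ xE] := xP (tcyl0 Omega); exists x; last exact: xE.
  apply: lb_le_inf; [exact: m0|move=> _ [Psi _ <-]]; have [y ym yE] := xP Psi.
  by move: yE; rewrite xE => -[->].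
split=> [|_ [mu muP <-]]; last first.
  by have [x xM xE] := upper mu muP; rewrite setE /Rintegral xE.
have phiM P : D P -> exists t1 t2 u1 u2, mixed V h g r nu f t1 t2 u1 u2 /\
    M <= t1 * (phi u1 + P u1) + t2 * (phi u2 + P u2).
  move=> [Psi _ <-]; have [_ _ [t1 [t2 [u1 [u2 [mx le]]]]]] := mP Psi.
  exists t1, t2, u1, u2; split; [exact: mx|apply: le_trans le].
  by apply: ge_inf; [exact: mlb|exists Psi].
(* This measure gives [phi] an integral at least [M]; the bound [upper] makes it equal to [M], so
   the supremum is attained. *)
have [mu [st [x Mx xE]]] := stationary_for_exists S rge0 nu_gt0 fb vH retP
  D_adm D_sub D_0 D_lin D_ly ap sp GE phiM.
have muP : fpsss nu f mu.
  case: st => s1 s2 s3; split; [exact: s1|exact: s2|move=> Psi].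
  by apply: (s3 (GP Psi)); exists Psi.
have [y yM yE] := upper mu muP; exists mu; first exact: muP.
rewrite setE /Rintegral xE /=; apply/eqP; rewrite eq_le Mx andbT.
by move: yE; rewrite xE => -[->].
Qed.
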